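(* Let $M$ be a Henselian non-trivially valued field of residue characteristic zero, with field sort $K(M)$, residue field $k(M)$, value group $\Gamma(M)$ and group of leading terms $\mathrm{RV}^*(M)$. Let $A\le B$ and $A\le C$ be valued subfields of $K(M)$ such that $M$ is $|B\cup C|^+$-saturated and strongly $|B\cup C|^+$-homogeneous. Assume: - $[K(M)^*:(K(M)^* )^N]$ is finite for every $N>0$; - for every $N>0$, every coset of $(\mathrm{RV}^* )^N$ in $\mathrm{RV}^*$ contains $\mathrm{rv}(a)$ for some $a\in A^*$; - for every $N>0$, every coset of $(k^* )^N$ in $k^*$ contains $\mathrm{res}(a)$ for some $a\in A$ of value $0$; - every $\gamma\in\Gamma(\mathrm{dcl}^{eq}(\varnothing))$ equals $\mathrm{val}(a)$ for some $a\in A$; - the field $k(M)$ is algebraically bounded, $\mathrm{res}(C)$ is a regular field extension of $\mathrm{res}(A)$, and $\mathrm{val}(C)$ is a pure extension of $\mathrm{val}(A)$; - $\mathrm{res}(C)$ and $\mathrm{res}(B)$ are linearly disjoint over $\mathrm{res}(A)$, and $\mathrm{val}(C)\cap\mathrm{val}(B)=\mathrm{val}(A)$; - the extension $C\ge A$ is separated. Then $\mathrm{tp}(C/B)$ does not fork over $A$ if and only if, in the field $k(M)$, $\mathrm{tp}(\mathrm{res}(C)/\mathrm{res}(B))$ does not fork over $\mathrm{res}(A)$ and, in the ordered group $\Gamma(M)$, $\mathrm{tp}(\mathrm{val}(C)/\mathrm{val}(B))$ does not fork over $\mathrm{val}(A)$.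
   Context: Convention: valuations are written additively with $\mathrm{val}(0)=-\infty$ the least value, so $\mathrm{val}(x+y)\le\max(\mathrm{val}(x),\mathrm{val}(y))$, the valuation ring is $\mathcal{O}=\{x:\mathrm{val}(x)\le0\}$ with maximal ideal $\mathfrak{M}=\{x:\mathrm{val}(x)<0\}$. $\mathrm{res}:\mathcal{O}\to k$ is the residue map and $\mathrm{res}(D)=\mathrm{res}(D\cap\mathcal{O})$ for a subfield $D$; $\mathrm{val}(D)$ denotes the value group of $D$. $\mathrm{RV}^*=K^*/(1+\mathfrak{M})$ with quotient map $\mathrm{rv}$. An extension $C\ge A$ of valued fields is separated if every finite-dimensional $A$-vector subspace of $C$ has a basis $(v_i)_i$ such that $\mathrm{val}(\sum_i\lambda_iv_i)=\max_i\mathrm{val}(\lambda_iv_i)$ for all $\lambda_i\in A$. A field $k'$ is algebraically bounded if for every subfield $F$, the model-theoretic algebraic closure of $F$ in $k'$ equals $F^{\mathrm{alg}}\cap k'$. A formula divides over $A$ if for some $A$-indiscernible sequence of conjugates of its parameters, starting with the original, the corresponding formulas are jointly inconsistent; it forks over $A$ if it implies a finite disjunction of formulas dividing over $A$; a type forks over $A$ if it implies a formula that does. The valued field is considered in any of the usual bi-interpretable languages. *)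

(* Defs.v *)
From HB Require Import structures.
From mathcomp Require Import all_boot all_order all_algebra.
From mathcomp Require Import boolp classical_sets functions cardinality.

Set Implicit Arguments.
Unset Strict Implicit.
Unset Printing Implicit Defensive.

Import Order.TTheory GRing.Theory Num.Theory.
Local Open Scope classical_set_scope.
Local Open Scope card_scope.
Local Open Scope ring_scope.

Record signature := Signature {
  sorts : Type;
  fsym : Type;
  farity : fsym -> nat;
  fdom : forall f : fsym, 'I_(farity f) -> sorts;
  fcod : fsym -> sorts;
  rsym : Type;
  rarity : rsym -> nat;
  rdom : forall r : rsym, 'I_(rarity r) -> sorts
}.

(* A context is a (possibly infinite) family of sorted variables.  Parameters
   are handled as variables too: a formula in the variables [X] over a set [P]
   is a formula in the context [cadd X (cpts P)]. *)
Record ctx (S : Type) := Ctx { cvar :> Type; csort : cvar -> S }.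

Definition cone (S : Type) (s : S) : ctx S := Ctx (fun _ : unit => s).

Definition cadd (S : Type) (V W : ctx S) : ctx S :=
  @Ctx S (V + W)%type
    (fun x => match x with inl v => csort v | inr w => csort w end).

Definition cext (S : Type) (V : ctx S) (s : S) : ctx S :=
  @Ctx S (option V) (fun x => if x is Some v then csort v else s).

Definition cpow (S : Type) (n : nat) (V : ctx S) : ctx S :=
  @Ctx S ('I_n * V)%type (fun x => csort x.2).

Inductive term (L : signature) (V : ctx (sorts L)) : sorts L -> Type :=
| TVar (x : V) : term V (csort x)
| TApp (f : fsym L) (a : forall i, term V (fdom (f := f) i)) : term V (fcod f).

Inductive form (L : signature) (V : ctx (sorts L)) : Type :=
| FEq (s : sorts L) (t u : term V s)
| FRel (r : rsym L) (a : forall i, term V (rdom (r := r) i))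
| FBot
| FImp (p q : form V)
| FAll (s : sorts L) (p : form (cext V s)).

Record structure (L : signature) := Structure {
  carrier :> sorts L -> Type;
  finterp : forall f : fsym L,
    (forall i, carrier (fdom (f := f) i)) -> carrier (fcod f);
  rinterp : forall r : rsym L,
    (forall i, carrier (rdom (r := r) i)) -> Prop
}.

Definition asg (S : Type) (T : S -> Type) (V : ctx S) :=
  forall x : V, T (csort x).

Definition asg_add (S : Type) (T : S -> Type) (V W : ctx S)
    (e : asg T V) (d : asg T W) : asg T (cadd V W) :=
  fun x => match x return T (csort (c := cadd V W) x) with
           | inl v => e v
           | inr w => d w
           end.

Definition asg_ext (S : Type) (T : S -> Type) (V : ctx S) (s : S)
    (e : asg T V) (a : T s) : asg T (cext V s) :=
  fun x => match x return T (csort (c := cext V s) x) with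
           | Some v => e v
           | None => a
           end.

Fixpoint eval (L : signature) (M : structure L) (V : ctx (sorts L))
    (e : asg M V) (s : sorts L) (t : term V s) : M s :=
  match t in term _ s return M s with
  | TVar x => e x
  | TApp f a => finterp (fun i => eval e (a i))
  end.

Fixpoint sat (L : signature) (M : structure L) (V : ctx (sorts L))
    (p : form V) : asg M V -> Prop :=
  match p with
  | FEq _ t u => fun e => eval e t = eval e u
  | FRel r a => fun e => rinterp (fun i => eval e (a i))
  | FBot => fun _ => False
  | FImp p q => fun e => sat p e -> sat q e
  | FAll s p => fun e => forall a : M s, sat p (asg_ext e a)
  end.

Definition points (L : signature) (M : structure L) := {s : sorts L & M s}.

Definition at_sort (L : signature) (M : structure L) (s : sorts L)
    (D : set (M s)) : set (points M) :=
  [set existT M s x | x in D].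

Arguments at_sort {L} M s D.

Definition cpts (L : signature) (M : structure L) (P : set (points M)) :
    ctx (sorts L) :=
  @Ctx (sorts L) {x : points M | P x} (fun x => projT1 (sval x)).

Definition incl (L : signature) (M : structure L) (P : set (points M)) :
    asg M (cpts P) :=
  fun x => projT2 (sval x).

Arguments incl {L M} P.

Definition tp (L : signature) (M : structure L) (X : ctx (sorts L))
    (c : asg M X) (P : set (points M)) : set (form (cadd X (cpts P))) :=
  [set p | sat p (asg_add c (incl P))].

Arguments tp {L M X} c P.

Definition defset (L : signature) (M : structure L) (P : set (points M))
    (s : sorts L) (p : form (cadd (cone s) (cpts P))) : set (M s) :=
  [set x : M s | sat p (asg_add ((fun _ => x) : asg M (cone s)) (incl P))].

Definition acl (L : signature) (M : structure L) (P : set (points M))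
    (s : sorts L) : set (M s) :=
  [set x | exists p : form (cadd (cone s) (cpts P)),
     defset p x /\ finite_set (defset p)].

(* On elements of the sorts of M itself, dcl^eq coincides with dcl, so this also
   gives the value-group part of dcl^eq when the value group is a sort. *)
Definition dcl (L : signature) (M : structure L) (P : set (points M))
    (s : sorts L) : set (M s) :=
  [set x | exists p : form (cadd (cone s) (cpts P)), defset p = [set x]].

Arguments acl {L M} P s.
Arguments dcl {L M} P s.

(* |D|^+-saturation and strong |D|^+-homogeneity: a set has cardinality
   < |D|^+ exactly when it has cardinality <= |D|. *)
Definition succ_saturated (L : signature) (M : structure L)
    (U : Type) (D : set U) : Prop :=
  forall P : set (points M), P #<= D ->
  forall (s : sorts L) (p : set (form (cadd (cone s) (cpts P)))),
    (forall q : set (form (cadd (cone s) (cpts P))),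
       q `<=` p -> finite_set q ->
       exists x : M s, forall f, q f -> defset f x) ->
    exists x : M s, forall f, p f -> defset f x.

Definition automorphism (L : signature) (M : structure L)
    (g : forall s, M s -> M s) : Prop :=
  [/\ forall s, bijective (g s),
      forall (f : fsym L) (a : forall i, M (fdom (f := f) i)),
        g (fcod f) (finterp a) = finterp (fun i => g _ (a i))
    & forall (r : rsym L) (a : forall i, M (rdom (r := r) i)),
        rinterp a <-> rinterp (fun i => g _ (a i))].

Definition succ_strongly_homogeneous (L : signature) (M : structure L)
    (U : Type) (D : set U) : Prop :=
  forall P : set (points M), P #<= D ->
  forall h : asg M (cpts P),
    (forall p : form (cpts P), sat p (incl P) <-> sat p h) ->
    exists g : forall s, M s -> M s,
      automorphism g /\ forall x : cpts P, g _ (incl P x) = h x.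

Definition indiscernible (L : signature) (M : structure L) (A : set (points M))
    (Y : ctx (sorts L)) (b : nat -> asg M Y) : Prop :=
  forall (n : nat) (i j : 'I_n -> nat),
    {homo i : x y / (x < y)%N} -> {homo j : x y / (x < y)%N} ->
  forall p : form (cadd (cpow n Y) (cpts A)),
    sat p (asg_add (fun x : cpow n Y => b (i x.1) x.2) (incl A)) <->
    sat p (asg_add (fun x : cpow n Y => b (j x.1) x.2) (incl A)).

(* The parameters are kept apart from the formula, since dividing moves them. *)
Record pform (L : signature) (M : structure L) (X : ctx (sorts L)) := PForm {
  parity : nat;
  psort : 'I_parity -> sorts L;
  pbody : form (cadd X (Ctx psort));
  pparam : asg M (Ctx psort)
}.

Arguments psort {L M X} p _.
Arguments pbody {L M X} p.
Arguments pparam {L M X} p _.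

Definition psat (L : signature) (M : structure L) (X : ctx (sorts L))
    (f : pform M X) (e : asg M X) : Prop :=
  sat (pbody f) (asg_add e (pparam f)).

(* Joint inconsistency is understood with respect to the elementary diagram
   of [M], i.e., some finite subfamily has no common solution in [M]. *)
Definition divides (L : signature) (M : structure L) (X : ctx (sorts L))
    (A : set (points M)) (f : pform M X) : Prop :=
  exists b : nat -> asg M (Ctx (psort f)),
    [/\ b 0%N = pparam f,
        forall n, tp (b n) A = tp (pparam f) A,
        indiscernible A b
      & exists n : nat, ~ exists e : asg M X,
          forall m, (m < n)%N -> sat (pbody f) (asg_add e (b m))].

Definition forks (L : signature) (M : structure L) (X : ctx (sorts L))
    (A : set (points M)) (f : pform M X) : Prop :=
  exists fs : set (pform M X),
    [/\ finite_set fs, forall g, fs g -> divides A g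
      & forall e : asg M X, psat f e -> exists2 g, fs g & psat g e].

(* Again modulo the elementary diagram of [M]: a partial type implies a formula
   when finitely many of its members do. *)
Definition type_implies (L : signature) (M : structure L) (X : ctx (sorts L))
    (B : set (points M)) (p : set (form (cadd X (cpts B)))) (f : pform M X) :
    Prop :=
  exists q : set (form (cadd X (cpts B))),
    [/\ q `<=` p, finite_set q
      & forall e : asg M X,
          (forall g, q g -> sat g (asg_add e (incl B))) -> psat f e].

Definition type_forks (L : signature) (M : structure L) (X : ctx (sorts L))
    (A B : set (points M)) (p : set (form (cadd X (cpts B)))) : Prop :=
  exists f : pform M X, type_implies p f /\ forks A f.

(* tp(C/B) forks over A, with [C] enumerated by itself. *)
Definition tp_forks (L : signature) (M : structure L)
    (C B A : set (points M)) : Prop :=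
  type_forks A (tp (incl C) B).

Inductive ring_op := RZero | ROne | ROpp | RAdd | RMul.

Definition ring_ar (o : ring_op) : nat :=
  match o with RZero | ROne => 0 | ROpp => 1 | RAdd | RMul => 2 end.

Definition ring_interp (R : nzRingType) (o : ring_op) :
    ('I_(ring_ar o) -> R) -> R :=
  match o with
  | RZero => fun _ => 0
  | ROne => fun _ => 1
  | ROpp => fun a => - a ord0
  | RAdd => fun a => a ord0 + a ord_max
  | RMul => fun a => a ord0 * a ord_max
  end.

Inductive grp_op := GOne | GInv | GMul.

Definition grp_ar (o : grp_op) : nat :=
  match o with GOne => 0 | GInv => 1 | GMul => 2 end.

Definition zmod_interp (G : zmodType) (o : grp_op) :
    ('I_(grp_ar o) -> G) -> G :=
  match o with
  | GOne => fun _ => 0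
  | GInv => fun a => - a ord0
  | GMul => fun a => a ord0 + a ord_max
  end.

Definition grp_interp (G : groupType) (o : grp_op) :
    ('I_(grp_ar o) -> G) -> G :=
  match o with
  | GOne => fun _ => 1%g
  | GInv => fun a => (a ord0)^-1%g
  | GMul => fun a => (a ord0 * a ord_max)%g
  end.

Definition ring_sig : signature :=
  @Signature unit ring_op ring_ar (fun _ _ => tt) (fun _ => tt)
    void (of_void nat) (fun _ _ => tt).

Definition field_struct (k : fieldType) : structure ring_sig :=
  @Structure ring_sig (fun _ => k) (@ring_interp k)
    (fun r : void => match r with end).

Definition ogroup_sig : signature :=
  @Signature unit grp_op grp_ar (fun _ _ => tt) (fun _ => tt)
    unit (fun _ => 2) (fun _ _ => tt).

Definition ogroup_struct (G : porderZmodType) : structure ogroup_sig :=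
  @Structure ogroup_sig (fun _ => G) (@zmod_interp G)
    (fun _ (a : 'I_2 -> G) => a ord0 <= a ord_max).

(* [None] stands for the least value -oo. *)
Definition vle (G : porderZmodType) (u v : option G) : bool :=
  match u, v with
  | None, _ => true
  | Some _, None => false
  | Some g, Some h => g <= h
  end.

Definition vlt (G : porderZmodType) (u v : option G) : bool := ~~ vle v u.

Definition vmax (G : porderZmodType) (u v : option G) : option G :=
  if vle u v then v else u.

(* [porderZmodType] does not relate the order to the addition: [vG_total] and
   [vG_leD] make [vG] an ordered abelian group.  The maps [vres] and [vrv] are
   only meaningful on the valuation ring and on the nonzero elements. *)
Record valuedField := ValuedField {
  vK : fieldType;
  vk : fieldType;
  vG : porderZmodType;
  vRV : groupType;
  vval : vK -> option vG;
  vres : vK -> vk;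
  vrv : vK -> vRV;
  vG_total : forall g h : vG, (g <= h) || (h <= g);
  vG_leD : forall g h i : vG, g <= h -> i + g <= i + h;
  val_eq_None : forall x, vval x = None <-> x = 0;
  valM : forall x y g h,
    vval x = Some g -> vval y = Some h -> vval (x * y) = Some (g + h);
  valD : forall x y, vle (vval (x + y)) (vmax (vval x) (vval y));
  val_surj : forall g, exists x, vval x = Some g;
  res1 : vres 1 = 1;
  resD : forall x y, vle (vval x) (Some 0) -> vle (vval y) (Some 0) ->
    vres (x + y) = vres x + vres y;
  resM : forall x y, vle (vval x) (Some 0) -> vle (vval y) (Some 0) ->
    vres (x * y) = vres x * vres y;
  res_eq0 : forall x, vle (vval x) (Some 0) ->
    (vres x = 0 <-> vlt (vval x) (Some 0));
  res_surj : forall a, exists2 x, vle (vval x) (Some 0) & vres x = a;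
  rvM : forall x y : vK, x != 0 -> y != 0 -> vrv (x * y) = (vrv x * vrv y)%g;
  rv_eq1 : forall x : vK, x != 0 ->
    (vrv x = 1%g <-> vlt (vval (x - 1)) (Some 0));
  rv_surj : forall r, exists2 x : vK, x != 0 & vrv x = r
}.

Arguments vval {v} _.
Arguments vres {v} _.
Arguments vrv {v} _.

Definition valring (M : valuedField) : set (vK M) :=
  [set x | vle (vval x) (Some 0)].

Inductive vf_sort := SK | Sk | SG | SRV.

Inductive vf_fsym :=
  FK of ring_op | Fk of ring_op | FG of grp_op | FRV of grp_op.

(* The order of the value group, and the graphs of [vval] (off 0), of
   [vres] (on the valuation ring) and of [vrv] (off 0). *)
Inductive vf_rsym := Rle | Rval | Rres | Rrv.

Definition vf_farity (f : vf_fsym) : nat :=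
  match f with FK o | Fk o => ring_ar o | FG o | FRV o => grp_ar o end.

Definition vf_fsort (f : vf_fsym) : vf_sort :=
  match f with FK _ => SK | Fk _ => Sk | FG _ => SG | FRV _ => SRV end.

Definition vf_rdom (r : vf_rsym) (i : 'I_2) : vf_sort :=
  match r, nat_of_ord i with
  | Rle, _ => SG
  | _, 0%N => SK
  | Rval, _ => SG
  | Rres, _ => Sk
  | Rrv, _ => SRV
  end.

Definition vf_sig : signature :=
  @Signature vf_sort vf_fsym vf_farity (fun f _ => vf_fsort f) vf_fsort
    vf_rsym (fun _ => 2) vf_rdom.

Definition vf_carrier (M : valuedField) (s : vf_sort) : Type :=
  match s with SK => vK M | Sk => vk M | SG => vG M | SRV => vRV M end.

Definition vf_finterp (M : valuedField) (f : vf_fsym) :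
    ('I_(vf_farity f) -> vf_carrier M (vf_fsort f)) ->
    vf_carrier M (vf_fsort f) :=
  match f with
  | FK o => @ring_interp (vK M) o
  | Fk o => @ring_interp (vk M) o
  | FG o => @zmod_interp (vG M) o
  | FRV o => @grp_interp (vRV M) o
  end.

Definition vf_rinterp (M : valuedField) (r : vf_rsym) :
    (forall i : 'I_2, vf_carrier M (vf_rdom r i)) -> Prop :=
  match r return (forall i : 'I_2, vf_carrier M (vf_rdom r i)) -> Prop with
  | Rle => fun a => ((a ord0 : vG M) <= (a ord_max : vG M))
  | Rval => fun a => vval (a ord0 : vK M) = Some (a ord_max : vG M)
  | Rres => fun a => valring (a ord0 : vK M) /\
                     vres (a ord0 : vK M) = (a ord_max : vk M)
  | Rrv => fun a => (a ord0 : vK M) != 0 /\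
                    vrv (a ord0 : vK M) = (a ord_max : vRV M)
  end.

Definition vf_struct (M : valuedField) : structure vf_sig :=
  @Structure vf_sig (vf_carrier M) (@vf_finterp M) (@vf_rinterp M).

Definition nontrivially_valued (M : valuedField) : Prop :=
  exists x : vK M, x != 0 /\ vval x <> Some 0.

Definition henselian (M : valuedField) : Prop :=
  forall (p : {poly vK M}) (a : vK M),
    (forall i, valring p`_i) -> valring a ->
    vlt (vval p.[a]) (Some 0) -> vval (p^`()).[a] = Some 0 ->
    exists b, [/\ valring b, root p b & vlt (vval (b - a)) (Some 0)].

Definition res_of (M : valuedField) (D : set (vK M)) : set (vk M) :=
  [set vres x | x in D `&` valring (M := M)].

Definition val_of (M : valuedField) (D : set (vK M)) : set (vG M) :=
  [set g | exists2 x, D x & vval x = Some g].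

Definition subfield (F : fieldType) (D : set F) : Prop :=
  divring_closed [in D].

Definition alg_over (F : fieldType) (D : set F) : set F :=
  [set x | exists p : {poly F}, [/\ p != 0, forall i, D p`_i & root p x]].

Definition lin_indep (F : fieldType) (D : set F) (n : nat) (v : 'I_n -> F) :
    Prop :=
  forall c : 'I_n -> F, (forall i, D (c i)) ->
    \sum_i c i * v i = 0 -> forall i, c i = 0.

Definition lin_disjoint (F : fieldType) (E D D0 : set F) : Prop :=
  forall (n : nat) (v : 'I_n -> F), (forall i, E (v i)) ->
    lin_indep D0 v -> lin_indep D v.

(* E is regular over D: E and the algebraic closure of D are linearly disjoint
   over D.  The ambient field [F] need not be algebraically closed, so this is
   tested in every extension [W] of [F], against the algebraic closure of D in
   [W]. *)
Definition regular_ext (F : fieldType) (D E : set F) : Prop :=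
  D `<=` E /\
  forall (W : fieldType) (j : {rmorphism F -> W}),
    lin_disjoint (j @` E) (alg_over (j @` D)) (j @` D).

Definition pure_ext (G : zmodType) (D E : set G) : Prop :=
  D `<=` E /\
  forall (n : nat) (e : G), (0 < n)%N -> E e -> D (e *+ n) ->
    exists2 d, D d & d *+ n = e *+ n.

Definition algebraically_bounded (k : fieldType) : Prop :=
  forall D : set k, subfield D ->
    acl (at_sort (field_struct k) tt D) tt = alg_over D.

Definition lspan (F : fieldType) (D : set F) (n : nat) (v : 'I_n -> F) :
    set F :=
  [set x | exists2 c : 'I_n -> F, (forall i, D (c i)) & x = \sum_i c i * v i].

Definition separated_ext (M : valuedField) (A C : set (vK M)) : Prop :=
  forall V : set (vK M), V `<=` C ->
    (exists (n : nat) (u : 'I_n -> vK M), V = lspan A u) ->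
    exists (m : nat) (v : 'I_m -> vK M),
      [/\ V = lspan A v, lin_indep A v
        & forall c : 'I_m -> vK M, (forall i, A (c i)) ->
            vval (\sum_i c i * v i) =
            \big[@vmax (vG M) / None]_i vval (c i * v i)].

(* Main.v *)
Require Import Defs.
From Stdlib Require List.
From HB Require Import structures.
From mathcomp Require Import all_boot all_order all_algebra.
From mathcomp Require Import boolp classical_sets functions cardinality filter.

From mathcomp Require Import ring zify.

Set Implicit Arguments.
Unset Strict Implicit.
Unset Printing Implicit Defensive.

Import Order.TTheory GRing.Theory Num.Theory.
Local Open Scope classical_set_scope.
Local Open Scope ring_scope.
Local Notation form := Defs.form.
Local Notation incl := Defs.incl.

(** Write K for the field, k for the residue field and G for the value group. Everything rests on a
    relative quantifier elimination over A for henselian fields of residue characteristic zero, in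
    back-and-forth form. A [system] consists of a small partial isomorphism of subfields of K fixing
    A, a compatible partial map of leading terms, and partial elementary maps of k and of G.
    [system_extend] enlarges the domain of a system by any small set, and [system_equiv] concludes
    that systems preserve all formulas. The leading-term map is extended in [gsys_extend]: since A
    meets every coset of N-th powers, a map fixing A controls N-th powers, and k and G can be
    treated independently. The field map is extended in [fsys_extend] by Hensel's lemma, through
    Taylor expansions at a point with no root of a derivative closer to the new element
    ([no_collision]).

    The second tool is amalgamation ([amalgam_exists]). Suppose that C is separated over A, that the
    residue fields of the two sides are linearly disjoint over res(A), and that their values meet
    only in val(A). Then the leading term of a sum of products c_i u_i, with c_i in C and u_i on the
    other side, is computed from the two sides ([pairing_value]), so a partial isomorphism on each
    side glue to a system.

    From k and G to M, forking goes up: by quantifier elimination the type over A of a tuple of k or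
    of G is determined by its type over res(A) in the pure field, or over val(A) in the pure ordered
    group ([equiv_k], [equiv_G]). A dividing sequence downstairs is therefore a dividing sequence in
    M, and forking is pulled back along the residue map and the valuation ([type_forks_interp]).

    For the converse ([nonforking_descent]), suppose that tp(C/B) implies a finite disjunction of
    formulas dividing over A. Put lifts of their parameters in a small closed field L. Realize
    tp(res C/res B) and tp(val C/val B) by tuples that do not fork over A even with respect to large
    sets containing res(L) and val(L). They extend to a copy g of C ([embedding]), and amalgamation
    with the identity of B shows that g realizes tp(C/B) ([base_equiv]). So g satisfies one of the
    dividing formulas, with parameters d = b_0 in an indiscernible sequence (b_m). The elements of
    res(L) and val(L) determined by d over A move along with the b_m as indiscernible sequences
    ([conjugates_indiscernible]). By nonforking there are residue and value tuples in the same
    position with respect to the first n conjugates of these elements; they extend to a second copy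
    g2 of C, and amalgamation gives tp(g, b_0) = tp(g2, b_m) for all m < n ([conjugate_equiv]).
    Hence the n conjugate formulas are consistent, against dividing.

    This last amalgamation needs the first copy to be independent from L. In k, nonforking gives
    linear disjointness, by algebraic boundedness and regularity ([nonforking_lin_disjoint]). In G,
    a nonforking value lying in val(L) lies in val(A) ([nonforking_value]): by purity it would
    otherwise have infinitely many conjugates, obtained by adding small divisible elements. *)

(** * Cardinal arithmetic: comparability, squares of infinite sets, hulls *)

Definition injects T U (A : set T) (D : set U) :=
  exists f : T -> U, (forall x, A x -> D (f x)) /\
    (forall x y, A x -> A y -> f x = f y -> x = y).

Lemma card_le_injects T U (A : set T) (D : set U) : injects A D -> (A #<= D)%card.
Proof.
move=> [f [fD finj]].
have : $|{injfun A >-> D}|.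
  apply/injfunPex; exists f => [x /fD //|x y /set_mem Ax /set_mem Ay]; exact: finj.
by case=> g; exact: inj_card_le g.
Qed.

Lemma injects_card_le T U (A : set T) (D : set U) (d : U) :
  (A #<= D)%card -> injects A D.
Proof.
move=> /card_leP[f].
pose g x := if pselect (A x) is left h then val (f (SigSub (mem_set h))) else d.
have gE x (h : A x) : g x = val (f (SigSub (mem_set h))).
  by rewrite /g; case: pselect => // h'; rewrite (Prop_irrelevance h h').
exists g; split=> [x h|x y hx hy].
  by rewrite gE; apply: set_mem; exact: valP.
rewrite !gE => /val_inj /(@inj _ _ _ f) H.
have := H (mem_set I) (mem_set I).
by move=> /(congr1 val).
Qed.

Lemma injects_trans T U V (A : set T) (B : set U) (C : set V) :
  injects A B -> injects B C -> injects A C.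
Proof.
move=> [f [fB fi]] [g [gC gi]]; exists (g \o f); split=> [x /fB/gC //|x y Ax Ay /= e].
by apply: fi => //; apply: gi => //; exact: fB.
Qed.

Lemma injects_sub T U (A B : set T) (D : set U) :
  A `<=` B -> injects B D -> injects A D.
Proof. by move=> AB [f [fD fi]]; exists f; split=> [x /AB/fD|x y /AB Bx /AB By /fi]//; auto. Qed.

Lemma injects_image T U V (f : T -> V) (A : set T) (D : set U) (d : U) :
  injects A D -> injects (f @` A) D.
Proof.
move=> [h [hD hi]].
pose g y := if pselect (exists2 x, A x & f x = y) is left e then h (projT1 (cid2 e)) else d.
have gE y : (f @` A) y -> exists x, [/\ A x, f x = y & g y = h x].
  move=> Ay; rewrite /g; case: pselect => // e.
  by case: (cid2 e) => x Ax fx /=; exists x.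
exists g; split=> [y /gE[x [Ax _ ->]]|y z /gE[x [Ax <- ->]] /gE[x' [Ax' <- ->]] /hi e].
  exact: hD.
by rewrite e.
Qed.

(** A maximal partial bijection between [A] and [B], given by Zorn's lemma, is total on one of the
    two sides. *)
Lemma injects_total T U (A : set T) (B : set U) (t : T) (u : U) :
  injects A B \/ injects B A.
Proof.
pose P (R : set (T * U)) := [/\ forall p, R p -> A p.1 /\ B p.2,
   forall x y z, R (x, y) -> R (x, z) -> y = z &
   forall x y z, R (x, z) -> R (y, z) -> x = y].
have [F FP tot|R [[RAB Rf Ri] Rmax]] := @Zorn_bigcup _ P.
  have two p q : (\bigcup_(X in F) X) p -> (\bigcup_(X in F) X) q ->
     exists X, [/\ F X, X p & X q].
    move=> [X FX Xp] [Y FY Yq]; have [s|s] := tot X Y FX FY.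
      by exists Y; split=> //; exact: s.
    by exists X; split=> //; exact: s.
  split.
  - by move=> p [X /FP[h _ _] /h].
  - by move=> x y z h1 h2; have [X [/FP[_ h _] a b]] := two _ _ h1 h2; exact: h a b.
  - by move=> x y z h1 h2; have [X [/FP[_ _ h] a b]] := two _ _ h1 h2; exact: h a b.
have [allA|] := pselect (forall x, A x -> exists y, R (x, y)).
  left; pose f x := if pselect (exists y, R (x, y)) is left e then projT1 (cid e) else u.
  have fR x : A x -> R (x, f x).
    by move=> /allA e; rewrite /f; case: pselect => // e'; case: (cid e').
  exists f; split=> [x /fR/RAB[]//|x y /fR h /fR h' e].
  by apply: Ri h _; rewrite e.
move=> /existsNP[x0 /not_implyP[Ax0 nx0]].
have [allB|] := pselect (forall y, B y -> exists x, R (x, y)).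
  right; pose f y := if pselect (exists x, R (x, y)) is left e then projT1 (cid e) else t.
  have fR y : B y -> R (f y, y).
    by move=> /allB e; rewrite /f; case: pselect => // e'; case: (cid e').
  exists f; split=> [y /fR/RAB[]//|x y /fR h /fR h' e].
  by apply: Rf h _; rewrite e.
move=> /existsNP[y0 /not_implyP[By0 ny0]].
exfalso; apply: (Rmax (R `|` [set (x0, y0)])).
  split; first by left.
  by move=> /(_ (x0, y0) (or_intror erefl)) h; apply: nx0; exists y0.
split.
- by move=> p [/RAB//|->].
- move=> x y z [h|[= -> ->]] [h'|e].
  + exact: Rf h h'.
  + by case: e => e1 e2; case: nx0; exists y; rewrite -e1.
  + by case: nx0; exists z.
  + by case: e.
- move=> x y z [h|[= -> ->]] [h'|e].
  + exact: Ri h h'.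
  + by case: e => e1 e2; case: ny0; exists x; rewrite -e2.
  + by case: ny0; exists y.
  + by case: e.
Qed.

Lemma infinite_injects U (D : set U) : ~ finite_set D -> injects [set: nat] D.
Proof.
move=> Dinf; have /infiniteP h := Dinf.
have [d Dd] : D !=set0 by exact: infinite_setN0.
exact: injects_card_le h.
Qed.

(** The graph of an injection of X x X into X for some X inside [D]. The set X is read off from the
    diagonal of the domain, so that Zorn's lemma can be applied to [R] alone. *)
Definition square_graph U (D : set U) (R : set (U * U * U)) :=
  let X := [set x | exists z, R (x, x, z)] in
  [/\ forall x y z, R (x, y, z) -> [/\ X x, X y, X z & D x],
      forall x y, X x -> X y -> exists z, R (x, y, z),
      forall p z z', R (p, z) -> R (p, z') -> z = z' &
      forall p p' z, R (p, z) -> R (p', z) -> p = p'].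

Lemma square_graph_nat U (D : set U) : injects [set: nat] D ->
  exists R, square_graph D R /\ injects [set: nat] [set x | exists z, R (x, x, z)].
Proof.
move=> [f [fD fi]].
have fI m n : f m = f n -> m = n by exact: fi.
have [h [_ hi]] : injects [set: nat * nat] [set: nat].
  by exists choice.pickle; split=> // x y _ _ /(pcan_inj choice.pickleK).
have hI m n : h m = h n -> m = n by exact: hi.
pose R : set (U * U * U) := [set t | exists m n, t = (f m, f n, f (h (m, n)))].
have XR n : exists z, R (f n, f n, z) by exists (f (h (n, n))), n, n.
exists R; split; last by exists f; split=> [n _|]; [exact: XR|exact: fi].
split.
- move=> x y z [m [n [-> -> ->]]]; split; [exact: XR|exact: XR|exact: XR|exact: fD].
- move=> x y [z [m [n [-> _ _]]]] [z' [m' [n' [-> _ _]]]].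
  by exists (f (h (m, m'))), m, m'.
- by move=> p z z' [m [n [-> ->]]] [m' [n' [/fI <- /fI <- ->]]].
- by move=> p p' z [m [n [-> ->]]] [m' [n' [-> /fI/hI[-> ->]]]].
Qed.

Lemma square_graph_injects U (D : set U) R : square_graph D R ->
  let X := [set x | exists z, R (x, x, z)] in
  injects (X `*` X) X.
Proof.
move=> [R1 R2 R3 R4] X.
have H p : exists z, X p.1 -> X p.2 -> R (p, z).
  case: p => x y /=; have [[h1 h2]|h] := pselect (X x /\ X y).
    by have [z ?] := R2 x y h1 h2; exists z.
  by exists x => h1 h2; case: h.
exists (fun p => projT1 (cid (H p))); split=> [[x y] [/= Xx Xy]|[x y] [x' y'] [/= Xx Xy] [/= Xx' Xy']].
  by case: cid => z /= /(_ Xx Xy) /R1[].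
case: cid => z /= /(_ Xx Xy) h; case: cid => z' /= /(_ Xx' Xy') h' e.
by apply: R4 h _; rewrite e.
Qed.

Lemma injects_prod T T' U V (A : set T) (B : set T') (C : set U) (D : set V) :
  injects A C -> injects B D -> injects (A `*` B) (C `*` D).
Proof.
move=> [f [fC fi]] [g [gD gi]]; exists (fun p => (f p.1, g p.2)); split.
  by move=> [x y] [/= /fC ? /gD].
by move=> [x y] [x' y'] [/= ? ?] [/= ? ?] [/fi-> // /gi ->].
Qed.

Lemma injects_union T U (X : set U) (A B : set T) (a b : U) :
  X a -> X b -> a <> b -> injects (X `*` X) X -> injects A X -> injects B X ->
  injects (A `|` B) X.
Proof.
move=> Xa Xb ab XX [f [fX fi]] [g [gX gi]]; apply: injects_trans XX.
pose h x := if pselect (A x) is left _ then (a, f x) else (b, g x).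
exists h; split=> [x ABx|x y ABx ABy].
  rewrite /h; case: pselect => [/fX //|nA]; split=> //=; apply: gX.
  by case: ABx.
rewrite /h; case: pselect => [Ax|nAx]; case: pselect => [Ay|nAy] [] //.
- exact: fi.
- by move=> /esym.
- by apply: gi; [case: ABx|case: ABy].
Qed.

(** The classical proof that an infinite cardinal equals its square. For a maximal graph on X, if D
    \ X injects into X then D does too; otherwise D \ X contains a copy Y of X, and the graph
    extends to the union of X and Y. *)
Lemma square_injects U (D : set U) : injects [set: nat] D -> injects (D `*` D) D.
Proof.
move=> Dinf; have [R0 [g0 n0]] := square_graph_nat Dinf.
have [F FP tot|R1 [gR R1max]] := @Zorn_bigcup _ [set R | square_graph D (R0 `|` R)].
  set B := \bigcup_(X in F) X.
  have two p q : (R0 `|` B) p -> (R0 `|` B) q ->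
     exists X, [/\ square_graph D (R0 `|` X), X `<=` B, (R0 `|` X) p & (R0 `|` X) q].
    have one r : (R0 `|` B) r -> exists X, [/\ F X \/ X = set0, X `<=` B & (R0 `|` X) r].
      move=> [h|[X FX Xp]]; first by exists set0; split=> //; [right|left].
      by exists X; split; [left|exact: bigcup_sup|right].
    have sq X : F X \/ X = set0 -> square_graph D (R0 `|` X).
      by move=> [/FP//|->]; rewrite setU0.
    move=> /one[X [FX sX Xp]] /one[Y [FY sY Yq]].
    have [s|s] : X `<=` Y \/ Y `<=` X.
      case: FX => [FX|->]; last by left.
      case: FY => [FY|->]; last by right.
      exact: tot.
      by exists Y; split=> //; [exact: sq|case: Xp => [h|/s h]; [left|right]].
    by exists X; split=> //; [exact: sq|case: Yq => [h|/s h]; [left|right]].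
  have up X t : X `<=` B -> (R0 `|` X) t -> (R0 `|` B) t.
    by move=> s [h|/s h]; [left|right].
  split.
  - move=> x y z h; have [X [[g _ _ _] s Xt _]] := two _ _ h h.
    have [[a ha] [b hb] [c hc] Dx] := g _ _ _ Xt.
    by split=> //; [exists a|exists b|exists c]; apply: up s _.
  - move=> x y [z h] [z' h']; have [X [[_ g _ _] s Xt Xt']] := two _ _ h h'.
    have [|//|w hw] := g x y; [by exists z|by exists z'|].
    by exists w; apply: up s _.
  - by move=> p z z' h h'; have [X [[_ _ g _] s Xt Xt']] := two _ _ h h'; exact: g Xt Xt'.
  - by move=> p p' z h h'; have [X [[_ _ _ g] s Xt Xt']] := two _ _ h h'; exact: g Xt Xt'.
move: gR; set R := R0 `|` R1 => gR.
pose X : set U := [set x | exists z, R (x, x, z)].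
have XX : injects (X `*` X) X by exact: square_graph_injects gR.
have XD : X `<=` D by move=> x [z h]; case: gR => /(_ _ _ _ h)[].
have [f [fX fi]] : injects [set: nat] X.
  apply: injects_trans n0 _; exists id; split=> // x [z h]; exists z; by left.
have fab : f 0%N <> f 1%N by move=> /fi => /(_ I I).
have d : U := f 0%N.
have XU := injects_union (fX 0%N I) (fX 1%N I) fab XX.
have [DX|XDX] := injects_total (D `\` X) X d d.
  have : injects D X.
    apply: injects_sub (XU _ (D `\` X) X DX _); last by exists id.
    by move=> x Dx; have [Xx|nX] := pselect (X x); [right|left].
  move=> DX'; apply: injects_trans (injects_prod DX' DX') _.
  apply: injects_trans XX _; by exists id; split.
exfalso.
have [g [gDX gi]] := XDX.
pose Y := g @` X.
have YX : injects Y X by apply: injects_image d _; exists id.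
have XY : injects X Y by exists g; split=> // x Xx; exists x.
have dis x : X x -> Y x -> False by move=> Xx [y /gDX[_ nX] e]; apply: nX; rewrite e.
pose Z := X `|` Y.
have ZX : injects Z X by apply: XU => //; exists id.
have ZZY : injects (Z `*` Z) Y.
  apply: injects_trans (injects_prod ZX ZX) _; exact: injects_trans XX _.
have [h [hY hi]] := ZZY.
(* All new pairs are sent into Y, which is disjoint from X, so they cannot collide with the old part
   of the graph. *)
pose S : set (U * U * U) := R `|` [set t | [/\ Z t.1.1, Z t.1.2, ~ (X t.1.1 /\ X t.1.2) & t.2 = h t.1]].
have [G1 G2 G3 G4] := gR.
have RX x y z : R (x, y, z) -> [/\ X x, X y & X z] by move=> /G1[].
have SZ x : (exists z, S (x, x, z)) <-> Z x.
  split; first by move=> [z [/RX[Xx _ _]|[]//]]; left.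
  move=> Zx; have [Xx|nX] := pselect (X x).
    by have [z hz] := G2 x x Xx Xx; exists z; left.
  by exists (h (x, x)); right; split=> // -[].
have gS : square_graph D S.
  split.
  - move=> x y z [|[/= Zx Zy _ ->]].
      move=> /[dup]/RX[Xx Xy Xz] /G1[_ _ _ Dx].
      by split=> //; apply/SZ; left.
    have Dx : D x by case: Zx => [/XD//|[w /gDX[Dw _] <-]].
    by split=> //; apply/SZ => //; right; apply: hY.
  - move=> x y /SZ Zx /SZ Zy; have [[Xx Xy]|n] := pselect (X x /\ X y).
      by have [z hz] := G2 x y Xx Xy; exists z; left.
    by exists (h (x, y)); right.
  - move=> [x y] z z' [a|[/= Zx Zy n ->]] [b|[/= Zx' Zy' n' ->]] //.
    + exact: G3 a b.
    + by case: n'; case/RX: a.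
    + by case: n; case/RX: b.
  - move=> [x y] [x' y'] z [a|[/= Zx Zy n e]] [b|[/= Zx' Zy' n' e']] //.
    + exact: G4 a b.
    + by exfalso; apply: (@dis z); [case/RX: a|rewrite e'; apply: hY].
    + by exfalso; apply: (@dis z); [case/RX: b|rewrite e; apply: hY].
    + by apply: hi => //; rewrite -e.
have RS : R `<=` S by move=> t; left.
apply: (R1max (R1 `|` S)).
  split; first by left.
  move=> s; pose y := g (f 0%N).
  have Yy : Y y by exists (f 0%N) => //; exact: fX.
  have [z Sz] : exists z, S (y, y, z) by apply/SZ; right.
  have /RX[Xy _ _] : R (y, y, z) by right; apply: s; right.
  exact: dis Xy Yy.
rewrite /= setUA (_ : _ `|` S = S) //.
by apply/seteqP; split=> t; [case=> // /RS|right].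
Qed.

Section Small.
Variables (U : Type) (D : set U).
Hypothesis Dinf : injects [set: nat] D.
Let DD : injects (D `*` D) D := square_injects Dinf.
Let d0 : U := projT1 (cid Dinf) 0%N.

Lemma small_sub T (A B : set T) : A `<=` B -> injects B D -> injects A D.
Proof. exact: injects_sub. Qed.

Lemma small_image T V (f : T -> V) (A : set T) : injects A D -> injects (f @` A) D.
Proof. exact: injects_image d0. Qed.

Lemma small_prod T V (A : set T) (B : set V) :
  injects A D -> injects B D -> injects (A `*` B) D.
Proof. by move=> a b; apply: injects_trans DD; exact: injects_prod. Qed.

Lemma small_nat T (f : T -> nat) (A : set T) :
  (forall x y, A x -> A y -> f x = f y -> x = y) -> injects A D.
Proof. by move=> fi; apply: injects_trans Dinf; exists f; split. Qed.

Lemma small_union T (A B : set T) : injects A D -> injects B D -> injects (A `|` B) D.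
Proof.
case: (Dinf) => f [fD fi].
apply: (@injects_union _ _ _ _ _ (f 0%N) (f 1%N)) => //; try exact: fD.
by move=> /fi => /(_ I I).
Qed.

Lemma small_set1 T (x : T) : injects [set x] D.
Proof. by apply: (@small_nat _ (fun=> 0%N)) => y z /= -> ->. Qed.

Lemma small_seq T (A : set T) : injects A D ->
  injects [set s : seq T | forall x, List.In x s -> A x] D.
Proof.
move=> [f [fD fi]]; have [n [nD ni]] := Dinf; have [q [qD qi]] := DD.
pose c := fix c s := if s is x :: s' then q (f x, c s') else n 0%N.
have cD s : (forall x, List.In x s -> A x) -> D (c s).
  elim: s => [|x s IH] h /=; first exact: nD.
  apply: qD; split=> /=; first by apply/fD/h; left.
  by apply: IH => y sy; apply: h; right.
exists (fun s => q (n (size s), c s)); split=> [s h|s t hs ht].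
  by apply: qD; split=> /=; [exact: nD|exact: cD].
move=> e; have : (n (size s), c s) = (n (size t), c t).
  by apply: qi e; split=> //=; [exact: nD|exact: cD|exact: nD|exact: cD].
move=> {e} [/ni-/(_ I I) e1 e2].
elim: s t e1 e2 hs ht => [|x s IH] [|y t] //= [e1] e2 hs ht.
have hs' z : List.In z s -> A z by move=> h; apply: hs; right.
have ht' z : List.In z t -> A z by move=> h; apply: ht; right.
have Ax : A x by apply: hs; left.
have Ay : A y by apply: ht; left.
have : (f x, c s) = (f y, c t).
  by apply: qi e2; split=> //=; [exact: fD|exact: cD|exact: fD|exact: cD].
by move=> [/fi-> // /IH-> //].
Qed.

Inductive hull_mem T (op : nat -> seq T -> T) (S : set T) : T -> Prop :=
| HullBase x : S x -> hull_mem op S x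
| HullOp n s : (forall x, List.In x s -> hull_mem op S x) -> hull_mem op S (op n s).

(** With countably many finitary operations the hull is a countable union of levels, each of them a
    small set of finite lists. *)
Lemma small_hull T (op : nat -> seq T -> T) (S : set T) :
  injects S D -> injects [set x | hull_mem op S x] D.
Proof.
move=> Ssm.
pose st (X : set T) := S `|` [set op p.1 p.2 | p in [set: nat] `*` [set s | forall x, List.In x s -> X x]].
pose lev := fix lev n := if n is m.+1 then st (lev m) else set0.
have levD n : injects (lev n) D.
  elim: n => [|n IH] /=; first by exists (fun=> d0).
  by apply: small_union => //; apply/small_image/small_prod; [exact: Dinf|exact: small_seq].
have levS n x : lev n x -> lev n.+1 x.
  elim: n x => [//|n IH] x /= [Sx|[[k s] [/= _ h] <-]]; first by left.
  by right; exists (k, s) => //; split=> // y /h/IH.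
have levm m n x : (m <= n)%N -> lev m x -> lev n x.
  by move=> /subnKC <-; elim: (n - m)%N => [|k IH]; rewrite ?addn0 // addnS => /IH/levS.
have hl x : hull_mem op S x -> exists n, lev n x.
  elim=> [{}x Sx|k s _ IH]; first by exists 1%N; left.
  suff [n h] : exists n, forall x, List.In x s -> lev n x.
    by exists n.+1; right; exists (k, s).
  elim: s IH => [|y s IH] h; first by exists 0%N.
  have [n1 h1] := h y (or_introl erefl).
  have [n2 h2] := IH (fun z hz => h z (or_intror hz)).
  exists (maxn n1 n2) => z [<-|/h2].
    by apply: levm h1; exact: leq_maxl.
  by apply: levm; exact: leq_maxr.
pose g n := projT1 (cid (levD n)).
have gD n x : lev n x -> D (g n x) by rewrite /g; case: cid => f [h1 h2] /=; exact: h1.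
have gi n x y : lev n x -> lev n y -> g n x = g n y -> x = y.
  by rewrite /g; case: cid => f [h1 h2] /=; exact: h2.
pose r x := if pselect (exists n, lev n x) is left e then projT1 (cid e) else 0%N.
have rP x : hull_mem op S x -> lev (r x) x.
  by move=> /hl e; rewrite /r; case: pselect => // e'; case: cid.
apply: injects_trans (small_prod Dinf (injects_sub (@subset_refl _ D) (ex_intro _ id (conj (fun x h => h) (fun x y _ _ e => e))))).
exists (fun x => (r x, g (r x) x)); split=> [x hx|x y hx hy [e1]].
  by split=> //=; apply/gD/rP.
by rewrite -e1 => /gi; apply; [exact: rP|rewrite e1; exact: rP].
Qed.

End Small.

(** * Lists and finite sets *)

Lemma In_filter T (a : T -> bool) (s : seq T) x :
  List.In x (seq.filter a s) <-> List.In x s /\ a x.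
Proof.
elim: s => [|y s IH] /=; first by split=> // -[].
case E: (a y) => /=; rewrite IH; split.
- by move=> [<-|[]]; auto.
- by move=> [[]]; auto.
- by move=> []; auto.
- by move=> [[<-|]]; [rewrite E|auto].
Qed.

Lemma In_map T U (f : T -> U) (s : seq T) y :
  List.In y [seq f x | x <- s] <-> exists2 x, List.In x s & f x = y.
Proof.
elim: s => [|z s IH] /=; first by split=> // -[].
rewrite IH; split.
- by move=> [<-|[x]]; [exists z|exists x]; auto.
- by move=> [x [->|]]; [left|right; exists x].
Qed.

Lemma In_cat T (s t : seq T) x : List.In x (s ++ t) <-> List.In x s \/ List.In x t.
Proof. by elim: s => [|y s IH] /=; [split; [right|case]|rewrite IH; tauto]. Qed.

Lemma In_mem (T : eqType) (s : seq T) x : List.In x s <-> x \in s.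
Proof.
elim: s => [|y s IH] //=; rewrite in_cons IH; split.
  by move=> [->|->]; rewrite ?eqxx ?orbT.
by move=> /orP[/eqP->|]; auto.
Qed.

Lemma finite_set_list T (A : set T) :
  finite_set A -> exists l : seq T, forall x, A x <-> List.In x l.
Proof.
move=> /finite_set_leP [n] /(injects_card_le 0%N) [f] [fI fi].
have [[x0 Ax0]|A0] := pselect (A !=set0); last first.
  by exists [::] => x; split=> // Ax; case: A0; exists x.
pose g i := if pselect (exists2 x, A x & f x = i) is left e then projT1 (cid2 e) else x0.
have gA i : A (g i) by rewrite /g; case: pselect => // e; case: cid2.
exists [seq g i | i <- iota 0 n] => x; rewrite In_map; split=> [Ax|[i _ <-]//].
exists (f x); first by rewrite In_mem mem_iota add0n; exact: fI.
rewrite /g; case: pselect => [e|[]]; last by exists x.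
by case: cid2 => y Ay /= /fi; exact.
Qed.

Lemma list_finite_set T (l : seq T) : finite_set [set x | List.In x l].
Proof.
elim: l => [|x l IH]; first exact: finite_set0.
rewrite (_ : [set _ | _] = [set x] `|` [set y | List.In y l]).
  by rewrite finite_setU; split=> //; exact: finite_set1.
by apply/seteqP; split=> y /= [->|]; auto.
Qed.

Lemma list_choice T U (R : T -> U -> Prop) (l : seq T) :
  (forall x, List.In x l -> exists y, R x y) ->
  exists m : seq U, (forall y, List.In y m -> exists2 x, List.In x l & R x y) /\
    forall x, List.In x l -> exists2 y, List.In y m & R x y.
Proof.
elim: l => [|x l IH] h; first by exists [::]; split.
have [y xy] := h x (or_introl erefl).
have [m [m1 m2]] := IH (fun z hz => h z (or_intror hz)).
exists (y :: m); split=> [z [<-|/m1[w ? ?]]|z [<-|/m2[w ? ?]]].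
- by exists x => //; left.
- by exists w => //; right.
- by exists y => //; left.
- by exists w => //; right.
Qed.

(** * Substitution, finite supports and quantification in infinite contexts *)

Section Substitution.
Variable L : signature.
Implicit Types V W : ctx (sorts L).

Fixpoint tsub V W (f : forall x : V, term W (csort x)) s (t : term V s) : term W s :=
  match t with
  | TVar x => f x
  | TApp g a => TApp (fun i => tsub f (a i))
  end.

Definition lsub V W s (f : forall x : V, term W (csort x)) :
    forall x : cext V s, term (cext W s) (csort x) :=
  fun x => match x return term (cext W s) (csort (c := cext V s) x) with
  | Some v => tsub (fun y => @TVar L (cext W s) (Some y)) (f v)
  | None => @TVar L (cext W s) None
  end.

Fixpoint fsub V (p : form V) : forall W, (forall x : V, term W (csort x)) -> form W :=
  match p with
  | FEq s t u => fun W f => FEq (tsub f t) (tsub f u)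
  | FRel r a => fun W f => FRel (fun i => tsub f (a i))
  | FBot => fun W f => @FBot L W
  | FImp p q => fun W f => FImp (fsub p f) (fsub q f)
  | FAll s p => fun W f => FAll (fsub p (lsub f))
  end.

Lemma eval_tsub (M : structure L) V W (f : forall x : V, term W (csort x))
    (e : asg M W) s (t : term V s) :
  eval e (tsub f t) = eval (fun x => eval e (f x)) t.
Proof.
elim: t => [x|g a IH] //=; congr finterp.
by apply: functional_extensionality_dep => i; exact: IH.
Qed.

Lemma eval_ext (M : structure L) V (e e' : asg M V) s (t : term V s) :
  (forall x, e x = e' x) -> eval e t = eval e' t.
Proof. by move=> h; rewrite (functional_extensionality_dep h). Qed.

Lemma sat_ext (M : structure L) V (e e' : asg M V) (p : form V) :
  (forall x, e x = e' x) -> sat p e = sat p e'.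
Proof. by move=> h; rewrite (functional_extensionality_dep h). Qed.

Lemma sat_fsub (M : structure L) V (p : form V) W
    (f : forall x : V, term W (csort x)) (e : asg M W) :
  sat (fsub p f) e = sat p (fun x => eval e (f x)).
Proof.
elim: p W f e => [{}V s t u|{}V r a|{}V|{}V p IHp q IHq|{}V s p IH] W f e //=.
- by rewrite !eval_tsub.
- congr rinterp; apply: functional_extensionality_dep => i; exact: eval_tsub.
- by rewrite IHp IHq.
- apply: eq_forall => a; rewrite IH; apply: sat_ext => -[x|] //=.
  by rewrite eval_tsub.
Qed.

Definition FNot V (p : form V) := FImp p (@FBot L V).
Definition FAnd V (p q : form V) := FNot (FImp p (FNot q)).
Definition FOr V (p q : form V) := FImp (FNot p) q.
Definition FEx V s (p : form (cext V s)) : form V := FNot (FAll (FNot p)).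
Definition FAnds V (l : seq (form V)) : form V := foldr (@FAnd V) (FNot (@FBot L V)) l.
Definition FOrs V (l : seq (form V)) : form V := foldr (@FOr V) (@FBot L V) l.

Lemma sat_not (M : structure L) V (p : form V) (e : asg M V) : sat (FNot p) e = ~ sat p e.
Proof. by []. Qed.

Lemma sat_and (M : structure L) V (p q : form V) (e : asg M V) :
  sat (FAnd p q) e = (sat p e /\ sat q e).
Proof.
apply: propext; rewrite /FAnd /=; split=> [h|[hp hq] h]; last exact: h hp hq.
by split; apply: contrapT => h'; apply: h => // hp.
Qed.

Lemma sat_or (M : structure L) V (p q : form V) (e : asg M V) :
  sat (FOr p q) e = (sat p e \/ sat q e).
Proof.
apply: propext; rewrite /FOr /=; split=> [h|[hp|hq] //].
by have [hp|hp] := pselect (sat p e); [left|right; exact: h].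
Qed.

Lemma sat_ex (M : structure L) V s (p : form (cext V s)) (e : asg M V) :
  sat (FEx p) e = exists a : M s, sat p (asg_ext e a).
Proof.
apply: propext; rewrite /FEx /=; split=> [h|[a ha] h]; last exact: h ha.
by apply: contrapT => h'; apply: h => a ha; apply: h'; exists a.
Qed.

Lemma sat_ands (M : structure L) V (l : seq (form V)) (e : asg M V) :
  sat (FAnds l) e = forall p, List.In p l -> sat p e.
Proof.
apply: propext; elim: l => [|p l IH]; first by split=> //= _ [].
rewrite [FAnds _]/= sat_and IH; split=> [[hp hl] q /= [<-|/hl]//|h].
by split=> [|q ql]; apply: h; [left|right].
Qed.

Lemma sat_ors (M : structure L) V (l : seq (form V)) (e : asg M V) :
  sat (FOrs l) e = exists2 p, List.In p l & sat p e.
Proof.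
apply: propext; elim: l => [|p l IH]; first by split=> //= -[].
rewrite [FOrs _]/= sat_or IH; split=> [[hp|[q ql hq]]|[q /= [->|ql] hq]].
- by exists p => //; left.
- by exists q => //; right.
- by left.
- by right; exists q.
Qed.

Definition subctx V (l : seq V) : ctx (sorts L) :=
  @Ctx _ {x : V | List.In x l} (fun x => csort (sval x)).

Definition sub_incl V (l m : seq V) (h : forall x, List.In x l -> List.In x m)
    (x : subctx l) : term (subctx m) (csort x) :=
  @TVar L (subctx m) (exist _ (sval x) (h _ (svalP x))).

Lemma term_finite V s (t : term V s) : exists (l : seq V) (t' : term (subctx l) s),
  forall (M : structure L) (e : asg M V), eval e t = eval (fun x : subctx l => e (sval x)) t'.
Proof.
elim: t => [x|f a IH].
  exists [:: x], (@TVar L (subctx [:: x]) (exist _ x (or_introl erefl))).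
  by [].
pose l i := projT1 (cid (IH i)).
have lP i : exists t' : term (subctx (l i)) _, forall (M : structure L) (e : asg M V),
    eval e (a i) = eval (fun x : subctx (l i) => e (sval x)) t'.
  by rewrite /l; case: cid.
pose m := flatten [seq l i | i <- enum 'I_(farity f)].
have lm i x : List.In x (l i) -> List.In x m.
  rewrite /m; have : i \in enum 'I_(farity f) by rewrite mem_enum.
  elim: (enum _) => //= j js IHs; rewrite in_cons In_cat => /orP[/eqP<-|/IHs h /h]; auto.
exists m, (TApp (fun i => tsub (sub_incl (lm i)) (projT1 (cid (lP i))))) => M e /=.
congr finterp; apply: functional_extensionality_dep => i.
by rewrite eval_tsub /=; case: cid => t' /= ->.
Qed.

(** Contexts may be infinite, but a formula mentions finitely many variables. Every compactness
    argument below relies on this. *)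
Lemma form_finite V (p : form V) : exists (l : seq V) (p' : form (subctx l)),
  forall (M : structure L) (e : asg M V), sat p e = sat p' (fun x : subctx l => e (sval x)).
Proof.
elim: p => [{}V s t u|{}V r a|{}V|{}V p [l [p' hp]] q [m [q' hq]]|{}V s p [l [p' hp]]].
- have [l [t' ht]] := term_finite t; have [m [u' hu]] := term_finite u.
  have h1 x : List.In x l -> List.In x (l ++ m) by rewrite In_cat; left.
  have h2 x : List.In x m -> List.In x (l ++ m) by rewrite In_cat; right.
  exists (l ++ m), (FEq (tsub (sub_incl h1) t') (tsub (sub_incl h2) u')) => M e /=.
  by rewrite !eval_tsub ht hu.
- have IH i := term_finite (a i).
  pose l i := projT1 (cid (IH i)).
  have lP i : exists t' : term (subctx (l i)) _, forall (M : structure L) (e : asg M V),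
      eval e (a i) = eval (fun x : subctx (l i) => e (sval x)) t'.
    by rewrite /l; case: cid.
  pose m := flatten [seq l i | i <- enum 'I_(rarity r)].
  have lm i x : List.In x (l i) -> List.In x m.
    rewrite /m; have : i \in enum 'I_(rarity r) by rewrite mem_enum.
    elim: (enum _) => //= j js IHs; rewrite in_cons In_cat => /orP[/eqP<-|/IHs h /h]; auto.
  exists m, (FRel (fun i => tsub (sub_incl (lm i)) (projT1 (cid (lP i))))) => M e /=.
  congr rinterp; apply: functional_extensionality_dep => i.
  by rewrite eval_tsub /=; case: cid => t' /= ->.
- by exists [::], (FBot _).
- have h1 x : List.In x l -> List.In x (l ++ m) by rewrite In_cat; left.
  have h2 x : List.In x m -> List.In x (l ++ m) by rewrite In_cat; right.
  exists (l ++ m), (FImp (fsub p' (sub_incl h1)) (fsub q' (sub_incl h2))) => M e /=.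
  by rewrite !sat_fsub hp hq.
- pose m : seq V := pmap id l.
  have lm v : List.In (Some v) l -> List.In v m.
    by rewrite /m; elim: (l) => //= -[w|] k IH /=; [move=> [[->]|/IH]|move=> [//|/IH]]; auto.
  pose f (x : subctx l) : term (cext (subctx m) s) (csort x) :=
    match sval x as o return List.In o l -> term (cext (subctx m) s) (csort (c := cext V s) o) with
    | Some v => fun h => @TVar L (cext (subctx m) s) (Some (exist _ v (lm v h)))
    | None => fun _ => @TVar L (cext (subctx m) s) None
    end (svalP x).
  exists m, (FAll (fsub p' f)) => M e /=.
  apply: eq_forall => a; rewrite hp sat_fsub; apply: sat_ext => -[[v|] hv] //=.
Qed.

Lemma form_support V (p : form V) : exists l : seq V,
  forall (M : structure L) (e e' : asg M V),
    (forall x, List.In x l -> e x = e' x) -> sat p e = sat p e'.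
Proof.
have [l [p' h]] := form_finite p; exists l => M e e' ee'.
by rewrite !h; apply: sat_ext => -[x hx] /=; exact: ee'.
Qed.

Lemma forms_support V (ps : seq (form V)) : exists l : seq V,
  forall (M : structure L) (e e' : asg M V), (forall x, List.In x l -> e x = e' x) ->
  forall p, List.In p ps -> sat p e = sat p e'.
Proof.
elim: ps => [|p ps [l hl]]; first by exists [::].
have [m hm] := form_support p; exists (m ++ l) => M e e' h q /= [<-|].
  by apply: hm => x hx; apply: h; rewrite In_cat; left.
by apply: hl => x hx; apply: h; rewrite In_cat; right.
Qed.

Definition tcast V s s' (h : s = s') (t : term V s) : term V s' :=
  match h in _ = z return term V z with erefl => t end.

(** A [pform] carries a finite tuple of parameters, while the formulas of a type live over an
    arbitrary context [W]; this extracts the variables of [W] that occur. *)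
Lemma form_params V W (p : form (cadd V W)) :
  exists (n : nat) (f : 'I_n -> W) (b : form (cadd V (Ctx (fun i => csort (f i))))),
  forall (M : structure L) (e : asg M V) (w : asg M W),
    sat b (asg_add e ((fun i : 'I_n => w (f i)) : asg M (Ctx (fun i => csort (f i))))) =
    sat p (asg_add e w).
Proof.
have [l [p' hp]] := form_finite p.
pose r := pmap (fun z : cadd V W => if z is inr y then Some y else None) l.
pose f i := tnth (in_tuple r) i.
have fP x : List.In (inr x) l -> exists i, f i = x.
  rewrite /f => h; have : exists i : nat, onth r i = Some x.
    have : List.In x r.
      rewrite /r; elim: l h {p' hp r f} => //= -[y|y] l IH /= [//|]; auto.
      by move=> [->]; left.
    by elim: r {f} => //= y r' IH [->|/IH[i hi]]; [exists 0%N|exists i.+1].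
  move=> [i hi]; have il : (i < size r)%N.
    by rewrite ltnNge; apply/negP => /onth_default; rewrite hi.
  by exists (Ordinal il); apply/tnth_onth.
pose X := Ctx (fun i => csort (f i)).
pose g (x : subctx l) : term (cadd V X) (csort x) :=
  match sval x as o return List.In o l -> term (cadd V X) (csort (c := cadd V W) o) with
  | inl v => fun _ => @TVar L (cadd V X) (inl v)
  | inr v => fun h => let: exist i h := cid (fP _ h) in
      tcast (congr1 (@csort _ W) h) (@TVar L (cadd V X) (inr i))
  end (svalP x).
exists (size r), f, (fsub p' g) => M e w.
rewrite sat_fsub hp; apply: sat_ext => -[[v|v] hx]; rewrite /g //=.
case: cid => i /= h; move: (h); case: _ / h => h.
by rewrite (Prop_irrelevance h erefl).
Qed.

(** The type of the value depends on the variable, so equality of variables is decided by [pselect]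
    and the new value is transported along it. *)
Definition upd (T : sorts L -> Type) V (e : asg T V) (y : V) (a : T (csort y)) : asg T V :=
  fun x => if pselect (y = x) is left h
           then match h in _ = z return T (csort z) with erefl => a end else e x.

Lemma upd_eq (T : sorts L -> Type) V (e : asg T V) (y : V) (a : T (csort y)) : upd e a y = a.
Proof.
rewrite /upd; case: pselect => // h.
by rewrite (Prop_irrelevance h erefl).
Qed.

Lemma upd_neq (T : sorts L -> Type) V (e : asg T V) (y : V) (a : T (csort y)) x :
  y <> x -> upd e a x = e x.
Proof. by rewrite /upd; case: pselect. Qed.

(** [FAll] binds a variable outside the context. Quantifying [y] in place keeps the context fixed,
    so that the operation can be iterated along a list. *)
Definition exq V (y : V) (p : form V) : form V :=
  @FEx V (csort y) (fsub p (fun x =>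
    if pselect (y = x) is left h
    then match h in _ = z return term (cext V (csort y)) (csort z) with
         | erefl => @TVar L (cext V (csort y)) None end
    else @TVar L (cext V (csort y)) (Some x))).

Lemma sat_exq (M : structure L) V (y : V) (p : form V) (e : asg M V) :
  sat (exq y p) e = exists a : M (csort y), sat p (upd e a).
Proof.
rewrite /exq sat_ex; apply: eq_exists => a; rewrite sat_fsub; apply: sat_ext => x.
by rewrite /upd; case: pselect => // h; case: _ / h.
Qed.

Definition exqs V (l : seq V) (p : form V) : form V := foldr (@exq V) p l.

Lemma sat_exqs (M : structure L) V (l : seq V) (p : form V) (e : asg M V) :
  sat (exqs l p) e = exists2 e', (forall x, ~ List.In x l -> e' x = e x) & sat p e'.
Proof.
apply: propext; elim: l e => [|y l IH] e; rewrite [exqs _ _]/=.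
  split=> [h|[e' h]]; first by exists e.
  by rewrite (sat_ext (e' := e)) // => x; apply: h.
rewrite sat_exq; split=> [[a /IH[e' h1 h2]]|[e' h1 h2]].
  exists e' => // x /= hx; rewrite h1 ?upd_neq //; first by move=> h; apply: hx; left.
  by move=> h; apply: hx; right.
exists (e' y); apply/IH; exists e' => // x hx.
have [h|h] := pselect (y = x); first by subst x; rewrite upd_eq.
by rewrite upd_neq //; apply: h1 => /= -[].
Qed.

End Substitution.

(** * Equivalence of tuples, saturation and realization of types *)

Lemma ultra_nat : exists U : set (set nat),
  [/\ forall A B : set nat, A `<=` B -> U A -> U B,
      forall A B : set nat, U A -> U B -> U (A `&` B),
      forall A : set nat, U A \/ U (~` A), ~ U set0 &
      forall N, U [set n | (N <= n)%N]].
Proof.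
have [U [UU EU]] := @ultraFilterLemma nat eventually _.
exists U; split.
- by move=> A B AB UA; exact: filterS UA.
- by move=> A B UA UB; exact: filterI.
- by move=> A; exact: in_ultra_setVsetC.
- exact: filter_not_empty.
- by move=> N; apply: EU; exists N.
Qed.

Definition equivalent (L : signature) (M : structure L) (V : ctx (sorts L)) (e e' : asg M V) :=
  forall p : form V, sat p e <-> sat p e'.

Lemma equiv_le (L : signature) (M : structure L) (V : ctx (sorts L)) (e e' : asg M V) :
  (forall p : form V, sat p e -> sat p e') -> equivalent e e'.
Proof.
move=> h p; split; first exact: h.
by move=> pe'; apply: contrapT => /(h (FNot p)); exact.
Qed.

Lemma equiv_sub (L : signature) (M : structure L) (V W : ctx (sorts L)) (e e' : asg M V)
    (f : forall x : W, term V (csort x)) : equivalent e e' ->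
  equivalent (fun x => eval e (f x)) (fun x => eval e' (f x)).
Proof. by move=> h p; rewrite -!sat_fsub. Qed.

Lemma equiv_sym (L : signature) (M : structure L) (V : ctx (sorts L)) (e e' : asg M V) :
  equivalent e e' -> equivalent e' e.
Proof. by move=> h p; rewrite (h p). Qed.

Lemma equiv_trans (L : signature) (M : structure L) (V : ctx (sorts L)) (e e' e'' : asg M V) :
  equivalent e e' -> equivalent e' e'' -> equivalent e e''.
Proof. by move=> h h' p; rewrite (h p). Qed.

(** The parameters form an assignment on a small context rather than a set of points: tuples may
    repeat points, and no set of points has to be formed. *)
Definition saturated (L : signature) (M : structure L) U (D : set U) :=
  forall W : ctx (sorts L), injects [set: W] D ->
  forall (w : asg M W) s (T : set (form (cadd (cone s) W))),
    (forall l, (forall p, List.In p l -> T p) ->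
       exists x : M s, forall p, List.In p l ->
         sat p (asg_add ((fun _ => x) : asg M (cone s)) w)) ->
    exists x : M s, forall p, T p -> sat p (asg_add ((fun _ => x) : asg M (cone s)) w).

Lemma succ_saturated_saturated (L : signature) (M : structure L) U (D : set U) (d : U) :
  injects [set: nat] D -> succ_saturated M D -> saturated M D.
Proof.
move=> Dinf hs W Wsm w s T Tfin.
pose P : set (points M) := [set existT M (csort y) (w y) | y in [set: W]].
have PD : (P #<= D)%card by apply: card_le_injects; apply: small_image.
pose f (x : cadd (cone s) W) : term (cadd (cone s) (cpts P)) (csort x) :=
  match x return term (cadd (cone s) (cpts P)) (csort (c := cadd (cone s) W) x) with
  | inl u => @TVar L (cadd (cone s) (cpts P)) (inl u)
  | inr y => @TVar L (cadd (cone s) (cpts P))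
       (inr (exist _ (existT M (csort y) (w y)) (ex_intro2 _ _ y I erefl)))
  end.
have fE (x : M s) p : sat (fsub p f) (asg_add ((fun _ => x) : asg M (cone s)) (incl P)) =
    sat p (asg_add ((fun _ => x) : asg M (cone s)) w).
  by rewrite sat_fsub; apply: sat_ext => -[u|y].
have [q qT /finite_set_list[l lP]|x hx] := hs P PD s [set fsub p f | p in T].
  have [m [m1 m2]] : exists m : seq (form (cadd (cone s) W)),
     (forall p, List.In p m -> exists2 r, List.In r l & T p /\ fsub p f = r) /\
     (forall r, List.In r l -> exists2 p, List.In p m & T p /\ fsub p f = r).
    by apply: list_choice => r /lP/qT[p Tp pr]; exists p.
  have [|x hx] := Tfin m; first by move=> p /m1[r _ []].
  exists x => r /lP/m2[p pm [_ <-]].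
  by rewrite /defset /= fE; exact: hx.
by exists x => p Tp; rewrite -fE; apply: hx; exists p.
Qed.

Section Saturated.
Variables (U : Type) (D : set U).
Hypothesis Dinf : injects [set: nat] D.
Variables (L : signature) (M : structure L).
Hypothesis Msat : saturated M D.
Variable cst : forall (V : ctx (sorts L)) s, term V s.

(** Zorn's lemma on the partial assignments [R] that keep every finite part of [T] satisfiable. A
    maximal one is total: saturation in one variable chooses the value of a further variable, the
    remaining ones being quantified out. *)
Lemma many_saturated (X W : ctx (sorts L)) (w : asg M W) (T : set (form (cadd X W))) :
  injects [set: X] D -> injects [set: W] D ->
  (forall l, (forall p, List.In p l -> T p) ->
     exists e : asg M X, forall p, List.In p l -> sat p (asg_add e w)) ->
  exists e : asg M X, forall p, T p -> sat p (asg_add e w).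
Proof.
move=> Xsm Wsm Tfin.
pose agr (R : set {x : X & M (csort x)}) (e : asg M X) :=
  forall x a, R (existT _ x a) -> e x = a.
pose good R := forall l, (forall p, List.In p l -> T p) ->
  exists2 e : asg M X, agr R e & forall p, List.In p l -> sat p (asg_add e w).
have [F FP tot|R [gR Rmax]] := @Zorn_bigcup _ good.
  set B := \bigcup_(R in F) R => l lT.
  have [lv hlv] := forms_support l.
  have Bfun x a b : B (existT _ x a) -> B (existT _ x b) -> a = b.
    move=> [Y FY Ya] [Z FZ Zb].
    have [Q [FQ Qa Qb]] : exists Q, [/\ F Q, Q (existT _ x a) & Q (existT _ x b)].
      by have [s|s] := tot _ _ FY FZ; [exists Z|exists Y]; split=> //; exact: s.
    have [|e he _] := FP Q FQ [::]; first by [].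
    by rewrite -(he _ _ Qa) -(he _ _ Qb).
  (* A single member of the chain already fixes the finitely many variables on which [l] depends. *)
  have [Y [FY hY]] : exists Y, (F Y \/ Y = set0) /\
      forall x a, List.In (inl x) lv -> B (existT _ x a) -> Y (existT _ x a).
    elim: lv {hlv} => [|[x|y] lv [Y [FY hY]]]; first by exists set0; split=> //; right.
      have [[a [Z FZ Za]]|na] := pselect (exists a, B (existT _ x a)); last first.
        exists Y; split=> // x' a /= [e|/hY]; last exact.
        have ex : x = x' by case: e.
        move: a; rewrite -ex => a Ba.
        by case: na; exists a.
      have [Q [FQ YQ ZQ]] : exists Q, [/\ F Q, Y `<=` Q & Z `<=` Q].
        case: FY => [FY|->]; last by exists Z; split.
        by have [s|s] := tot _ _ FY FZ; [exists Z|exists Y]; split.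
      exists Q; split; first by left.
      move=> x' a' /= [e|/hY h /h]; last exact: YQ.
      have ex : x = x' by case: e.
      move: a'; rewrite -ex => a' Ba'.
      by rewrite (Bfun _ _ _ Ba' (ex_intro2 _ _ _ FZ Za)); exact: ZQ.
    by exists Y; split=> // x a /= [e|/hY]; [case: e|exact].
  have YB : Y `<=` B by case: (FY) => [FY'|->//] q Yq; exists Y.
  have [e he el] : exists2 e : asg M X, agr Y e & forall p, List.In p l -> sat p (asg_add e w).
    case: FY => [/FP h|Y0]; first exact: h.
    have [e he] := Tfin l lT; exists e; last exact: he.
    by move=> x a; rewrite Y0.
  pose e' : asg M X := fun x =>
    if pselect (exists a, B (existT _ x a)) is left h then projT1 (cid h) else e x.
  exists e'.
    move=> x a Ba; rewrite /e'; case: pselect => [h|[]]; last by exists a.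
    by case: cid => b /= Bb; exact: Bfun Bb Ba.
  move=> p pl; rewrite -(hlv M (asg_add e w)) //; first exact: el.
  move=> [x|y] xl //=; rewrite /e'; case: pselect => // h; case: cid => b /= Bb.
  by apply: he; exact: hY.
have Rfun x a b : R (existT _ x a) -> R (existT _ x b) -> a = b.
  move=> Ra Rb; have [|e he _] := gR [::]; first by [].
  by rewrite -(he _ _ Ra) -(he _ _ Rb).
suff Rtot x : exists a, R (existT _ x a).
  exists (fun x => projT1 (cid (Rtot x))) => p Tp.
  have [q [<-|//]|e he ep] := gR [:: p]; first exact: Tp.
  rewrite -(sat_ext (e := asg_add e w)); first by apply: ep; left.
  by move=> [x|y] //=; case: cid => a Ra /=; exact: he.
apply: contrapT => nx.
have [e0 he0 _] := gR [::] (fun p h => False_ind _ h).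
pose lv l := projT1 (cid (@forms_support L (cadd X W) l)).
have lvP l (e e' : asg M (cadd X W)) : (forall x, List.In x (lv l) -> e x = e' x) ->
    forall p, List.In p l -> sat p e = sat p e'.
  by rewrite /lv; case: cid => m h /=; exact: h.
pose elim_ (z : cadd X W) : bool :=
  if z is inl y then `[< y <> x /\ ~ exists a, R (existT _ y a) >] else false.
(* [phi l] says that [l] is satisfiable with [x] and the domain of [R] held fixed: only the other
   variables of [X] are quantified. *)
pose phi l := exqs (seq.filter elim_ (lv l)) (FAnds l).
pose V := cadd X W.
pose f (z : V) : term (cadd (cone (csort x)) V) (csort z) :=
  match z return term (cadd (cone (csort x)) V) (csort (c := V) z) with
  | inl y => if pselect (x = y) is left h
             then tcast (congr1 (@csort _ X) h) (@TVar L (cadd (cone (csort x)) V) (inl tt))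
             else @TVar L (cadd (cone (csort x)) V) (inr (inl y))
  | inr y => @TVar L (cadd (cone (csort x)) V) (inr (inr y))
  end.
have fE l (a : M (csort x)) :
    sat (fsub (phi l) f) (asg_add ((fun _ => a) : asg M (cone (csort x))) (asg_add e0 w)) =
    sat (phi l) (asg_add (upd e0 a) w).
  rewrite sat_fsub; apply: sat_ext => -[y|y] //=; rewrite /upd.
  by case: pselect => // h; case: _ / h.
have Vsm : injects [set: V] D.
  apply: (@injects_sub _ _ _ (inl @` [set: X] `|` inr @` [set: W])).
    by move=> [y|y] _; [left|right]; exists y.
  by apply: small_union => //; exact: small_image.
have [ls lsT|a ha] := Msat Vsm (w := asg_add e0 w)
    (T := [set fsub (phi l) f | l in [set l | forall p, List.In p l -> T p]]).
  have [m [m1 m2]] := @list_choice _ _ (fun r l =>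
      (forall p, List.In p l -> T p) /\ fsub (phi l) f = r) ls
    (fun r h => let: ex_intro2 l hl e := lsT r h in ex_intro _ l (conj hl e)).
  have [|e he el] := gR (flatten m).
    elim: m m1 {m2} => //= l m IH m1 p; rewrite In_cat => -[pl|].
      by have [|r _ [h _]] := m1 l; [left|exact: h].
    by apply: IH => l' h; apply: m1; right.
  exists (e x) => r /m2[l lm]; case=> hl <-.
  rewrite fE /phi sat_exqs.
  exists (fun z => if elim_ z && `[< List.In z (lv l) >] then asg_add e w z else asg_add (upd e0 (e x)) w z).
    move=> z; rewrite In_filter; case: asboolP => h; last by rewrite andbF.
    by move=> h'; case: (elim_ z) h' => //= -[].
  rewrite sat_ands => p pl; rewrite -(lvP l (asg_add e w)) //.
    apply: el; elim: m lm {m1 m2} => //= l' m IH [->|h]; rewrite In_cat; first by left.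
    by right; exact: IH.
  move=> z zl; case: asboolP => // _; rewrite andbT.
  case: ifPn => //; case: z zl => [y|y] zl //= /asboolPn.
  have [<-|nxy] := pselect (x = y); first by rewrite upd_eq.
  rewrite upd_neq // => /not_andP[[]|/contrapT[b Rb]]; first by move=> e'; apply: nxy.
  by rewrite (he _ _ Rb) (he0 _ _ Rb).
apply: (Rmax (R `|` [set existT _ x a])).
  split; first by left.
  by move=> s; apply: nx; exists a; apply: s; right.
move=> l lT.
have := ha _ (ex_intro2 _ _ l lT erefl); rewrite fE /phi sat_exqs => -[e' h1].
rewrite sat_ands => h2.
exists (fun y => e' (inl y)).
  have agree y b : (upd e0 a) y = b -> (y = x \/ exists a, R (existT _ y a)) -> e' (inl y) = b.
    move=> <- h; rewrite h1 // In_filter => -[_ /asboolP[n1 n2]].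
    by case: h.
  move=> y b [Rb|e].
    apply: agree; last by right; exists b.
    rewrite upd_neq; first exact: he0.
    by move=> e; apply: nx; move: b Rb; rewrite -e => b Rb; exists b.
  have updE q : q = existT (fun x => M (csort x)) x a -> (upd e0 a) (projT1 q) = projT2 q.
    by move=> ->; exact: upd_eq.
  apply: agree; first exact: updE e.
  by left; exact: (congr1 (@projT1 _ _) e).
move=> p pl; rewrite -(sat_ext (e := e')); first exact: h2.
by move=> [y|y] //=; rewrite h1 // In_filter => -[].
Qed.

(** After quantification the variables of [X] no longer matter, but the formula has to live over
    [W]: they are replaced by constants, which is why every sort must have a term. *)
Lemma exists_form (X W : ctx (sorts L)) (p : form (cadd X W)) :
  exists q : form W, forall (N : structure L) (w : asg N W),
    sat q w <-> exists e : asg N X, sat p (asg_add e w).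
Proof.
have [l hl] := form_support p.
pose a (z : cadd X W) : bool := if z is inl _ then true else false.
pose f (z : cadd X W) : term W (csort z) :=
  match z return term W (csort (c := cadd X W) z) with
  | inl x => cst W (csort x) | inr y => @TVar L W y end.
exists (fsub (exqs (seq.filter a l) p) f) => N w; rewrite sat_fsub sat_exqs; split.
  move=> [e' h1 h2]; exists (fun x => e' (inl x)).
  rewrite -(sat_ext (e := e')) // => -[x|y] //=.
  by rewrite h1 // In_filter => -[].
move=> [e he]; exists (fun z => if `[< List.In z (seq.filter a l) >] then asg_add e w z
    else (fun x => eval w (f x)) z).
  by move=> z hz; case: asboolP.
rewrite -(hl N (asg_add e w)) // => -[x|y] xl; case: asboolP => //=.
by rewrite In_filter => -[].
Qed.

(** The type of [c] over [w], read over [w'], is finitely satisfiable because its existential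
    consequences are true of [w]. *)
Lemma transfer (X W : ctx (sorts L)) (c : asg M X) (w w' : asg M W) :
  injects [set: X] D -> injects [set: W] D -> equivalent w w' ->
  exists c' : asg M X, equivalent (asg_add c w) (asg_add c' w').
Proof.
move=> Xsm Wsm ww.
have [l hl|c' hc'] := many_saturated (w := w') (T := [set p | sat p (asg_add c w)]) Xsm Wsm.
  have [q hq] := exists_form (FAnds l).
  have /hq[e he] : sat q w'.
    by apply/ww/hq; exists c; rewrite sat_ands; exact: hl.
  by exists e => p pl; move: he; rewrite sat_ands; exact.
by exists c'; apply: equiv_le => p; exact: hc'.
Qed.

End Saturated.

(** * Nonforking extensions and nonforking along indiscernible sequences *)

Section ForkingTools.
Variables (U : Type) (D : set U).
Hypothesis Dinf : injects [set: nat] D.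
Variables (L : signature) (M : structure L).
Hypothesis Msat : saturated M D.
Variable cst : forall (V : ctx (sorts L)) s, term V s.

Lemma forks_le (X : ctx (sorts L)) (A : set (points M)) (f g : pform M X) :
  (forall e, psat f e -> psat g e) -> forks A g -> forks A f.
Proof. by move=> fg [fs [h1 h2 h3]]; exists fs; split=> // e /fg/h3. Qed.

Lemma divides_forks (X : ctx (sorts L)) (A : set (points M)) (f : pform M X) :
  divides A f -> forks A f.
Proof.
move=> df; exists [set f]; split; first exact: finite_set1.
  by move=> g ->.
by move=> e fe; exists f.
Qed.

Definition nonforking_over (X : ctx (sorts L)) (A S : set (points M)) (c : asg M X) :=
  forall n (ps : 'I_n -> sorts L) (b : form (cadd X (Ctx ps))) (d : asg M (Ctx ps)),
    (forall i, S (existT _ _ (d i))) -> sat b (asg_add c d) -> ~ forks A (PForm b d).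

Lemma small_sum (X W : Type) : injects [set: X] D -> injects [set: W] D ->
  injects [set: X + W] D.
Proof.
move=> Xsm Wsm; apply: (@injects_sub _ _ _ (inl @` [set: X] `|` inr @` [set: W])).
  by move=> [y|y] _; [left|right]; exists y.
by apply: small_union => //; exact: small_image.
Qed.

Lemma small_sig T (P : set T) : injects P D -> injects [set: {x | P x}] D.
Proof.
move=> [f [fD fi]]; exists (fun x => f (sval x)); split=> [x _|[x Px] [y Py] _ _ /= e].
  by apply: fD; exact: svalP.
by apply: eq_exist; exact: fi.
Qed.

Lemma small_fin (T : finType) : injects [set: T] D.
Proof.
apply: (@small_nat _ _ Dinf _ (fun x => enum_rank x : nat)) => x y _ _.
by move=> /ord_inj /enum_rank_inj.
Qed.

(** Add to the type the negations of all forking formulas over [S]. If this were inconsistent,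
    finitely many members of the type would imply a finite disjunction of forking formulas, and the
    type would fork. *)
Lemma nonforking_realization (X : ctx (sorts L)) (c : asg M X) (A B S : set (points M)) :
  injects [set: X] D -> injects B D -> injects S D ->
  ~ type_forks A (tp c B) ->
  exists c' : asg M X,
    (forall p : form (cadd X (cpts B)), sat p (asg_add c (incl B)) ->
       sat p (asg_add c' (incl B))) /\ nonforking_over A S c'.
Proof.
move=> Xsm Bsm Ssm nf.
pose W := cadd (cpts B) (cpts S).
pose f (x : cadd X (cpts B)) : term (cadd X W) (csort x) :=
  match x return term (cadd X W) (csort (c := cadd X (cpts B)) x) with
  | inl x => @TVar L (cadd X W) (inl x) | inr y => @TVar L (cadd X W) (inr (inl y)) end.
pose g (x : cadd X (cpts S)) : term (cadd X W) (csort x) :=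
  match x return term (cadd X W) (csort (c := cadd X (cpts S)) x) with
  | inl x => @TVar L (cadd X W) (inl x) | inr y => @TVar L (cadd X W) (inr (inr y)) end.
pose w := asg_add (incl B) (incl S) : asg M W.
have fE p e : sat (fsub p f) (asg_add e w) = sat p (asg_add e (incl B)).
  by rewrite sat_fsub; apply: sat_ext => -[y|y].
have gE p e : sat (fsub p g) (asg_add e w) = sat p (asg_add e (incl S)).
  by rewrite sat_fsub; apply: sat_ext => -[y|y].
pose T : set (form (cadd X W)) := [set fsub p f | p in tp c B] `|`
  [set FNot (fsub q g) | q in [set q | exists h : pform M X,
     (forall e, psat h e <-> sat q (asg_add e (incl S))) /\ forks A h]].
have [|l lT|c' hc'] := many_saturated Dinf Msat (w := w) (T := T) Xsm.
- by apply: small_sum; exact: small_sig.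
- have [ps [hs [psP [hsP lP]]]] : exists (ps : seq (form (cadd X (cpts B)))) (hs : seq (pform M X)),
     (forall p, List.In p ps -> tp c B p) /\ (forall h, List.In h hs -> forks A h) /\
     forall e, (forall p, List.In p ps -> sat p (asg_add e (incl B))) ->
       (forall h, List.In h hs -> ~ psat h e) -> forall r, List.In r l -> sat r (asg_add e w).
    elim: l lT => [|r l IH] lT; first by exists [::], [::].
    have [ps [hs [h1 [h2 h3]]]] := IH (fun p h => lT p (or_intror h)).
    have [[p pc pr]|[q [h [hq hf]] qr]] := lT r (or_introl erefl).
      exists (p :: ps), hs; split; first by move=> q /= [<-|/h1].
      split=> // e e1 e2 q /= [<-|]; last by apply: h3 => // q' h'; apply: e1; right.
      by rewrite -pr fE; apply: e1; left.
    exists ps, (h :: hs); split=> //; split; first by move=> q' /= [<-|/h2].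
    move=> e e1 e2 q' /= [<-|]; last by apply: h3 => // h'' hh; apply: e2; right.
    by rewrite -qr sat_not gE -hq; apply: e2; left.
  apply: contrapT => ne; apply: nf.
  have [n [i [b hb]]] := form_params (FAnds ps).
  exists (PForm b ((fun k => incl B (i k)) : asg M (Ctx (fun k => csort (i k))))); split.
    exists [set p | List.In p ps]; split=> //; first exact: list_finite_set.
    by move=> e he; rewrite /psat /= (hb M e (incl B)) sat_ands; exact: he.
  have hsF h : exists fs : set (pform M X), List.In h hs -> [/\ finite_set fs,
      forall g, fs g -> divides A g & forall e, psat h e -> exists2 g, fs g & psat g e].
    have [/hsP[fs hfs]|nh] := pselect (List.In h hs); first by exists fs.
    by exists set0.
  pose F h := projT1 (cid (hsF h)).
  have FP h : List.In h hs -> [/\ finite_set (F h), forall g, F h g -> divides A g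
      & forall e, psat h e -> exists2 g, F h g & psat g e].
    by rewrite /F; case: cid.
  exists (\bigcup_(h in [set h | List.In h hs]) F h); split.
  - by apply: bigcup_finite => [|h /FP[]//]; exact: list_finite_set.
  - by move=> h [h' /FP[_ q _] /q].
  - move=> e; rewrite /psat /= (hb M e (incl B)) sat_ands => he.
    apply: contrapT => ng; apply: ne; exists e; apply: lP => // h hh he'.
    by have [_ _ /(_ e he')[k k1 k2]] := FP h hh; apply: ng; exists k => //; exists h.
- exists c'; split=> [p pc|n ps b d dS bc' fk].
    by rewrite -fE; apply: hc'; left; exists p.
  pose q := fsub b (fun x : cadd X (Ctx ps) =>
    match x return term (cadd X (cpts S)) (csort (c := cadd X (Ctx ps)) x) with
    | inl x => @TVar L (cadd X (cpts S)) (inl x)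
    | inr i => @TVar L (cadd X (cpts S)) (inr (exist _ _ (dS i)))
    end).
  have qE e : sat q (asg_add e (incl S)) = sat b (asg_add e d).
    by rewrite /q sat_fsub; apply: sat_ext => -[x|i].
  have : T (FNot (fsub q g)) by right; exists q => //; exists (PForm b d); split=> // e; rewrite qE.
  by move=> /hc'; rewrite sat_not gE qE.
Qed.

(** Dividing, contraposed and applied to whole types: by compactness the failure is witnessed by one
    formula true of [c] and a finite part of [d 0], and that formula divides. Hence indiscernibility
    is only asked of finite subtuples. *)
Lemma nonforking_conjugates (X K : ctx (sorts L)) (A S : set (points M)) (c : asg M X)
    (d : nat -> asg M K) :
  injects [set: X] D -> injects [set: K] D -> nonforking_over A S c ->
  (forall y, S (existT _ _ (d 0%N y))) ->
  (forall n (f : 'I_n -> K) (Y := Ctx (fun i => csort (f i)))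
      (df := (fun m i => d m (f i)) : nat -> asg M Y),
     (forall m, tp (df m) A = tp (df 0%N) A) /\ indiscernible A df) ->
  forall n, exists c' : asg M X, forall m, (m < n)%N ->
    forall p : form (cadd X K), sat p (asg_add c (d 0%N)) -> sat p (asg_add c' (d m)).
Proof.
move=> Xsm Ksm nf dS dind n.
pose W := Ctx (fun z : 'I_n * K => csort z.2).
pose w : asg M W := fun z => d z.1 z.2.
pose f (m : 'I_n) (x : cadd X K) : term (cadd X W) (csort x) :=
  match x return term (cadd X W) (csort (c := cadd X K) x) with
  | inl x => @TVar L (cadd X W) (inl x) | inr y => @TVar L (cadd X W) (inr (m, y)) end.
have fE m p e : sat (fsub p (f m)) (asg_add e w) = sat p (asg_add e (d m)).
  by rewrite sat_fsub; apply: sat_ext => -[y|y].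
pose T : set (form (cadd X W)) :=
  [set fsub q.2 (f q.1) | q in [set q | sat q.2 (asg_add c (d 0%N))]].
have [|l lT|c' hc'] := many_saturated Dinf Msat (w := w) (T := T) Xsm.
- rewrite /W /=; apply: injects_sub (small_prod Dinf (small_fin 'I_n) Ksm).
  by move=> z _; split.
- have [ps [psP lP]] : exists ps : seq (form (cadd X K)),
    (forall p, List.In p ps -> sat p (asg_add c (d 0%N))) /\
    (forall r, List.In r l -> exists (m : 'I_n) p, List.In p ps /\ r = fsub p (f m)).
    elim: l lT => [|r l IH] lT; first by exists [::].
    have [ps [h1 h2]] := IH (fun p h => lT p (or_intror h)).
    have [[m p] pc pr] := lT r (or_introl erefl).
    exists (p :: ps); split=> [q /= [<-|/h1]//|q /= [<-|/h2[m' [p' [h ->]]]]].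
      by exists m, p; split=> //; left.
    by exists m', p'; split=> //; right.
  have [N [i [b hb]]] := form_params (FAnds ps).
  pose df m := (fun k => d m (i k)) : asg M (Ctx (fun k => csort (i k))).
  have [e he] : exists e : asg M X, forall m, (m < n)%N -> sat b (asg_add e (df m)).
    apply: contrapT => ne.
    apply: (nf N _ b (df 0%N)); first by move=> k; exact: dS.
      by rewrite (hb M c (d 0%N)) sat_ands.
    apply: divides_forks; have [h1 h2] := dind N i.
    by exists df; split=> //; exists n.
  exists e => r /lP[m [p [pp ->]]]; rewrite fE.
  by have := he m (ltn_ord m); rewrite (hb M e (d m)) sat_ands; exact.
- exists c' => m mn p pc.
  by rewrite -(fE (Ordinal mn)); apply: hc'; exists (Ordinal mn, p).
Qed.

End ForkingTools.

(** * Indiscernible sequences from infinitely many conjugates *)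

Section Indiscernibles.
Variables (U : Type) (D : set U).
Hypothesis Dinf : injects [set: nat] D.
Variables (L : signature) (M : structure L).
Hypothesis Msat : saturated M D.
Variable cst : forall (V : ctx (sorts L)) s, term V s.
Variables (Y : ctx (sorts L)) (P : set (points M)).
Hypotheses (Ysm : injects [set: Y] D) (Psm : injects P D).

(* The realizations of the average type of the sequence [a] with respect to
   an ultrafilter, each one over its predecessors and the whole sequence. *)
Lemma average_sequence (a : nat -> asg M Y) (y0 : Y) :
  (forall m, tp (a m) P = tp (a 0%N) P) ->
  (forall m m', a m y0 = a m' y0 -> m = m') ->
  exists b : nat -> asg M Y,
    [/\ forall n, tp (b n) P = tp (a 0%N) P, indiscernible P b & b 0%N y0 <> b 1%N y0].
Proof.
move=> atp ainj.
have [F [Fup FI Fu F0 Fcof]] := ultra_nat.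
have FC A : F (~` A) <-> ~ F A.
  split=> [h h'|]; last by case: (Fu A).
  by apply: F0; rewrite -(setICr A); exact: FI.
pose Sq := Ctx (fun z : nat * Y => csort z.2).
pose W := cadd (cpts P) Sq.
pose w : asg M W := asg_add (incl P) ((fun z => a z.1 z.2) : asg M Sq).
pose hst k (b : nat -> asg M Y) : asg M (cpow k Y) := fun z => b z.1 z.2.
have Wsm : injects [set: W] D.
  apply: small_sum => //; first exact: small_sig.
  by apply: injects_sub (small_prod Dinf Dinf Ysm) => z _; split.
(* Finitely many formulas of the average type hold together on a set of the ultrafilter, so some
   [a m] satisfies them. *)
have step k (b : nat -> asg M Y) : exists c : asg M Y,
    forall p : form (cadd Y (cadd W (cpow k Y))),
      sat p (asg_add c (asg_add w (hst k b))) <->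
      F [set m | sat p (asg_add (a m) (asg_add w (hst k b)))].
  have [|l lT|c hc] := many_saturated Dinf Msat (w := asg_add w (hst k b))
     (T := [set p | F [set m | sat p (asg_add (a m) (asg_add w (hst k b)))]]) Ysm.
  - apply: small_sum => //.
    by apply: injects_sub (small_prod Dinf (small_fin Dinf 'I_k) Ysm) => z _; split.
  - have : F [set m | forall p, List.In p l -> sat p (asg_add (a m) (asg_add w (hst k b)))].
      elim: l lT => [|p l IH] lT; first by apply: (Fup _ _ _ (Fcof 0%N)) => m _ q [].
      apply: (Fup _ _ _ (FI _ _ (lT p (or_introl erefl)) (IH (fun q h => lT q (or_intror h))))).
      by move=> m [h1 h2] q /= [<-|/h2].
    move=> Fl; have [[m hm]|nm] := pselect ([set m | forall p, List.In p l ->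
      sat p (asg_add (a m) (asg_add w (hst k b)))] !=set0); first by exists (a m).
    by case: F0; apply: (Fup _ _ _ Fl) => m hm; apply: nm; exists m.
  - exists c => p; split; last exact: hc.
    by move=> pc; apply: contrapT => /FC h; apply: (hc (FNot p) _ pc); exact: h.
pose nx k s := projT1 (cid (step k (fun i => nth (a 0%N) s i))).
pose lst := fix lst k := if k is k'.+1 then rcons (lst k') (nx k' (lst k')) else [::].
pose b k := nx k (lst k).
have sz k : size (lst k) = k by elim: k => //= k IH; rewrite size_rcons IH.
have nl k i : (i < k)%N -> nth (a 0%N) (lst k) i = b i.
  elim: k => // k IH; rewrite ltnS leq_eqVlt /= nth_rcons sz => /orP[/eqP->|ik].
    by rewrite ltnn eqxx.
  by rewrite ik IH.
have bE k (p : form (cadd Y (cadd W (cpow k Y)))) :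
    sat p (asg_add (b k) (asg_add w (hst k b))) <->
    F [set m | sat p (asg_add (a m) (asg_add w (hst k b)))].
  have hE : hst k (fun i => nth (a 0%N) (lst k) i) = hst k b.
    by apply: functional_extensionality_dep => -[i y]; rewrite /hst /= nl.
  by rewrite /b /nx; case: cid => c /= hc; rewrite -hE; exact: hc.
have ind n : forall (i j : 'I_n -> nat), {homo i : x y / (x < y)%N} -> {homo j : x y / (x < y)%N} ->
   forall p : form (cadd (cpow n Y) W),
    sat p (asg_add ((fun x => b (i x.1) x.2) : asg M (cpow n Y)) w) <->
    sat p (asg_add ((fun x => b (j x.1) x.2) : asg M (cpow n Y)) w).
  elim: n => [|n IH] i j hi hj p.
    by rewrite (sat_ext (e' := asg_add ((fun x => b (j x.1) x.2) : asg M (cpow 0 Y)) w)) // => -[[[]]|].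
  pose r (i : 'I_n.+1 -> nat) (k : 'I_n) := i (widen_ord (leqnSn n) k).
  have hr (i' : 'I_n.+1 -> nat) : {homo i' : x y / (x < y)%N} -> {homo r i' : x y / (x < y)%N}.
    by move=> h x y xy; exact: h.
  have lt (i' : 'I_n.+1 -> nat) (k : 'I_n) : {homo i' : x y / (x < y)%N} -> (r i' k < i' ord_max)%N.
    move=> h; apply: h; exact: (ltn_ord k).
  pose f m (z : cadd (cpow n.+1 Y) W) : term (cadd (cpow n Y) W) (csort z) :=
    match z return term (cadd (cpow n Y) W) (csort (c := cadd (cpow n.+1 Y) W) z) with
    | inl (k, y) => if insub (k : nat) is Some k' then @TVar L (cadd (cpow n Y) W) (inl (k', y))
                    else @TVar L (cadd (cpow n Y) W) (inr (inr (m, y)))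
    | inr v => @TVar L (cadd (cpow n Y) W) (inr v)
    end.
  (* The last term of an increasing tuple realizes the average type over the earlier ones, so it can
     be replaced by [a m] for ultrafilter-many m; this lowers the length by one. *)
  have key (i' : 'I_n.+1 -> nat) : {homo i' : x y / (x < y)%N} ->
     (sat p (asg_add ((fun x => b (i' x.1) x.2) : asg M (cpow n.+1 Y)) w) <->
      F [set m | sat (fsub p (f m)) (asg_add ((fun x => b (r i' x.1) x.2) : asg M (cpow n Y)) w)]).
    move=> hi'; set k := i' ord_max.
    pose V := cadd Y (cadd W (cpow k Y)).
    pose g (z : cadd (cpow n.+1 Y) W) : term V (csort z) :=
      match z return term V (csort (c := cadd (cpow n.+1 Y) W) z) with
      | inl (l, y) => if insub (i' l) is Some l' then @TVar L V (inr (inr (l' : 'I_k, y)))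
                      else @TVar L V (inl y)
      | inr v => @TVar L V (inr (inl v))
      end.
    have -> : sat p (asg_add ((fun x => b (i' x.1) x.2) : asg M (cpow n.+1 Y)) w) =
        sat (fsub p g) (asg_add (b k) (asg_add w (hst k b))).
      rewrite sat_fsub; apply: sat_ext => -[[l y]|v] //=.
      case: insubP => [l' _ /= e|]; first by rewrite /= /hst /= e.
      rewrite -leqNgt /= => kl; congr (b _ y); apply/eqP; rewrite eqn_leq kl andbT.
      have [->//|nl'] := eqVneq l ord_max.
      by apply/ltnW/hi'; rewrite ltn_neqAle nl' -ltnS ltn_ord.
    rewrite bE (_ : [set m | sat (fsub p g) _] = [set m | sat (fsub p (f m))
      (asg_add ((fun x => b (r i' x.1) x.2) : asg M (cpow n Y)) w)]) //.
    apply: funext => m; rewrite /mkset !sat_fsub; apply: sat_ext => -[[l y]|v] //=.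
    case: insubP => [l' lk el|kl]; case: insubP => [l2 ln el2|nln] //=.
    - by rewrite /hst /= el; congr (b (i' _) y); apply: val_inj; rewrite /= el2.
    - exfalso; move: lk; rewrite (_ : l = ord_max) ?ltnn //.
      by apply/val_inj/eqP; rewrite eqn_leq /= -ltnS ltn_ord /= leqNgt.
    - exfalso; move: kl; rewrite (_ : l = widen_ord (leqnSn n) l2) ?(lt _ l2 hi') //.
      by apply: val_inj; rewrite /= el2.
  rewrite (key i hi) (key j hj).
  by split; apply: Fup => m; rewrite /= (IH (r i) (r j) (hr _ hi) (hr _ hj)).
have bP k (p : form (cadd Y (cadd W (cpow k Y)))) (T : set nat) :
    (forall m, sat p (asg_add (a m) (asg_add w (hst k b))) -> T m) ->
    sat p (asg_add (b k) (asg_add w (hst k b))) -> T !=set0.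
  move=> h /bE/(Fup _ _ h) FT; apply: contrapT => nT; apply: F0; apply: Fup FT => m Tm.
  by apply: nT; exists m.
exists b; split.
- move=> n.
  have tpb p : tp (b n) P p -> tp (a 0%N) P p.
    pose V := cadd Y (cadd W (cpow n Y)).
    pose f (z : cadd Y (cpts P)) : term V (csort z) :=
      match z return term V (csort (c := cadd Y (cpts P)) z) with
      | inl x => @TVar L V (inl x)
      | inr x => @TVar L V (inr (inl (inl x))) end.
    have fE e : sat (fsub p f) (asg_add e (asg_add w (hst n b))) = sat p (asg_add e (incl P)).
      by rewrite sat_fsub; apply: sat_ext => -[x|x].
    rewrite /tp /= -(fE (b n)) => /(bP _ _ [set m | tp (a 0%N) P p])[m|m //].
    by rewrite fE -[sat p _]/(tp (a m) P p) atp.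
  apply/seteqP; split=> p; first exact: tpb.
  by move=> pa; apply: contrapT => /(tpb (FNot p)); exact.
- move=> n i j hi hj p.
  pose f (z : cadd (cpow n Y) (cpts P)) : term (cadd (cpow n Y) W) (csort z) :=
    match z return term (cadd (cpow n Y) W) (csort (c := cadd (cpow n Y) (cpts P)) z) with
    | inl x => @TVar L (cadd (cpow n Y) W) (inl x)
    | inr x => @TVar L (cadd (cpow n Y) W) (inr (inl x)) end.
  have fE e : sat p (asg_add e (incl P)) = sat (fsub p f) (asg_add e w).
    by rewrite sat_fsub; apply: sat_ext => -[x|x].
  by rewrite !fE; exact: ind.
(* If the first two terms agreed at [y0], ultrafilter-many [a m] would take the same value there,
   against injectivity. *)
- move=> e.
  pose V := cadd Y (cadd W (cpow 1 Y)).
  pose p : form V := FEq (@TVar L V (inl y0)) (@TVar L V (inr (inr (ord0, y0)))).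
  have : F [set m | sat p (asg_add (a m) (asg_add w (hst 1%N b)))] by apply/bE; rewrite /p /= /hst /= e.
  move=> FE; have [m0 hm0] : [set m | a m y0 = b 0%N y0] !=set0.
    by apply: (bP _ p); [|rewrite /p /= /hst /= e].
  have := FI _ _ FE (Fcof m0.+1) => /(Fup _ set0) h; apply: F0; apply: h => m [/= hm].
  by rewrite (ainj m m0) ?ltnn // hm0.
Qed.
End Indiscernibles.

(** The averaged sequence starts at some realization of the type of [e]; [transfer] moves the whole
    sequence so that it starts at [e] itself. *)
Lemma indiscernible_from U (D : set U) (L : signature) (M : structure L)
    (Y : ctx (sorts L)) (P : set (points M)) (e : asg M Y) (a : nat -> asg M Y) (y0 : Y) :
  injects [set: nat] D -> saturated M D -> (forall (V : ctx (sorts L)) s, term V s) ->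
  injects [set: Y] D -> injects P D ->
  (forall m, tp (a m) P = tp e P) -> (forall m m', a m y0 = a m' y0 -> m = m') ->
  exists b : nat -> asg M Y, [/\ b 0%N = e, forall n, tp (b n) P = tp e P,
    indiscernible P b & b 0%N y0 <> b 1%N y0].
Proof.
move=> Dinf Msat cst Ysm Psm atp ainj.
have [m|b [btp bind bne]] := average_sequence Dinf Msat Ysm Psm _ ainj.
  by rewrite !atp.
pose X := Ctx (fun z : nat * Y => csort z.2).
pose W := cadd Y (cpts P).
pose c : asg M X := fun z => b z.1 z.2.
have ww : equivalent (asg_add (b 0%N) (incl P) : asg M W) (asg_add e (incl P)).
  by move=> p; have := btp 0%N; rewrite atp => /seteqP[h1 h2]; split; [exact: h1|exact: h2].
have [||c' cc] := transfer Dinf Msat cst c _ _ ww.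
- by apply: injects_sub (small_prod Dinf Dinf Ysm) => z _; split.
- by apply: small_sum => //; exact: small_sig.
pose b' n : asg M Y := fun y => c' (n, y).
have cn n : equivalent (asg_add (b n) (incl P)) (asg_add (b' n) (incl P)).
  pose f (x : cadd Y (cpts P)) : term (cadd X W) (csort x) :=
    match x return term (cadd X W) (csort (c := cadd Y (cpts P)) x) with
    | inl y => @TVar L (cadd X W) (inl (n, y))
    | inr y => @TVar L (cadd X W) (inr (inr y)) end.
  move=> p; have := cc (fsub p f); rewrite !sat_fsub.
  rewrite (sat_ext (e' := asg_add (b n) (incl P))); last by case.
  by rewrite (sat_ext (e := fun x => eval (asg_add c' _) _) (e' := asg_add (b' n) (incl P))); last by case.
exists b'; split.
- apply: functional_extensionality_dep => y.
  have := cc (FEq (@TVar L (cadd X W) (inl (0%N, y))) (@TVar L (cadd X W) (inr (inl y)))).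
  by move=> [h _]; exact: h.
- by move=> n; rewrite -(atp 0%N) -(btp n); apply/seteqP; split=> p; apply: (cn n p).2 || apply: (cn n p).1.
- move=> n i j hi hj p.
  pose f (i : 'I_n -> nat) (x : cadd (cpow n Y) (cpts P)) : term (cadd X W) (csort x) :=
    match x return term (cadd X W) (csort (c := cadd (cpow n Y) (cpts P)) x) with
    | inl y => @TVar L (cadd X W) (inl (i y.1, y.2))
    | inr y => @TVar L (cadd X W) (inr (inr y)) end.
  have H i' : sat p (asg_add ((fun x => b' (i' x.1) x.2) : asg M (cpow n Y)) (incl P)) <->
              sat p (asg_add ((fun x => b (i' x.1) x.2) : asg M (cpow n Y)) (incl P)).
    have := cc (fsub p (f i')); rewrite !sat_fsub => h.
    rewrite (sat_ext (e' := fun x => eval (asg_add c' (asg_add e (incl P))) (f i' x))); last by case.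
    by rewrite -h; rewrite (sat_ext (e' := asg_add ((fun x => b (i' x.1) x.2) : asg M (cpow n Y)) (incl P))); last by case.
  by rewrite !H; exact: bind.
- have := cc (FEq (@TVar L (cadd X W) (inl (0%N, y0))) (@TVar L (cadd X W) (inl (1%N, y0)))).
  by move=> [_ h] h'; apply: bne; exact: h.
Qed.

(** * Partial elementary maps of one-sorted structures *)

Section Elementary.
Variable L : signature.
Variable s0 : sorts L.
Hypothesis one_sort : forall s s' : sorts L, s = s'.
Variables (K : Type) (fi : forall f : Defs.fsym L, ('I_(farity f) -> K) -> K)
  (ri : forall r : rsym L, ('I_(rarity r) -> K) -> Prop).
Let N := @Structure L (fun _ => K) fi ri.

(** A partial elementary map given by its graph. That [E] is functional and injective is a
    consequence, see [elementary_eq]. *)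
Definition elementary (E : set (K * K)) := forall (V : ctx (sorts L)) (e e' : asg N V),
  (forall x, E (e x, e' x)) -> equivalent e e'.

Lemma elementary_sub (E E' : set (K * K)) : E `<=` E' -> elementary E' -> elementary E.
Proof. by move=> s h V e e' H; apply: h => x; exact: s. Qed.

Lemma elementary_swap (E : set (K * K)) : elementary E -> elementary [set p | E (p.2, p.1)].
Proof. by move=> h V e e' H; apply: equiv_sym; exact: h. Qed.

Lemma eval_tcast (V : ctx (sorts L)) s s' (h : s = s') (t : term V s) (e : asg N V) :
  eval e (tcast h t) = eval e t :> K.
Proof. by case: _ / h. Qed.

Lemma equiv_reindex (V W : ctx (sorts L)) (e e' : asg N W) (f f' : asg N V) :
  equivalent e e' ->
  (forall v, exists w, f v = e w :> K /\ f' v = e' w :> K) -> equivalent f f'.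
Proof.
move=> ee /choice[r rP].
have := equiv_sub (fun v => tcast (one_sort (csort (r v)) (csort v)) (TVar (r v))) ee.
move=> H p; have := H p.
rewrite (sat_ext (e' := f)); last first.
  by move=> v; rewrite (rP v).1; exact: (eval_tcast _ (TVar (r v)) e).
rewrite (sat_ext (e := fun x => eval e' _) (e' := f')) //.
by move=> v; rewrite (rP v).2; exact: (eval_tcast _ (TVar (r v)) e').
Qed.

Lemma elementary_range (V : ctx (sorts L)) (e e' : asg N V) :
  equivalent e e' -> elementary [set (e x : K, e' x : K) | x in [set: V]].
Proof.
move=> ee W f f' H; apply: (equiv_reindex ee) => v.
by have [w _ [<- <-]] := H v; exists w.
Qed.

Lemma elementary_eq (E : set (K * K)) x y x' y' : elementary E ->
  E (x, x') -> E (y, y') -> (x = y) <-> (x' = y').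
Proof.
move=> h xx yy; pose V := Ctx (fun b : bool => s0).
apply: (h V (fun b => if b then x else y) (fun b => if b then x' else y') _
  (FEq (@TVar L V true) (@TVar L V false))).
by case.
Qed.

Lemma elementary_fun (E : set (K * K)) (f : Defs.fsym L) (a a' : 'I_(farity f) -> K) z :
  elementary E -> (forall i, E (a i, a' i)) -> E (fi a, z) -> z = fi a'.
Proof.
move=> h aa zz.
pose V := @Ctx (sorts L) (option 'I_(farity f)) (fun o => if o is Some i then fdom i else fcod f).
have := h V (fun o => if o is Some i then a i else fi a)
  (fun o => if o is Some i then a' i else z) _
  (FEq (@TVar L V None) (TApp (fun i => @TVar L V (Some i)))).
by move=> [|h1 _]; [case|apply: h1].
Qed.

Lemma elementary_rel (E : set (K * K)) (r : rsym L) (a a' : 'I_(rarity r) -> K) :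
  elementary E -> (forall i, E (a i, a' i)) -> ri a <-> ri a'.
Proof.
move=> h aa; pose V := @Ctx (sorts L) 'I_(rarity r) (fun i => rdom i).
by have := h V a a' aa (FRel (fun i => @TVar L V i)).
Qed.

Variables (U : Type) (D : set U).
Hypothesis Dinf : injects [set: nat] D.
Hypothesis Nsat : saturated N D.
Variable cst : forall (V : ctx (sorts L)) s, term V s.

(** The last clause controls the new domain: when [S] contains the old domain and is closed under
    the operations, the extended graph is closed as well. *)
Lemma elementary_extend (E : set (K * K)) (S : set K) :
  elementary E -> injects E D -> injects S D ->
  exists E', [/\ E `<=` E', elementary E', injects E' D, forall x, S x -> exists x', E' (x, x')
    & forall p, E' p -> E p \/ S p.1].
Proof.
move=> hE Esm Ssm.
pose W := @Ctx (sorts L) {p | E p} (fun _ => s0).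
pose X := @Ctx (sorts L) {x | S x} (fun _ => s0).
have [|||c' cc] := transfer Dinf Nsat cst (X := X) (W := W) (fun x => sval x)
   (w := fun p => (sval p).1) (w' := fun p => (sval p).2).
- exact: small_sig.
- exact: small_sig.
- by apply: hE => -[[x x'] h].
have := elementary_range cc; set E' := [set _ | _ in _] => hE'.
exists E'; split=> //.
- by move=> [x x'] Ex; exists (inr (exist _ _ Ex)).
- apply: small_image => //; apply: small_sum => //; exact: small_sig.
- by move=> x Sx; exists (c' (exist _ _ Sx)), (inl (exist _ _ Sx)).
- by move=> p [[[x Sx]|[q Eq]] _ <-]; [right|left; case: q Eq].
Qed.

End Elementary.

(** * Structures interpreted on a sort, and pulling back forking *)

Lemma ex_iff T (P Q : T -> Prop) :
  (forall x, P x <-> Q x) -> (exists x, P x) <-> (exists x, Q x).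
Proof. by move=> h; split=> -[x /h hx]; exists x. Qed.

(* [N] is a one-sorted structure interpreted on the sort [s] of [M], and [R] is
   the graph of a partial definable map from the sort [t] onto it. *)
Section Interpretation.
Variables (L : signature) (M : structure L) (s t : sorts L) (L0 : signature).
Variables (fi : forall f : Defs.fsym L0, ('I_(farity f) -> M s) -> M s)
  (ri : forall r : rsym L0, ('I_(rarity r) -> M s) -> Prop).
Let N := @Structure L0 (fun _ => M s) fi ri.
Let sc (V0 : ctx (sorts L0)) := Ctx (fun _ : V0 => s).
Hypothesis interp : forall (V0 : ctx (sorts L0)) (p : form V0),
  exists q : form (sc V0), forall e : asg N V0, sat q (e : asg M (sc V0)) <-> sat p e.
Variable cst : forall (V : ctx (sorts L)) s, term V s.

Lemma saturated_interp U (D : set U) : saturated M D -> saturated N D.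
Proof.
move=> Msat W Wsm w s1 T Tfin.
pose g (z : sc (cadd (cone s1) W)) : term (cadd (cone s) (sc W)) s :=
  match z with
  | inl u => @TVar L (cadd (cone s) (sc W)) (inl u)
  | inr y => @TVar L (cadd (cone s) (sc W)) (inr y) end.
have [tr trP] := choice (@interp (cadd (cone s1) W)).
have gE p (x : M s) : sat (fsub (tr p) g) (asg_add ((fun _ => x) : asg M (cone s)) (w : asg M (sc W))) <->
    sat p (asg_add ((fun _ => x) : asg N (cone s1)) w).
  rewrite sat_fsub -trP (sat_ext (e' := (asg_add ((fun _ => x) : asg N (cone s1)) w : asg M (sc (cadd (cone s1) W))))) //.
  by move=> [u|y].
have [l lT|x hx] := Msat (sc W) Wsm w s [set fsub (tr p) g | p in T].
  have [m [m1 m2]] := @list_choice _ _ (fun r p => T p /\ fsub (tr p) g = r) l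
    (fun r h => let: ex_intro2 p hp e := lT r h in ex_intro _ p (conj hp e)).
  have [p /m1[r _ []]//|x hx] := Tfin m.
  by exists x => r /m2[p pm [_ <-]]; apply/gE; exact: hx.
by exists x => p Tp; apply/gE; apply: hx; exists p.
Qed.

Variables (R : M t -> M s -> Prop) (rho : form (cadd (cone t) (cone s))).
Hypothesis rhoP : forall (x : M t) (u : M s),
  sat rho (asg_add ((fun _ => x) : asg M (cone t)) ((fun _ => u) : asg M (cone s))) <-> R x u.
Hypothesis Rfun : forall x u u', R x u -> R x u' -> u = u'.

(** The pullback of a formula of [N] along [R]. Only the variables in the finite list [l] are tied
    to their preimages, since infinitely many constraints cannot be expressed. *)
Lemma pull_form (V0 Y0 : ctx (sorts L0)) (Z : ctx (sorts L)) (g : V0 -> term Z t)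
    (p : form (cadd V0 Y0)) (l : seq V0) :
  exists q : form (cadd Z (sc Y0)), forall (e : asg M Z) (d : asg N Y0),
    sat q (asg_add e (d : asg M (sc Y0))) <->
    exists u : asg N V0, (forall x, List.In x l -> R (eval e (g x)) (u x)) /\
      sat p (asg_add u d).
Proof.
have [p' hp'] := interp p.
pose W := cadd Z (sc Y0); pose V := cadd (sc V0) W.
pose r (x : V0) : form V := fsub rho (fun z =>
  match z return term V (csort (c := cadd (cone t) (cone s)) z) with
  | inl _ => tsub (fun y => @TVar L V (inr (inl y))) (g x)
  | inr _ => @TVar L V (inl x) end).
pose a (z : sc (cadd V0 Y0)) : term V s :=
  match z with
  | inl x => @TVar L V (inl x) | inr y => @TVar L V (inr (inr y)) end.
have [q hq] := exists_form cst (FAnd (FAnds [seq r x | x <- l]) (fsub p' a)).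
exists q => e d; rewrite hq; apply: ex_iff => u; rewrite sat_and sat_ands.
have rE x : sat (r x) (asg_add u (asg_add e (d : asg M (sc Y0)))) <-> R (eval e (g x)) (u x).
  rewrite -rhoP /r sat_fsub.
  rewrite (sat_ext (e' := asg_add ((fun _ => eval e (g x)) : asg M (cone t)) ((fun _ => u x) : asg M (cone s)))) //.
  by move=> [z|z] //=; rewrite eval_tsub.
have -> : sat (fsub p' a) (asg_add u (asg_add e (d : asg M (sc Y0)))) = sat p (asg_add (u : asg N V0) d).
  apply: propext; rewrite -hp' sat_fsub.
  by rewrite (sat_ext (e' := (asg_add (u : asg N V0) d : asg M (sc (cadd V0 Y0))))) // => -[z|z].
split=> -[h1 h2]; split=> //.
  by move=> x xl; apply/rE/h1; rewrite In_map; exists x.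
by move=> q'; rewrite In_map => -[x xl <-]; apply/rE/h1.
Qed.

Variables (A0 B0 : set (points N)) (A B : set (points M)).
Hypothesis transA : forall (Y0 : ctx (sorts L0)) (d d' : asg N Y0),
  equivalent (asg_add d (incl A0)) (asg_add d' (incl A0)) ->
  equivalent (asg_add (d : asg M (sc Y0)) (incl A)) (asg_add (d' : asg M (sc Y0)) (incl A)).

(** Implications and dividing are both pulled back along [R]. Conjugacy and indiscernibility of the
    dividing sequences survive by [transA], inconsistency because [R] is functional and finitely
    many variables matter. *)
Lemma type_forks_interp (X0 : ctx (sorts L0)) (X : ctx (sorts L)) (c : asg N X0) (cM : asg M X)
    (gX : X0 -> term X t) (gB : cpts B0 -> term (cpts B) t) :
  (forall x, R (eval cM (gX x)) (c x)) ->
  (forall y, R (eval (incl B) (gB y)) (incl B0 y)) ->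
  type_forks A0 (tp c B0) -> type_forks A (tp cM B).
Proof.
move=> RX RB [f [[Q [Qtp Qfin Qf]] [fs [fsfin fsdiv ffs]]]].
have [q /= qP] := finite_set_list Qfin; have [hs hsP] := finite_set_list fsfin.
have [lq hlq] := forms_support q.
pose isl (W0 : Type) (z : (X0 + W0)%type) := if z is inl x then Some x else None.
pose supp (h : pform N X0) := pmap (@isl _) (projT1 (cid (form_support (pbody h)))).
have suppP (h : pform N X0) (l : seq X0) : (forall x, List.In x (supp h) -> List.In x l) ->
    forall (e e' : asg N X0) d, (forall x, List.In x l -> e x = e' x) ->
    sat (pbody h) (asg_add e d) = sat (pbody h) (asg_add e' d).
  rewrite /supp; case: cid => k hk /= kl e e' d ee; apply: hk => -[x|y] //= xk.
  apply/ee/kl; elim: k xk {kl} => //= -[x'|y'] k IH /= [e1|/IH]; auto.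
  - by left; case: e1.
  - by case: e1.
(* All pullbacks constrain the same list: the variables of the implied formula, of the dividing
   formulas and of the finite part of the type. *)
pose l := flatten [seq supp h | h <- f :: hs] ++ pmap (@isl _) lq.
have lf h : List.In h (f :: hs) -> forall x, List.In x (supp h) -> List.In x l.
  move=> hh x xh; rewrite /l In_cat; left.
  by elim: (f :: hs) hh => //= h' k IH [->|/IH hk]; rewrite In_cat; auto.
have pull (h : pform N X0) := pull_form gX (pbody h) l.
pose P (h : pform N X0) : pform M X :=
  @PForm L M X (parity h) (fun _ => s) (projT1 (cid (pull h))) (pparam h).
have PP h e d : sat (pbody (P h)) (asg_add e (d : asg M (Ctx (psort (P h))))) <->
    exists u : asg N X0, (forall x, List.In x l -> R (eval e (gX x)) (u x)) /\
      sat (pbody h) (asg_add u (d : asg N (Ctx (psort h)))).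
  by rewrite /P /=; case: cid => r hr /=; exact: hr.
exists (P f); split.
  pose V0 := cadd X0 (cpts B0); pose Z := cadd X (cpts B).
  pose E0 : ctx (sorts L0) := @Ctx (sorts L0) void (of_void _).
  pose gg (z : V0) : term Z t :=
    match z with
    | inl x => tsub (fun y => @TVar L Z (inl y)) (gX x)
    | inr y => tsub (fun y => @TVar L Z (inr y)) (gB y) end.
  pose ll : seq V0 := [seq inl x | x <- l] ++ lq.
  have [r hr] := pull_form gg (fsub (FAnds q) (fun z => @TVar L0 (cadd V0 E0) (inl z))) ll.
  pose d0 : asg N E0 := of_void _.
  pose r' := fsub r (fun z => match z return term Z (csort (c := cadd Z (sc E0)) z) with
     | inl z => @TVar L Z z | inr v => of_void _ v end).
  have r'P e : sat r' e <-> exists u : asg N V0,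
      (forall x, List.In x ll -> R (eval e (gg x)) (u x)) /\ forall p, List.In p q -> sat p u.
    rewrite /r' sat_fsub (sat_ext (e' := asg_add e (d0 : asg M (sc E0)))); last by case.
    rewrite hr; apply: ex_iff => u; rewrite sat_fsub.
    rewrite (sat_ext (e := fun x => eval _ _) (e' := u)) // sat_ands.
    by split.
  exists [set r']; split; last 1 first.
  - move=> e /(_ r' erefl)/r'P[u [u1 u2]].
    apply/PP; exists (fun x => u (inl x)); split.
      move=> x xl; have := u1 (inl x); rewrite /gg /= eval_tsub; apply.
      by rewrite In_cat In_map; left; exists x.
    apply: Qf => p pQ.
    rewrite (hlq _ _ u) //; first by apply/u2/qP.
      move=> [x|y] // yq; apply: (Rfun (x := eval (asg_add e (incl B)) (gg (inr y)))).
        by rewrite /gg /= eval_tsub; exact: RB.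
      by apply: u1; rewrite In_cat; right.
    exact/qP.
  - move=> _ -> /=; apply/r'P; exists (asg_add c (incl B0)); split.
      by move=> [x|y] _; rewrite /gg /= eval_tsub; [exact: RX|exact: RB].
    by move=> p /qP/Qtp.
  - exact: finite_set1.
exists [set P h | h in fs]; split.
- exact: finite_image.
- move=> _ [h hh <-]; have [d [d0 dtp dind [n dn]]] := fsdiv h hh.
  have hl : List.In h (f :: hs) by right; apply/hsP.
  exists d; split=> //.
  + move=> m; have := dtp m => /seteqP[h1 h2].
    have /transA E : equivalent (asg_add (d m) (incl A0)) (asg_add (pparam h) (incl A0)).
      by apply: equiv_le => p; exact: h1.
    by apply/seteqP; split=> p; [exact: (E p).1|exact: (E p).2].
  + move=> k i j hi hj p.
    exact: (@transA (cpow k (Ctx (psort h))) (fun z => d (i z.1) z.2) (fun z => d (j z.1) z.2) (dind k i j hi hj)).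
  + exists n => -[e he]; apply: dn.
    (* For n = 0 any assignment is a common solution, and [c] is one. *)
    have [n0|[m0 m0n]] : n = 0%N \/ exists m, (m < n)%N.
      by case: (n) => [|m]; [left|right; exists m].
      by exists c => m; rewrite n0.
    (* The solution is taken at one index; functionality of [R] makes it agree on [l] with the
       solutions at the other indices. *)
    have [u [u1 _]] := (PP h e (d m0)).1 (he m0 m0n).
    exists u => m mn; have [u' [u1' u2']] := (PP h e (d m)).1 (he m mn).
    rewrite (suppP h l (lf h hl) _ u') // => x xl.
    exact: Rfun (u1 x xl) (u1' x xl).
- move=> e /PP[u [u1 u2]]; have [h hh hu] := ffs u u2.
  by exists (P h); [exists h|apply/PP; exists u].
Qed.

End Interpretation.

(** * Elementary valuation theory and Hensel's lemma for powers *)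

Section ValuedField.
Variable M : valuedField.
Implicit Types x y z : vK M.
Implicit Types g h : vG M.

(** A valuation with values in the group itself, hence with a default value at 0; statements about
    it assume nonzero arguments. *)
Definition v x : vG M := odflt 0 (vval x).
Definition integral x : Prop := vle (vval x) (Some 0).
Definition small_el x : Prop := vlt (vval x) (Some 0).
Definition unit_el x : Prop := vval x = Some 0.
(** Equality of leading terms, expressed in the field; see [rv_near]. *)
Definition near x y : Prop := [/\ x != 0, y != 0 & small_el (x / y - 1)].
Definition is_power n x : Prop := exists y, x = y ^+ n.

Lemma gle_add2l g h k : (k + g <= k + h) = (g <= h).
Proof.
apply/idP/idP => [/(vG_leD (- k))|/(vG_leD k)//].
by rewrite !addKr.
Qed.

Lemma gle_sub g h : (g <= h) = (g - h <= 0).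
Proof. by rewrite -(gle_add2l g h (- h)) addrC addNr. Qed.

Lemma val_v x : x != 0 -> vval x = Some (v x).
Proof.
rewrite /v; case E: (vval x) => [g|] //= /eqP x0.
by case: x0; apply/val_eq_None.
Qed.

Lemma val0 : vval (0 : vK M) = None.
Proof. exact/val_eq_None. Qed.

Lemma val_neq0 x g : vval x = Some g -> x != 0.
Proof. by move=> xg; apply/eqP => /val_eq_None; rewrite xg. Qed.

Lemma vM x y : x != 0 -> y != 0 -> v (x * y) = v x + v y.
Proof. by move=> /val_v hx /val_v hy; rewrite {1}/v (Defs.valM hx hy). Qed.

Lemma v1 : v 1 = 0.
Proof.
have := vM (oner_neq0 (vK M)) (oner_neq0 (vK M)); rewrite mulr1 => /eqP.
by rewrite -{1}(addr0 (v 1)) => /eqP/addrI.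
Qed.

Lemma vV x : x != 0 -> v x^-1 = - v x.
Proof.
move=> x0; apply/eqP; rewrite -addr_eq0 -vM ?invr_neq0 // mulVf // v1.
exact: eqxx.
Qed.

Lemma vX x n : x != 0 -> v (x ^+ n) = v x *+ n.
Proof.
move=> x0; elim: n => [|n IH]; first by rewrite expr0 v1.
by rewrite exprS vM ?expf_neq0 // IH mulrS.
Qed.

Lemma vle_trans (a b c : option (vG M)) : vle a b -> vle b c -> vle a c.
Proof. by case: a b c => [a|] [b|] [c|] //=; exact: le_trans. Qed.

Lemma vle_total (a b : option (vG M)) : vle a b || vle b a.
Proof. by case: a b => [a|] [b|] //=; exact: vG_total. Qed.

Lemma vmax_le (a b c : option (vG M)) : vle a c -> vle b c -> vle (vmax a b) c.
Proof. by rewrite /vmax; case: ifP. Qed.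

Lemma vmax_lt (a b c : option (vG M)) : vlt a c -> vlt b c -> vlt (vmax a b) c.
Proof. by rewrite /vmax; case: ifP. Qed.

Lemma integralP x : integral x <-> x = 0 \/ v x <= 0.
Proof.
have [->|x0] := eqVneq x 0; first by rewrite /integral val0; split=> // _; left.
rewrite /integral val_v //=; split; first by right.
by case=> // xx; rewrite xx eqxx in x0.
Qed.

Lemma unit_elP x : unit_el x <-> x != 0 /\ v x = 0.
Proof.
rewrite /unit_el; split=> [h|[x0 e]]; last by rewrite val_v // e.
by split; [exact: val_neq0 h|rewrite /v h].
Qed.

Lemma unit_integral x : unit_el x -> integral x.
Proof. by rewrite /integral => -> /=. Qed.

Lemma integral_cases x : integral x -> small_el x \/ unit_el x.
Proof.
rewrite /integral /small_el /unit_el /vlt; case: (vval x) => [g|] /= h; last by left.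
have [h'|] := boolP (0 <= g); last by left.
by right; congr Some; apply/eqP; rewrite eq_le h h'.
Qed.

Lemma small_integral x : small_el x -> integral x.
Proof.
rewrite /integral /small_el /vlt.
by have /orP[->//|->] := vle_total (vval x) (Some 0).
Qed.

Lemma unit_not_small x : unit_el x -> ~ small_el x.
Proof. by rewrite /unit_el /small_el /vlt => -> /=; rewrite lexx. Qed.

Lemma integral0 : integral 0. Proof. by apply/integralP; left. Qed.
Lemma small0 : small_el 0. Proof. by rewrite /small_el val0. Qed.
Lemma unit1 : unit_el 1. Proof. by apply/unit_elP; split; [exact: oner_neq0|exact: v1]. Qed.
Lemma integral1 : integral 1. Proof. exact: unit_integral unit1. Qed.

Lemma integralD x y : integral x -> integral y -> integral (x + y).
Proof. by move=> hx hy; apply: vle_trans (Defs.valD x y) _; exact: vmax_le. Qed.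

Lemma smallD x y : small_el x -> small_el y -> small_el (x + y).
Proof.
move=> hx hy; apply/negP => h.
have /negP[] : vlt (vmax (vval x) (vval y)) (Some 0) by exact: vmax_lt.
exact: vle_trans h (Defs.valD x y).
Qed.

Lemma valM_cases x y : [\/ x * y = 0, x = 0, y = 0 | [/\ x != 0, y != 0 & v (x * y) = v x + v y]].
Proof.
have [->|x0] := eqVneq x 0; first by constructor 2.
have [->|y0] := eqVneq y 0; first by constructor 3.
by constructor 4; split=> //; exact: vM.
Qed.

Lemma integralM x y : integral x -> integral y -> integral (x * y).
Proof.
move=> /integralP[->|hx] /integralP[->|hy]; rewrite ?mul0r ?mulr0; try exact: integral0.
have [->|x0] := eqVneq x 0; first by rewrite mul0r; exact: integral0.
have [->|y0] := eqVneq y 0; first by rewrite mulr0; exact: integral0.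
apply/integralP; right; rewrite vM //; apply: le_trans hx.
by rewrite -{2}(addr0 (v x)) gle_add2l.
Qed.

Lemma unitM x y : unit_el x -> unit_el y -> unit_el (x * y).
Proof.
move=> /unit_elP[x0 hx] /unit_elP[y0 hy]; apply/unit_elP.
by rewrite mulf_neq0 // vM // hx hy addr0.
Qed.

Lemma unitV x : unit_el x -> unit_el x^-1.
Proof. by move=> /unit_elP[x0 hx]; apply/unit_elP; rewrite invr_neq0 // vV // hx oppr0. Qed.

Lemma unitX x n : unit_el x -> unit_el (x ^+ n).
Proof. by move=> hx; elim: n => [|n IH]; [exact: unit1|rewrite exprS; exact: unitM]. Qed.

Lemma integralX x n : integral x -> integral (x ^+ n).
Proof. by move=> hx; elim: n => [|n IH]; [exact: integral1|rewrite exprS; exact: integralM]. Qed.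

Lemma smallM x y : integral x -> small_el y -> small_el (x * y).
Proof.
move=> hx hy; have hy' := small_integral hy.
have [//|/unit_elP[xy0 e]] := integral_cases (integralM hx hy').
have : x != 0 /\ y != 0 by apply/andP; rewrite -negb_or -mulf_eq0.
move=> [x0 y0]; exfalso; apply: (@unit_not_small y) => //; apply/unit_elP; split=> //.
rewrite vM // in e.
case/integralP: hx => [xx|hx]; first by rewrite xx eqxx in x0.
case/integralP: hy' => [xx|hy']; first by rewrite xx eqxx in y0.
apply/eqP; rewrite eq_le hy' /=.
have -> : v y = - v x by apply/eqP; rewrite -addr_eq0 addrC e.
by rewrite -(gle_add2l _ _ (v x)) addr0 subrr.
Qed.

Lemma smallMl x y : small_el x -> integral y -> small_el (x * y).
Proof. by move=> hx hy; rewrite mulrC; exact: smallM. Qed.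

Lemma unitN1 : unit_el (- 1).
Proof.
apply/unit_elP; split; first by rewrite oppr_eq0 oner_neq0.
have n0 : (- 1 : vK M) != 0 by rewrite oppr_eq0 oner_neq0.
have := vM n0 n0; rewrite mulrNN mulr1 v1 => /esym e.
have /orP[h|h] := vG_total (v (- 1)) 0; apply/eqP; rewrite eq_le h ?andbT /=.
  by move: h; rewrite -(gle_add2l _ _ (v (- 1))) e addr0.
by move: h; rewrite -(gle_add2l _ _ (v (- 1))) e addr0.
Qed.

Lemma integralN x : integral x -> integral (- x).
Proof. by rewrite -mulN1r; apply: integralM; exact: unit_integral unitN1. Qed.

Lemma integralB x y : integral x -> integral y -> integral (x - y).
Proof. by move=> hx hy; apply: integralD => //; exact: integralN. Qed.

Lemma smallN x : small_el x -> small_el (- x).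
Proof. by rewrite -mulN1r; apply: smallM; exact: unit_integral unitN1. Qed.

Lemma smallB x y : small_el x -> small_el y -> small_el (x - y).
Proof. by move=> hx hy; apply: smallD => //; exact: smallN. Qed.

Lemma integral_sum I (r : seq I) (P : pred I) (F : I -> vK M) :
  (forall i, P i -> integral (F i)) -> integral (\sum_(i <- r | P i) F i).
Proof. by move=> h; apply: (big_ind integral) => //; [exact: integral0|exact: integralD]. Qed.

Lemma small_sum_el I (r : seq I) (P : pred I) (F : I -> vK M) :
  (forall i, P i -> small_el (F i)) -> small_el (\sum_(i <- r | P i) F i).
Proof. by move=> h; apply: (big_ind small_el) => //; [exact: small0|exact: smallD]. Qed.

Lemma integral_total x : x != 0 -> integral x \/ small_el x^-1.
Proof.
move=> x0; have [h|h] := pselect (integral x); [by left|right].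
rewrite /small_el /vlt val_v ?invr_neq0 //= vV //; apply/negP => h'.
apply: h; apply/integralP; right.
by rewrite -(gle_add2l _ _ (- v x)) addNr addr0.
Qed.

Lemma integral_div x y : x != 0 -> y != 0 -> integral (x / y) <-> v x <= v y.
Proof.
move=> x0 y0; rewrite gle_sub -vV // -vM ?invr_neq0 //.
split=> [/integralP[/eqP|//]|h]; last by apply/integralP; right.
by rewrite mulf_eq0 invr_eq0 (negPf x0) (negPf y0).
Qed.

Lemma unit_div x y : x != 0 -> y != 0 -> unit_el (x / y) <-> v x = v y.
Proof.
move=> x0 y0; rewrite unit_elP vM ?invr_neq0 // vV // mulf_neq0 ?invr_neq0 //.
by split=> [[_ /eqP]|->]; rewrite ?subr_eq0 ?subrr // => /eqP.
Qed.

Lemma small_inv x : unit_el x -> small_el (x - 1) -> small_el (x^-1 - 1).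
Proof.
move=> ux h; have /unit_elP[x0 _] := ux.
rewrite (_ : x^-1 - 1 = - x^-1 * (x - 1)).
  by apply: smallM => //; apply/integralN/unit_integral/unitV.
by rewrite mulrBr mulr1 mulNr mulVf // addrC opprK.
Qed.

Lemma near1_unit x : small_el (x - 1) -> unit_el x.
Proof.
move=> h; have ix : integral x.
  by rewrite -(subrK 1 x); apply: integralD integral1; exact: small_integral.
have [sx|//] := integral_cases ix.
exfalso; apply: (unit_not_small unit1).
by rewrite -(subKr x 1); apply: smallB => //; rewrite -opprB; exact: smallN.
Qed.

Lemma near_refl x : x != 0 -> near x x.
Proof. by move=> x0; split=> //; rewrite divff // subrr; exact: small0. Qed.

Lemma near_sym x y : near x y -> near y x.
Proof.
move=> [x0 y0 h]; split=> //; rewrite -(invrK (y / x)) invf_div.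
by apply: small_inv => //; exact: near1_unit.
Qed.

Lemma small_mul1 x y : small_el (x - 1) -> small_el (y - 1) -> small_el (x * y - 1).
Proof.
move=> hx hy; rewrite (_ : x * y - 1 = x * (y - 1) + (x - 1)).
  by apply: smallD => //; apply: smallM => //; exact/unit_integral/near1_unit.
by rewrite mulrBr mulr1 addrA subrK.
Qed.

Lemma nearM x y x' y' : near x y -> near x' y' -> near (x * x') (y * y').
Proof.
move=> [x0 y0 h] [x0' y0' h']; split; rewrite ?mulf_neq0 //.
by rewrite invfM mulrACA; exact: small_mul1.
Qed.

Lemma near_trans x y z : near x y -> near y z -> near x z.
Proof.
move=> [x0 y0 h] [_ z0 h']; split=> //.
have := small_mul1 h h'; rewrite mulrA divfK //.
Qed.

Lemma nearV x y : near x y -> near x^-1 y^-1.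
Proof.
move=> /near_sym[y0 x0 h]; split; rewrite ?invr_neq0 //.
by rewrite invrK mulrC.
Qed.

Lemma near_v x y : near x y -> v x = v y.
Proof. by move=> [x0 y0 /near1_unit] /(unit_div x0 y0). Qed.

Lemma near_mulr x z : x != 0 -> small_el (z - 1) -> near (x * z) x.
Proof.
move=> x0 h; have /unit_elP[z0 _] := near1_unit h.
by split; rewrite ?mulf_neq0 // mulrAC divff // mul1r.
Qed.

Lemma res0 : vres (0 : vK M) = 0.
Proof. by apply/(res_eq0 integral0); exact: small0. Qed.

Lemma resN x : integral x -> vres (- x) = - vres x.
Proof.
move=> hx; apply/eqP; rewrite -addr_eq0 -resD //; first by rewrite addNr res0.
exact: integralN.
Qed.

Lemma resB x y : integral x -> integral y -> vres (x - y) = vres x - vres y.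
Proof. by move=> hx hy; rewrite resD ?resN //; exact: integralN. Qed.

Lemma res_unit x : integral x -> unit_el x <-> vres x != 0.
Proof.
move=> hx; split=> [ux|/eqP h].
  by apply/eqP => /(res_eq0 hx); exact: unit_not_small.
by case: (integral_cases hx) => // /(res_eq0 hx).
Qed.

Lemma resV x : unit_el x -> vres x^-1 = (vres x)^-1.
Proof.
move=> ux; have /unit_elP[x0 _] := ux; have hx := unit_integral ux.
have r0 := (res_unit hx).1 ux.
apply: (mulfI r0); rewrite mulfV // -resM ?mulfV ?res1 //.
exact/unit_integral/unitV.
Qed.

Lemma resX x n : integral x -> vres (x ^+ n) = vres x ^+ n.
Proof.
move=> hx; elim: n => [|n IH]; first by rewrite !expr0 res1.
by rewrite !exprS resM ?IH //; exact: integralX.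
Qed.

Lemma res_sum I (r : seq I) (P : pred I) (F : I -> vK M) :
  (forall i, P i -> integral (F i)) ->
  vres (\sum_(i <- r | P i) F i) = \sum_(i <- r | P i) vres (F i).
Proof.
move=> h; elim: r => [|i r IH]; first by rewrite !big_nil res0.
rewrite !big_cons; case: ifP => Pi //; rewrite resD ?IH //; first exact: h.
exact: integral_sum.
Qed.

Lemma res_near1 x : integral x -> vres x = 1 <-> small_el (x - 1).
Proof.
move=> hx; have := res_eq0 (integralB hx integral1); rewrite resB // ?res1; last exact: integral1.
move=> [h1 h2]; split=> [e|/h2/eqP]; last by rewrite subr_eq0 => /eqP.
by apply: h1; rewrite e subrr.
Qed.

Lemma near_res x y : unit_el x -> unit_el y -> near x y <-> vres x = vres y.
Proof.
move=> ux uy; have /unit_elP[x0 _] := ux; have /unit_elP[y0 _] := uy.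
have hxy : integral (x / y) by exact/unit_integral/unitM/unitV.
have ry : vres y != 0 by apply/res_unit => //; exact: unit_integral.
have e : vres (x / y) = vres x / vres y.
  by rewrite resM ?resV //; [exact: unit_integral|exact/unit_integral/unitV].
rewrite /near; split=> [[_ _ /(res_near1 hxy)]|h].
  by rewrite e => /(canRL (mulfVK ry)); rewrite mul1r.
by split=> //; apply/(res_near1 hxy); rewrite e h divff.
Qed.

Lemma rv_near x y : x != 0 -> y != 0 -> vrv x = vrv y <-> near x y.
Proof.
move=> x0 y0; have xy0 : x / y != 0 by apply: mulf_neq0 => //; rewrite invr_neq0.
have e : vrv x = (vrv (x / y)%R * vrv y)%g by rewrite -rvM ?divfK.
rewrite /near; split=> [h|[_ _ h]].
  by split=> //; apply/(rv_eq1 xy0); apply: (mulIg (vrv y)); rewrite mul1g -e.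
by rewrite e; have -> : vrv (x / y) = 1%g; [exact/(rv_eq1 xy0)|rewrite mul1g].
Qed.

Hypothesis Mhens : henselian M.
Hypothesis Mchar : [pchar (vk M)] =i pred0.

Lemma res_nat n : vres (n%:R : vK M) = n%:R /\ integral (n%:R : vK M).
Proof.
elim: n => [|n [IH1 IH2]]; first by rewrite res0; split=> //; exact: integral0.
rewrite !mulrS; split; last exact: integralD integral1 IH2.
by rewrite resD ?res1 ?IH1 //; exact: integral1.
Qed.

Lemma unit_nat n : (0 < n)%N -> unit_el (n%:R : vK M).
Proof.
move=> n0; have [h1 h2] := res_nat n; apply/res_unit => //; rewrite h1.
by rewrite (pcharf0P (vk M)).1 // -lt0n.
Qed.

(** Hensel's lemma for X^n - z at 1, where the derivative n is a unit because the residue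
    characteristic is zero. *)
Lemma near1_power n z : (0 < n)%N -> small_el (z - 1) ->
  exists y, [/\ z = y ^+ n & small_el (y - 1)].
Proof.
move=> n0 h; have uz := near1_unit h.
have [||||y [_ /rootP hy sy]] := Mhens (p := 'X^n - z%:P) (a := 1).
- move=> i; rewrite coefB coefXn coefC; apply: integralB.
    by case: eqP => _; [exact: integral1|exact: integral0].
  by case: eqP => _; [exact: unit_integral|exact: integral0].
- exact: integral1.
- rewrite hornerD hornerN hornerXn hornerC expr1n -opprB; exact: smallN.
- rewrite derivB derivXn derivC subr0 hornerMn hornerXn expr1n; exact: unit_nat.
exists y; split=> //; apply/esym/eqP; rewrite -subr_eq0.
by move: hy; rewrite hornerD hornerN hornerXn hornerC => ->.
Qed.

(** Two elements with the same leading term differ by a factor in 1 + M, which is an n-th power. *)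
Lemma near_power n x y : (0 < n)%N -> near x y -> is_power n x <-> is_power n y.
Proof.
move=> n0 xy; wlog: x y xy / is_power n x; last first.
  move=> hx; split=> // _; have [y0 x0 h] := near_sym xy.
  have [w [hw _]] := near1_power n0 h; have [u hu] := hx.
  by exists (u * w); rewrite exprMn -hu -hw mulrC divfK.
move=> H; split=> h; first by apply/(H _ _ xy h).
exact/(H _ _ (near_sym xy) h).
Qed.

Lemma is_powerM n x y : is_power n x -> is_power n y -> is_power n (x * y).
Proof. by move=> [a ->] [b ->]; exists (a * b); rewrite exprMn. Qed.

Lemma is_powerV n x : is_power n x -> is_power n x^-1.
Proof. by move=> [a ->]; exists a^-1; rewrite exprVn. Qed.

Lemma is_power_mul2 n x y : y != 0 -> is_power n y -> is_power n (x * y) <-> is_power n x.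
Proof.
move=> y0 hy; split=> h; last exact: is_powerM.
by rewrite -(mulfK y0 x); apply: is_powerM => //; exact: is_powerV.
Qed.

End ValuedField.

(** * Definable conditions and the interpretation of the residue field and value group *)

Lemma dependent_choice T (Y : T -> Type) (R : forall t, Y t -> Prop) :
  (forall t, exists y, R t y) -> exists f : forall t, Y t, forall t, R t (f t).
Proof. by move=> h; exists (fun t => projT1 (cid (h t))) => t; case: cid. Qed.

Lemma interp_intro (L : signature) (M : structure L) (s : sorts L) (L0 : signature)
    (fi : forall f : Defs.fsym L0, ('I_(farity f) -> M s) -> M s)
    (ri : forall r : rsym L0, ('I_(rarity r) -> M s) -> Prop)
    (N := @Structure L0 (fun _ => M s) fi ri)
    (sc := fun V0 : ctx (sorts L0) => Ctx (fun _ : V0 => s)) :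
  (forall (V0 : ctx (sorts L0)) s0 (t : term V0 s0), exists t' : term (sc V0) s,
     forall e : asg N V0, eval (e : asg M (sc V0)) t' = eval e t) ->
  (forall (V0 : ctx (sorts L0)) r (a : forall i, term V0 (rdom (r := r) i)),
     exists q : form (sc V0),
     forall e : asg N V0, sat q (e : asg M (sc V0)) <-> sat (FRel a) e) ->
  forall (V0 : ctx (sorts L0)) (p : form V0),
  exists q : form (sc V0), forall e : asg N V0, sat q (e : asg M (sc V0)) <-> sat p e.
Proof.
move=> ht hr V0 p; elim: p => [{}V0 s0 t u|{}V0 r a|{}V0|{}V0 p [p' hp] q [q' hq]|{}V0 s0 p [p' hp]].
- have [t' ht'] := ht V0 s0 t; have [u' hu'] := ht V0 s0 u.
  by exists (FEq t' u') => e /=; rewrite ht' hu'.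
- exact: hr.
- by exists (@FBot L (sc V0)).
- by exists (FImp p' q') => e /=; rewrite hp hq.
- pose f (x : sc (cext V0 s0)) : term (cext (sc V0) s) s :=
    match x with
    | Some v => @TVar L (cext (sc V0) s) (Some v)
    | None => @TVar L (cext (sc V0) s) None end.
  exists (FAll (fsub p' f)) => e /=.
  have E (a : M s) : sat (fsub p' f) (asg_ext (e : asg M (sc V0)) a) <-> sat p (asg_ext e (a : N s0)).
    rewrite sat_fsub -hp.
    by rewrite (sat_ext (e' := (asg_ext e (a : N s0) : asg M (sc (cext V0 s0))))) // => -[x|].
  by split=> h a; apply/E/h.
Qed.

Section Definable.
Variables (L : signature) (M : structure L) (s : sorts L).

(** Countable parameter contexts suffice for all conditions below, and a small family of them still
    uses a small context. *)
Definition definable_by (P : M s -> Prop) := exists (W : ctx (sorts L)) (w : asg M W)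
    (p : @Defs.form L (cadd (cone s) W)),
  injects [set: W] [set: nat] /\
  forall x : M s, sat p (asg_add ((fun _ => x) : asg M (cone s)) w) <-> P x.

Lemma saturated_definable_by U (D : set U) (I : Type) (P : I -> M s -> Prop) :
  injects [set: nat] D -> saturated M D -> injects [set: I] D ->
  (forall i, definable_by (P i)) ->
  (forall l : seq I, exists x, forall i, List.In i l -> P i x) ->
  exists x, forall i, P i x.
Proof.
move=> Dinf Msat Ism dP fin.
have [W HW] := choice dP; have [w Hw] := dependent_choice HW; have [p Hp] := dependent_choice Hw.
pose V := @Ctx (sorts L) {i : I & W i} (fun z => csort (projT2 z)).
pose u : asg M V := fun z => w (projT1 z) (projT2 z).
pose f i (z : cadd (cone s) (W i)) :
    @term L (cadd (cone s) V) (csort z) :=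
  match z return @term L (cadd (cone s) V)
     (csort (c := cadd (cone s) (W i)) z) with
  | inl x => @TVar L (cadd (cone s) V) (inl x)
  | inr y => @TVar L (cadd (cone s) V) (inr (existT _ i y)) end.
have fE i (x : M s) : sat (fsub (p i) (f i))
    (asg_add ((fun _ => x) : asg M (cone s)) u) <-> P i x.
  rewrite sat_fsub -(Hp i).2.
  by rewrite (sat_ext (e' := asg_add ((fun _ => x) : asg M (cone s)) (w i))) // => -[].
have Vsm : injects [set: V] D.
  have h i := (Hp i).1; have [g Hg] := dependent_choice h.
  apply: injects_trans (small_prod Dinf Ism Dinf).
  exists (fun z => (projT1 z, g _ (projT2 z))); split=> // -[i y] [j z] _ _ /= [ij].
  subst j => gg; congr existT; exact: (Hg i).2.
have [l lT|x hx] := Msat V Vsm u s [set fsub (p i) (f i) | i in [set: I]].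
  have [m [m1 m2]] := @list_choice _ _ (fun r i => fsub (p i) (f i) = r) l
    (fun r h => let: ex_intro2 i _ e := lT r h in ex_intro _ i e).
  have [x hx] := fin m; exists x => r /m2[i im <-].
  exact/fE/hx.
by exists x => i; apply/fE/hx; exists i.
Qed.

End Definable.

Section Formulas.
Variable M : valuedField.
Notation MM := (vf_struct M).
Implicit Types V : ctx (sorts vf_sig).

Definition vf_cst V (s : vf_sort) : @term vf_sig V s :=
  match s return @term vf_sig V s with
  | SK => @TApp vf_sig V (FK RZero) (fun i : 'I_0 => False_rect _ (notF (valP i)))
  | Sk => @TApp vf_sig V (Fk RZero) (fun i : 'I_0 => False_rect _ (notF (valP i)))
  | SG => @TApp vf_sig V (FG GOne) (fun i : 'I_0 => False_rect _ (notF (valP i)))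
  | SRV => @TApp vf_sig V (FRV GOne) (fun i : 'I_0 => False_rect _ (notF (valP i)))
  end.

Definition ring_cst (V : ctx unit) (s : unit) : @term ring_sig V s :=
  match s with tt =>
    @TApp ring_sig V RZero (fun i : 'I_0 => False_rect _ (notF (valP i))) end.

Definition ogroup_cst (V : ctx unit) (s : unit) : @term ogroup_sig V s :=
  match s with tt =>
    @TApp ogroup_sig V GOne (fun i : 'I_0 => False_rect _ (notF (valP i))) end.

Definition tadd V (t u : @term vf_sig V SK) : @term vf_sig V SK :=
  @TApp vf_sig V (FK RAdd) (fun i : 'I_2 => if nat_of_ord i is 0%N then t else u).
Definition tmul V (t u : @term vf_sig V SK) : @term vf_sig V SK :=
  @TApp vf_sig V (FK RMul) (fun i : 'I_2 => if nat_of_ord i is 0%N then t else u).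
Definition tone V : @term vf_sig V SK :=
  @TApp vf_sig V (FK ROne) (fun i : 'I_0 => False_rect _ (notF (valP i))).
Definition tpow V (t : @term vf_sig V SK) n : @term vf_sig V SK :=
  iter n (fun u => tmul t u) (tone V).
Definition tpoly V (l : seq (@term vf_sig V SK)) (t : @term vf_sig V SK) : @term vf_sig V SK :=
  foldr (fun c u => tadd (tmul u t) c) (vf_cst V SK) l.

Lemma eval_tpow V (e : asg MM V) (t : @term vf_sig V SK) n :
  eval e (tpow t n) = ((eval e t : vK M) ^+ n : vK M).
Proof. by elim: n => // n IH; rewrite exprS -IH. Qed.

Lemma eval_tpoly V (e : asg MM V) (l : seq (@term vf_sig V SK)) (t : @term vf_sig V SK) :
  eval e (tpoly l t) = (Poly (map (fun c : @term vf_sig V SK => eval e c : vK M) l)).[(eval e t : vK M)].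
Proof. by rewrite horner_Poly; elim: l => //= c l <-. Qed.

Definition fval V (x : @term vf_sig V SK) (g : @term vf_sig V SG) : @Defs.form vf_sig V :=
  @FRel vf_sig V Rval (fun i : 'I_2 =>
    let: Ordinal m h := i in
    match m as m return forall h : (m < 2)%N, @term vf_sig V (vf_rdom Rval (Ordinal h)) with
    | 0%N => fun _ => x | _.+1 => fun _ => g end h).
Definition fres V (x : @term vf_sig V SK) (u : @term vf_sig V Sk) : @Defs.form vf_sig V :=
  @FRel vf_sig V Rres (fun i : 'I_2 =>
    let: Ordinal m h := i in
    match m as m return forall h : (m < 2)%N, @term vf_sig V (vf_rdom Rres (Ordinal h)) with
    | 0%N => fun _ => x | _.+1 => fun _ => u end h).
Definition frv V (x : @term vf_sig V SK) (r : @term vf_sig V SRV) : @Defs.form vf_sig V :=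
  @FRel vf_sig V Rrv (fun i : 'I_2 =>
    let: Ordinal m h := i in
    match m as m return forall h : (m < 2)%N, @term vf_sig V (vf_rdom Rrv (Ordinal h)) with
    | 0%N => fun _ => x | _.+1 => fun _ => r end h).

Definition twk V s s' (t : @term vf_sig V s') : @term vf_sig (cext V s) s' :=
  @tsub vf_sig V (cext V s) (fun y : V => @TVar vf_sig (cext V s) (Some y)) s' t.

Definition fnear V (x y : @term vf_sig V SK) : @Defs.form vf_sig V :=
  @FEx vf_sig V SRV (FAnd (frv (twk _ x) (@TVar vf_sig (cext V SRV) None))
                          (frv (twk _ y) (@TVar vf_sig (cext V SRV) None))).

Lemma eval_twk V s s' (t : @term vf_sig V s') (e : asg MM V) (a : MM s) :
  eval (asg_ext e a) (twk s t) = eval e t.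
Proof. by rewrite /twk eval_tsub. Qed.

Lemma sat_fval V (e : asg MM V) x g :
  sat (fval x g) e <-> vval (eval e x : vK M) = Some (eval e g : vG M).
Proof. by []. Qed.

Lemma sat_fres V (e : asg MM V) x u :
  sat (fres x u) e <-> integral (eval e x : vK M) /\ vres (eval e x : vK M) = (eval e u : vk M).
Proof. by []. Qed.

Lemma sat_frv V (e : asg MM V) x r :
  sat (frv x r) e <-> (eval e x : vK M) != 0 /\ vrv (eval e x : vK M) = (eval e r : vRV M).
Proof. by []. Qed.

Lemma sat_fnear V (e : asg MM V) x y :
  sat (fnear x y) e <-> near (eval e x : vK M) (eval e y : vK M).
Proof.
rewrite /fnear sat_ex; split.
  move=> [r]; rewrite sat_and !sat_frv !eval_twk => -[[x0 xr] [y0 yr]].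
  by apply/rv_near => //; rewrite xr yr.
move=> h; have [x0 y0 _] := h; exists (vrv (eval e x : vK M)).
rewrite sat_and !sat_frv !eval_twk; do 2!split=> //.
by apply/rv_near => //; exact: near_sym.
Qed.

Definition fpower V (n : nat) (x y : @term vf_sig V SK) : @Defs.form vf_sig V :=
  @FEx vf_sig V SK (FEq (twk SK x)
     (tmul (twk SK y) (@tpow (cext V SK) (@TVar vf_sig (cext V SK) None) n))).

Lemma sat_fpower V (e : asg MM V) n x y :
  sat (fpower n x y) e <-> exists z, (eval e x : vK M) = (eval e y : vK M) * z ^+ n.
Proof.
rewrite /fpower sat_ex; apply: ex_iff => z.
set p := FEq _ _; set e' := asg_ext _ _.
have -> : sat p e' = ((eval e' (twk SK x) : vK M) = (eval e' (twk SK y) : vK M) *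
    (eval e' (@tpow (cext V SK) (@TVar vf_sig (cext V SK) None) n) : vK M)) by [].
by rewrite eval_tpow /e' !eval_twk.
Qed.

Lemma interp_k (V0 : ctx unit) (p : @Defs.form ring_sig V0) :
  exists q : @Defs.form vf_sig (Ctx (fun _ : V0 => Sk)),
    forall e : asg (field_struct (vk M)) V0, sat q (e : asg MM (Ctx (fun _ : V0 => Sk))) <-> sat p e.
Proof.
apply: (@interp_intro vf_sig MM Sk ring_sig (@ring_interp (vk M)) _).
- move=> {p}{}V0 s0 t; elim: t => [x|f a IH].
    by exists (@TVar vf_sig (Ctx (fun _ : V0 => Sk)) x).
  have [a' ha] := choice IH.
  exists (@TApp vf_sig (Ctx (fun _ : V0 => Sk)) (Fk f) a') => e /=.
  by congr ring_interp; apply: functional_extensionality_dep => i; exact: ha.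
- by move=> {p}{}V0 [].
Qed.

Lemma interp_G (V0 : ctx unit) (p : @Defs.form ogroup_sig V0) :
  exists q : @Defs.form vf_sig (Ctx (fun _ : V0 => SG)),
    forall e : asg (ogroup_struct (vG M)) V0, sat q (e : asg MM (Ctx (fun _ : V0 => SG))) <-> sat p e.
Proof.
have ht (W0 : ctx unit) s0 (t : @term ogroup_sig W0 s0) :
   exists t' : @term vf_sig (Ctx (fun _ : W0 => SG)) SG,
   forall e : asg (ogroup_struct (vG M)) W0, eval (e : asg MM (Ctx (fun _ : W0 => SG))) t' = eval e t.
  elim: t => [x|f a IH]; first by exists (@TVar vf_sig (Ctx (fun _ : W0 => SG)) x).
  have [a' ha] := choice IH.
  exists (@TApp vf_sig (Ctx (fun _ : W0 => SG)) (FG f) a') => e /=.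
  by congr zmod_interp; apply: functional_extensionality_dep => i; exact: ha.
apply: (@interp_intro vf_sig MM SG ogroup_sig (@zmod_interp (vG M)) _) => //.
move=> {p}{}V0 r a; have [a' ha] := choice (fun i => ht V0 tt (a i)).
exists (@FRel vf_sig (Ctx (fun _ : V0 => SG)) Rle a') => e.
rewrite -[sat _ _]/(is_true ((eval (e : asg MM (Ctx (fun _ : V0 => SG))) (a' ord0) : vG M) <=
   (eval (e : asg MM (Ctx (fun _ : V0 => SG))) (a' ord_max) : vG M))).
by rewrite !ha.
Qed.

Lemma saturated_k U (D : set U) : saturated MM D -> saturated (field_struct (vk M)) D.
Proof. by move=> h; exact: (@saturated_interp vf_sig MM Sk ring_sig (@ring_interp (vk M))
  (fun r : void => match r with end) (@interp_k) U D h). Qed.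

Lemma saturated_G U (D : set U) : saturated MM D -> saturated (ogroup_struct (vG M)) D.
Proof. by move=> h; exact: (@saturated_interp vf_sig MM SG ogroup_sig (@zmod_interp (vG M))
  (fun _ (a : 'I_2 -> vG M) => a ord0 <= a ord_max) (@interp_G) U D h). Qed.

Definition definable1 (P : vK M -> Prop) := @definable_by vf_sig MM SK P.

Lemma saturated_definable U (D : set U) (I : Type) (P : I -> vK M -> Prop) :
  injects [set: nat] D -> saturated MM D -> injects [set: I] D ->
  (forall i, definable1 (P i)) ->
  (forall l : seq I, exists x, forall i, List.In i l -> P i x) ->
  exists x, forall i, P i x.
Proof. exact: saturated_definable_by. Qed.

Lemma definable_param (s : sorts vf_sig) (a : MM s) (P : vK M -> Prop)
    (p : @Defs.form vf_sig (cadd (cone (SK : sorts vf_sig)) (cone s))) :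
  (forall x : vK M, sat p (asg_add ((fun _ => x) : asg MM (cone (SK : sorts vf_sig)))
     ((fun _ => a) : asg MM (cone s))) <-> P x) -> definable1 P.
Proof.
move=> h; exists (cone s), (fun _ => a), p; split=> //.
by exists (fun=> 0%N); split=> // -[] [].
Qed.

Lemma definable_val (g : vG M) : definable1 (fun x => vval x = Some g).
Proof.
pose V := cadd (cone (SK : sorts vf_sig)) (cone (SG : sorts vf_sig)).
exact: (@definable_param SG g _ (@fval V (@TVar vf_sig V (inl tt)) (@TVar vf_sig V (inr tt)))).
Qed.

Lemma definable_near_power (a : vK M) n : definable1 (fun x => near (x ^+ n) a).
Proof.
pose V := cadd (cone (SK : sorts vf_sig)) (cone (SK : sorts vf_sig)).
apply: (@definable_param SK a _ (@fnear V (tpow (@TVar vf_sig V (inl tt)) n) (@TVar vf_sig V (inr tt)))).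
by move=> x; rewrite sat_fnear eval_tpow.
Qed.

Lemma definable_power (b : vK M) n : b != 0 -> definable1 (fun x => is_power n (x / b)).
Proof.
move=> b0; pose V := cadd (cone (SK : sorts vf_sig)) (cone (SK : sorts vf_sig)).
apply: (@definable_param SK b _ (@fpower V n (@TVar vf_sig V (inl tt)) (@TVar vf_sig V (inr tt)))).
move=> x; rewrite sat_fpower; apply: ex_iff => z /=.
by split=> [->|/(canRL (divfK b0)) ->]; rewrite mulrC ?mulKf.
Qed.

Lemma definable_poly (p : {poly vK M}) (P : vK M -> Prop) :
  definable1 P -> definable1 (fun x => P p.[x]).
Proof.
move=> [W [w [q [Wc hq]]]].
pose Y := @Ctx (sorts vf_sig) 'I_(size p) (fun _ => SK).
pose V := cadd (cone (SK : sorts vf_sig)) (cadd Y W).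
pose t : @term vf_sig V SK :=
  @tpoly V [seq (@TVar vf_sig V (inr (inl i)) : @term vf_sig V SK) | i <- enum 'I_(size p)]
    (@TVar vf_sig V (inl tt)).
exists (cadd Y W), (asg_add ((fun i : 'I_(size p) => p`_i) : asg MM Y) w),
  (fsub q (fun z => match z return @term vf_sig V (csort (c := cadd (cone (SK : sorts vf_sig)) W) z) with
    | inl _ => t | inr y => @TVar vf_sig V (inr (inr y)) end)); split.
  have n0 : injects [set: nat] [set: nat] by exists id.
  by apply: small_sum => //; exact: small_fin.
move=> x; rewrite -hq sat_fsub.
rewrite (sat_ext (e' := asg_add ((fun _ => p.[x]) : asg MM (cone (SK : sorts vf_sig))) w)) //.
move=> [z|y] //=; rewrite eval_tpoly -map_comp /=; congr _.[x].
apply/polyP => i; rewrite coef_Poly.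
have [ip|pi] := ltnP i (size p).
  by rewrite (nth_map (Ordinal ip)) ?size_enum_ord //= nth_enum_ord.
by rewrite !nth_default // size_map size_enum_ord.
Qed.

Lemma definable_near (a : vK M) : definable1 (fun x => near x a).
Proof.
pose V := cadd (cone (SK : sorts vf_sig)) (cone (SK : sorts vf_sig)).
apply: (@definable_param SK a _ (@fnear V (@TVar vf_sig V (inl tt)) (@TVar vf_sig V (inr tt)))).
by move=> x; rewrite sat_fnear.
Qed.

Lemma definable_zero : definable1 (fun x => x = 0).
Proof.
pose V := cadd (cone (SK : sorts vf_sig)) (cone (SK : sorts vf_sig)).
exact: (@definable_param SK 0 _ (FEq (@TVar vf_sig V (inl tt)) (@TVar vf_sig V (inr tt)))).
Qed.

End Formulas.

(** * Closing partial elementary maps of the residue field and of the value group *)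

Lemma Zorn_above T (Q : set T -> Prop) (G : set T) :
  Q G -> (forall F : set (set T), F !=set0 -> (forall X, F X -> G `<=` X /\ Q X) ->
     total_on F subset -> Q (\bigcup_(X in F) X)) ->
  exists G', [/\ G `<=` G', Q G' & forall H, G' `<=` H -> Q H -> H `<=` G'].
Proof.
move=> QG Qch; have [F FQ tot|X [QX Xmax]] := @Zorn_bigcup _ (fun X => Q (G `|` X)).
  have [[X0 FX0]|F0] := pselect (F !=set0); last first.
    rewrite (_ : \bigcup_(X in F) X = set0) ?setU0 //.
    by apply/seteqP; split=> // x [X FX _]; case: F0; exists X.
  have -> : G `|` \bigcup_(X in F) X = \bigcup_(Y in [set G `|` X | X in F]) Y.
    apply/seteqP; split=> x.
      move=> [Gx|[X FX Xx]]; first by exists (G `|` X0); [exists X0|left].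
      by exists (G `|` X); [exists X|right].
    by move=> [_ [X FX <-] [Gx|Xx]]; [left|right; exists X].
  apply: Qch; first by exists (G `|` X0), X0.
    by move=> _ [X FX <-]; split; last exact: FQ.
  move=> _ _ [X FX <-] [Y FY <-].
  by have [s|s] := tot X Y FX FY; [left|right]; exact: setUS.
exists (G `|` X); split=> //.
move=> H GH QH; apply: contrapT => nH; apply: (Xmax H).
  split; first by move=> x Xx; apply: GH; right.
  by move=> HX; apply: nH => x /HX; right.
by rewrite (_ : G `|` H = H) //; apply/setUidPr => x Gx; apply: GH; left.
Qed.

Lemma bigcup_chain2 T (F : set (set T)) p q : total_on F subset ->
  (\bigcup_(X in F) X) p -> (\bigcup_(X in F) X) q -> exists X, [/\ F X, X p & X q].
Proof.
move=> tot [X FX Xp] [Y FY Yq].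
by have [s|s] := tot X Y FX FY; [exists Y|exists X]; split=> //; exact: s.
Qed.

Lemma unit_sort (s s' : unit) : s = s'. Proof. by case: s; case: s'. Qed.

Section Subfield.
Variables (F : fieldType) (A : set F).
Hypothesis Asub : subfield A.

Lemma A1 : A 1.
Proof. by case: Asub; rewrite inE. Qed.
Lemma AB a b : A a -> A b -> A (a - b).
Proof. by case: Asub => _ h _ Aa Ab; have := h a b; rewrite !inE; apply. Qed.
Lemma Adiv a b : A a -> A b -> A (a / b).
Proof. by case: Asub => _ _ h Aa Ab; have := h a b; rewrite !inE; apply. Qed.
Lemma A0 : A 0. Proof. by rewrite -(subrr 1); apply: AB; exact: A1. Qed.
Lemma AV a : A a -> A a^-1.
Proof. by move=> Aa; rewrite -div1r; apply: Adiv => //; exact: A1. Qed.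
Lemma AM a b : A a -> A b -> A (a * b).
Proof. by move=> Aa Ab; rewrite -(invrK b); apply: Adiv => //; exact: AV. Qed.
Lemma AN a : A a -> A (- a).
Proof. by move=> Aa; rewrite -sub0r; apply: AB => //; exact: A0. Qed.
Lemma AD a b : A a -> A b -> A (a + b).
Proof. by move=> Aa Ab; rewrite -(opprK b); apply: AB => //; exact: AN. Qed.

End Subfield.

Section System.
Variable M : valuedField.
Notation MM := (vf_struct M).
Notation K := (vK M).
Variables (A : set K) (U : Type) (D : set U).
Hypothesis Dinf : injects [set: nat] D.
Hypothesis Msat : saturated MM D.
Hypothesis Asub : subfield A.
Hypothesis Asm : injects A D.
Hypothesis Mhens : henselian M.
Hypothesis Mchar : [pchar (vk M)] =i pred0.
Hypothesis Acosets : forall n (x : K), (0 < n)%N -> x != 0 ->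
  exists a y, [/\ A a, a != 0 & x = a * y ^+ n].
Hypothesis Aunits : forall n (x : K), (0 < n)%N -> unit_el x ->
  exists a y, [/\ A a, unit_el a, unit_el y & vres a = vres x * vres y ^+ n].

Definition elem_k (E : set (vk M * vk M)) :=
  @elementary ring_sig (vk M) (@ring_interp (vk M)) (fun r : void => match r with end) E.
Definition elem_G (E : set (vG M * vG M)) :=
  @elementary ogroup_sig (vG M) (@zmod_interp (vG M))
    (fun _ (a : 'I_2 -> vG M) => a ord0 <= a ord_max) E.

(** The graph is a subring of the product; together with elementarity this makes it an isomorphism
    of subrings. *)
Record ring_rel (R : pzRingType) (E : set (R * R)) : Prop := RingRel {
  rr_1 : E (1, 1);
  rr_B : forall p q, E p -> E q -> E (p.1 - q.1, p.2 - q.2);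
  rr_M : forall p q, E p -> E q -> E (p.1 * q.1, p.2 * q.2) }.

Definition group_rel (E : set (vG M * vG M)) :=
  E (0, 0) /\ forall p q, E p -> E q -> E (p.1 - q.1, p.2 - q.2).

Lemma rr_0 (R : pzRingType) (E : set (R * R)) : ring_rel E -> E (0, 0).
Proof. by move=> h; have := rr_B h (rr_1 h) (rr_1 h); rewrite /= subrr. Qed.

Lemma rr_D (R : pzRingType) (E : set (R * R)) p q : ring_rel E -> E p -> E q ->
  E (p.1 + q.1, p.2 + q.2).
Proof.
move=> h hp hq; have := rr_B h hp (rr_B h (rr_0 h) hq).
by rewrite /= !sub0r !opprK.
Qed.

Lemma rr_X (R : pzRingType) (E : set (R * R)) p n : ring_rel E -> E p ->
  E (p.1 ^+ n, p.2 ^+ n).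
Proof.
move=> h hp; elim: n => [|n IH]; first exact: rr_1.
by have := rr_M h hp IH; rewrite /= !exprS.
Qed.

Lemma gr_N E p : group_rel E -> E p -> E (- p.1, - p.2).
Proof. by move=> [h0 h] hp; have := h _ _ h0 hp; rewrite /= !sub0r. Qed.

Lemma gr_D E p q : group_rel E -> E p -> E q -> E (p.1 + q.1, p.2 + q.2).
Proof. by move=> h hp hq; have := h.2 _ _ hp (gr_N h hq); rewrite /= !opprK. Qed.

Lemma gr_MnZ E p (i : int) : group_rel E -> E p -> E (p.1 *~ i, p.2 *~ i).
Proof.
move=> h hp; have hn n : E (p.1 *+ n, p.2 *+ n).
  elim: n => [|n IH]; first exact: h.1.
  by have := gr_D h hp IH; rewrite /= !mulrS.
case: i => n; first by have := hn n.
by have := gr_N h (hn n.+1).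
Qed.

Lemma elem_k_eq E x y x' y' : elem_k E -> E (x, x') -> E (y, y') -> (x = y) <-> (x' = y').
Proof. exact: (@elementary_eq ring_sig tt). Qed.

Lemma elem_G_eq E x y x' y' : elem_G E -> E (x, x') -> E (y, y') -> (x = y) <-> (x' = y').
Proof. exact: (@elementary_eq ogroup_sig tt). Qed.

Lemma elem_G_le E x y x' y' : elem_G E -> E (x, x') -> E (y, y') -> (x <= y) = (x' <= y').
Proof.
move=> hE hx hy; apply/idP/idP.
  by apply: (@elementary_rel ogroup_sig _ _ _ E tt (fun i => if nat_of_ord i is 0%N then x else y)
    (fun i => if nat_of_ord i is 0%N then x' else y') hE _).1 => i; case: (nat_of_ord i).
by apply: (@elementary_rel ogroup_sig _ _ _ E tt (fun i => if nat_of_ord i is 0%N then x else y)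
    (fun i => if nat_of_ord i is 0%N then x' else y') hE _).2 => i; case: (nat_of_ord i).
Qed.

(** The domain is first enlarged to the subfield [S'] generated by the old domain and [S].
    Elementary maps respect the operations, so a closed domain makes the graph closed. *)
Lemma elem_k_close (E : set (vk M * vk M)) (S : set (vk M)) :
  elem_k E -> injects E D -> injects S D ->
  exists E', [/\ E `<=` E', elem_k E', injects E' D, ring_rel E' &
     (forall p, E' p -> E' (p.1^-1, p.2^-1)) /\ forall x, S x -> exists x', E' (x, x')].
Proof.
move=> hE Esm Ssm.
pose op (n : nat) (s : seq (vk M)) : vk M := match n with
  | 0%N => 1 | 1%N => nth 0 s 0 + nth 0 s 1 | 2%N => - nth 0 s 0 | 3%N => (nth 0 s 0)^-1
  | _ => nth 0 s 0 * nth 0 s 1 end.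
pose S' := [set x | hull_mem op ([set p.1 | p in E] `|` S) x].
have S'sm : injects S' D.
  by apply: small_hull => //; apply: small_union => //; exact: small_image.
have [E' [EE' hE' E'sm dom domS]] :=
  @elementary_extend ring_sig tt unit_sort _ _ _ U D Dinf (saturated_k Msat) ring_cst E S' hE Esm S'sm.
have {}domS p : E' p -> S' p.1.
  by move=> /domS[Ep|//]; apply: HullBase; left; exists p.
have opS n x y : S' x -> S' y -> S' (op n [:: x; y]).
  by move=> hx hy; apply: HullOp => z /= [<-|[<-|]].
have cl (o : ring_op) (a a' : 'I_(ring_ar o) -> vk M) : (forall i, E' (a i, a' i)) ->
    S' (ring_interp a) -> E' (ring_interp a, ring_interp a').
  move=> aa /dom[z hz].
  by rewrite -(@elementary_fun ring_sig _ _ _ E' o a a' z hE' aa hz).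

have clD x y x' y' : E' (x, x') -> E' (y, y') -> E' (x + y, x' + y').
  move=> hx hy; apply: (cl RAdd (fun i => if nat_of_ord i is 0%N then x else y)
    (fun i => if nat_of_ord i is 0%N then x' else y')); first by move=> i; case: (nat_of_ord i).
  by apply: (opS 1%N); [exact: domS hx|exact: domS hy].
have clM x y x' y' : E' (x, x') -> E' (y, y') -> E' (x * y, x' * y').
  move=> hx hy; apply: (cl RMul (fun i => if nat_of_ord i is 0%N then x else y)
    (fun i => if nat_of_ord i is 0%N then x' else y')); first by move=> i; case: (nat_of_ord i).
  by apply: (opS 4%N); [exact: domS hx|exact: domS hy].
have clN x x' : E' (x, x') -> E' (- x, - x').
  move=> hx; apply: (cl ROpp (fun=> x) (fun=> x')) => //.
  by apply: (opS 2%N x x); exact: domS hx.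
have cl1 : E' (1, 1).
  have no : forall i : 'I_0, False by case.
  apply: (cl ROne (fun i => False_rect _ (no i)) (fun i => False_rect _ (no i))); first by case.
  by apply: (@HullOp _ op _ 0%N [::]).
have cl0 : E' (0, 0) by have := clD _ _ _ _ cl1 (clN _ _ cl1); rewrite subrr.
exists E'; split=> //.
- split=> //.
  + by move=> [x x'] [y y'] /= hx hy; apply: clD => //; exact: clN.
  + by move=> [x x'] [y y'] /= hx hy; exact: clM.
- split; last by move=> x Sx; apply: dom; apply: HullBase; right.
  move=> [x x'] hx /=; have [x0|x0] := eqVneq x 0.
    by have /(elem_k_eq hE' hx cl0) -> := x0; rewrite x0 invr0.
  have [z hz] : exists z, E' (x^-1, z) by apply: dom; apply: (opS 3%N x x); exact: domS hx.
  have e : x' * z = 1.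
    by apply: (elem_k_eq hE' (clM _ _ _ _ hx hz) cl1).1; rewrite mulfV.
  have x'0 : x' != 0.
    by apply: contra_eq_neq e => ->; rewrite mul0r eq_sym oner_neq0.
  by rewrite -(mulKf x'0 z) e mulr1 in hz.
Qed.

Lemma elem_G_close (E : set (vG M * vG M)) (S : set (vG M)) :
  elem_G E -> injects E D -> injects S D ->
  exists E', [/\ E `<=` E', elem_G E', injects E' D, group_rel E' &
     forall x, S x -> exists x', E' (x, x')].
Proof.
move=> hE Esm Ssm.
pose op (n : nat) (s : seq (vG M)) : vG M := match n with
  | 0%N => 0 | 1%N => nth 0 s 0 + nth 0 s 1 | _ => - nth 0 s 0 end.
pose S' := [set x | hull_mem op ([set p.1 | p in E] `|` S) x].
have S'sm : injects S' D.
  by apply: small_hull => //; apply: small_union => //; exact: small_image.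
have [E' [EE' hE' E'sm dom domS]] :=
  @elementary_extend ogroup_sig tt unit_sort _ _ _ U D Dinf (saturated_G Msat) ogroup_cst E S' hE Esm S'sm.
have {}domS p : E' p -> S' p.1.
  by move=> /domS[Ep|//]; apply: HullBase; left; exists p.
have opS n x y : S' x -> S' y -> S' (op n [:: x; y]).
  by move=> hx hy; apply: HullOp => z /= [<-|[<-|]].
have cl (o : grp_op) (a a' : 'I_(grp_ar o) -> vG M) : (forall i, E' (a i, a' i)) ->
    S' (zmod_interp a) -> E' (zmod_interp a, zmod_interp a').
  move=> aa /dom[z hz].
  by rewrite -(@elementary_fun ogroup_sig _ _ _ E' o a a' z hE' aa hz).
have clD x y x' y' : E' (x, x') -> E' (y, y') -> E' (x + y, x' + y').
  move=> hx hy; apply: (cl GMul (fun i => if nat_of_ord i is 0%N then x else y)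
    (fun i => if nat_of_ord i is 0%N then x' else y')); first by move=> i; case: (nat_of_ord i).
  by apply: (opS 1%N); [exact: domS hx|exact: domS hy].
have clN x x' : E' (x, x') -> E' (- x, - x').
  move=> hx; apply: (cl GInv (fun=> x) (fun=> x')) => //.
  by apply: (opS 2%N x x); exact: domS hx.
exists E'; split=> //.
- split.
  + have no : forall i : 'I_0, False by case.
    apply: (cl GOne (fun i => False_rect _ (no i)) (fun i => False_rect _ (no i))).
      by case.
    by apply: (@HullOp _ op _ 0%N [::]).
  + by move=> [x x'] [y y'] /= hx hy; apply: clD => //; exact: clN.
- by move=> x Sx; apply: dom; apply: HullBase; right.
Qed.

End System.

(** * Extending the map of leading terms *)

Lemma torsion_free_le (M : valuedField) (g h : vG M) n : (0 < n)%N -> g *+ n <= h *+ n -> g <= h.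
Proof.
move=> n0; have mono k (a b : vG M) : a <= b -> a *+ k <= b *+ k.
  move=> ab; elim: k => [|k IH]; first by rewrite !mulr0n.
  rewrite !mulrS; apply: (le_trans (y := b + a *+ k)); last by rewrite gle_add2l.
  by rewrite addrC (addrC b) gle_add2l.
move=> gh; have /orP[//|hg] := vG_total g h.
have e : g *+ n = h *+ n by apply/eqP; rewrite eq_le gh mono.
case: n n0 gh e => // n _ _; rewrite !mulrS => e.
rewrite -(gle_add2l _ _ (h *+ n)) (addrC _ h) -e (addrC _ g) gle_add2l.
exact: mono.
Qed.

Lemma torsion_free (M : valuedField) (g h : vG M) n : (0 < n)%N -> g *+ n = h *+ n -> g = h.
Proof.
move=> n0 e; apply/eqP; rewrite eq_le; apply/andP.
by split; apply: (torsion_free_le n0); rewrite e.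
Qed.

Section GSystem.
Variable M : valuedField.
Notation MM := (vf_struct M).
Notation K := (vK M).
Variables (A : set K) (U : Type) (D : set U).
Hypothesis Dinf : injects [set: nat] D.
Hypothesis Msat : saturated MM D.
Hypothesis Asub : subfield A.
Hypothesis Mhens : henselian M.
Hypothesis Mchar : [pchar (vk M)] =i pred0.
Hypothesis Acosets : forall n (x : K), (0 < n)%N -> x != 0 ->
  exists a y, [/\ A a, a != 0 & x = a * y ^+ n].

(** A partial isomorphism of RV over A, written on representatives in K: by [gs_1] the relation is a
    union of classes modulo 1 + M on each side. Preservation of powers is part of the data, because
    roots have to be extracted on the other side. *)
Record gsys (G : set (K * K)) (Ek : set (vk M * vk M)) (EG : set (vG M * vG M)) : Prop := GSys {
  gs_A : forall a, A a -> a != 0 -> G (a, a);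
  gs_M : forall p q, G p -> G q -> G (p.1 * q.1, p.2 * q.2);
  gs_V : forall p, G p -> G (p.1^-1, p.2^-1);
  gs_nz : forall p, G p -> p.1 != 0 /\ p.2 != 0;
  gs_1 : forall z z', small_el (z - 1) -> small_el (z' - 1) -> G (z, z');
  gs_pow : forall p n, G p -> (0 < n)%N -> is_power n p.1 <-> is_power n p.2;
  gs_v : forall p, G p -> EG (v p.1, v p.2);
  gs_k : forall p, G p -> v p.1 = 0 -> Ek (vres p.1, vres p.2) }.

Lemma vXz (x : K) (i : int) : x != 0 -> v (x ^ i) = v x *~ i.
Proof.
move=> x0; case: i => n; first by rewrite -exprnP vX.
by rewrite NegzE -exprnN vV ?expf_neq0 // vX // mulrNz.
Qed.

Lemma gs_near G Ek EG x x' y y' : gsys G Ek EG -> G (x, x') -> near x y -> near x' y' -> G (y, y').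
Proof.
move=> h hx /near_sym[y0 x0 n] /near_sym[y0' x0' n'].
have := gs_M h hx (gs_1 h n n') => /=.
by rewrite !(mulrC _ (_ / _)) !divfK.
Qed.

Lemma gs_Xz G Ek EG p (i : int) : gsys G Ek EG -> G p -> G (p.1 ^ i, p.2 ^ i).
Proof.
move=> h hp; have hn n : G (p.1 ^+ n, p.2 ^+ n).
  elim: n => [|n IH]; first by rewrite !expr0; apply: (gs_1 h); rewrite subrr; exact: small0.
  by rewrite !exprS; exact: (gs_M h hp IH).
by case: i => n; [exact: hn|exact: (gs_V h (hn n.+1))].
Qed.

Lemma gs_div G Ek EG p q : gsys G Ek EG -> G p -> G q -> G (p.1 / q.1, p.2 / q.2).
Proof. by move=> h hp hq; exact: (gs_M h hp (gs_V h hq)). Qed.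

Definition adjoin (G : set (K * K)) (y y' : K) : set (K * K) :=
  [set p | exists g (i : int), G g /\ p = (g.1 * y ^ i, g.2 * y' ^ i)].

Lemma is_powerXz n (x : K) (i : int) : is_power n x -> is_power n (x ^ i).
Proof.
move=> [y ->]; case: i => m; first by exists (y ^+ m); rewrite -exprnP exprAC.
by exists (y ^+ m.+1)^-1; rewrite NegzE -exprnN exprVn exprAC.
Qed.

(** Powers are respected because [y] and [y'] share, for each n, a representative [b] in [A] of
    their coset of n-th powers: a product g y^i is an n-th power if and only if g b^i is. *)
Lemma adjoin_gsys G Ek EG y y' : gsys G Ek EG -> group_rel EG -> y != 0 -> y' != 0 ->
  EG (v y, v y') ->
  (forall n, (0 < n)%N -> exists b, [/\ A b, b != 0, is_power n (y / b) & is_power n (y' / b)]) ->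
  (forall g (i : int), G g -> v (g.1 * y ^ i) = 0 -> Ek (vres (g.1 * y ^ i), vres (g.2 * y' ^ i))) ->
  gsys (adjoin G y y') Ek EG.
Proof.
move=> h hEG y0 y0' vy py ky; split.
- move=> a Aa a0; exists (a, a), 0; split; first exact: gs_A h _ _ _.
  by rewrite !expr0z !mulr1.
- move=> _ _ [g [i [Gg ->]]] [g' [j [Gg' ->]]].
  exists (g.1 * g'.1, g.2 * g'.2), (i + j); split; first exact: gs_M h _ _ Gg Gg'.
  by rewrite /= !expfzDr // !mulrA (mulrAC g.1) (mulrAC g.2).
- move=> _ [g [i [Gg ->]]]; exists (g.1^-1, g.2^-1), (- i); split; first exact: (gs_V h Gg).
  by rewrite /= !invfM !invr_expz.
- by move=> _ [g [i [/(gs_nz h)[g1 g2] ->]]] /=; rewrite !mulf_neq0 ?expfz_neq0.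
- move=> z z' hz hz'; exists (z, z'), 0; split; first exact: (gs_1 h).
  by rewrite !expr0z !mulr1.
- move=> _ n [g [i [Gg ->]]] n0 /=.
  have [b [Ab b0 p1 p2]] := py n n0.
  have bi : G (b ^ i, b ^ i) by exact: (gs_Xz i h (gs_A h Ab b0)).
  have e1 (g1 w : K) : w != 0 -> is_power n (w / b) -> is_power n (g1 * w ^ i) <-> is_power n (g1 * b ^ i).
    move=> w0 pw; have wb : (w / b) ^ i != 0 by rewrite expfz_neq0 // mulf_neq0 ?invr_neq0.
    have := is_power_mul2 (g1 * b ^ i) wb (is_powerXz i pw).
    by rewrite -mulrA -expfzMl (mulrC b) divfK.
  rewrite e1 // e1 //; exact: (gs_pow h (gs_M h Gg bi) n0).
- move=> _ [g [i [Gg ->]]] /=; have [g1 g2] := gs_nz h Gg.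
  rewrite !vM ?expfz_neq0 // !vXz //.
  exact: (gr_D hEG (gs_v h Gg) (gr_MnZ i hEG vy)).
- by move=> _ [g [i [Gg ->]]] /=; exact: ky.
Qed.

Lemma sub_adjoin G Ek EG y y' : gsys G Ek EG -> G `<=` adjoin G y y'.
Proof. by move=> h [x x'] Gx; exists (x, x'), 0; rewrite !expr0z !mulr1. Qed.

Lemma adjoin_mem G Ek EG y y' : gsys G Ek EG -> adjoin G y y' (y, y').
Proof.
move=> h; exists (1, 1), 1; rewrite !expr1z !mul1r; split=> //.
exact: (gs_A h (A1 Asub) (oner_neq0 _)).
Qed.

(** The domains on which an extension step is carried out: subfields relatively algebraically closed
    in K, containing witnesses for the fact that A represents all power cosets. *)
Record closed_field (L : set K) : Prop := ClosedField {
  cf_1 : L 1;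
  cf_B : forall x y, L x -> L y -> L (x - y);
  cf_M : forall x y, L x -> L y -> L (x * y);
  cf_V : forall x, L x -> L x^-1;
  cf_A : A `<=` L;
  cf_root : forall (p : {poly K}) x, p != 0 -> (forall i, L p`_i) -> root p x -> L x;
  cf_coset : forall n x, (0 < n)%N -> L x -> x != 0 ->
    exists a y, [/\ A a, a != 0, L y & x = a * y ^+ n];
  cf_unit : forall n x, (0 < n)%N -> L x -> unit_el x ->
    exists a y, [/\ A a, unit_el a, L y, unit_el y & vres a = vres x * vres y ^+ n] }.

Lemma cf_Xz L x (i : int) : closed_field L -> L x -> L (x ^ i).
Proof.
move=> h Lx; have hn n : L (x ^+ n).
  by elim: n => [|n IH]; [exact: cf_1|rewrite exprS; exact: cf_M].
by case: i => n; [exact: hn|rewrite NegzE -exprnN; exact: (cf_V h (hn _))].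
Qed.

(** The residue equation gives [a] and z w^n the same leading term. *)
Lemma unit_power_coset n (a z w : K) : (0 < n)%N -> unit_el a -> unit_el z -> unit_el w ->
  vres a = vres z * vres w ^+ n -> is_power n (z / a).
Proof.
move=> n0 ua uz uw e; have [a0 _] := (unit_elP a).1 ua.
have [z0 _] := (unit_elP z).1 uz; have [w0 _] := (unit_elP w).1 uw.
have nr : near a (z * w ^+ n).
  apply/near_res => //; first exact/unitM/unitX.
  by rewrite resM ?resX // -?e //; [exact: unit_integral..|exact/integralX/unit_integral].
have pz : is_power n ((z / a) * w ^+ n).
  apply/(near_power Mhens Mchar n0 (y := 1)); last by exists 1; rewrite expr1n.
  rewrite mulrAC; apply: near_trans (nearM (near_sym nr) (near_refl (invr_neq0 a0))) _.
  by rewrite divff //; apply: near_refl; exact: oner_neq0.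
by apply/(is_power_mul2 _ _ (y := w ^+ n)) => //; [rewrite expf_neq0|exists w].
Qed.

(** In a maximal extension [G'] every y of [L] is reached in one of three ways. A unit is sent to a
    lift of the image of its residue. If no positive multiple of v(y) is a value of [G'], any
    element with the image value and in the power cosets of y will do. Otherwise take the least N
    such that N v(y) is a value of [G'], correct y by a unit so that its N-th power enters the
    domain, and extract an N-th root on the other side. *)
Lemma gsys_extend G Ek EG L : gsys G Ek EG -> ring_rel Ek -> group_rel EG -> elem_k Ek -> elem_G EG ->
  injects L D -> closed_field L ->
  (forall p, G p -> exists2 l, L l & near p.1 l) ->
  (forall x, L x -> integral x -> exists u, Ek (vres x, u)) ->
  (forall x, L x -> x != 0 -> exists g, EG (v x, g)) ->
  exists G', [/\ G `<=` G', gsys G' Ek EG, (forall p, G' p -> exists2 l, L l & near p.1 l) &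
    forall x, L x -> x != 0 -> exists x', G' (x, x')].
Proof.
move=> G0 hEk hEG elk elG Lsm hL GL Ldk LdG.
pose Q G' := gsys G' Ek EG /\ forall p, G' p -> exists2 l, L l & near p.1 l.
have [F [X0 FX0] FQ tot|G' [GG' [hG G'L] Gmax]] := @Zorn_above _ Q G (conj G0 GL).
  have [_ [h0 _]] := FQ X0 FX0.
  have ch p : (\bigcup_(X in F) X) p -> exists X, [/\ F X, Q X & X p].
    by move=> [X FX Xp]; exists X; split=> //; case: (FQ X FX).
  split; last by move=> p /ch[X [_ [_ h] /h]].
  split.
  - by move=> a Aa a0; exists X0 => //; exact: (gs_A h0).
  - move=> p q hp hq; have [X [FX Xp Xq]] := bigcup_chain2 tot hp hq.
    by have [_ [hX _]] := FQ X FX; exists X => //; exact: (gs_M hX).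
  - by move=> p [X FX Xp]; have [_ [hX _]] := FQ X FX; exists X => //; exact: (gs_V hX).
  - by move=> p /ch[X [_ [h _] /(gs_nz h)]].
  - by move=> z z' hz hz'; exists X0 => //; exact: (gs_1 h0).
  - by move=> p n /ch[X [_ [h _] /(gs_pow h) e]]; exact: e.
  - by move=> p /ch[X [_ [h _] /(gs_v h)]].
  - by move=> p /ch[X [_ [h _] /(gs_k h)]].
have adj y y' : L y -> y != 0 -> y' != 0 -> EG (v y, v y') ->
  (forall n, (0 < n)%N -> exists b, [/\ A b, b != 0, is_power n (y / b) & is_power n (y' / b)]) ->
  (forall g (i : int), G' g -> v (g.1 * y ^ i) = 0 -> Ek (vres (g.1 * y ^ i), vres (g.2 * y' ^ i))) ->
  G' (y, y').
  move=> Ly y0 y0' h1 h2 h3.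
  have hadj := adjoin_gsys hG hEG y0 y0' h1 h2 h3.
  apply: (Gmax (adjoin G' y y')); [exact: (sub_adjoin _ _ hG)| |exact: (adjoin_mem _ _ hG)].
  split=> // _ [g [i [/G'L[l Ll gl] ->]]] /=; exists (l * y ^ i).
    by apply: (cf_M hL) => //; exact: cf_Xz.
  by apply: nearM => //; apply: near_refl; rewrite expfz_neq0.
have G'1 : G' (1, 1) by exact: (gs_A hG (A1 Asub) (oner_neq0 _)).
have unitin y : L y -> unit_el y -> exists y', G' (y, y').
  move=> Ly uy; have [y0 vy] := (unit_elP y).1 uy; have iy := unit_integral uy.
  have Ek00 := rr_0 hEk; have Ek11 := rr_1 hEk.
  have [u hu] := Ldk y Ly iy.
  have u0 : u != 0.
    by apply/eqP => /(elem_k_eq elk hu Ek00).2 e; move/(res_unit iy): uy; rewrite e eqxx.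
  have [y' iy' ry'] := res_surj u.
  have uy' : unit_el y' by apply/res_unit => //; rewrite ry'.
  have [y'0 vy'] := (unit_elP y').1 uy'.
  exists y'; apply: adj => //; first by rewrite vy vy'; exact: hEG.1.
  - move=> n n0; have [a [d [Aa ua Ld ud ra]]] := cf_unit hL n0 Ly uy.
    have [a0 _] := (unit_elP a).1 ua; exists a.
    split=> //; first exact: (unit_power_coset n0 ua uy ud ra).
    have [w hw] := Ldk d Ld (unit_integral ud).
    have w0 : w != 0.
      by apply/eqP => /(elem_k_eq elk hw Ek00).2 e; move/(res_unit (unit_integral ud)): ud; rewrite e eqxx.
    have [d' id' rd'] := res_surj w.
    have ud' : unit_el d' by apply/res_unit => //; rewrite rd'.
    apply: (unit_power_coset n0 ua uy' ud'); rewrite ry' rd'.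
    have h1 := rr_M hEk hu (rr_X n hEk hw); rewrite /= -ra in h1.
    have h2 : Ek (vres a, vres a) by apply: (gs_k hG (gs_A hG Aa a0)); case/unit_elP: ua.
    exact: ((elem_k_eq elk h2 h1).1 erefl).
  - move=> g i Gg; have [g0 g0'] := gs_nz hG Gg.
    rewrite vM ?expfz_neq0 // vXz // vy mul0rz addr0 => vg.
    have ug : unit_el g.1 by apply/unit_elP.
    have vg' : v g.2 = 0.
      by have := gs_v hG Gg; rewrite vg => /(elem_G_eq elG hEG.1) [h _]; rewrite h.
    have ug' : unit_el g.2 by apply/unit_elP.
    have uX z (j : int) : unit_el z -> unit_el (z ^ j).
      by case: j => m uz; [exact: unitX|rewrite NegzE -exprnN; exact/unitV/unitX].
    rewrite !resM; try by apply: unit_integral => //; exact: uX.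
    apply: (@rr_M _ _ hEk (_, _) (_, _) (gs_k hG Gg vg)).
    have hn n : Ek (vres (y ^+ n), vres (y' ^+ n)).
      by rewrite !resX // ry'; exact: (@rr_X _ _ (_, _) n hEk hu).
    case: i => n; first exact: hn.
    rewrite NegzE -!exprnN.
    have [w hw] := Ldk _ (cf_V hL (cf_Xz n.+1 hL Ly)) (unit_integral (unitV (unitX n.+1 uy))).
    have h1 := rr_M hEk (hn n.+1) hw.
    rewrite /= -resM ?divff ?expf_neq0 // ?res1 in h1; last 2 first.
      exact/integralX. exact/unit_integral/unitV/unitX.
    rewrite (_ : vres (y' ^- n.+1) = w) //; have /esym e := (elem_k_eq elk Ek11 h1).1 erefl.
    have uyn := unitX n.+1 uy'; have ryn := (res_unit (unit_integral uyn)).1 uyn.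
    rewrite resV //; apply: (mulfI ryn); rewrite e mulfV //.
have common (ns : seq nat) (y b : K) m t : y = b * t ^+ m -> (forall n, List.In n ns -> (n %| m)%N) ->
    b != 0 -> t != 0 -> forall n, List.In n ns -> is_power n (y / b).
  move=> -> h b0 t0 n /h/dvdnP[k ->]; exists (t ^+ k).
  by rewrite mulrAC divff // mul1r exprM.
have prodP (ns : seq nat) : (forall n, List.In n ns -> (0 < n)%N) ->
    (0 < \prod_(n <- ns) n)%N /\ forall n, List.In n ns -> (n %| \prod_(n <- ns) n)%N.
  elim: ns => [|n ns IH] h; first by rewrite big_nil.
  have [IH1 IH2] := IH (fun m hm => h m (or_intror hm)).
  rewrite big_cons muln_gt0 IH1 (h n (or_introl erefl)); split=> // m /= [->|/IH2 hm].
    by rewrite dvdn_mulr.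
  by rewrite dvdn_mull.
have bch (y : K) : y != 0 -> exists b : nat -> K, forall n, (0 < n)%N ->
    [/\ A (b n), b n != 0 & is_power n (y / b n)].
  move=> y0; have h n : exists b, (0 < n)%N -> [/\ A b, b != 0 & is_power n (y / b)].
    have [n0|n0] := posnP n; first by exists 0; rewrite n0.
    have [a [t [Aa a0 e]]] := Acosets n0 y0; exists a => _; split=> //.
    by exists t; rewrite e mulrAC divff // mul1r.
  by have [b hb] := choice h; exists b.
have vnz (i : int) : i != 0 -> exists2 N, (0 < N)%N & forall g : vG M, g *~ i = g *+ N \/ g *~ i = - (g *+ N).
  case: i => n; first by case: n => // n _; exists n.+1 => // g; left.
  by move=> _; exists n.+1 => // g; right.
exists G'; split=> // y Ly y0.
have [tors|ntors] := pselect (exists N, (0 < N)%N /\ exists2 g, G' g & v g.1 = v y *+ N); last first.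
  have [g' hg'] := LdG y Ly y0; have [b hb] := bch y y0.
  (* [None] prescribes the value and [Some n] the coset of n-th powers; n = 0 imposes nothing. *)
  have [|||y' hy'] := @saturated_definable M U D (option nat)
      (fun o x => if o is Some n then if (0 < n)%N then is_power n (x / b n) else True
                  else vval x = Some g') Dinf Msat.
  - by apply: (@small_nat _ _ Dinf _ (fun o : option nat => if o is Some n then n.+1 else 0%N)) => -[m|] [n|] _ _ //= -[->].
  - case=> [n|]; last exact: definable_val.
    have [n0|n0] := posnP n; last first.
      by have [_ bn0 _] := hb n n0; exact: definable_power.
    have [W [w [p [h1 h2]]]] := definable_zero M.
    by exists W, w, (FImp p p); split=> // x; split=> // _ h.
  - move=> l.
    pose ns := seq.filter (fun n => 0 < n)%N (pmap id l).
    have [m0 mP] := prodP ns (fun n h => ((In_filter _ _ _).1 h).2).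
    set m := \prod_(n <- ns) n in m0 mP.
    (* [m] is a common multiple of the exponents involved, so [c * t' ^+ m] lies in the same cosets
       as [y] whatever [t'] is, and [t'] is free to carry the value prescribed by [EG]. *)
    have [c [t [Ac c0 Lt e]]] := cf_coset hL m0 Ly y0.
    have t0 : t != 0 by apply: contra_neq y0; rewrite e => ->; rewrite expr0n gtn_eqF // mulr0.
    have [tau htau] := LdG t Lt t0.
    have [t' vt'] := val_surj tau; have t'0 := val_neq0 vt'.
    exists (c * t' ^+ m); have cn0 : c * t' ^+ m != 0 by rewrite mulf_neq0 // expf_neq0.
    case=> [n|] nl.
      case: ifP => n0 //.
      have nns : List.In n ns.
        rewrite In_filter; split=> //; elim: (l) nl => //= -[k|] l' IH /= [//|]; auto.
        by move=> [->]; left.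
      have [Ab b0 pb] := hb n n0.
      have p1 := common ns y c m t e mP c0 t0 n nns.
      have p2 := common ns _ c m t' erefl mP c0 t'0 n nns.
      have -> : c * t' ^+ m / b n = (c * t' ^+ m / c) * (y / b n) / (y / c).
        by field; rewrite b0 c0 y0.
      by apply: is_powerM; [exact: is_powerM|exact: is_powerV].
    rewrite val_v // vM ?expf_neq0 // vX //.
    have vv : v t' = tau by rewrite /v vt'.
    rewrite vv; congr Some.
    have h1 : EG (v c, v c) by exact: (gs_v hG (gs_A hG Ac c0)).
    have h2 := gr_D hEG h1 (gr_MnZ m hEG htau); rewrite /= in h2.
    apply/esym; apply: (elem_G_eq elG hg' h2).1.
    by rewrite e vM ?expf_neq0 // vX.
  exists y'; have vy' := hy' None; have y'0 := val_neq0 vy'.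
  apply: adj => //; first by rewrite {2}/v vy'.
  - move=> n n0; have [h1 h2 h3] := hb n n0; exists (b n); split=> //.
    by have := hy' (Some n); rewrite n0.
  - move=> g i Gg; have [g0 g0'] := gs_nz hG Gg.
    rewrite vM ?expfz_neq0 // vXz //; have [->|i0] := eqVneq i 0.
      by rewrite !expr0z !mulr1 mulr0z addr0; exact: (gs_k hG).
    have [N N0 hN] := vnz i i0.
    move=> e; exfalso; apply: ntors; exists N; split=> //.
    have [e'|e'] := hN (v y); rewrite e' in e.
      exists (g.1^-1, g.2^-1); first exact: (gs_V hG).
      by apply/eqP; rewrite /= vV // eq_sym -addr_eq0 addrC e.
    by exists g => //; apply/eqP; rewrite -subr_eq0 e.
have exN : exists N, `[< (0 < N)%N /\ exists2 g, G' g & v g.1 = v y *+ N >].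
  by have [N h] := tors; exists N; apply/asboolP.
case: (ex_minnP exN) => N /asboolP[N0 [s Gs vs]] Nmin.
have [s0 s0'] := gs_nz hG Gs.
have [l Ll sl] := G'L s Gs; have [_ l0 _] := sl.
have Gl : G' (l, s.2) by apply: (@gs_near _ _ _ s.1 s.2 _ _ hG) => //; [case: (s) Gs|exact: near_refl].
have Lu : L (y ^+ N / l) by apply: (cf_M hL); [exact: (cf_Xz N hL)|exact: cf_V].
have uu : unit_el (y ^+ N / l).
  by apply/unit_div; rewrite ?expf_neq0 // vX // -vs; exact: near_v.
(* The unit y^N / l need not have its residue in res(A). Multiplying y by the unit [d] repairs this:
   the N-th power of [y1] gets the leading term of [l * a], which is in the domain. *)
have [a [d [Aa ua Ld ud ra]]] := cf_unit hL N0 Lu uu.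
have [a0 va] := (unit_elP a).1 ua; have [d0 vd] := (unit_elP d).1 ud.
have [d' Gd] := unitin d Ld ud.
pose y1 := y * d; have Ly1 : L y1 by exact: cf_M.
have y10 : y1 != 0 by rewrite mulf_neq0.
have vy1 : v y1 = v y by rewrite vM // vd addr0.
have nr : near (y1 ^+ N) (l * a).
  have : near (y ^+ N / l * d ^+ N) a.
    apply/near_res => //; first exact/unitM/unitX.
    by rewrite resM ?resX //; [exact: unit_integral..|exact/integralX/unit_integral].
  move/(nearM (near_refl l0)); rewrite /y1 exprMn mulrA (mulrCA l) divff // mulr1 //.
pose e := s.2 * a.
have Gla : G' (l * a, e) by exact: (gs_M hG Gl (gs_A hG Aa a0)).
have [_ e0] := gs_nz hG Gla.
have GyN : G' (y1 ^+ N, e) by apply: (gs_near hG Gla (near_sym nr)); exact: near_refl.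
have [b hb] := bch y1 y10.
have [|||y' hy'] := @saturated_definable M U D (option nat)
    (fun o x => if o is Some n then if (0 < n)%N then is_power n (x / b n) else True
                else near (x ^+ N) e) Dinf Msat.
- by apply: (@small_nat _ _ Dinf _ (fun o : option nat => if o is Some n then n.+1 else 0%N)) => -[m|] [n|] _ _ //= -[->].
- case=> [n|]; last exact: definable_near_power.
  have [n0|n0] := posnP n; last first.
    by have [_ bn0 _] := hb n n0; exact: definable_power.
  have [W [w [p [h1 h2]]]] := definable_zero M.
  by exists W, w, (FImp p p); split=> // x; split=> // _ h.
- move=> ll.
  pose ns := seq.filter (fun n => 0 < n)%N (pmap id ll).
  have [m0 mP] := prodP ns (fun n h => ((In_filter _ _ _).1 h).2).
  set m := \prod_(n <- ns) n in m0 mP.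
  have [c [t [Ac c0 et]]] := Acosets m0 y10.
  have t0 : t != 0 by apply: contra_neq y10; rewrite et => ->; rewrite expr0n gtn_eqF // mulr0.
  have cN0 : c ^+ N != 0 by rewrite expf_neq0.
  have Gc : G' (c ^+ N, c ^+ N) by exact: (gs_Xz N hG (gs_A hG Ac c0)).
  have mN0 : (0 < m * N)%N by rewrite muln_gt0 m0.
  (* Powers of exponent m N are preserved: y1^N / c^N = t^(m N), so its image e / c^N is also such a
     power, and [c * t' ^+ m] is an N-th root of [e] in the right cosets. *)
  have [|t' ht'] := (gs_pow hG (gs_div hG GyN Gc) mN0).1.
    by exists t; rewrite /= et exprMn -exprM mulrAC divff // mul1r.
  rewrite /= in ht'.
  have t'0 : t' != 0.
    apply/eqP => tt; move: ht'; rewrite tt expr0n gtn_eqF //=.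
    by move/eqP; rewrite mulf_eq0 invr_eq0 (negPf e0) (negPf cN0).
  exists (c * t' ^+ m); have cn0 : c * t' ^+ m != 0 by rewrite mulf_neq0 // expf_neq0.
  case=> [n|] nl.
    case: ifP => n0 //.
    have nns : List.In n ns.
      rewrite In_filter; split=> //; elim: (ll) nl => //= -[k|] l' IH /= [//|]; auto.
      by move=> [->]; left.
    have [Ab b0 pb] := hb n n0.
    have p1 := common ns y1 c m t et mP c0 t0 n nns.
    have p2 := common ns _ c m t' erefl mP c0 t'0 n nns.
    have -> : c * t' ^+ m / b n = (c * t' ^+ m / c) * (y1 / b n) / (y1 / c).
      by field; rewrite b0 c0 y10.
    by apply: is_powerM; [exact: is_powerM|exact: is_powerV].
  rewrite exprMn -exprM -ht' mulrC divfK //; exact: near_refl.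
have ny' := hy' None; rewrite /= in ny'; have y'0 : y' != 0.
  by have [h _ _] := ny'; apply: contra_neq h => ->; rewrite expr0n gtn_eqF.
have GNN : G' (y1 ^+ N, y' ^+ N) by apply: (gs_near hG GyN (near_refl _) (near_sym ny')); rewrite expf_neq0.
have Gy1 : G' (y1, y').
  apply: adj => //.
  - have [g hg] := LdG y1 Ly1 y10.
    have h1 := gs_v hG GNN; rewrite /= !vX // in h1.
    have h2 := gr_MnZ N hEG hg; rewrite /= in h2.
    by rewrite -(torsion_free N0 ((elem_G_eq elG h2 h1).1 erefl)).
  - move=> n n0; have [h1 h2 h3] := hb n n0; exists (b n); split=> //.
    by have := hy' (Some n); rewrite n0.
  - move=> g i Gg; have [g0 g0'] := gs_nz hG Gg.
    rewrite vM ?expfz_neq0 // vXz // vy1 => vg.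
    (* With i = q N + r, a nonzero remainder would make r v(y) a value of [G'], against the
       minimality of [N]. *)
    pose q := (i %/ N)%Z; pose r := `|(i %% N)%Z|%N.
    have iE : i = q * N + r.
      rewrite {1}(divz_eq i N) /r gez0_abs // modz_ge0 // -lt0n //.
    have rN : (r < N)%N.
      by rewrite -ltz_nat /r gez0_abs ?ltz_pmod // modz_ge0 // -lt0n.
    have Gq := gs_Xz q hG GNN; rewrite /= in Gq.
    have GgP := gs_M hG Gg Gq; rewrite /= in GgP.
    have [r0|r0] := posnP r.
      have E z : z ^ i = (z ^+ N) ^ q :> K by rewrite iE r0 addr0 mulrC -exprz_exp.
      rewrite !E; apply: (gs_k hG GgP) => /=.
      by rewrite -E vM ?expfz_neq0 // vXz // vy1.
    suff : (N <= r)%N by rewrite leqNgt rN.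
    apply: Nmin; apply/asboolP; split=> //.
    exists ((g.1 * (y1 ^+ N) ^ q)^-1, (g.2 * (y' ^+ N) ^ q)^-1); first exact: (gs_V hG GgP).
    rewrite /= vV ?mulf_neq0 ?expfz_neq0 ?expf_neq0 // vM ?expfz_neq0 ?expf_neq0 //.
    rewrite vXz ?expf_neq0 // vX // vy1.
    have ye : v y *~ i = (v y *+ N) *~ q + v y *+ r.
      by rewrite iE mulrzDr mulrzA mulrzAC -!pmulrn.
    by apply/esym/eqP; rewrite -addr_eq0 addrC -addrA -ye vg.
have := gs_div hG Gy1 Gd; rewrite /= /y1 mulfK // => h; exists (y' / d'); exact: h.
Qed.

End GSystem.

(** * Extending the field isomorphism *)

Lemma poly_roots_list (F : fieldType) (p : {poly F}) : p != 0 ->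
  exists rs : seq F, forall x, root p x -> x \in rs.
Proof.
move: {2}(size p) (leqnn (size p)) => n; elim: n p => [|n IH] p sp p0.
  by rewrite leqn0 size_poly_eq0 (negPf p0) in sp.
have [[x /factor_theorem[q pq]]|nr] := pselect (exists x, root p x); last first.
  by exists [::] => x px; case: nr; exists x.
have q0 : q != 0 by apply: contra_neq p0 => e; rewrite pq e mul0r.
have [|rs hrs] := IH q _ q0.
  by move: sp; rewrite pq size_mul ?polyXsubC_eq0 // size_XsubC addn2.
exists (x :: rs) => z; rewrite pq rootM in_cons root_XsubC => /orP[/hrs->|->//].
by rewrite orbT.
Qed.

Section PolyRel.
Variables (F : fieldType) (E : set (F * F)).
Hypothesis hE : ring_rel E.

Definition poly_rel (p p' : {poly F}) := forall i, E (p`_i, p'`_i).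

Lemma rr_Mn p n : E p -> E (p.1 *+ n, p.2 *+ n).
Proof.
move=> hp; elim: n => [|n IH]; first exact: rr_0.
by have := rr_D hE hp IH; rewrite /= !mulrS.
Qed.

Lemma rr_sum I (r : seq I) (P : pred I) (f f' : I -> F) :
  (forall i, P i -> E (f i, f' i)) -> E (\sum_(i <- r | P i) f i, \sum_(i <- r | P i) f' i).
Proof.
move=> h; elim: r => [|i r IH]; first by rewrite !big_nil; exact: rr_0.
rewrite !big_cons; case: ifP => Pi //.
exact: (@rr_D _ _ (_, _) (_, _) hE (h i Pi) IH).
Qed.

Lemma poly_relB p p' q q' : poly_rel p p' -> poly_rel q q' -> poly_rel (p - q) (p' - q').
Proof. by move=> h h' i; rewrite !coefB; exact: (rr_B hE (h i) (h' i)). Qed.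

Lemma poly_relD p p' q q' : poly_rel p p' -> poly_rel q q' -> poly_rel (p + q) (p' + q').
Proof. by move=> h h' i; rewrite !coefD; exact: (rr_D hE (h i) (h' i)). Qed.

Lemma poly_relM p p' q q' : poly_rel p p' -> poly_rel q q' -> poly_rel (p * q) (p' * q').
Proof.
move=> h h' i; rewrite !coefM; apply: rr_sum => j _.
exact: (rr_M hE (h j) (h' (i - j)%N)).
Qed.

Lemma poly_relC c c' : E (c, c') -> poly_rel c%:P c'%:P.
Proof. by move=> h i; rewrite !coefC; case: eqP => _ //; exact: rr_0. Qed.

Lemma poly_relX : poly_rel 'X 'X.
Proof. by move=> i; rewrite coefX; case: eqP => _; [exact: rr_1|exact: rr_0]. Qed.

Lemma poly_relXn n : poly_rel 'X^n 'X^n.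
Proof. by move=> i; rewrite coefXn; case: eqP => _; [exact: rr_1|exact: rr_0]. Qed.

Lemma poly_relZ c c' p p' : E (c, c') -> poly_rel p p' -> poly_rel (c *: p) (c' *: p').
Proof. by move=> h hp i; rewrite !coefZ; exact: (rr_M hE h (hp i)). Qed.

Lemma poly_rel_horner p p' x x' : poly_rel p p' -> E (x, x') -> E (p.[x], p'.[x']).
Proof.
move=> hp hx; rewrite (horner_coef_wide _ (leq_maxl (size p) (size p'))).
rewrite (horner_coef_wide _ (leq_maxr (size p) (size p'))).
by apply: rr_sum => i _; exact: (rr_M hE (hp i) (rr_X i hE hx)).
Qed.

Lemma poly_rel_comp p p' q q' : poly_rel p p' -> poly_rel q q' -> poly_rel (p \Po q) (p' \Po q').
Proof.
move=> hp hq.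
have hX n : poly_rel (q ^+ n) (q' ^+ n).
  elim: n => [|n IH]; last by rewrite !exprS; exact: poly_relM.
  by rewrite !expr0 -!polyC1; apply: poly_relC; exact: (rr_1 hE).
have E1 (r s : {poly F}) n : (size r <= n)%N -> r \Po s = \sum_(i < n) r`_i *: s ^+ i.
  move=> rn; rewrite comp_polyE.
  rewrite (big_ord_widen n (fun i => r`_i *: s ^+ i)) // big_mkcond /=.
  by apply: eq_bigr => i _; case: ltnP => // h; rewrite nth_default // scale0r.
rewrite (E1 _ q _ (leq_maxl (size p) (size p'))) (E1 _ q' _ (leq_maxr (size p) (size p'))).
move=> i; rewrite !coef_sum; apply: rr_sum => j _.
exact: (poly_relZ (hp j) (hX j)).
Qed.

Lemma poly_rel_derivn p p' n : poly_rel p p' -> poly_rel p^`(n) p'^`(n).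
Proof. by move=> hp i; rewrite !coef_derivn; exact: (rr_Mn _ (hp _)). Qed.

End PolyRel.

Lemma coef_comp_scaleX (F : fieldType) (p : {poly F}) t i : (p \Po (t *: 'X))`_i = p`_i * t ^+ i.
Proof.
rewrite comp_polyE coef_sum.
under eq_bigr => j _ do rewrite exprZn coefZ coefZ coefXn.
have [ip|pi] := ltnP i (size p).
  rewrite (bigD1 (Ordinal ip)) //= eqxx mulr1 big1 ?addr0 // => j ji.
  have -> : (i == j) = false by apply/negbTE; move: ji; rewrite -val_eqE /= eq_sym.
  by rewrite !mulr0.
rewrite nth_default // mul0r big1 // => j _.
by rewrite gtn_eqF ?mulr0 //; exact: leq_trans (ltn_ord j) pi.
Qed.

Lemma derivn_comp_scaleX (F : fieldType) (p : {poly F}) t n :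
  (p \Po (t *: 'X))^`(n) = t ^+ n *: (p^`(n) \Po (t *: 'X)).
Proof.
elim: n => [|n IH]; first by rewrite !derivn0 expr0 scale1r.
rewrite !derivnS IH derivZ deriv_comp derivZ derivX -!scalerAr mulr1.
by rewrite scalerA -exprSr.
Qed.

Lemma derivn_comp_shift (F : fieldType) (p : {poly F}) a n :
  (p \Po ('X + a%:P))^`(n) = p^`(n) \Po ('X + a%:P).
Proof.
elim: n => [|n IH] //.
by rewrite !derivnS IH deriv_comp derivD derivX derivC addr0 mulr1.
Qed.

Section Collision.
Variable M : valuedField.
Notation K := (vK M).
Hypothesis Mhens : henselian M.
Hypothesis Mchar : [pchar (vk M)] =i pred0.

Lemma max_term I (r : seq I) (f : I -> K) i0 : List.In i0 r -> f i0 != 0 ->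
  exists j, [/\ List.In j r, f j != 0 & forall i, List.In i r -> integral (f i / f j)].
Proof.
have main (l : seq I) j0 : f j0 != 0 ->
   exists j, [/\ j = j0 \/ List.In j l, f j != 0, integral (f j0 / f j) &
     forall i, List.In i l -> integral (f i / f j)].
  elim: l j0 => [|i l IH] j0 f0.
    by exists j0; split=> //; [left|rewrite divff //; exact: integral1].
  have [h|h] : integral (f i / f j0) \/ (f i != 0 /\ integral (f j0 / f i)).
    have [fi|fi] := eqVneq (f i) 0; first by left; rewrite fi mul0r; exact: integral0.
    have [h|h] := integral_total (mulf_neq0 fi (invr_neq0 f0)); first by left.
    by right; split=> //; rewrite -invf_div; exact: small_integral.
  - have [j [h1 h2 h3 h4]] := IH j0 f0; exists j; split=> //; first by case: h1 => [->|h1]; [left|right; right].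
    move=> k /= [<-|/h4//].
    have -> : f i / f j = (f i / f j0) * (f j0 / f j) by field; rewrite f0 h2.
    exact: integralM.
  - have [fi h'] := h; have [j [h1 h2 h3 h4]] := IH i fi; exists j; split=> //.
    + by right; case: h1 => [->|]; [left|right].
    + have -> : f j0 / f j = (f j0 / f i) * (f i / f j) by field; rewrite fi h2.
      exact: integralM.
    + by move=> k /= [<-|/h4//].
move=> hr f0; have [j [h1 h2 h3 h4]] := main r i0 f0.
by exists j; split=> //; case: h1 => [->|].
Qed.

(** The argument t becomes 1, and with [e] a dominant term of c at t the coefficients become
    integral, one of them being 1. Hensel's lemma is then applied at 1. *)
Definition scaled (c : {poly K}) (t e : K) : {poly K} := e^-1 *: (c \Po (t *: 'X)).

Lemma coef_scaled c t e i : (scaled c t e)`_i = c`_i * t ^+ i / e.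
Proof. by rewrite coefZ coef_comp_scaleX mulrC. Qed.

Lemma derivn_scaled c t e n x : (scaled c t e)^`(n).[x] = t ^+ n * c^`(n).[t * x] / e.
Proof. by rewrite derivnZ derivn_comp_scaleX !hornerZ horner_comp hornerZ hornerX mulrC. Qed.

Lemma dominant_term (c : {poly K}) t : c != 0 -> t != 0 -> exists j, c`_j != 0 /\
  forall i, integral (scaled c t (c`_j * t ^+ j))`_i.
Proof.
move=> c0 t0; have c00 : c`_(size c).-1 * t ^+ (size c).-1 != 0.
  by rewrite mulf_neq0 ?expf_neq0 // -lead_coefE lead_coef_eq0.
have cin i : (i < size c)%N -> List.In i (iota 0 (size c)).
  by move=> h; rewrite In_mem mem_iota.
have [|j [jr cj hj]] := @max_term _ (iota 0 (size c)) (fun i => c`_i * t ^+ i) (size c).-1 _ c00.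
  by apply: cin; rewrite prednK // size_poly_gt0.
exists j; split; first by move: cj; rewrite mulf_eq0 negb_or => /andP[].
move=> i; rewrite coef_scaled; have [ic|ci] := ltnP i (size c); first exact/hj/cin.
by rewrite nth_default // !mul0r; exact: integral0.
Qed.

(** [m] is the multiplicity of 1 as a root of the nonzero reduction of [q]. It exists in residue
    characteristic zero: if n is the largest index of a unit coefficient, the n-th derivative
    reduces to the nonzero constant n! q_n. *)
Lemma unit_derivative (q : {poly K}) : (forall i, integral q`_i) -> (exists j, q`_j = 1) ->
  exists m, unit_el q^`(m).[1] /\ forall l, (l < m)%N -> small_el q^`(l).[1].
Proof.
move=> qi [j qj].
have iq l : integral q^`(l).[1].
  rewrite horner_coef; apply: integral_sum => i _; rewrite expr1n mulr1 coef_derivn -mulr_natr.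
  by apply: integralM => //; exact: (res_nat _ _).2.
have exu : exists m, `[< unit_el q^`(m).[1] >].
  have exj : exists i, `[< unit_el q`_i >].
    by exists j; apply/asboolP; rewrite qj; exact: unit1.
  have bnd i : `[< unit_el q`_i >] -> (i <= size q)%N.
    move=> /asboolP u; rewrite leqNgt; apply/negP => h.
    move: u; rewrite nth_default ?(ltnW h) // => /unit_elP[]; by rewrite eqxx.
  case: (ex_maxnP exj bnd) => n /asboolP un nmax.
  exists n; apply/asboolP; rewrite horner_coef.
  have qn0 : (0 < size q^`(n))%N.
    rewrite size_poly_gt0; apply/eqP => /(congr1 (fun p : {poly K} => p`_0)).
    rewrite coef_derivn addn0 ffactnn coef0 -mulr_natr => /eqP.
    have [h1 _] := (unit_elP _).1 un.
    have [h2 _] := (unit_elP _).1 (unit_nat Mchar (fact_gt0 n)).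
    by rewrite mulf_eq0 (negPf h1) (negPf h2).
  have uf : unit_el (q^`(n)`_0) .
    rewrite coef_derivn addn0 ffactnn -mulr_natr; apply: unitM => //.
    exact: unit_nat (fact_gt0 n).
  rewrite (bigD1 (Ordinal qn0)) //= expr0 mulr1.
  have sr : small_el (\sum_(i < size q^`(n) | i != Ordinal qn0) (q^`(n))`_i * 1 ^+ i).
    apply: small_sum_el => i i0; rewrite expr1n mulr1 coef_derivn -mulr_natr.
    apply: smallMl; last exact: (res_nat _ _).2.
    have [//|u] := integral_cases (qi (n + i)%N).
    have := nmax (n + i)%N (asboolT u).
    rewrite -[X in (_ <= X)%N]addn0 leq_add2l leqn0 => /eqP i00.
    by move: i0; rewrite -val_eqE /= i00.
  set S := \sum_(i < _ | _) _ in sr *.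
  have iS := small_integral sr; have i0 := unit_integral uf.
  apply/res_unit; first exact: integralD.
  rewrite resD // (res_eq0 iS).2 // addr0; exact/res_unit.
case: (ex_minnP exu) => m /asboolP um mmin; exists m; split=> // l lm.
have [//|u] := integral_cases (iq l).
by have := mmin l (asboolT u); rewrite leqNgt lm.
Qed.

(** Hensel's lemma at 1 for the m-th derivative of the rescaled polynomial. Back on the original
    scale the root t b is closer to t than 0 is. *)
Lemma hensel_closer (c : {poly K}) t e m : t != 0 -> e != 0 ->
  (forall i, integral (scaled c t e)`_i) ->
  unit_el (scaled c t e)^`(m.+1).[1] -> small_el (scaled c t e)^`(m).[1] ->
  c^`(m) != 0 /\ exists b, root c^`(m) (t * b) /\ small_el (b - 1).
Proof.
move=> t0 e0 qi um sm; split.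
  apply: contraPneq um => c0; rewrite derivn_scaled derivnS c0 linear0 horner0 mulr0 mul0r.
  by move=> /unit_elP[]; rewrite eqxx.
have [||//||b [_ rb sb]] := Mhens (p := (scaled c t e)^`(m)) (a := 1).
- move=> i; rewrite coef_derivn -mulr_natr /valring; apply: integralM => //.
  exact: (res_nat _ _).2.
- exact: integral1.
- by rewrite -derivnS; exact: um.
exists b; split=> //.
move: rb; rewrite !rootE derivn_scaled !mulf_eq0 invr_eq0 (negPf e0) orbF.
by rewrite (negPf (expf_neq0 _ t0)).
Qed.

End Collision.

Section FSystem.
Variable M : valuedField.
Notation MM := (vf_struct M).
Notation K := (vK M).
Variables (A : set K) (U : Type) (D : set U).
Hypothesis Dinf : injects [set: nat] D.
Hypothesis Msat : saturated MM D.
Hypothesis Asub : subfield A.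
Hypothesis Asm : injects A D.
Hypothesis Mhens : henselian M.
Hypothesis Mchar : [pchar (vk M)] =i pred0.
Hypothesis Acosets : forall n (x : K), (0 < n)%N -> x != 0 ->
  exists a y, [/\ A a, a != 0 & x = a * y ^+ n].
Hypothesis Aunits : forall n (x : K), (0 < n)%N -> unit_el x ->
  exists a y, [/\ A a, unit_el a, unit_el y & vres a = vres x * vres y ^+ n].

Lemma closed_hull (S : set K) : injects S D ->
  exists L, [/\ S `<=` L, injects L D & closed_field A L].
Proof.
move=> Ssm.
have [rts rtsP] : exists rts : {poly K} -> seq K, forall p, p != 0 -> forall x, root p x -> x \in rts p.
  have h (p : {poly K}) : exists rs : seq K, p != 0 -> forall x, root p x -> x \in rs.
    have [->|/poly_roots_list[rs hrs]] := eqVneq p 0; first by exists [::].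
    by exists rs.
  by have [f hf] := choice h; exists f.
have [t tP] : exists t : nat * K -> K, forall n x, (0 < n)%N -> x != 0 ->
    exists a, [/\ A a, a != 0 & x = a * t (n, x) ^+ n].
  have h (p : nat * K) : exists y, (0 < p.1)%N -> p.2 != 0 -> exists a, [/\ A a, a != 0 & p.2 = a * y ^+ p.1].
    have [[n0 x0]|n] := pselect ((0 < p.1)%N /\ p.2 != 0).
      by have [a [y ?]] := Acosets n0 x0; exists y => _ _; exists a.
    by exists 0 => n0 x0; case: n.
  by have [f hf] := choice h; exists f => n x; exact: (hf (n, x)).
have [d dP] : exists d : nat * K -> K, forall n x, (0 < n)%N -> unit_el x ->
    exists a, [/\ A a, unit_el a, unit_el (d (n, x)) & vres a = vres x * vres (d (n, x)) ^+ n].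
  have h (p : nat * K) : exists y, (0 < p.1)%N -> unit_el p.2 ->
      exists a, [/\ A a, unit_el a, unit_el y & vres a = vres p.2 * vres y ^+ p.1].
    have [[n0 x0]|n] := pselect ((0 < p.1)%N /\ unit_el p.2).
      by have [a [y ?]] := Aunits n0 x0; exists y => _ _; exists a.
    by exists 0 => n0 x0; case: n.
  by have [f hf] := choice h; exists f => n x; exact: (hf (n, x)).
(* Codes 0 to 3 are the field operations. Beyond them the code modulo 3 selects a root of the
   polynomial with coefficients [s], a witness for power cosets in K, or one for residues; the
   quotient by 3 is the index of the root or the exponent. *)
pose op (n : nat) (s : seq K) : K := match n with
  | 0%N => nth 0 s 0 - nth 0 s 1
  | 1%N => nth 0 s 0 * nth 0 s 1
  | 2%N => (nth 0 s 0)^-1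
  | 3%N => 1
  | k.+4 => match (k %% 3)%N with
            | 0%N => nth 0 (rts (Poly s)) (k %/ 3)
            | 1%N => t ((k %/ 3)%N, nth 0 s 0)
            | _ => d ((k %/ 3)%N, nth 0 s 0) end end.
pose L := [set x | hull_mem op (A `|` S) x].
have L2 n x y : L x -> L y -> L (op n [:: x; y]).
  by move=> hx hy; apply: HullOp => z /= [<-|[<-|]].
have L1 n x : L x -> L (op n [:: x]) by move=> hx; apply: HullOp => z /= [<-|].
have LA : A `<=` L by move=> a Aa; apply: HullBase; left.
have k3 n i : (i < 3)%N -> ((n * 3 + i) %% 3 = i)%N /\ ((n * 3 + i) %/ 3 = n)%N.
  by move=> i3; rewrite modnMDl divnMDl // modn_small // divn_small // addn0.
exists L; split.
- by move=> x Sx; apply: HullBase; right.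
- by apply: small_hull => //; exact: small_union.
split=> //.
- by apply: (@HullOp _ op _ 3%N [::]).
- by move=> x y; exact: (L2 0%N).
- by move=> x y; exact: (L2 1%N).
- by move=> x; exact: (L1 2%N).
- move=> p x p0 pL px; have xr := rtsP p p0 x px.
  have [h1 h2] := k3 (index x (rts p)) 0%N isT.
  have := @HullOp _ op (A `|` S) (index x (rts p) * 3 + 0).+4 p.
  rewrite /op h1 h2 polyseqK nth_index //; apply=> c /In_mem /(nthP 0)[i _ <-]; exact: pL.
- move=> n x n0 Lx x0; have [a [Aa a0 e]] := tP n x n0 x0.
  exists a, (t (n, x)); split=> //.
  have [h1 h2] := k3 n 1%N isT.
  by have := L1 (n * 3 + 1).+4 x Lx; rewrite /op h1 h2.
- move=> n x n0 Lx ux; have [a [Aa ua ud e]] := dP n x n0 ux.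
  exists a, (d (n, x)); split=> //.
  have [h1 h2] := k3 n 2%N isT.
  by have := L1 (n * 3 + 2).+4 x Lx; rewrite /op h1 h2.
Qed.

Record fsys (F G : set (K * K)) : Prop := FSys {
  fs_A : forall a, A a -> F (a, a);
  fs_B : forall p q, F p -> F q -> F (p.1 - q.1, p.2 - q.2);
  fs_M : forall p q, F p -> F q -> F (p.1 * q.1, p.2 * q.2);
  fs_V : forall p, F p -> F (p.1^-1, p.2^-1);
  fs_G : forall p, F p -> p.1 != 0 -> G p;
  fs_0 : forall p, F p -> p.1 = 0 -> p.2 = 0 }.

Lemma fsys_ring F G : fsys F G -> ring_rel F.
Proof.
move=> h; split; [exact/(fs_A h)/(A1 Asub)|exact: fs_B h|exact: fs_M h].
Qed.

Lemma fs_fun F G x y y' : fsys F G -> F (x, y) -> F (x, y') -> y = y'.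
Proof.
move=> h h1 h2; apply/eqP; rewrite -subr_eq0; apply/eqP.
by have := fs_0 h (fs_B h h1 h2); apply; rewrite /= subrr.
Qed.

Section Step.
Variables (F G : set (K * K)) (Ek : set (vk M * vk M)) (EG : set (vG M * vG M)) (L : set K).
Hypotheses (hF : fsys F G) (hG : gsys A G Ek EG) (hEk : ring_rel Ek) (hEG : group_rel EG).
Hypotheses (elk : elem_k Ek) (elG : elem_G EG).
Hypotheses (hL : closed_field A L) (Ldom : forall x, L x -> x != 0 -> exists x', G (x, x')).
Hypothesis FL : forall p, F p -> L p.1.

Let dom x := exists x', F (x, x').

Definition res_rel : set (K * K) :=
  [set p | [/\ integral p.1, integral p.2 & Ek (vres p.1, vres p.2)]].

Lemma res_rel_ring : ring_rel res_rel.
Proof.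
split; rewrite /res_rel.
- split; [exact: integral1|exact: integral1|by rewrite /= res1; exact: (rr_1 hEk)].
- move=> p q [p1 p2 hp] [q1 q2 hq]; split; [exact: integralB|exact: integralB|rewrite /=].
  by rewrite !resB //; exact: (rr_B hEk hp hq).
- move=> p q [p1 p2 hp] [q1 q2 hq]; split; [exact: integralM|exact: integralM|rewrite /=].
  by rewrite !resM //; exact: (rr_M hEk hp hq).
Qed.

Lemma gs_integral p : G p -> integral p.1 -> res_rel p.
Proof.
move=> Gp i1; have [p1 p2] := gs_nz hG Gp; have Gv := gs_v hG Gp.
have h1 : v p.1 <= 0.
  by case/integralP: i1 => // e; rewrite e eqxx in p1.
have h2 : v p.2 <= 0 by rewrite -(elem_G_le elG Gv hEG.1).
have i2 : integral p.2 by apply/integralP; right.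
split=> //; have [s1|u1] := integral_cases i1.
  have [s2|u2] := integral_cases i2.
    by rewrite (res_eq0 i1).2 // (res_eq0 i2).2 //; exact: (rr_0 hEk).
  have [_ v2] := (unit_elP p.2).1 u2.
  have v1' : v p.1 = 0 by apply: (elem_G_eq elG Gv hEG.1).2.
  by exfalso; apply: (unit_not_small _ s1); apply/unit_elP.
by apply: (gs_k hG Gp); case/unit_elP: u1.
Qed.

Lemma res_rel_unit p : res_rel p -> unit_el p.1 <-> unit_el p.2.
Proof.
move=> [i1 i2 e]; have E := elem_k_eq elk e (rr_0 hEk).
have H1 := res_unit i1; have H2 := res_unit i2.
rewrite H1 H2; split=> /eqP h; apply/eqP => h'; apply: h; exact/E.
Qed.

Lemma res_rel_near p q : G p -> G q -> unit_el (p.1 / q.1) ->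
  forall x x', res_rel (x, x') -> p.1 = q.1 * x -> G (p.1, q.2 * x').
Proof.
move=> Gp Gq u x x' [ix ix' ex] e.
have [p1 p2] := gs_nz hG Gp; have [q1 q2] := gs_nz hG Gq.
have xE : p.1 / q.1 = x by rewrite e mulrAC divff // mul1r.
have Gd := gs_div hG Gp Gq; rewrite /= xE in Gd; rewrite xE in u.
have vx := ((unit_elP x).1 u).2.
have [_ iy ey] := gs_integral Gd ix.
have rr : vres (p.2 / q.2) = vres x' by apply: (elem_k_eq elk ey ex).1.
have uy : unit_el (p.2 / q.2) by apply/(@res_rel_unit (x, p.2 / q.2)); [split|].
have ux' : unit_el x' by apply/(@res_rel_unit (x, x')); [split|].
have n1 : near (p.2 / q.2) x' by apply/near_res.
apply: (gs_near hG (x := p.1) (x' := p.2)) => //; first by case: (p) Gp.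
  exact: near_refl.
by have := nearM (near_refl q2) n1; rewrite mulrCA divff // mulr1.
Qed.

(** The Taylor coefficients at [a] and [a'] correspond under F and their leading terms under G, so
    after division by corresponding dominant terms the two polynomials have corresponding
    residues. *)
Lemma taylor_pair (p p' : {poly K}) a a' t t' : poly_rel F p p' -> F (a, a') -> G (t, t') ->
  L t -> p != 0 ->
  exists e e' q q', [/\ G (e, e'), L e, poly_rel res_rel q q', (exists j, q`_j = 1) &
   [/\ q = scaled (p \Po ('X + a%:P)) t e, q' = scaled (p' \Po ('X + a'%:P)) t' e',
      (forall i, integral q`_i), (forall i, integral q'`_i) & e != 0 /\ e' != 0]].
Proof.
move=> pp aa tt Lt p0.
pose c := p \Po ('X + a%:P); pose c' := p' \Po ('X + a'%:P).
have rF := fsys_ring hF.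
have cc : poly_rel F c c'.
  apply: poly_rel_comp => //; apply: poly_relD => //; [exact: poly_relX|exact: poly_relC].
have [t0 t0'] := gs_nz hG tt.
have c0 : c != 0.
  apply: contra_neq p0 => c0.
  have := congr1 (fun r => r \Po ('X - a%:P)) c0.
  by rewrite /c -comp_polyA comp_polyD comp_polyX comp_polyC subrK comp_polyXr comp_poly0.
have [j [cj hj]] := dominant_term c0 t0.
have Gt i : G (t ^+ i, t' ^+ i) by exact: (gs_Xz i hG tt).
have Gc i : c`_i != 0 -> G (c`_i * t ^+ i, c'`_i * t' ^+ i).
  by move=> h; exact: (gs_M hG (fs_G hF (cc i) h) (Gt i)).
pose e := c`_j * t ^+ j; pose e' := c'`_j * t' ^+ j.
have Ge : G (e, e') by exact: Gc.
have [e0 e0'] := gs_nz hG Ge.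
have qq : poly_rel res_rel (scaled c t e) (scaled c' t' e').
  move=> i; rewrite !coef_scaled; have [ci|ci] := eqVneq c`_i 0.
    have ci' : c'`_i = 0 by exact: (fs_0 hF (cc i)).
    rewrite ci ci' !mul0r; split; [exact: integral0|exact: integral0|by rewrite !res0; exact: (rr_0 hEk)].
  apply: gs_integral; first exact: (gs_div hG (Gc i ci) Ge).
  by have := hj i; rewrite coef_scaled.
exists e, e', (scaled c t e), (scaled c' t' e'); split=> //.
- by apply: (cf_M hL); [exact: (FL (cc j))|exact: (cf_Xz j hL)].
- by exists j; rewrite coef_scaled divff.
- by split=> // i; case: (qq i).
Qed.

Lemma scaled1 (p : {poly K}) a t e : (scaled (p \Po ('X + a%:P)) t e).[1] = p.[a + t] / e.
Proof.
rewrite /scaled hornerZ !horner_comp !hornerE mulrC; congr (p.[_] / e).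
by rewrite addrC.
Qed.

(* [a] is the closest to [y] of the roots of derivatives of the given
   polynomials, so no cancellation occurs in their Taylor expansions at [a]. *)
Lemma no_collision (y : K) (N : nat) (Ps : seq ({poly K} * {poly K})) (mu mu' : {poly K}) :
  L y -> ~ dom y ->
  (forall p : {poly K}, p != 0 -> (forall i, dom p`_i) -> (size p < N)%N ->
     forall z, root p z -> dom z) ->
  (forall q, List.In q Ps -> poly_rel F q.1 q.2 /\ (size q.1 < N)%N) ->
  poly_rel F mu mu' -> (size mu <= N)%N ->
  exists a a' t', [/\ F (a, a'), G (y - a, t'),
    (forall s, G (y - a, s) -> forall q, List.In q Ps -> q.1 != 0 ->
      G (q.1.[y], q.2.[a' + s])) &
    (mu != 0 -> mu.[y] = 0 -> exists2 s, G (y - a, s) & mu'.[a' + s] = 0)].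
Proof.
move=> Ly ndy rdom PsP mm muN.
have rF := fsys_ring hF.
have F0 : F (0, 0) := rr_0 rF.
have sder (p : {poly K}) l : (size p^`(l) <= size p - l)%N.
  apply/leq_sizeP => i h; rewrite coef_derivn nth_default ?mul0rn //.
  by rewrite -leq_subLR.
have [rng rngP] : exists rng : seq nat, forall l, (l <= N)%N -> List.In l rng.
  by exists (iota 0 N.+1) => l lN; rewrite In_mem mem_iota.
pose cand : seq {poly K} :=
  flatten [seq [seq q.1^`(l) | l <- rng] | q <- Ps] ++ [seq mu^`(l.+1) | l <- rng].
have candP r : List.In r cand -> r != 0 -> (forall i, dom r`_i) /\ (size r < N)%N.
  rewrite /cand In_cat => -[|].
    elim: (Ps) PsP => //= q Qs IH QsP; rewrite In_cat => -[|]; last first.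
      by move=> rin r0; apply: (IH _ rin r0) => q' h; apply: QsP; right.
    rewrite In_map => -[l _ <-] _; have [h1 h2] := QsP q (or_introl erefl).
    split=> [i|]; last exact: leq_ltn_trans (leq_trans (sder _ _) (leq_subr _ _)) h2.
    by exists (q.2^`(l)`_i); exact: poly_rel_derivn.
  rewrite In_map => -[l _ <-] r0; split=> [i|].
    by exists (mu'^`(l.+1)`_i); exact: poly_rel_derivn.
  rewrite -size_poly_gt0 in r0; apply: leq_trans muN.
  have := leq_trans r0 (sder mu l.+1); rewrite subn_gt0 => h.
  apply: leq_ltn_trans (sder _ _) _; rewrite ltn_subrL /= .
  exact: leq_ltn_trans h.
have [zs zsP] : exists zs : seq K, (forall z, List.In z zs -> dom z) /\
    forall r z, List.In r cand -> r != 0 -> root r z -> List.In z zs.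
  elim: cand candP => [|r cs IH] csP; first by exists [::].
  have [zs [h1 h2]] := IH (fun r' h => csP r' (or_intror h)).
  have [->|r0] := eqVneq r 0.
    by exists zs; split=> // r' z /= [<-|/h2]; [rewrite eqxx|exact].
  have [rs hrs] := poly_roots_list r0.
  exists (seq.filter (root r) rs ++ zs); split.
    move=> z; rewrite In_cat In_filter => -[[_ rz]|/h1//].
    by have [c1 c2] := csP r (or_introl erefl) r0; exact: rdom rz.
  move=> r' z /= [<-|h] r'0 rz; rewrite In_cat; last by right; exact: h2 h r'0 rz.
  by left; rewrite In_filter; split=> //; apply/In_mem; exact: hrs.
have ny z : dom z -> y - z != 0.
  by move=> dz; rewrite subr_eq0; apply/eqP => e; apply: ndy; rewrite e.
have d0 : dom 0 by exists 0.
(* A largest inverse distance to y selects a closest point; 0 is added so that the list is not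
   empty. *)
have [a [az ya hz]] := @max_term M _ (0 :: zs) (fun z => (y - z)^-1) 0 (or_introl erefl) (invr_neq0 (ny 0 d0)).
have [a' aa] : dom a by case: az => [<-//|/zsP.1].
have t0 : y - a != 0 by apply: ny; exists a'.
have La : L a by exact: (FL aa).
have Lt : L (y - a) by exact: (cf_B hL).
have [t' Gt] := Ldom Lt t0.
(* With b in 1 + M such a root would be strictly closer to y than [a]. *)
have closest r b : List.In r cand -> root r (a + (y - a) * b) -> r != 0 -> ~ small_el (b - 1).
  move=> rc rb r0 sb; set z := a + (y - a) * b in rb.
  have zz := zsP.2 r z rc r0 rb.
  have yz : y - z != 0 by apply/ny/zsP.1.
  have e : y - z = - (b - 1) * (y - a) by rewrite /z; ring.
  have b1 : b - 1 != 0 by apply: contra_neq yz => b1; rewrite e b1 oppr0 mul0r.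
  have := hz z (or_intror zz); rewrite invrK => iz.
  apply: (unit_not_small (unit1 M)).
  rewrite (_ : 1 = ((y - z)^-1 * (y - a)) * - (b - 1)).
    by apply: smallM => //; exact: smallN.
  by rewrite e; rewrite -mulrA (mulrC (y - a)) mulVf // mulf_neq0 // oppr_eq0.
have root_shift (p : {poly K}) l x : root (p \Po ('X + a%:P))^`(l) x = root p^`(l) (a + x).
  by rewrite derivn_comp_shift !rootE horner_comp !hornerE (addrC x).
have LE : ring_rel [set p : K * K | L p.1].
  by split=> /=; [exact: (cf_1 hL)|move=> p q; exact: (cf_B hL)|move=> p q; exact: (cf_M hL)].
have Lhorner (p p' : {poly K}) : poly_rel F p p' -> L p.[y].
  move=> pp; have h : poly_rel [set p : K * K | L p.1] p p' by move=> i; exact: (FL (pp i)).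
  exact: (poly_rel_horner LE h (x := y) (x' := y) Ly).
have yE : a + (y - a) = y by rewrite addrC subrK.
exists a, a', t'; split=> //.
- move=> s Gs q qP q0; have [pp sq] := PsP q qP.
  have [e [e' [r [r' [Ge Le rr rj [rE r'E ri r'i [e0 e0']]]]]]] := taylor_pair pp aa Gs Lt q0.
  have [m [um smin]] := unit_derivative Mchar ri rj.
  (* For m = 0 the rescaled value r(1) is a unit, and the leading term of [q.1.[y]] is that of e
     r(1), known on both sides. For m > 0 [hensel_closer] yields a root of a derivative closer to y
     than [a]. *)
  have [m0|[l ml]] : m = 0%N \/ exists l, m = l.+1 by case: (m) => [|l]; [left|right; exists l].
    rewrite m0 derivn0 in um.
    have rr1 := poly_rel_horner res_rel_ring rr (rr_1 res_rel_ring).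
    have E1 : q.1.[y] = e * r.[1] by rewrite rE scaled1 yE mulrC divfK.
    have E2 : q.2.[a' + s] = e' * r'.[1] by rewrite r'E scaled1 mulrC divfK.
    have y0 : q.1.[y] != 0 by rewrite E1 mulf_neq0 //; case/unit_elP: um.
    have [s0 Gs0] := Ldom (Lhorner _ _ pp) y0.
    rewrite E2; apply: (@res_rel_near (q.1.[y], s0) (e, e') Gs0 Ge _ r.[1] r'.[1] rr1 E1).
    by rewrite /= E1 mulrAC divff // mul1r.
  exfalso; rewrite ml in um smin; rewrite rE in ri um smin.
  have [c0 [b [rb sb]]] := hensel_closer Mhens t0 e0 ri um (smin l (ltnSn l)).
  rewrite root_shift in rb; apply: (closest q.1^`(l)) rb _ sb.
    rewrite /cand In_cat; left; have lN : (l <= N)%N.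
      rewrite leqNgt; apply/negP => Nl.
      move: c0; rewrite derivn_comp_shift derivn_poly0 ?comp_poly0 ?eqxx //.
      exact: ltnW (ltn_trans sq Nl).
    elim: (Ps) qP {PsP} => //= q' Qs IH [->|/IH h]; rewrite In_cat; last by right.
    by left; rewrite In_map; exists l => //; exact: rngP.
  by apply: contra_neq c0; rewrite derivn_comp_shift => ->; rewrite comp_poly0.
- move=> mu0 muy.
  have [e [e' [r [r' [Ge Le rr rj [rE r'E ri r'i [e0 e0']]]]]]] := taylor_pair mm aa Gt Lt mu0.
  have [m [um smin]] := unit_derivative Mchar ri rj.
  have r1 : r.[1] = 0 by rewrite rE scaled1 yE muy mul0r.
  have t'0 := (gs_nz hG Gt).2; rewrite /= in t'0.
  have [m0|[l ml]] : m = 0%N \/ exists l, m = l.+1 by case: (m) => [|l]; [left|right; exists l].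
    by exfalso; move: um; rewrite m0 derivn0 r1 => /unit_elP[]; rewrite eqxx.
  (* For l = 0 the point 1 is a simple root of the reduction, on the other side too, and Hensel's
     lemma provides the root of [mu']. For l > 0 a proper derivative of [mu] has a root too close to
     y. *)
  have [l0|[k lk]] : l = 0%N \/ exists k, l = k.+1 by case: (l) => [|k]; [left|right; exists k].
    have rr1 := poly_rel_horner res_rel_ring rr (rr_1 res_rel_ring).
    have rr2 := poly_rel_horner res_rel_ring (poly_rel_derivn res_rel_ring 1 rr) (rr_1 res_rel_ring).
    rewrite ml l0 in um.
    have um' : unit_el r'^`(1).[1] by apply/(res_rel_unit rr2).
    have sm' : small_el r'^`(0).[1].
      have [_ i' _] := rr1; rewrite derivn0; have [//|u] := integral_cases i'.
      have : unit_el r.[1] by apply/(res_rel_unit rr1).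
      by rewrite r1 => /unit_elP[]; rewrite eqxx.
    rewrite r'E in um' sm' r'i.
    have [c0 [b [rb sb]]] := hensel_closer Mhens t'0 e0' r'i um' sm'.
    exists (t' * b).
      apply: (gs_near hG Gt); first exact: near_refl.
      exact/near_sym/near_mulr.
    by move: rb; rewrite derivn0 rootE horner_comp !hornerE addrC => /eqP.
  exfalso; rewrite ml in um smin; rewrite rE in ri um smin.
  have [c0 [b [rb sb]]] := hensel_closer Mhens t0 e0 ri um (smin l (ltnSn l)).
  rewrite root_shift in rb; apply: (closest mu^`(l)) rb _ sb.
    rewrite /cand In_cat; right; rewrite In_map; exists k; last by rewrite lk.
    apply: rngP; rewrite leqNgt; apply/negP => Nl.
    move: c0; rewrite derivn_comp_shift derivn_poly0 ?comp_poly0 ?eqxx // lk.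
    exact: leq_trans muN (leq_trans (ltnW Nl) (leqnSn k)).
  by apply: contra_neq c0; rewrite derivn_comp_shift => ->; rewrite comp_poly0.
Qed.

Lemma gs_fun x x' x'' : G (x, x') -> G (x, x'') -> near x' x''.
Proof.
move=> h1 h2; have [x0 x0'] := gs_nz hG h1; have [_ x0''] := gs_nz hG h2.
have := gs_div hG h1 h2; rewrite /= in x0 x0' x0'' *; rewrite divff // => Gd.
have [i1 i2 e] := gs_integral Gd (integral1 M).
rewrite /= res1 in e i2; split=> //; apply/(res_near1 i2).
by apply/esym; apply: (elem_k_eq elk (rr_1 hEk) e).1.
Qed.

Lemma small_graph : injects L D -> injects F D.
Proof.
move=> [f [fD fi]]; exists (fun p => f p.1); split=> [p /FL/fD //|[x x'] [y y'] hx hy /=].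
move=> /(fi _ _ (FL hx) (FL hy)) /= e; rewrite -e in hy *.
by rewrite (fs_fun hF hx hy).
Qed.

(** Saturation: membership in G with a given first component only fixes the leading term of the
    second, so each condition on z is definable. *)
Lemma realize_pairs (y : K) (B : set ({poly K} * {poly K})) :
  injects L D -> L y -> (forall q, B q -> poly_rel F q.1 q.2) ->
  (forall l, (forall q, List.In q l -> B q) -> exists z, forall q, List.In q l ->
     (q.1.[y] = 0 -> q.2.[z] = 0) /\ (q.1.[y] != 0 -> G (q.1.[y], q.2.[z]))) ->
  exists y', forall q, B q ->
     (q.1.[y] = 0 -> q.2.[y'] = 0) /\ (q.1.[y] != 0 -> G (q.1.[y], q.2.[y'])).
Proof.
move=> Lsm Ly BF fin.
have LE : ring_rel [set p : K * K | L p.1].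
  by split=> /=; [exact: (cf_1 hL)|move=> p q; exact: (cf_B hL)|move=> p q; exact: (cf_M hL)].
have Lh q : B q -> L q.1.[y].
  move=> /BF pp; have h : poly_rel [set p : K * K | L p.1] q.1 q.2 by move=> i; exact: (FL (pp i)).
  exact: (poly_rel_horner LE h (x := y) (x' := y) Ly).
have [|||z hz] := @saturated_definable M U D {q | B q}
   (fun q z => ((sval q).1.[y] = 0 -> (sval q).2.[z] = 0) /\
               ((sval q).1.[y] != 0 -> G ((sval q).1.[y], (sval q).2.[z]))) Dinf Msat.
- apply: small_sig.
  pose f (s : seq (K * K)) := (Poly (map fst s), Poly (map snd s)).
  apply: (@small_sub _ _ _ _ (f @` [set s : seq (K * K) | forall x, List.In x s -> F x])).
    move=> [p p'] /BF /= pp.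
    have coefE (r : {poly K}) n (g : K * K -> K) : (size r <= n)%N ->
        (forall i, g (p`_i, p'`_i) = r`_i) ->
        Poly (map g [seq (p`_i, p'`_i) | i <- iota 0 n]) = r.
      move=> rn gr; apply/polyP => i; rewrite coef_Poly -map_comp.
      have [ilt|ige] := ltnP i n.
        by rewrite (nth_map 0%N) ?size_iota //= nth_iota // add0n gr.
      by rewrite !nth_default // ?size_map ?size_iota //; exact: leq_trans ige.
    exists [seq (p`_i, p'`_i) | i <- iota 0 (maxn (size p) (size p'))].
      by move=> x /In_map[i _ <-]; exact: pp.
    by rewrite /f (coefE p) ?leq_maxl // (coefE p') ?leq_maxr.
  by apply: small_image => //; apply: small_seq => //; exact: small_graph.
- move=> [q Bq] /=; have [q0|q0] := eqVneq q.1.[y] 0.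
    have [W [w [p [h1 h2]]]] := definable_poly q.2 (definable_zero M).
    by exists W, w, p; split=> // x; rewrite h2; split=> [h|[h _]]; [split|exact: h].
  have [s hs] := Ldom (Lh q Bq) q0.
  have [W [w [p [h1 h2]]]] := definable_poly q.2 (definable_near s).
  exists W, w, p; split=> // x; rewrite h2; split=> [h|[_ h]].
    split=> [e|_]; first by rewrite e eqxx in q0.
    by apply: (gs_near hG hs (near_refl q0)); exact: near_sym.
  by apply: gs_fun hs; exact: h.
- move=> l; have [|z hz] := fin (map sval l); first by move=> q /In_map[q' _ <-]; exact: svalP.
  by exists z => q ql; apply: hz; rewrite In_map; exists q.
by exists z => q Bq; exact: (hz (exist _ q Bq)).
Qed.

(** The new graph sends p(y) / r(y) to p'(y') / r'(y'); the hypothesis on zeros and leading terms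
    makes it a partial isomorphism compatible with G. *)
Lemma extend_by_evaluation (y y' : K) : L y ->
  (forall p p', poly_rel F p p' -> (p.[y] = 0 -> p'.[y'] = 0) /\ (p.[y] != 0 -> G (p.[y], p'.[y']))) ->
  exists F1, [/\ F `<=` F1, fsys F1 G, forall p, F1 p -> L p.1 & F1 (y, y')].
Proof.
move=> Ly H; have rF := fsys_ring hF.
pose F1 : set (K * K) := [set s | exists p p' r r', [/\ poly_rel F p p', poly_rel F r r', r.[y] != 0 &
  s = (p.[y] / r.[y], p'.[y'] / r'.[y'])]].
have nz r r' : poly_rel F r r' -> r.[y] != 0 -> r'.[y'] != 0.
  by move=> rr r0; have := (H r r' rr).2 r0 => /(gs_nz hG)[].
have one : poly_rel F 1%:P 1%:P := poly_relC rF (rr_1 rF).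
have n1 : (1%:P : {poly K}).[y] != 0 by rewrite hornerC oner_neq0.
have FF1 : F `<=` F1.
  move=> [x x'] Fx; exists x%:P, x'%:P, 1%:P, 1%:P; split=> //; first exact: poly_relC.
  by rewrite !hornerC !divr1.
have LE : ring_rel [set p : K * K | L p.1].
  by split=> /=; [exact: (cf_1 hL)|move=> p q; exact: (cf_B hL)|move=> p q; exact: (cf_M hL)].
have Lh p p' : poly_rel F p p' -> L p.[y].
  move=> pp; have h : poly_rel [set p : K * K | L p.1] p p' by move=> i; exact: (FL (pp i)).
  exact: (poly_rel_horner LE h (x := y) (x' := y) Ly).
exists F1; split=> //.
- split.
  + by move=> a Aa; apply: FF1; exact: (fs_A hF).
  + move=> _ _ [p [p' [r [r' [pp rr r0 ->]]]]] [q [q' [s [s' [qq ss s0 ->]]]]].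
    exists (p * s - q * r), (p' * s' - q' * r'), (r * s), (r' * s'); split.
    * by apply: poly_relB => //; exact: poly_relM.
    * exact: poly_relM.
    * by rewrite hornerM mulf_neq0.
    * have r0' := nz _ _ rr r0; have s0' := nz _ _ ss s0.
      rewrite /= !(hornerM, hornerD, hornerN).
      by congr pair; field; rewrite ?r0 ?s0 ?r0' ?s0'.
  + move=> _ _ [p [p' [r [r' [pp rr r0 ->]]]]] [q [q' [s [s' [qq ss s0 ->]]]]].
    exists (p * q), (p' * q'), (r * s), (r' * s'); split.
    * exact: poly_relM.
    * exact: poly_relM.
    * by rewrite hornerM mulf_neq0.
    * have r0' := nz _ _ rr r0; have s0' := nz _ _ ss s0.
      rewrite /= !(hornerM, hornerD, hornerN).
      by congr pair; field; rewrite ?r0 ?s0 ?r0' ?s0'.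
  + move=> _ [p [p' [r [r' [pp rr r0 ->]]]]].
    have [p0|p0] := eqVneq p.[y] 0.
      rewrite /= p0 (H _ _ pp).1 // !mul0r invr0; apply: FF1; exact: (rr_0 rF).
    by exists r, r', p, p'; split=> //=; rewrite !invf_div.
  + move=> _ [p [p' [r [r' [pp rr r0 ->]]]]] /=.
    rewrite mulf_eq0 negb_or => /andP[p0 _].
    exact: (gs_div hG ((H _ _ pp).2 p0) ((H _ _ rr).2 r0)).
  + move=> _ [p [p' [r [r' [pp rr r0 ->]]]]] /= /eqP.
    by rewrite mulf_eq0 invr_eq0 (negPf r0) orbF => /eqP/(H _ _ pp).1 ->; rewrite mul0r.
- move=> _ [p [p' [r [r' [pp rr r0 ->]]]]] /=.
  by apply: (cf_M hL); [exact: Lh pp|apply: (cf_V hL); exact: Lh rr].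
- exists 'X, 'X, 1%:P, 1%:P; split=> //; first exact: poly_relX.
  by rewrite !hornerX !hornerC !divr1.
Qed.

(** Division with remainder is performed in parallel on the two sides. It reduces evaluation at a
    common root to polynomials of smaller degree. *)
Lemma poly_rel_division (mu mu' : {poly K}) : poly_rel F mu mu' -> mu \is monic ->
  forall p p', poly_rel F p p' -> exists h h' r r', [/\ poly_rel F h h', poly_rel F r r',
    (size r < size mu)%N, p = mu * h + r & p' = mu' * h' + r'].
Proof.
move=> mm mon p p'; have rF := fsys_ring hF.
have mu0 : (0 < size mu)%N by rewrite size_poly_gt0 monic_neq0.
have F0 : F (0, 0) := rr_0 rF.
have z0 : poly_rel F 0 0 by move=> i; rewrite coef0.
move: {2}(size p) (leqnn (size p)) => n; elim: n p p' => [|n IH] p p' sp pp.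
  by exists 0, 0, p, p'; split; rewrite ?mulr0 ?add0r //; exact: leq_ltn_trans sp mu0.
have [lt|ge] := ltnP (size p) (size mu).
  by exists 0, 0, p, p'; split; rewrite ?mulr0 ?add0r.
pose k := (size p - size mu)%N; pose c := p`_(size p).-1; pose c' := p'`_(size p).-1.
have hh : poly_rel F (c *: 'X^k) (c' *: 'X^k).
  by apply: (@poly_relZ _ F rF) => //; [exact: pp|exact: (poly_relXn rF)].
have p0 : p != 0 by rewrite -size_poly_gt0; exact: leq_trans mu0 ge.
have sz : (size (p - mu * (c *: 'X^k))%R <= n)%N.
  have s1 : (size (mu * (c *: 'X^k))%R <= size p)%N.
    rewrite -scalerAr; apply: leq_trans (size_scale_leq _ _) _.
    by rewrite size_mulXn ?monic_neq0 // /k subnK.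
  apply/leq_sizeP => i ni; rewrite coefB -scalerAr coefZ coefMXn.
  have [e|ne] := eqVneq i (size p).-1.
    rewrite ifN; last by rewrite -leqNgt e /k; rewrite -subn1 leq_sub2l.
    rewrite (_ : (i - k)%N = (size mu).-1); last first.
      rewrite e /k; case: (size mu) mu0 ge => // m _; case: (size p) => // l ge.
      by rewrite subSS /= subKn.
    by rewrite -lead_coefE (monicP mon) mulr1 e subrr.
  have ip : (size p <= i)%N.
    move: ni ne; case: (size p) sp => [|l] // ln; rewrite /= => ni ne.
    by rewrite ltn_neqAle eq_sym ne /=; exact: leq_trans (ltnSE ln) ni.
  rewrite nth_default // sub0r; case: ifP => _; first by rewrite mulr0 oppr0.
  rewrite [mu`__]nth_default ?mulr0 ?oppr0 // /k.
  rewrite leq_subRL ?subnK //; apply: leq_trans ip; exact: leq_subr.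
have [h [h' [r [r' [h1 h2 h3 h4 h5]]]]] := IH _ _ sz (poly_relB rF pp (poly_relM rF mm hh)).
exists (h + c *: 'X^k), (h' + c' *: 'X^k), r, r'; split=> //; first exact: poly_relD.
- by rewrite mulrDr addrAC -h4 subrK.
- by rewrite mulrDr addrAC -h5 subrK.
Qed.

End Step.

(** Suppose that a maximal extension misses a point of [L]. If its domain contains the roots in K of
    its polynomials, the missing point is transcendental and all polynomials are handled at once by
    [no_collision]. If not, choose a polynomial of least degree with a missing root y: all
    polynomials of smaller degree have their roots in the domain, so [no_collision] applies, and
    division reduces to remainders. *)
Lemma fsys_extend F G Ek EG L : fsys F G -> gsys A G Ek EG -> ring_rel Ek -> group_rel EG ->
  elem_k Ek -> elem_G EG -> injects L D -> closed_field A L ->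
  (forall x, L x -> x != 0 -> exists x', G (x, x')) -> (forall p, F p -> L p.1) ->
  exists F', [/\ F `<=` F', fsys F' G, forall p, F' p -> L p.1 & forall x, L x -> exists x', F' (x, x')].
Proof.
move=> hF0 hG hEk hEG elk elG Lsm hL Ldom FL0.
pose Q F' := fsys F' G /\ forall p, F' p -> L p.1.
have [S [X0 SX0] SQ tot|F' [FF' [hF FL] Fmax]] := @Zorn_above _ Q F (conj hF0 FL0).
  have [_ [h0 _]] := SQ X0 SX0.
  have ch p : (\bigcup_(X in S) X) p -> exists X, [/\ S X, Q X & X p].
    by move=> [X FX Xp]; exists X; split=> //; case: (SQ X FX).
  split; last by move=> p /ch[X [_ [_ h] /h]].
  split.
  - by move=> a Aa; exists X0 => //; exact: (fs_A h0).
  - move=> p q hp hq; have [X [FX Xp Xq]] := bigcup_chain2 tot hp hq.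
    by have [_ [hX _]] := SQ X FX; exists X => //; exact: (fs_B hX).
  - move=> p q hp hq; have [X [FX Xp Xq]] := bigcup_chain2 tot hp hq.
    by have [_ [hX _]] := SQ X FX; exists X => //; exact: (fs_M hX).
  - by move=> p [X FX Xp]; have [_ [hX _]] := SQ X FX; exists X => //; exact: (fs_V hX).
  - by move=> p /ch[X [_ [h _] /(fs_G h)]].
  - by move=> p /ch[X [_ [h _] /(fs_0 h)]].
exists F'; split=> // x Lx; apply: contrapT => ndx.
pose dom x := exists x', F' (x, x'); have rF := fsys_ring hF.
have F00 : F' (0, 0) := rr_0 rF.
have done_ y y' : L y -> ~ dom y ->
  (forall p p', poly_rel F' p p' -> (p.[y] = 0 -> p'.[y'] = 0) /\ (p.[y] != 0 -> G (p.[y], p'.[y']))) -> False.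
  move=> Ly ny H; have [F1 [h1 h2 h3 h4]] := extend_by_evaluation hF hG hL FL Ly H.
  by apply: ny; exists y'; apply: (Fmax F1).
have lift (p : {poly K}) : (forall i, dom p`_i) -> exists p', poly_rel F' p p'.
  move=> pd; have [f hf] := choice pd; exists (\poly_(i < size p) f i) => i.
  rewrite coef_poly; case: ltnP => h; first exact: hf.
  by rewrite nth_default //; exact: F00.
have domL z : dom z -> L z by move=> [z' /FL].
pose bad n := exists (p : {poly K}) y, [/\ p != 0, forall i, dom p`_i, size p = n, root p y & ~ dom y].
have [ex|noalg] := pselect (exists n, bad n); last first.
  have rdom (p : {poly K}) : p != 0 -> (forall i, dom p`_i) -> forall z, root p z -> dom z.
    move=> p0 pd z pz; apply: contrapT => nz; apply: noalg.
    by exists (size p), p, z.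
  have trans (p : {poly K}) : p.[x] = 0 -> (forall i, dom p`_i) -> p = 0.
    move=> px pd; apply: contrapT => /eqP p0; apply: ndx.
    by apply: (rdom p p0 pd); exact/rootP.
  have [|l lB|x' hx'] := @realize_pairs F' G Ek EG L hF hG hEk hEG elk elG hL Ldom FL x
      [set q | poly_rel F' q.1 q.2] Lsm Lx; first by [].
    have [||||a [a' [t' [aa Ga h _]]]] := @no_collision F' G Ek EG L hF hG hEk hEG elk elG hL Ldom FL
       x (\max_(q <- l) size q.1).+1 l 0 0 Lx ndx.
    - by move=> p p0 pd _; exact: rdom.
    - move=> q ql; split; first exact: lB.
      rewrite ltnS; elim: l ql {lB} => //= q' l IH [->|/IH h]; rewrite big_cons ?leq_maxl //.
      by apply: leq_trans h _; exact: leq_maxr.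
    - by move=> i; rewrite coef0; exact: F00.
    - by rewrite size_poly0.
    exists (a' + t') => q ql; have qq := lB q ql; split=> [qx|qx].
      have q0 : q.1 = 0 by apply: trans => // i; exists (q.2`_i); exact: qq.
      have -> : q.2 = 0 by apply/polyP => i; rewrite coef0; apply: (fs_0 hF (qq i)); rewrite /= q0 coef0.
      by rewrite horner0.
    by apply: h => //; apply: contra_neq qx => ->; rewrite horner0.
  by apply: (done_ x x' Lx ndx) => p p' pp; exact: (hx' (p, p')).
have exb : exists n, `[< bad n >] by have [n h] := ex; exists n; apply/asboolP.
case: (ex_minnP exb) => N /asboolP[p0 [y [p00 p0d sp0 p0y ndy]]] Nmin.
have Ly : L y by apply: (cf_root hL p00) p0y => i; exact/domL.
have lc0 : lead_coef p0 != 0 by rewrite lead_coef_eq0.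
have [p0' pp0] := lift p0 p0d.
pose mu := (lead_coef p0)^-1 *: p0.
have [lc' hlc'] : dom (lead_coef p0) by exact: p0d.
have mm : poly_rel F' mu (lc'^-1 *: p0') by apply: poly_relZ => //; exact: (fs_V hF hlc').
have mon : mu \is monic by rewrite monicE lead_coefZ mulVf.
have smu : size mu = N by rewrite size_scale ?invr_neq0.
have muy : mu.[y] = 0 by rewrite hornerZ (rootP p0y) mulr0.
have rdom (p : {poly K}) : p != 0 -> (forall i, dom p`_i) -> (size p < N)%N ->
    forall z, root p z -> dom z.
  move=> pn pd pN z pz; apply: contrapT => nz.
  have : (N <= size p)%N by apply: Nmin; apply/asboolP; exists p, z.
  by rewrite leqNgt pN.
set mu' := lc'^-1 *: p0' in mm.
have lowdeg (p p' : {poly K}) : poly_rel F' p p' -> (size p < N)%N -> p.[y] = 0 -> p = 0.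
  move=> pp pN py; apply: contrapT => /eqP pn; apply: ndy.
  by apply: (rdom p pn _ pN); [move=> i; exists (p'`_i)|exact/rootP].
have zero' (p p' : {poly K}) : poly_rel F' p p' -> p = 0 -> p' = 0.
  by move=> pp e; apply/polyP => i; rewrite coef0; apply: (fs_0 hF (pp i)); rewrite /= e coef0.
pose B : set ({poly K} * {poly K}) :=
  [set q | poly_rel F' q.1 q.2 /\ ((size q.1 < N)%N \/ q = (mu, mu'))].
have [|l lB|y' hy'] := @realize_pairs F' G Ek EG L hF hG hEk hEG elk elG hL Ldom FL y B Lsm Ly.
- by move=> q [].
- have [|||a [a' [t' [aa Ga h hmu]]]] := @no_collision F' G Ek EG L hF hG hEk hEG elk elG hL Ldom FL
     y N (seq.filter (fun q : {poly K} * {poly K} => (size q.1 < N)%N) l) mu mu' Ly ndy rdom.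
  + by move=> q /In_filter[/lB[h _] ?].
  + exact: mm.
  + by rewrite smu.
  have [s Gs mus] := hmu (monic_neq0 mon) muy.
  exists (a' + s) => q ql; have [qq [qN|->]] := lB q ql; last first.
    by split=> // ; rewrite /= muy eqxx.
  split=> [qx|qx]; first by rewrite (zero' _ _ qq) ?horner0 //; exact: (lowdeg _ q.2).
  apply: h => //; first by rewrite In_filter.
  by apply: contra_neq qx => ->; rewrite horner0.
apply: (done_ y y' Ly ndy) => p p' pp.
have [h [h' [r [r' [_ rr sr -> ->]]]]] := poly_rel_division hF mm mon pp.
have mu'y : mu'.[y'] = 0 by apply: (hy' (mu, mu') _).1 => //; split=> //; right.
rewrite !hornerD !hornerM muy mu'y !mul0r !add0r.
by apply: (hy' (r, r')); split=> //; left; rewrite -smu.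
Qed.

End FSystem.

(** * Relative quantifier elimination by back-and-forth *)

Section FullSystem.
Variable M : valuedField.
Notation MM := (vf_struct M).
Notation K := (vK M).
Variables (A : set K) (U : Type) (D : set U).
Hypothesis Dinf : injects [set: nat] D.
Hypothesis Msat : saturated MM D.
Hypothesis Asub : subfield A.
Hypothesis Asm : injects A D.
Hypothesis Mhens : henselian M.
Hypothesis Mchar : [pchar (vk M)] =i pred0.
Hypothesis Acosets : forall n (x : K), (0 < n)%N -> x != 0 ->
  exists a y, [/\ A a, a != 0 & x = a * y ^+ n].
Hypothesis Aunits : forall n (x : K), (0 < n)%N -> unit_el x ->
  exists a y, [/\ A a, unit_el a, unit_el y & vres a = vres x * vres y ^+ n].

Definition swap T (E : set (T * T)) : set (T * T) := [set p | E (p.2, p.1)].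

(** A position of the back-and-forth. Since [G] contains all pairs from 1 + M, its smallness is only
    required up to leading terms, in [sy_near]. *)
Record system (F G : set (K * K)) (Ek : set (vk M * vk M)) (EG : set (vG M * vG M)) : Prop := System {
  sy_F : fsys A F G;
  sy_G : gsys A G Ek EG;
  sy_k : ring_rel Ek;
  sy_g : group_rel EG;
  sy_ek : elem_k Ek;
  sy_eg : elem_G EG;
  sy_smF : injects F D;
  sy_smk : injects Ek D;
  sy_smg : injects EG D;
  sy_near : exists2 S : set K, injects S D & forall p, G p -> exists2 q, S q & near p.1 q }.

Lemma gsys_mono G Ek EG Ek' EG' : Ek `<=` Ek' -> EG `<=` EG' -> gsys A G Ek EG -> gsys A G Ek' EG'.
Proof.
move=> s s' []; split=> //; first by move=> p hp; apply: s'; auto.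
by move=> p hp vp; apply: s; auto.
Qed.

Lemma fsys_mono F G G' : G `<=` G' -> fsys A F G -> fsys A F G'.
Proof. by move=> s []; split=> // p hp p0; apply: s; auto. Qed.

(** A closed field containing [S] and the old domains is fixed; then the maps of residues and
    values, the map of leading terms and the field map are extended in this order, each relying on
    the earlier ones. *)
Lemma system_extend F G Ek EG (S : set K) : system F G Ek EG -> injects S D ->
  exists F' G' Ek' EG', [/\ F `<=` F', G `<=` G', Ek `<=` Ek', EG `<=` EG' &
    system F' G' Ek' EG' /\ forall x, S x -> exists x', F' (x, x')].
Proof.
move=> [hF hG hk hg ek eg smF smk smg [S0 S0sm S0n]] Ssm.
have [|L [SL Lsm hL]] := closed_hull Dinf Asm Acosets Aunits (S := S `|` [set p.1 | p in F] `|` S0).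
  by apply: small_union => //; apply: small_union => //; exact: small_image.
have [Ek' [sk ek' smk' hk' [_ domk]]] := elem_k_close Dinf Msat ek smk (small_image Dinf (@vres M) Lsm).
have [EG' [sg eg' smg' hg' domg]] := elem_G_close Dinf Msat eg smg (small_image Dinf (@v M) Lsm).
have hG' := gsys_mono sk sg hG.
have [|||G' [GG' hG'' G'L domG]] := gsys_extend Dinf Msat Asub Mhens Mchar Acosets hG' hk' hg' ek' eg' Lsm hL.
- by move=> p /S0n[q Sq n]; exists q => //; apply: SL; right.
- by move=> x Lx _; apply: domk; exists x.
- by move=> x Lx _; apply: domg; exists x.
have hF' := fsys_mono GG' hF.
have [|F' [FF' hF'' FL domF]] := fsys_extend Dinf Msat Asub Mhens Mchar hF' hG'' hk' hg' ek' eg' Lsm hL domG.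
  by move=> p Fp; apply: SL; left; right; exists p.
exists F', G', Ek', EG'; split=> //; split; last by move=> x Sx; apply/domF/SL; left; left.
split=> //; last by exists L.
exact: (small_graph hF'' FL Lsm).
Qed.

(** The axioms are symmetric in content, so that extending the inverse gives the back step. *)
Lemma system_swap F G Ek EG : system F G Ek EG -> system (swap F) (swap G) (swap Ek) (swap EG).
Proof.
move=> [hF hG hk hg ek eg smF smk smg [S0 S0sm S0n]].
have smsw T (E : set (T * T)) : injects E D -> injects (swap E) D.
  move=> h; apply: small_sub (small_image Dinf (fun p => (p.2, p.1)) h).
  by move=> [x y] Exy; exists (y, x).
split; try exact: smsw.
- split; rewrite /swap /=.
  + exact: (fs_A hF).
  + by move=> [x y] [x' y']; exact: (fs_B hF).
  + by move=> [x y] [x' y']; exact: (fs_M hF).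
  + by move=> [x y]; exact: (fs_V hF).
  + move=> [x y] Fp y0; apply: (fs_G hF Fp) => /=.
    by apply: contra_neq y0 => x0; exact: (fs_0 hF Fp).
  + move=> [x y] /= Fp x0; apply: contrapT => /eqP y0.
    have := gs_nz hG (fs_G hF Fp y0) => -[] /=; by rewrite x0 eqxx.
- split; rewrite /swap /=.
  + exact: (gs_A hG).
  + by move=> [x y] [x' y']; exact: (gs_M hG).
  + by move=> [x y]; exact: (gs_V hG).
  + by move=> [x y] /(gs_nz hG)[].
  + by move=> z z' ? ?; exact: (gs_1 hG).
  + by move=> [x y] n /(gs_pow hG) h n0; apply: iff_sym; exact: h.
  + by move=> [x y]; exact: (gs_v hG).
  + move=> [x y] Gp vy; apply: (gs_k hG Gp); exact: (elem_G_eq eg (gs_v hG Gp) hg.1).2.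
- split; rewrite /swap /=; first exact: (rr_1 hk).
  + by move=> [x y] [x' y']; exact: (rr_B hk).
  + by move=> [x y] [x' y']; exact: (rr_M hk).
- by split; [exact: hg.1|move=> [x y] [x' y']; exact: hg.2].
- exact: elementary_swap.
- exact: elementary_swap.
- have h q : exists q', forall y, G (q, y) -> near y q'.
    have [[y Gy]|n] := pselect (exists y, G (q, y)); last by exists 0 => y Gy; case: n; exists y.
    by exists y => y' Gy'; exact: (gs_fun hG hk hg ek eg Gy' Gy).
  have [r hr] := choice h; exists (r @` S0); first exact: small_image.
  move=> [y x] /= Gp; have [q Sq n] := S0n _ Gp.
  exists (r q); first by exists q.
  have [_ y0] := gs_nz hG Gp.
  by apply: hr; apply: (gs_near hG Gp n); exact: near_refl.
Qed.

(** Leading terms have no component of their own; they are related through representatives in G. *)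
Definition related (F G : set (K * K)) (Ek : set (vk M * vk M)) (EG : set (vG M * vG M)) (s : vf_sort) :
    MM s -> MM s -> Prop :=
  match s with
  | SK => fun x y => F (x, y)
  | Sk => fun x y => Ek (x, y)
  | SG => fun x y => EG (x, y)
  | SRV => fun x y => exists p, [/\ G p, x = vrv p.1 & y = vrv p.2]
  end.

Lemma related_swap F G Ek EG s x y :
  @related (swap F) (swap G) (swap Ek) (swap EG) s x y <-> related F G Ek EG y x.
Proof. by case: s x y => //= x y; split=> -[[a b] [h1 h2 h3]]; exists (b, a). Qed.

Lemma related_mono F G Ek EG F' G' Ek' EG' s x y :
  F `<=` F' -> G `<=` G' -> Ek `<=` Ek' -> EG `<=` EG' ->
  @related F G Ek EG s x y -> related F' G' Ek' EG' x y.
Proof.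
move=> sF sG sk sg; case: s x y => /= x y; [exact: sF|exact: sk|exact: sg|].
by move=> [p [h1 h2 h3]]; exists p; split=> //; exact: sG.
Qed.

Lemma related_fun F G Ek EG s x y y' : system F G Ek EG ->
  @related F G Ek EG s x y -> related F G Ek EG x y' -> y = y'.
Proof.
move=> hs; have hG := sy_G hs; case: s x y y' => /= x y y'.
- exact: (fs_fun (sy_F hs)).
- by move=> h1 h2; apply: (elem_k_eq (sy_ek hs) h1 h2).1.
- by move=> h1 h2; apply: (elem_G_eq (sy_eg hs) h1 h2).1.
- move=> [[a b] /= [ab -> ->]] [[a' b'] /= [ab' e ->]].
  have [a0 b0] := gs_nz hG ab; have [a0' b0'] := gs_nz hG ab'.
  have n := (rv_near a0 a0').1 e.
  have h := gs_near hG ab n (near_refl b0).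
  by apply/(rv_near b0 b0'); exact: (gs_fun hG (sy_k hs) (sy_g hs) (sy_ek hs) (sy_eg hs) h ab').
Qed.

Lemma related_op F G Ek EG (f : vf_fsym) (a a' : forall i : 'I_(vf_farity f), MM (vf_fsort f)) :
  system F G Ek EG -> (forall i, related F G Ek EG (a i) (a' i)) ->
  @related F G Ek EG (vf_fsort f) (@finterp vf_sig MM f a) (@finterp vf_sig MM f a').
Proof.
move=> hs; have hF := sy_F hs; have hG := sy_G hs; have hk := sy_k hs; have hg := sy_g hs.
have rF := fsys_ring Asub hF.
case: f a a' => [[]|[]|[]|[]] a a' aa /=.
- exact: (rr_0 rF).
- exact: (rr_1 rF).
- by have := rr_B rF (rr_0 rF) (aa ord0); rewrite /= !sub0r.
- exact: (rr_D rF (aa ord0) (aa ord_max)).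
- exact: (rr_M rF (aa ord0) (aa ord_max)).
- exact: (rr_0 hk).
- exact: (rr_1 hk).
- by have := rr_B hk (rr_0 hk) (aa ord0); rewrite /= !sub0r.
- exact: (rr_D hk (aa ord0) (aa ord_max)).
- exact: (rr_M hk (aa ord0) (aa ord_max)).
- exact: hg.1.
- exact: (gr_N hg (aa ord0)).
- exact: (gr_D hg (aa ord0) (aa ord_max)).
- exists (1, 1); split; first exact/(gs_A hG (A1 Asub))/oner_neq0.
  + by apply/esym/(rv_eq1 (oner_neq0 _)); rewrite subrr; exact: small0.
  + by apply/esym/(rv_eq1 (oner_neq0 _)); rewrite subrr; exact: small0.
- have [p [Gp e e']] := aa ord0; have [p0 p0'] := gs_nz hG Gp.
  have rvV (x : K) : x != 0 -> vrv x^-1 = (vrv x)^-1%g.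
    move=> x0; apply: (@mulgI _ (vrv x)); rewrite mulgV -rvM ?invr_neq0 // divff //.
    by apply/(rv_eq1 (oner_neq0 _)); rewrite subrr; exact: small0.
  exists (p.1^-1, p.2^-1); split; first exact: (gs_V hG Gp).
  + by rewrite rvV // -e.
  + by rewrite rvV // -e'.
- have [p [Gp e e']] := aa ord0; have [p0 p0'] := gs_nz hG Gp.
  have [q [Gq f f']] := aa ord_max; have [q0 q0'] := gs_nz hG Gq.
  exists (p.1 * q.1, p.2 * q.2); split; first exact: (gs_M hG Gp Gq).
  + by rewrite rvM // -e -f.
  + by rewrite rvM // -e' -f'.
Qed.

Lemma related_rel F G Ek EG (r : vf_rsym) (a a' : forall i : 'I_2, MM (vf_rdom r i)) :
  system F G Ek EG -> (forall i, related F G Ek EG (a i) (a' i)) ->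
  @rinterp vf_sig MM r a -> @rinterp vf_sig MM r a'.
Proof.
move=> hs; have hF := sy_F hs; have hG := sy_G hs; have hk := sy_k hs; have hg := sy_g hs.
case: r a a' => a a' aa /=.
- by rewrite (elem_G_le (sy_eg hs) (aa ord0) (aa ord_max)).
- move=> e; have x0 := val_neq0 e.
  have Gx := fs_G hF (aa ord0) x0; have [_ y0] := gs_nz hG Gx; have h := gs_v hG Gx.
  move: e; rewrite !val_v // => -[e].
  by congr Some; apply: (elem_G_eq (sy_eg hs) h (aa ord_max)).1.
- move=> [ix e]; have [x0|x0] := eqVneq (a ord0 : K) 0.
    have y0 : (a' ord0 : K) = 0 by exact: (fs_0 hF (aa ord0)).
    rewrite /valring /= y0 res0; split; first exact: integral0.
    apply: (elem_k_eq (sy_ek hs) (rr_0 hk) (aa ord_max)).1.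
    by rewrite -e x0 res0.
  have Gx := fs_G hF (aa ord0) x0.
  have [_ iy h] := gs_integral hG hk hg (sy_eg hs) Gx ix.
  by split=> //; apply: (elem_k_eq (sy_ek hs) h (aa ord_max)).1.
- move=> [x0 e]; have Gx := fs_G hF (aa ord0) x0; have [_ y0] := gs_nz hG Gx.
  split=> //; apply: (@related_fun F G Ek EG SRV (vrv (a ord0 : K)) _ _ hs).
    by exists (a ord0, a' ord0).
  by have := aa ord_max; rewrite /= e.
Qed.

(** An element of any sort is carried by an element of K, so a quantifier over any sort only
    requires extending the field map. *)
Lemma related_lift (s : vf_sort) (b : MM s) : exists y : K, forall F G Ek EG, system F G Ek EG ->
  forall x, F (y, x) -> exists a, related F G Ek EG b a.
Proof.
have nz F G Ek EG : system F G Ek EG -> forall x y, F (y, x) -> y != 0 -> G (y, x).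
  by move=> hs x y Fxy y0; exact: (fs_G (sy_F hs) Fxy).
case: s b => /= b.
- by exists b => F G Ek EG hs x Fx; exists x.
- have [y iy <-] := res_surj b; exists y => F G Ek EG hs x Fx.
  have [y0|y0] := eqVneq y 0.
    by exists 0; rewrite y0 res0; exact: (rr_0 (sy_k hs)).
  have [_ _ h] := gs_integral (sy_G hs) (sy_k hs) (sy_g hs) (sy_eg hs) (nz _ _ _ _ hs _ _ Fx y0) iy.
  by exists (vres x).
- have [y vy] := val_surj b; have y0 := val_neq0 vy.
  exists y => F G Ek EG hs x Fx; exists (v x).
  by have := gs_v (sy_G hs) (nz _ _ _ _ hs _ _ Fx y0); rewrite /= {1}/v vy.
- have [y y0 <-] := rv_surj b; exists y => F G Ek EG hs x Fx; exists (vrv x).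
  by exists (y, x); split=> //; exact: nz hs _ _ Fx y0.
Qed.

(** Induction on formulas. Atomic formulas are preserved by the axioms, read in both directions by
    [system_swap]; at a quantifier the inverse system is extended by a carrier of the new
    element. *)
Theorem system_equiv F G Ek EG (V : ctx (sorts vf_sig)) (e e' : asg MM V) : system F G Ek EG ->
  (forall x, related F G Ek EG (e x) (e' x)) -> equivalent e e'.
Proof.
have ev (V0 : ctx (sorts vf_sig)) s (t : term V0 s) F0 G0 Ek0 EG0 (d d' : asg MM V0) : system F0 G0 Ek0 EG0 ->
    (forall x, related F0 G0 Ek0 EG0 (d x) (d' x)) -> related F0 G0 Ek0 EG0 (eval d t) (eval d' t).
  move=> hs dd; elim: t => [x|f a IH]; first exact: dd.
  exact: (@related_op _ _ _ _ f _ _ hs IH).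
move=> hs ee p; elim: p F G Ek EG e e' hs ee => [{}V s t u|{}V r a|{}V|{}V p hp q hq|{}V s p hp] F G Ek EG e e' hs ee.
- have main F0 G0 Ek0 EG0 (d d' : asg MM V) : system F0 G0 Ek0 EG0 ->
    (forall x, related F0 G0 Ek0 EG0 (d x) (d' x)) -> sat (FEq t u) d -> sat (FEq t u) d'.
    move=> hs0 dd /= E; apply: (@related_fun _ _ _ _ _ (eval d t) _ _ hs0).
      exact: ev.
    by rewrite E; exact: ev.
  split; first exact: main hs ee.
  by apply: main (system_swap hs) _ => x; apply/related_swap.
- have main F0 G0 Ek0 EG0 (d d' : asg MM V) : system F0 G0 Ek0 EG0 ->
    (forall x, related F0 G0 Ek0 EG0 (d x) (d' x)) -> sat (FRel a) d -> sat (FRel a) d'.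
    by move=> hs0 dd /=; apply: (related_rel hs0) => i; exact: ev.
  split; first exact: main hs ee.
  by apply: main (system_swap hs) _ => x; apply/related_swap.
- by [].
- have := hp _ _ _ _ _ _ hs ee; have := hq _ _ _ _ _ _ hs ee => /= h1 h2.
  by split=> h /h2/h/h1.
- have main F0 G0 Ek0 EG0 (d d' : asg MM V) : system F0 G0 Ek0 EG0 ->
    (forall x, related F0 G0 Ek0 EG0 (d x) (d' x)) -> sat (FAll p) d -> sat (FAll p) d'.
    move=> hs0 dd /= h b; have [y hy] := related_lift b.
    have [F1 [G1 [Ek1 [EG1 [sF sG sk sg [hs1 dom]]]]]] :=
      system_extend (system_swap hs0) (small_set1 Dinf y).
    have [x Fx] := dom y erefl; have [a ha] := hy _ _ _ _ hs1 x Fx.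
    apply/(hp _ _ _ _ (asg_ext d a) (asg_ext d' b) (system_swap hs1)); last exact: h.
    move=> [z|] /=; last by apply/related_swap.
    apply/related_swap; apply: (related_mono sF sG sk sg).
    by apply/related_swap.
  split; first exact: main hs ee.
  by apply: main (system_swap hs) _ => x; apply/related_swap.
Qed.

End FullSystem.

(** * Amalgamation of two partial isomorphisms over A *)

Lemma lin_disjoint_in (F : fieldType) (E D D0 : set F) (T : finType) (J : {set T}) (u c : T -> F) :
  lin_disjoint E D D0 -> D0 0 -> (forall j, j \in J -> E (u j)) ->
  (forall a : T -> F, (forall j, D0 (a j)) -> \sum_(j in J) a j * u j = 0 -> forall j, j \in J -> a j = 0) ->
  (forall j, j \in J -> D (c j)) -> \sum_(j in J) c j * u j = 0 -> forall j, j \in J -> c j = 0.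
Proof.
move=> ld D00 Eu ind Dc sc j jJ.
have h (a : 'I_#|J| -> F) : (forall i, D0 (a i)) ->
    \sum_i a i * u (enum_val i) = 0 -> forall i, a i = 0.
  move=> Da sa i.
  pose b t := if [pick i | enum_val i == t] is Some i then a i else 0.
  have bE k : b (enum_val k) = a k.
    rewrite /b; case: pickP => [k' /eqP/enum_val_inj -> //|/(_ k)]; by rewrite eqxx.
  rewrite -bE; apply: (ind b) (enum_valP i).
    by move=> t; rewrite /b; case: pickP.
  rewrite big_enum_val; under eq_bigr => k _ do rewrite bE.
  exact: sa.
have := ld #|J| (fun i => u (enum_val i)) (fun i => Eu _ (enum_valP i)) h (fun i => c (enum_val i))
  (fun i => Dc _ (enum_valP i)).
rewrite big_enum_val in sc; move=> /(_ sc (enum_rank_in jJ j)).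
by rewrite enum_rankK_in.
Qed.

Section Amalgam.
Variable M : valuedField.
Notation MM := (vf_struct M).
Notation K := (vK M).
Variables (A : set K) (U : Type) (D : set U).
Hypothesis Dinf : injects [set: nat] D.
Hypothesis Msat : saturated MM D.
Hypothesis Asub : subfield A.
Hypothesis Asm : injects A D.
Hypothesis Mhens : henselian M.
Hypothesis Mchar : [pchar (vk M)] =i pred0.
Hypothesis Acosets : forall n (x : K), (0 < n)%N -> x != 0 ->
  exists a y, [/\ A a, a != 0 & x = a * y ^+ n].
Hypothesis Aunits : forall n (x : K), (0 < n)%N -> unit_el x ->
  exists a y, [/\ A a, unit_el a, unit_el y & vres a = vres x * vres y ^+ n].

(* No cancellation in A-linear combinations, expressed without the valuation
   so as to be invariant under maps that change the values. *)
Definition norming (m : nat) (w : 'I_m -> K) := forall (a : 'I_m -> K) j, (forall i, A (a i)) ->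
  a j != 0 -> (forall i, integral (a i * w i / (a j * w j))) ->
  unit_el (\sum_i a i * w i / (a j * w j)).

(** Separatedness for finite families: the coordinates in [A] are kept explicit, as the maps fixing
    [A] carry them along. *)
Definition normed_set (C : set K) := forall n (c : 'I_n -> K), (forall i, C (c i)) ->
  exists m (w : 'I_m -> K) (a : 'I_n -> 'I_m -> K), [/\ forall j, C (w j), forall j, w j != 0,
    forall i j, A (a i j), forall i, c i = \sum_j a i j * w j & norming w].

(** [RC], [GC], [Ck], [CG] are the maps of field elements, leading terms, residues and values on the
    side of C; [RK], [RH], [Rk], [RG] are those of the other side. [Ek] and [EG] contain the residue
    and value maps of both. *)
Variables (RC GC RK RH : set (K * K)) (Ck Rk Ek : set (vk M * vk M)) (CG RG EG : set (vG M * vG M)).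
Hypotheses (hRC : fsys A RC GC) (hGC : gsys A GC Ck CG) (hRK : fsys A RK RH) (hRH : gsys A RH Rk RG).
Hypotheses (hEk : ring_rel Ek) (hEkV : forall p, Ek p -> Ek (p.1^-1, p.2^-1)) (hEG : group_rel EG).
Hypotheses (elk : elem_k Ek) (elG : elem_G EG) (smk : injects Ek D) (smG : injects EG D).
Hypotheses (CkE : Ck `<=` Ek) (RkE : Rk `<=` Ek) (CGE : CG `<=` EG) (RGE : RG `<=` EG).
Hypothesis Cnormed : normed_set [set x | exists x', RC (x, x')].
Hypothesis indep_G : forall p q, GC p -> RH q -> v p.1 + v q.1 = 0 -> exists a, [/\ A a, a != 0 & v a = v p.1].
Hypothesis indep_k : lin_disjoint [set u | exists u', Ck (u, u')] [set u | exists u', Rk (u, u')] (res_of A).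
Hypotheses (smRC : injects RC D) (smRK : injects RK D).
Hypothesis nearC : exists2 S : set K, injects S D & forall p, GC p -> exists2 q, S q & near p.1 q.
Hypothesis nearH : exists2 S : set K, injects S D & forall p, RH p -> exists2 q, S q & near p.1 q.

(** The unit factor [w] makes room for sums: a combination of elements of both sides is a product of
    one term from each side and a unit whose residue is in the domain of [Ek]. *)
Definition amalgam_group : set (K * K) := [set s | exists c h w, [/\ GC c, RH h,
  unit_el w.1 /\ unit_el w.2, Ek (vres w.1, vres w.2) & s = (c.1 * h.1 * w.1, c.2 * h.2 * w.2)]].

Lemma power_coset G k g (p : K * K) n : gsys A G k g -> G p -> (0 < n)%N ->
  exists a, [/\ A a, a != 0, is_power n (p.1 / a) & is_power n (p.2 / a)].
Proof.
move=> hG Gp n0; have [p0 _] := gs_nz hG Gp.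
have [a [y [Aa a0 e]]] := Acosets n0 p0; exists a.
have h1 : is_power n (p.1 / a) by exists y; rewrite e mulrAC divff // mul1r.
by split=> //; apply: (gs_pow hG (gs_div hG Gp (gs_A hG Aa a0)) n0).1.
Qed.

(** The witness y for the coset of the first component may have its residue outside the domain of
    [Ek]; extending [Ek] by that residue transfers the witness. *)
Lemma unit_coset (w : K * K) n : unit_el w.1 -> unit_el w.2 -> Ek (vres w.1, vres w.2) -> (0 < n)%N ->
  exists a, [/\ A a, a != 0, is_power n (w.1 / a) & is_power n (w.2 / a)].
Proof.
move=> u1 u2 e n0; have [a [y [Aa ua uy ra]]] := Aunits n0 u1; exists a.
have [a0 va] := (unit_elP a).1 ua.
split=> //; first exact: (unit_power_coset Mhens Mchar n0 ua u1 uy ra).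
have [E' [EE' elE' _ hE' [_ dom]]] := elem_k_close Dinf Msat elk smk (small_set1 Dinf (vres y)).
have [r hr] := dom _ erefl; have [y' iy' ry'] := res_surj r.
have uy' : unit_el y'.
  apply/(res_unit iy'); rewrite ry'; apply/eqP => /(elem_k_eq elE' hr (rr_0 hE')).2.
  by apply/eqP/(res_unit (unit_integral uy)).
apply: (unit_power_coset Mhens Mchar n0 ua u2 uy'); rewrite ry'.
have h1 := rr_M hE' (EE' _ e) (rr_X n hE' hr); rewrite /= -ra in h1.
apply: (elem_k_eq elE' _ h1).1 erefl; apply/EE'/RkE.
by apply: (gs_k hRH (gs_A hRH Aa a0)).
Qed.

Lemma amalgam_gsys : gsys A amalgam_group Ek EG.
Proof.
have e1 : Ek (vres 1, vres 1) by rewrite res1; exact: (rr_1 hEk).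
have u1 : unit_el (1 : K) := unit1 M.
have C1 := gs_A hGC (A1 Asub) (oner_neq0 _); have H1 := gs_A hRH (A1 Asub) (oner_neq0 _).
split.
- move=> a Aa a0; exists (a, a), (1, 1), (1, 1); split=> //; first exact: (gs_A hGC).
  by rewrite /= !mulr1.
- move=> _ _ [c [h [w [Gc Hh [wu wu'] we ->]]]] [c' [h' [w' [Gc' Hh' [wv wv'] we' ->]]]].
  exists (c.1 * c'.1, c.2 * c'.2), (h.1 * h'.1, h.2 * h'.2), (w.1 * w'.1, w.2 * w'.2); split.
  + exact: (gs_M hGC).
  + exact: (gs_M hRH).
  + by split; exact: unitM.
  + by rewrite /= !resM; try exact: unit_integral; exact: (rr_M hEk we we').
  + by congr pair => /=; ring.
- move=> _ [c [h [w [Gc Hh [wu wu'] we ->]]]].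
  exists (c.1^-1, c.2^-1), (h.1^-1, h.2^-1), (w.1^-1, w.2^-1); split.
  + exact: (gs_V hGC).
  + exact: (gs_V hRH).
  + by split; exact: unitV.
  + by rewrite /= !resV //; exact: (hEkV we).
  + by rewrite /= !invfM.
- move=> _ [c [h [w [/(gs_nz hGC)[c0 c0'] /(gs_nz hRH)[h0 h0'] [wu wu'] we ->]]]] /=.
  have [w0 _] := (unit_elP _).1 wu; have [w0' _] := (unit_elP _).1 wu'.
  by rewrite !mulf_neq0.
- move=> z z' hz hz'; have uz := near1_unit hz; have uz' := near1_unit hz'.
  exists (1, 1), (1, 1), (z, z'); split=> //=; last by rewrite !mul1r.
  by rewrite !(res_near1 (unit_integral _)).2 //; exact: (rr_1 hEk).
- move=> _ n [c [h [w [Gc Hh [wu wu'] we ->]]]] n0 /=.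
  have [a [Aa a0 a1 a2]] := power_coset hGC Gc n0.
  have [b [Ab b0 b1 b2]] := power_coset hRH Hh n0.
  have [d [Ad d0 d1 d2]] := unit_coset wu wu' we n0.
  have [c0 c0'] := gs_nz hGC Gc; have [h0 h0'] := gs_nz hRH Hh.
  have [w0 _] := (unit_elP _).1 wu; have [w0' _] := (unit_elP _).1 wu'.
  have E (x y z : K) : x != 0 -> y != 0 -> z != 0 -> is_power n (x / a) -> is_power n (y / b) ->
      is_power n (z / d) -> is_power n (x * y * z) <-> is_power n (a * b * d).
    move=> x0 y0 z0 h1 h2 h3.
    have -> : x * y * z = (a * b * d) * ((x / a) * (y / b) * (z / d)) by field; rewrite d0 b0 a0.
    apply: is_power_mul2; last exact/is_powerM/h3/is_powerM.
    by rewrite !mulf_neq0 ?invr_neq0.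
  by rewrite E // E.
- move=> _ [c [h [w [Gc Hh [wu wu'] we ->]]]] /=.
  have [c0 c0'] := gs_nz hGC Gc; have [h0 h0'] := gs_nz hRH Hh.
  have [w0 vw] := (unit_elP _).1 wu; have [w0' vw'] := (unit_elP _).1 wu'.
  rewrite !vM ?mulf_neq0 // vw vw' !addr0.
  exact: (gr_D hEG (CGE (gs_v hGC Gc)) (RGE (gs_v hRH Hh))).
- move=> _ [c [h [w [Gc Hh [wu wu'] we ->]]]] /=.
  have [c0 c0'] := gs_nz hGC Gc; have [h0 h0'] := gs_nz hRH Hh.
  have [w0 vw] := (unit_elP _).1 wu; have [w0' vw'] := (unit_elP _).1 wu'.
  rewrite !vM ?mulf_neq0 // vw addr0 => vch.
  (* The value of [c] lies in val(A), so dividing [c] and multiplying [h] by [a] makes both units,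
     whose residues correspond separately. *)
  have [a [Aa a0 va]] := indep_G Gc Hh vch.
  have Gca := gs_div hGC Gc (gs_A hGC Aa a0).
  have Hah := gs_M hRH (gs_A hRH Aa a0) Hh.
  rewrite /= in Gca Hah.
  have v1 : v (c.1 / a) = 0 by rewrite vM ?invr_neq0 // vV // va subrr.
  have v2 : v (a * h.1) = 0 by rewrite vM // va.
  have v1' : v (c.2 / a) = 0 by apply: (elem_G_eq elG (CGE (gs_v hGC Gca)) hEG.1).1.
  have v2' : v (a * h.2) = 0 by apply: (elem_G_eq elG (RGE (gs_v hRH Hah)) hEG.1).1.
  have ug (x : K) : x != 0 -> v x = 0 -> integral x by move=> *; apply/unit_integral/unit_elP.
  have i1 : integral (c.1 / a) by apply: ug => //; rewrite mulf_neq0 ?invr_neq0.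
  have i2 : integral (a * h.1) by apply: ug => //; rewrite mulf_neq0.
  have i1' : integral (c.2 / a) by apply: ug => //; rewrite mulf_neq0 ?invr_neq0.
  have i2' : integral (a * h.2) by apply: ug => //; rewrite mulf_neq0.
  have iw := unit_integral wu; have iw' := unit_integral wu'.
  have -> : c.1 * h.1 * w.1 = (c.1 / a) * (a * h.1) * w.1 by field.
  have -> : c.2 * h.2 * w.2 = (c.2 / a) * (a * h.2) * w.2 by field.
  rewrite (resM (integralM i1 i2) iw) (resM i1 i2) (resM (integralM i1' i2') iw') (resM i1' i2').
  exact: (rr_M hEk (rr_M hEk (CkE (gs_k hGC Gca v1)) (RkE (gs_k hRH Hah v2))) we).
Qed.

Definition pairing n (c u : 'I_n -> K * K) : K * K :=
  (\sum_i (c i).1 * (u i).1, \sum_i (c i).2 * (u i).2).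

(** Expand the c_i in a normed family w, so that the sum becomes a sum of w_j b_j with b_j on the
    other side, and divide by a dominant term to get integral t_j. Those t_j that are units factor
    as e_j f_j with a unit on each side; norming makes the res(e_j) independent over res(A), linear
    disjointness keeps them independent over the residues of the other side, and so the sum of the
    t_j is a unit. The leading term of the whole sum is then given by the dominant term and that
    residue. *)
Lemma pairing_value n (c u : 'I_n -> K * K) : (forall i, RC (c i)) -> (forall i, RK (u i)) ->
  ((pairing c u).1 = 0 -> (pairing c u).2 = 0) /\ ((pairing c u).1 != 0 -> amalgam_group (pairing c u)).
Proof.
move=> Cc Ku; have rRC := fsys_ring Asub hRC; have rRK := fsys_ring Asub hRK.
have [|m [w [a [Cw w0 Aa ca nw]]]] := Cnormed (c := fun i => (c i).1).
  by move=> i; exists (c i).2; case: (c i) (Cc i).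
have [w' ww] := choice Cw.
have ca' i : (c i).2 = \sum_j a i j * w' j.
  have h : RC ((c i).1, \sum_j a i j * w' j).
    rewrite ca; apply: (rr_sum rRC) => j _; exact: (rr_M rRC (fs_A hRC (Aa i j)) (ww j)).
  by apply: (fs_fun hRC _ h); case: (c i) (Cc i).
pose b j := \sum_i a i j * (u i).1; pose b' j := \sum_i a i j * (u i).2.
have bb j : RK (b j, b' j).
  apply: (rr_sum rRK) => i _; have hu : RK ((u i).1, (u i).2) by case: (u i) (Ku i).
  exact: (rr_M rRK (fs_A hRK (Aa i j)) hu).
have s1 : (pairing c u).1 = \sum_j w j * b j.
  rewrite /pairing /=; under eq_bigr => i _ do rewrite ca mulr_suml.
  rewrite exchange_big; apply: eq_bigr => j _; rewrite mulr_sumr.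
  by apply: eq_bigr => i _; rewrite mulrA (mulrC (w j)).
have s2 : (pairing c u).2 = \sum_j w' j * b' j.
  rewrite /pairing /=; under eq_bigr => i _ do rewrite ca' mulr_suml.
  rewrite exchange_big; apply: eq_bigr => j _; rewrite mulr_sumr.
  by apply: eq_bigr => i _; rewrite mulrA (mulrC (w' j)).
have [[j1 bj1]|nb] := pselect (exists j, b j != 0); last first.
  have b0 j : b j = 0 by apply: contrapT => /eqP h; apply: nb; exists j.
  have b0' j : b' j = 0 by apply: (fs_0 hRK (bb j)); exact: b0.
  have z1 : \sum_j w j * b j = 0 by rewrite big1 // => j _; rewrite b0 mulr0.
  have z2 : \sum_j w' j * b' j = 0 by rewrite big1 // => j _; rewrite b0' mulr0.
  by rewrite s1 s2 z1 z2 eqxx.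
have injn j : List.In j (enum 'I_m) by rewrite In_mem mem_enum.
have [j0 [_ j00 jmax]] := max_term (f := fun j => w j * b j) (injn j1) (mulf_neq0 (w0 j1) bj1).
have /andP[_ bj0] : (w j0 != 0) && (b j0 != 0) by rewrite -negb_or -mulf_eq0.
have GCw j : GC (w j, w' j) by exact: (fs_G hRC (ww j) (w0 j)).
have w0' j : w' j != 0 by case: (gs_nz hGC (GCw j)).
have RHb j : b j != 0 -> RH (b j, b' j) by move=> h; exact: (fs_G hRK (bb j) h).
have bj0' : b' j0 != 0 by case: (gs_nz hRH (RHb j0 bj0)).
pose t j := w j * b j / (w j0 * b j0); pose t' j := w' j * b' j / (w' j0 * b' j0).
have it j : integral (t j) by exact: jmax.
have e1 : Ek (vres 1, vres 1) by rewrite res1; exact: (rr_1 hEk).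
have u1 : unit_el (1 : K) := unit1 M.
have Gt j : b j != 0 -> amalgam_group (t j, t' j).
  move=> h; exists (w j / w j0, w' j / w' j0), (b j / b j0, b' j / b' j0), (1, 1); split=> //.
  - exact: (gs_div hGC (GCw j) (GCw j0)).
  - exact: (gs_div hRH (RHb j h) (RHb j0 bj0)).
  - by rewrite /t /t' /=; congr pair; field; rewrite ?bj0 ?bj0' ?w0 ?w0'.
have rt j : res_rel Ek (t j, t' j).
  have [h|h] := eqVneq (b j) 0; last exact: (gs_integral amalgam_gsys hEk hEG elG (Gt j h) (it j)).
  have h' : b' j = 0 by exact: (fs_0 hRK (bb j)).
  rewrite /t /t' h h' !mulr0 !mul0r; split; [exact: integral0|exact: integral0|].
  by rewrite /= res0; exact: (rr_0 hEk).
have hS : res_rel Ek (\sum_j t j, \sum_j t' j).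
  by apply: (rr_sum (res_rel_ring hEk)) => j _; exact: rt.
have [iS iS' eS] := hS.
have E1 : (pairing c u).1 = w j0 * b j0 * \sum_j t j.
  rewrite s1 mulr_sumr; apply: eq_bigr => j _.
  by rewrite /t; field; rewrite bj0 w0.
have E2 : (pairing c u).2 = w' j0 * b' j0 * \sum_j t' j.
  rewrite s2 mulr_sumr; apply: eq_bigr => j _.
  by rewrite /t'; field; rewrite bj0' w0'.
have uS : unit_el (\sum_j t j).
  apply/(res_unit iS); apply/eqP; rewrite res_sum => [rS|j _]; last exact: it.
  (* Only the terms of maximal value contribute to the residue of the sum. *)
  pose J := [set j : 'I_m | vres (t j) != 0]%SET.
  have tb j : j \in J -> b j != 0.
    by rewrite inE; apply: contra_neq => e; rewrite /t e mulr0 mul0r res0.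
  (* The values of the two factors of a unit [t j] are opposite, hence in val(A); [d] serves to
     split [t j] into two units. *)
  have hd j : exists d, j \in J -> [/\ A d, d != 0 & v d = v (w j / w j0)].
    have [jJ|njJ] := boolP (j \in J); last by exists 0.
    have [|d hd] := indep_G (gs_div hGC (GCw j) (GCw j0)) (gs_div hRH (RHb j (tb j jJ)) (RHb j0 bj0)) .
      have n1 : w j / w j0 != 0 by rewrite mulf_neq0 ?invr_neq0.
      have n2 : b j / b j0 != 0 by rewrite mulf_neq0 ?invr_neq0 // tb.
      rewrite /= -(vM n1 n2).
      have -> : w j / w j0 * (b j / b j0) = t j by rewrite /t; field; rewrite bj0 w0.
      by move: jJ; rewrite inE => /(res_unit (it j))/unit_elP[].
    by exists d.
  have [d dP] := choice hd.
  pose e j := w j / (d j * w j0); pose f j := d j * b j / b j0.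
  have eP j : j \in J -> [/\ unit_el (e j), unit_el (f j), t j = e j * f j,
     Ck (vres (e j), vres (w' j / (d j * w' j0))) & Rk (vres (f j), vres (d j * b' j / b' j0))].
    move=> jJ; have [Ad d0 vd] := dP j jJ; have bj := tb j jJ.
    have h1 := gs_div hGC (gs_div hGC (GCw j) (GCw j0)) (gs_A hGC Ad d0).
    have h2 := gs_M hRH (gs_A hRH Ad d0) (gs_div hRH (RHb j bj) (RHb j0 bj0)).
    have vw : v (w j / (d j * w j0)) = 0.
      by move: vd; rewrite !vM ?invr_neq0 ?mulf_neq0 // !vV ?mulf_neq0 // vM // => ->; rewrite subrK subrr.
    have te : t j = e j * f j by rewrite /t /e /f; field; rewrite bj0 d0 w0.
    have ue : unit_el (e j) by apply/unit_elP; rewrite /e mulf_neq0 ?invr_neq0 ?mulf_neq0.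
    have uf : unit_el (f j).
      have -> : f j = t j / e j by rewrite te mulrC mulKf //; case/unit_elP: ue.
      by apply/unitM/unitV => //; apply/(res_unit (it j)); rewrite inE in jJ.
    split=> //.
      have x1 : w j / w j0 / d j = w j / (d j * w j0) by field; rewrite d0 w0.
      have x2 : w' j / w' j0 / d j = w' j / (d j * w' j0) by field; rewrite d0 w0'.
      by have := gs_k hGC h1; rewrite /= x1 x2; apply.
    have := gs_k hRH h2; rewrite /= !mulrA; apply.
    by case/unit_elP: uf.
  have rt0 j : j \in J -> vres (t j) = vres (f j) * vres (e j).
    move=> jJ; have [ue uf -> _ _] := eP j jJ.
    by rewrite (resM (unit_integral ue) (unit_integral uf)) mulrC.
  have j0J : j0 \in J by rewrite inE /t divff // res1 oner_neq0.
  have [_ uf0 _ _ _] := eP j0 j0J.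
  have := (res_unit (unit_integral uf0)).1 uf0; apply/negP; rewrite negbK; apply/eqP.
  apply: (lin_disjoint_in (u := fun j => vres (e j)) (c := fun j => vres (f j)) (J := J) indep_k _ _ _ _ _ j0J).
  - by exists 0; [split; [exact: (A0 Asub)|exact: integral0]|exact: res0].
  - by move=> j /eP[_ _ _ h _]; eexists; exact: h.
  (* A relation over res(A) among the residues of the [e j], lifted to [A], would produce a
     combination of [w] with cancellation, against [norming]. *)
  - move=> r Ar sr j jJ; apply: contrapT => /eqP rj.
    have /choice[al hal] : forall i, exists x, [/\ A x, integral x & vres x = r i].
      by move=> i; have [x [Ax ix] <-] := Ar i; exists x.
    have [Aal ial ral] := hal j.
    have ualj : unit_el (al j) by apply/res_unit => //; rewrite ral.
    have [al0 _] := (unit_elP _).1 ualj.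
    pose g i := if i \in J then al i / d i else 0.
    have [Ad d0 _] := dP j jJ; have [uej _ _ _ _] := eP j jJ.
    have [ej0 _] := (unit_elP _).1 uej.
    have gj : g j = al j / d j by rewrite /g jJ.
    have gE i : g i * w i / (g j * w j) = (if i \in J then al i * e i else 0) / (al j * e j).
      rewrite gj /g; case: ifP => iJ; last by rewrite !mul0r.
      have [_ di _] := dP i iJ; rewrite /e.
      by field; rewrite d0 di !w0 al0.
    have ij : integral (al j * e j)^-1 by apply/unit_integral/unitV/unitM.
    have ii i : integral (if i \in J then al i * e i else 0).
      case: ifP => iJ; last exact: integral0.
      have [h _ _ _ _] := eP i iJ; have [_ h' _] := hal i.
      by apply: integralM => //; exact: unit_integral.
    have gA i : A (g i).
      rewrite /g; case: ifP => iJ; last exact: (A0 Asub).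
      by have [h _ _] := hal i; have [h' _ _] := dP i iJ; exact: (Adiv Asub).
    have g0 : g j != 0 by rewrite gj mulf_neq0 ?invr_neq0.
    have gi i : integral (g i * w i / (g j * w j)) by rewrite gE; exact: integralM.
    have := nw g j gA g0 gi; under eq_bigr => i _ do rewrite gE.
    rewrite -mulr_suml => us.
    have : unit_el (\sum_i (if i \in J then al i * e i else 0)).
      rewrite -[X in unit_el X](divfK (mulf_neq0 al0 ej0)).
      by apply: unitM => //; exact: unitM.
    move=> us'; have := (res_unit (unit_integral us')).1 us'.
    rewrite res_sum => [|i _]; last exact: ii.
    have -> : \sum_i vres (if i \in J then al i * e i else 0) = \sum_(j in J) r j * vres (e j).
      rewrite [RHS]big_mkcond; apply: eq_bigr => i _; case: ifP => iJ; last exact: res0.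
      have [h _ _ _ _] := eP i iJ; have [_ h' <-] := hal i.
      by rewrite resM //; exact: unit_integral.
    by rewrite sr eqxx.
  - by move=> j /eP[_ _ _ _ h]; eexists; exact: h.
  - rewrite -[RHS]rS [LHS]big_mkcond; apply: eq_bigr => j _; case: ifP => jJ; first by rewrite rt0.
    by apply/esym/eqP; move: jJ; rewrite inE => /negbFE.
have uS' : unit_el (\sum_j t' j).
  exact: (res_rel_unit hEk elk hS).1 uS.
have [S0 _] := (unit_elP _).1 uS.
split=> [/eqP|_]; first by rewrite E1 !mulf_eq0 (negPf (w0 j0)) (negPf bj0) (negPf S0).
exists (w j0, w' j0), (b j0, b' j0), (\sum_j t j, \sum_j t' j); split=> //; first exact: RHb.
by rewrite -E1 -E2.
Qed.

Definition combination (l : seq ((K * K) * (K * K))) : K * K :=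
  (\sum_(x <- l) x.1.1 * x.2.1, \sum_(x <- l) x.1.2 * x.2.2).

Definition combinations : set (K * K) :=
  [set combination l | l in [set l | forall x, List.In x l -> RC x.1 /\ RK x.2]].

Lemma combination_value s : combinations s -> (s.1 = 0 -> s.2 = 0) /\ (s.1 != 0 -> amalgam_group s).
Proof.
move=> [l lP <-].
have := @pairing_value (size l) (fun i => (tnth (in_tuple l) i).1) (fun i => (tnth (in_tuple l) i).2).
rewrite /pairing /combination !(big_tnth _ _ l); apply=> i.
  by have [] := lP _ ((In_mem _ _).2 (mem_tnth i (in_tuple l))).
by have [] := lP _ ((In_mem _ _).2 (mem_tnth i (in_tuple l))).
Qed.

Lemma combinations_mul c u : RC c -> RK u -> combinations (c.1 * u.1, c.2 * u.2).
Proof.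
move=> Cc Ku; exists [:: (c, u)]; first by move=> x /= [<-|].
by rewrite /combination !big_seq1.
Qed.

Lemma combinations_C c : RC c -> combinations c.
Proof.
move=> Cc; have := combinations_mul Cc (rr_1 (fsys_ring Asub hRK)).
by rewrite !mulr1; case: c Cc.
Qed.

Lemma combinations_K u : RK u -> combinations u.
Proof.
move=> Ku; have := combinations_mul (rr_1 (fsys_ring Asub hRC)) Ku.
by rewrite !mul1r; case: u Ku.
Qed.

Lemma combinationsD s t : combinations s -> combinations t -> combinations (s.1 + t.1, s.2 + t.2).
Proof.
move=> [l lP <-] [m mP <-]; exists (l ++ m); last by rewrite /combination !big_cat.
by move=> x; rewrite In_cat => -[/lP|/mP].
Qed.

Lemma combinationsM s t : combinations s -> combinations t -> combinations (s.1 * t.1, s.2 * t.2).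
Proof.
move=> [l lP <-] [m mP <-].
pose pr (p q : K * K) := (p.1 * q.1, p.2 * q.2).
elim: l lP => [|x l IH] lP.
  by exists [::] => //; rewrite /combination /= !big_nil !mul0r.
have [|k kP e] := IH; first by move=> y h; apply: lP; right.
have [Cx Kx] := lP x (or_introl erefl).
have [k' k'P e'] : combinations (x.1.1 * x.2.1 * (combination m).1, x.1.2 * x.2.2 * (combination m).2).
  exists [seq (pr x.1 y.1, pr x.2 y.2) | y <- m].
    move=> z /In_map[y /mP[Cy Ky] <-]; split; first exact: (fs_M hRC Cx Cy).
    exact: (fs_M hRK Kx Ky).
  by rewrite /combination !big_map /= !mulr_sumr; congr pair; apply: eq_bigr => y _ /=; ring.
exists (k' ++ k); first by move=> z; rewrite In_cat => -[/k'P|/kP].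
rewrite /combination !big_cat /= !big_cons !mulrDl.
by move: e e'; rewrite /combination => -[-> ->] [-> ->].
Qed.

Lemma combinationsN s : combinations s -> combinations (- s.1, - s.2).
Proof.
move=> hs; have h := fs_A hRC (AN Asub (A1 Asub)).
by have := combinationsM (combinations_C h) hs; rewrite /= !mulN1r.
Qed.

Definition amalgam_field : set (K * K) := [set p | exists s t, [/\ combinations s, combinations t,
  t.1 != 0 & p = (s.1 / t.1, s.2 / t.2)]].

Lemma combination_nz s : combinations s -> s.1 != 0 -> s.2 != 0.
Proof. by move=> /combination_value[_ h] /h /(gs_nz amalgam_gsys)[]. Qed.

Lemma amalgam_fsys : fsys A amalgam_field amalgam_group.
Proof.
split.
- move=> a Aa; exists (a, a), (1, 1); split; rewrite ?oner_neq0 //= ?divr1 //.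
    exact/combinations_C/(fs_A hRC).
  exact/combinations_C/(fs_A hRC)/(A1 Asub).
- move=> _ _ [s [t [hs ht t0 ->]]] [s' [t' [hs' ht' t0' ->]]].
  exists (s.1 * t'.1 - s'.1 * t.1, s.2 * t'.2 - s'.2 * t.2), (t.1 * t'.1, t.2 * t'.2); split.
  + exact: (combinationsD (combinationsM hs ht') (combinationsN (combinationsM hs' ht))).
  + exact: combinationsM.
  + by rewrite mulf_neq0.
  + by congr pair => /=; field; rewrite ?t0 ?t0' ?combination_nz.
- move=> _ _ [s [t [hs ht t0 ->]]] [s' [t' [hs' ht' t0' ->]]].
  exists (s.1 * s'.1, s.2 * s'.2), (t.1 * t'.1, t.2 * t'.2); split.
  + exact: combinationsM.
  + exact: combinationsM.
  + by rewrite mulf_neq0.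
  + by congr pair => /=; field; rewrite ?t0 ?t0' ?combination_nz.
- move=> _ [s [t [hs ht t0 ->]]] /=; have [s0|s0] := eqVneq s.1 0.
    rewrite s0 (combination_value hs).1 // !mul0r invr0; exists (0, 0), t; split=> //; last by rewrite !mul0r.
    by have := combinationsD hs (combinationsN hs); rewrite !subrr.
  by exists t, s; split=> //; rewrite !invf_div.
- move=> _ [s [t [hs ht t0 ->]]] /=; rewrite mulf_eq0 negb_or => /andP[s0 _].
  by apply: (gs_div amalgam_gsys); exact: (combination_value _).2.
- move=> _ [s [t [hs ht t0 ->]]] /= /eqP.
  by rewrite mulf_eq0 invr_eq0 (negPf t0) orbF => /eqP/(combination_value hs).1 ->; rewrite mul0r.
Qed.

Lemma amalgam_system : system A D amalgam_field amalgam_group Ek EG.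
Proof.
have smc : injects combinations D.
  apply: small_image => //.
  apply: (@small_sub _ _ _ _ [set l | forall x, List.In x l -> (RC `*` RK) x]) => //.
  exact/small_seq/small_prod.
split=> //.
- exact: amalgam_fsys.
- exact: amalgam_gsys.
- apply: (@small_sub _ _ _ _ [set (p.1.1 / p.2.1, p.1.2 / p.2.2) | p in combinations `*` combinations]).
    by move=> _ [s [t [hs ht _ ->]]]; exists (s, t).
  by apply: small_image => //; exact: small_prod.
- have [S S_small Sn] := nearC; have [T T_small Tn] := nearH.
  have /choice[f hf] : forall u : vk M, exists x : K, integral x /\ vres x = u.
    by move=> u; have [x ? ?] := res_surj u; exists x.
  exists [set p.1.1 * p.1.2 * f p.2.1 | p in (S `*` T) `*` Ek].
    by apply: small_image => //; apply: small_prod => //; exact: small_prod.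
  move=> _ [c [h [w [/Sn[c' Sc nc] /Tn[h' Th nh] [wu wu'] we ->]]]] /=.
  exists (c' * h' * f (vres w.1)); first by exists ((c', h'), (vres w.1, vres w.2)).
  have [i1 e1] := hf (vres w.1).
  apply: nearM; first exact: nearM.
  by apply/near_res => //; apply/(res_unit i1); rewrite e1; exact/(res_unit (unit_integral wu)).
Qed.

Lemma amalgam_C : RC `<=` amalgam_field.
Proof.
move=> c Cc; exists c, (1, 1); split; rewrite ?oner_neq0 //= ?divr1; last by case: c Cc.
  exact: combinations_C.
exact/combinations_C/(fs_A hRC)/(A1 Asub).
Qed.

Lemma amalgam_K : RK `<=` amalgam_field.
Proof.
move=> c Cc; exists c, (1, 1); split; rewrite ?oner_neq0 //= ?divr1; last by case: c Cc.
  exact: combinations_K.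
exact/combinations_C/(fs_A hRC)/(A1 Asub).
Qed.

Lemma amalgam_H : RH `<=` amalgam_group.
Proof.
move=> [h h'] Hh; exists (1, 1), (h, h'), (1, 1); split=> //.
- exact: (gs_A hGC (A1 Asub) (oner_neq0 _)).
- by split; exact: unit1.
- by rewrite res1; exact: (rr_1 hEk).
- by rewrite /= !mulr1 !mul1r.
Qed.

End Amalgam.

(** * Initial systems, maps between copies of C, restrictions of automorphisms *)

Section Relations.
Variable M : valuedField.
Notation MM := (vf_struct M).
Notation K := (vK M).
Variables (A : set K) (U : Type) (D : set U).
Hypothesis Dinf : injects [set: nat] D.
Hypothesis Msat : saturated MM D.
Hypothesis Asub : subfield A.
Hypothesis Asm : injects A D.
Hypothesis Mhens : henselian M.
Hypothesis Mchar : [pchar (vk M)] =i pred0.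
Hypothesis Acosets : forall n (x : K), (0 < n)%N -> x != 0 ->
  exists a y, [/\ A a, a != 0 & x = a * y ^+ n].
Hypothesis Aunits : forall n (x : K), (0 < n)%N -> unit_el x ->
  exists a y, [/\ A a, unit_el a, unit_el y & vres a = vres x * vres y ^+ n].

Lemma near_unit (x y : K) : near x y -> unit_el x -> unit_el y.
Proof. by move=> n /unit_elP[_ vx]; have [_ y0 _] := n; apply/unit_elP; rewrite -(near_v n). Qed.

Lemma near_vres (x y : K) : near x y -> unit_el x -> vres x = vres y.
Proof. by move=> n ux; apply/near_res => //; exact: near_unit n ux. Qed.

(** Saturation under equality of leading terms, as [gs_1] demands. *)
Definition near_rel (R : set (K * K)) : set (K * K) :=
  [set p | exists2 q, R q & near q.1 p.1 /\ near q.2 p.2].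

Lemma near_rel_gsys (R : set (K * K)) (Rk : set (vk M * vk M)) (RG : set (vG M * vG M)) :
  (forall a, A a -> a != 0 -> R (a, a)) ->
  (forall p q, R p -> R q -> R (p.1 * q.1, p.2 * q.2)) ->
  (forall p, R p -> R (p.1^-1, p.2^-1)) ->
  (forall p n, R p -> (0 < n)%N -> is_power n p.1 <-> is_power n p.2) ->
  (forall p, R p -> RG (v p.1, v p.2)) ->
  (forall p, R p -> unit_el p.1 -> unit_el p.2 /\ Rk (vres p.1, vres p.2)) ->
  gsys A (near_rel R) Rk RG.
Proof.
move=> hA hM hV hp hv hk; split.
- by move=> a Aa a0; exists (a, a); [exact: hA|split; exact: near_refl].
- move=> p q [p' Rp [p1 p2]] [q' Rq [q1 q2]]; exists (p'.1 * q'.1, p'.2 * q'.2); first exact: hM.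
  by split; exact: nearM.
- by move=> p [p' Rp [p1 p2]]; exists (p'.1^-1, p'.2^-1); [exact: hV|split; exact: nearV].
- by move=> p [p' Rp [[_ p1 _] [_ p2 _]]].
- move=> z z' hz hz'; exists (1, 1); first exact: (hA _ (A1 Asub) (oner_neq0 _)).
  have h (x : K) : small_el (x - 1) -> near 1 x.
    by move=> hx; apply: near_sym; have := near_mulr (oner_neq0 K) hx; rewrite mul1r.
  by split; exact: h.
- move=> p n [p' Rp [p1 p2]] n0.
  have h1 := near_power Mhens Mchar n0 p1; have h2 := near_power Mhens Mchar n0 p2.
  have h3 := hp _ _ Rp n0; exact: iff_trans (iff_sym h1) (iff_trans h3 h2).
- by move=> p [p' Rp [p1 p2]]; rewrite -(near_v p1) -(near_v p2); exact: hv.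
- move=> p [p' Rp [p1 p2]] vp; have [_ p10 _] := p1.
  have u1 : unit_el p'.1 by apply: near_unit (near_sym p1) _; apply/unit_elP.
  by have [u2 h] := hk _ Rp u1; rewrite -(near_vres p1 u1) -(near_vres p2 u2).
Qed.

(** The identity of [A] is compatible with any elementary maps fixing res(A) and val(A), and these
    two may be chosen independently of each other. *)
Lemma initial_system (Ek : set (vk M * vk M)) (EG : set (vG M * vG M)) :
  elem_k Ek -> elem_G EG -> injects Ek D -> injects EG D ->
  (forall u, res_of A u -> Ek (u, u)) -> (forall g, val_of A g -> EG (g, g)) ->
  exists F G Ek' EG', [/\ system A D F G Ek' EG', Ek `<=` Ek' & EG `<=` EG'].
Proof.
move=> elk elG smk smG EkA EGA.
have e0 : injects (set0 : set (vk M)) D by apply: (small_sub _ (small_set1 Dinf (0 : vk M))).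
have e0' : injects (set0 : set (vG M)) D by apply: (small_sub _ (small_set1 Dinf (0 : vG M))).
have [Ek' [sk ek' smk' hk' _]] := elem_k_close Dinf Msat elk smk e0.
have [EG' [sg eg' smg' hg' _]] := elem_G_close Dinf Msat elG smG e0'.
pose R : set (K * K) := [set p | [/\ A p.1, p.1 != 0 & p.2 = p.1]].
pose F : set (K * K) := [set p | A p.1 /\ p.2 = p.1].
exists F, (near_rel R), Ek', EG'; split=> //; split=> //.
- split=> /=.
  + by move=> a Aa.
  + by move=> p q [Ap ->] [Aq ->]; split=> //=; exact: (AB Asub).
  + by move=> p q [Ap ->] [Aq ->]; split=> //=; exact: (AM Asub).
  + by move=> p [Ap ->]; split=> //=; exact: (AV Asub).
  + move=> [x y] [/= Ap ->] p0; exists (x, x); first by split.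
    by split; exact: near_refl.
  + by move=> [x y] [/= _ ->].
- apply: near_rel_gsys => /=.
  + by move=> a Aa a0.
  + by move=> [x x'] [y y'] [/= ax x0 ->] [/= ay y0 ->]; split=> /=; [exact: (AM Asub)|rewrite mulf_neq0|].
  + by move=> [x x'] [/= ax x0 ->]; split=> /=; [exact: (AV Asub)|rewrite invr_neq0|].
  + by move=> [x x'] n [/= ax x0 ->].
  + by move=> [x x'] [/= ax x0 ->]; apply/sg/EGA; exists x => //; exact: val_v.
  + move=> [x x'] [/= ax x0 ->] ux; split=> //; apply/sk/EkA.
    by exists x => //; split=> //; exact: unit_integral.
- apply: (small_sub _ (small_image Dinf (fun a => (a, a)) Asm)).
  by move=> [x y] [/= Ax ->]; exists x.
- by exists A => // p [q [Aq _ _] [n _]]; exists q.1 => //; exact: near_sym.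
Qed.

Lemma amalgam_exists (RC GC RK RH : set (K * K)) (Ck Rk : set (vk M * vk M)) (CG RG : set (vG M * vG M)) :
  fsys A RC GC -> gsys A GC Ck CG -> fsys A RK RH -> gsys A RH Rk RG ->
  elem_k (Ck `|` Rk) -> elem_G (CG `|` RG) -> injects (Ck `|` Rk) D -> injects (CG `|` RG) D ->
  normed_set A [set x | exists x', RC (x, x')] ->
  (forall p q, GC p -> RH q -> v p.1 + v q.1 = 0 -> exists a, [/\ A a, a != 0 & v a = v p.1]) ->
  lin_disjoint [set u | exists u', Ck (u, u')] [set u | exists u', Rk (u, u')] (res_of A) ->
  injects RC D -> injects RK D ->
  (exists2 S : set K, injects S D & forall p, GC p -> exists2 q, S q & near p.1 q) ->
  (exists2 S : set K, injects S D & forall p, RH p -> exists2 q, S q & near p.1 q) ->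
  exists F G Ek EG, [/\ system A D F G Ek EG, RC `<=` F, RK `<=` F & [/\ RH `<=` G, Rk `<=` Ek & RG `<=` EG]].
Proof.
move=> hRC hGC hRK hRH elk elG smk smG nC iG ik sRC sRK nGC nRH.
have e0 : injects (set0 : set (vk M)) D by apply: (small_sub _ (small_set1 Dinf (0 : vk M))).
have e0' : injects (set0 : set (vG M)) D by apply: (small_sub _ (small_set1 Dinf (0 : vG M))).
have [Ek [sk ek' smk' hk' [hkV _]]] := elem_k_close Dinf Msat elk smk e0.
have [EG [sg eg' smg' hg' _]] := elem_G_close Dinf Msat elG smG e0'.
have ck : Ck `<=` Ek by move=> x h; apply: sk; left.
have rk : Rk `<=` Ek by move=> x h; apply: sk; right.
have cg : CG `<=` EG by move=> x h; apply: sg; left.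
have rg : RG `<=` EG by move=> x h; apply: sg; right.
exists (amalgam_field RC RK), (amalgam_group GC RH Ek), Ek, EG; split.
- exact: (amalgam_system Dinf Msat Asub Mhens Mchar Acosets Aunits hRC hGC hRK hRH).
- exact: (amalgam_C Asub hRC hRK).
- exact: (amalgam_K Asub hRC hRK).
- by split=> //; exact: (amalgam_H Asub hGC hk').
Qed.

Section Span.
Variables (C : set K) (F1 G1 F2 G2 : set (K * K)) (E1 E2 : set (vk M * vk M)) (H1 H2 : set (vG M * vG M)).
Hypotheses (Csub : subfield C) (AC : A `<=` C).
Hypotheses (hF1 : fsys A F1 G1) (hG1 : gsys A G1 E1 H1) (hF2 : fsys A F2 G2) (hG2 : gsys A G2 E2 H2).
Hypotheses (elH1 : elem_G H1) (hH1 : group_rel H1) (hE1 : ring_rel E1).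

(** [F1] and [F2] map C onto two copies; the relation goes from the first copy to the second by
    passing through C. *)
Definition span_field : set (K * K) := [set p | exists c, [/\ C c, F1 (c, p.1) & F2 (c, p.2)]].
Definition span_group : set (K * K) := [set p | exists c, [/\ C c, G1 (c, p.1) & G2 (c, p.2)]].
Definition span_k : set (vk M * vk M) := [set p | exists u, [/\ res_of C u, E1 (u, p.1) & E2 (u, p.2)]].
Definition span_G : set (vG M * vG M) := [set p | exists g, [/\ val_of C g, H1 (g, p.1) & H2 (g, p.2)]].

Lemma span_fsys : fsys A span_field span_group.
Proof.
split.
- by move=> a Aa; exists a; split; [exact: AC|exact: (fs_A hF1)|exact: (fs_A hF2)].
- move=> p q [c [Cc p1 p2]] [d [Cd q1 q2]]; exists (c - d); split; first exact: (AB Csub).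
  + exact: (fs_B hF1 p1 q1).
  + exact: (fs_B hF2 p2 q2).
- move=> p q [c [Cc p1 p2]] [d [Cd q1 q2]]; exists (c * d); split; first exact: (AM Csub).
  + exact: (fs_M hF1 p1 q1).
  + exact: (fs_M hF2 p2 q2).
- move=> p [c [Cc p1 p2]]; exists c^-1; split; first exact: (AV Csub).
  + exact: (fs_V hF1 p1).
  + exact: (fs_V hF2 p2).
- move=> p [c [Cc p1 p2]] p0.
  have c0 : c != 0 by apply: contra_neq p0 => c0; exact: (fs_0 hF1 p1).
  by exists c; split=> //; [exact: (fs_G hF1)|exact: (fs_G hF2)].
- move=> p [c [Cc p1 p2]] p0; apply: (fs_0 hF2 p2) => /=; apply: contrapT => /eqP c0.
  by have [_] := gs_nz hG1 (fs_G hF1 p1 c0); rewrite /= p0 eqxx.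
Qed.

Lemma span_gsys : gsys A span_group span_k span_G.
Proof.
split.
- by move=> a Aa a0; exists a; split; [exact: AC|exact: (gs_A hG1)|exact: (gs_A hG2)].
- move=> p q [c [Cc p1 p2]] [d [Cd q1 q2]]; exists (c * d); split; first exact: (AM Csub).
  + exact: (gs_M hG1 p1 q1).
  + exact: (gs_M hG2 p2 q2).
- move=> p [c [Cc p1 p2]]; exists c^-1; split; first exact: (AV Csub).
  + exact: (gs_V hG1 p1).
  + exact: (gs_V hG2 p2).
- by move=> p [c [Cc /(gs_nz hG1)[_ ?] /(gs_nz hG2)[_ ?]]].
- have s1 : small_el (1 - 1 : K) by rewrite subrr; exact: small0.
  by move=> z z' hz hz'; exists 1; split; [exact/AC/(A1 Asub)|exact: (gs_1 hG1)|exact: (gs_1 hG2)].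
- move=> p n [c [Cc p1 p2]] n0.
  exact: iff_trans (iff_sym (gs_pow hG1 p1 n0)) (gs_pow hG2 p2 n0).
- move=> p [c [Cc p1 p2]]; have [c0 _] := gs_nz hG1 p1; exists (v c); split.
  + by exists c => //; exact: val_v.
  + exact: (gs_v hG1 p1).
  + exact: (gs_v hG2 p2).
- move=> p [c [Cc p1 p2]] vp; have [c0 _] := gs_nz hG1 p1.
  have vc : v c = 0 by apply: (elem_G_eq elH1 (gs_v hG1 p1) hH1.1).2.
  exists (vres c); split.
  + by exists c => //; split=> //; apply/unit_integral/unit_elP.
  + exact: (gs_k hG1 p1).
  + exact: (gs_k hG2 p2).
Qed.

Hypothesis elE1 : elem_k E1.
Hypothesis dom1 : forall c, C c -> exists x, F1 (c, x).
Hypothesis dom2 : forall c, C c -> exists x, F2 (c, x).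

Lemma fs_unit p : F1 p -> unit_el p.1 <-> unit_el p.2.
Proof.
move=> hp; split=> u.
  have [p0 vp] := (unit_elP _).1 u; have Gp := fs_G hF1 hp p0.
  apply/unit_elP; split; first by case: (gs_nz hG1 Gp).
  exact: (elem_G_eq elH1 (gs_v hG1 Gp) hH1.1).1.
have [p0' vp] := (unit_elP _).1 u.
have p0 : p.1 != 0 by apply: contra_neq p0' => e; exact: (fs_0 hF1 hp).
apply/unit_elP; split=> //; exact: (elem_G_eq elH1 (gs_v hG1 (fs_G hF1 hp p0)) hH1.1).2.
Qed.

Lemma fs_integral p : F1 p -> integral p.2 -> integral p.1.
Proof.
move=> hp i2; have [p0|p0] := eqVneq p.1 0; first by rewrite p0; exact: integral0.
have Gp := fs_G hF1 hp p0; have [_ p0'] := gs_nz hG1 Gp.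
apply/integralP; right; rewrite (elem_G_le elH1 (gs_v hG1 Gp) hH1.1).
by case/integralP: i2 => // e; rewrite e eqxx in p0'.
Qed.

(** [norming] only involves integrality, which [F1] reflects, and units, which it preserves. *)
Lemma span_normed : normed_set A C -> normed_set A [set x | exists x', span_field (x, x')].
Proof.
have rF1 := fsys_ring Asub hF1.
move=> nC n c cC; have /choice[d dP] : forall i, exists d, C d /\ F1 (d, c i).
  by move=> i; have [x' [d [h1 h2 _]]] := cC i; exists d.
have [|m [w [a [Cw w0 Aa da nw]]]] := nC n d; first by move=> i; case: (dP i).
have /choice[W WP] : forall j, exists x, F1 (w j, x) by move=> j; exact: dom1.
exists m, W, a; split=> //.
- by move=> j; have [x' h] := dom2 (Cw j); exists x', (w j).
- by move=> j; case: (gs_nz hG1 (fs_G hF1 (WP j) (w0 j))).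
- move=> i; have h : F1 (d i, \sum_j a i j * W j).
    rewrite da; apply: (rr_sum rF1) => j _; exact: (rr_M rF1 (fs_A hF1 (Aa i j)) (WP j)).
  by apply: (fs_fun hF1 _ h); case: (dP i).
- move=> b j Ab bj bi.
  have h i : F1 (b i * w i / (b j * w j), b i * W i / (b j * W j)).
    have e k := fs_M hF1 (fs_A hF1 (Ab k)) (WP k).
    exact: (fs_M hF1 (e i) (fs_V hF1 (e j))).
  apply: (fs_unit (p := (\sum_i b i * w i / (b j * w j), _)) _).1.
    by apply: (rr_sum rF1) => i _; exact: h.
  by apply: nw => // i; exact: (fs_integral (h i) (bi i)).
Qed.

Lemma span_near : injects C D ->
  exists2 S : set K, injects S D & forall p, span_group p -> exists2 q, S q & near p.1 q.
Proof.
move=> Csm; have h (c : K) : exists x, forall y, G1 (c, y) -> near y x.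
  have [[y Gy]|n] := pselect (exists y, G1 (c, y)); last by exists 0 => y Gy; case: n; exists y.
  by exists y => y' Gy'; exact: (gs_fun hG1 hE1 hH1 elE1 elH1 Gy' Gy).
have [r hr] := choice h; exists (r @` C); first exact: small_image.
by move=> p [c [Cc p1 _]]; exists (r c); [exists c|exact: hr].
Qed.

Lemma span_small : injects C D -> injects span_field D.
Proof.
move=> Csm; have /choice[f hf] : forall c, exists p, forall x y, F1 (c, x) -> F2 (c, y) -> p = (x, y).
  move=> c; have [[[x y] [/= h1 h2]]|n] := pselect (exists p, F1 (c, p.1) /\ F2 (c, p.2)).
    by exists (x, y) => x' y' h1' h2'; rewrite (fs_fun hF1 h1 h1') (fs_fun hF2 h2 h2').
  by exists (0, 0) => x y h1 h2; case: n; exists (x, y).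
apply: small_sub (small_image Dinf f Csm) => -[x y] [c [Cc h1 h2]].
by exists c => //; exact: hf.
Qed.

End Span.

Section Automorphism.
Variable sigma : forall s, MM s -> MM s.
Hypothesis autM : automorphism sigma.
Let sK : K -> K := sigma (s := SK).
Let sk : vk M -> vk M := sigma (s := Sk).
Let sG : vG M -> vG M := sigma (s := SG).
Let sR : vRV M -> vRV M := sigma (s := SRV).

Lemma aut_fun (f : vf_fsym) (a : forall i : 'I_(vf_farity f), MM (vf_fsort f)) :
  sigma (@finterp vf_sig MM f a) = @finterp vf_sig MM f (fun i => sigma (a i)).
Proof. by case: autM => _ h _; exact: h. Qed.

Let no (i : 'I_0) : False := notF (valP i).

Let pair2 T (x y : T) : 'I_2 -> T := fun i => if nat_of_ord i is 0%N then x else y.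

Lemma aut_inj s : injective (@sigma s).
Proof. by case: autM => h _ _; exact: bij_inj. Qed.

Lemma aut_D x y : sK (x + y) = sK x + sK y.
Proof. exact: (@aut_fun (FK RAdd) (pair2 x y)). Qed.
Lemma aut_M x y : sK (x * y) = sK x * sK y.
Proof. exact: (@aut_fun (FK RMul) (pair2 x y)). Qed.
Lemma aut_N x : sK (- x) = - sK x.
Proof. exact: (@aut_fun (FK ROpp) (fun=> x)). Qed.
Lemma aut_1 : sK 1 = 1.
Proof. exact: (@aut_fun (FK ROne) (fun i : 'I_0 => False_rect _ (no i))). Qed.
Lemma aut_0 : sK 0 = 0.
Proof. exact: (@aut_fun (FK RZero) (fun i : 'I_0 => False_rect _ (no i))). Qed.
Lemma aut_B x y : sK (x - y) = sK x - sK y.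
Proof. by rewrite aut_D aut_N. Qed.
Lemma aut_eq0 x : (sK x == 0) = (x == 0).
Proof. by rewrite -{1}aut_0 (inj_eq (@aut_inj SK)). Qed.
Lemma aut_V x : sK x^-1 = (sK x)^-1.
Proof.
have [->|x0] := eqVneq x 0; first by rewrite invr0 aut_0 invr0.
by apply: (mulfI (x := sK x)); rewrite ?aut_eq0 // -aut_M !mulfV ?aut_eq0 ?aut_1.
Qed.
Lemma aut_X x n : sK (x ^+ n) = sK x ^+ n.
Proof. by elim: n => [|n IH]; rewrite ?expr0 ?aut_1 // !exprS aut_M IH. Qed.

Lemma aut_val x g : vval x = Some g -> vval (sK x) = Some (sG g).
Proof.
case: autM => _ _ h.
exact: (h Rval (fun i : 'I_2 => let: Ordinal m h := i in
    match m as m return forall h : (m < 2)%N, MM (vf_rdom Rval (Ordinal h)) with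
    | 0%N => fun _ => x | _.+1 => fun _ => g end h)).1.
Qed.
Lemma aut_v x : x != 0 -> v (sK x) = sG (v x).
Proof. by move=> x0; rewrite /v (aut_val (val_v x0)). Qed.
Lemma aut_res x : integral x -> integral (sK x) /\ vres (sK x) = sk (vres x).
Proof.
case: autM => _ _ h ix.
apply: (h Rres (fun i : 'I_2 => let: Ordinal m h := i in
    match m as m return forall h : (m < 2)%N, MM (vf_rdom Rres (Ordinal h)) with
    | 0%N => fun _ => x | _.+1 => fun _ => vres x end h)).1.
by split.
Qed.
Lemma aut_rv x : x != 0 -> vrv (sK x) = sR (vrv x).
Proof.
case: autM => _ _ h x0.
by case: ((h Rrv (fun i : 'I_2 => let: Ordinal m h := i in
    match m as m return forall h : (m < 2)%N, MM (vf_rdom Rrv (Ordinal h)) with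
    | 0%N => fun _ => x | _.+1 => fun _ => vrv x end h)).1 (conj x0 erefl)).
Qed.
Lemma aut_near x y : near x y -> near (sK x) (sK y).
Proof.
move=> n; have [x0 y0 _] := n.
by apply/rv_near; rewrite ?aut_eq0 // !aut_rv //; congr sR; apply/rv_near.
Qed.
Lemma aut_G0 : sG 0 = 0.
Proof. exact: (@aut_fun (FG GOne) (fun i : 'I_0 => False_rect _ (no i))). Qed.
Lemma aut_unit x : unit_el x -> unit_el (sK x).
Proof. by move=> u; rewrite /unit_el (aut_val u) aut_G0. Qed.

Hypothesis fixA : forall a, A a -> sK a = a.
Variables (K0 H : set K) (k0 : set (vk M)) (G0 : set (vG M)).
Hypotheses (K0sub : subfield K0) (AK0 : A `<=` K0).
Hypothesis K0H : forall x, K0 x -> x != 0 -> H x.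
Hypothesis H_M : forall x y, H x -> H y -> H (x * y).
Hypothesis H_V : forall x, H x -> H x^-1.
Hypothesis H_nz : forall x, H x -> x != 0.
Hypothesis H_res : forall x, H x -> unit_el x -> k0 (vres x).
Hypothesis H_val : forall x, H x -> G0 (v x).

Definition aut_field : set (K * K) := [set p | K0 p.1 /\ p.2 = sK p.1].
(** [H] may contain more than the nonzero elements of [K0], because a leading term can be controlled
    without any representative of it being so. *)
Definition aut_group : set (K * K) := near_rel [set p | H p.1 /\ p.2 = sK p.1].
Definition aut_k : set (vk M * vk M) := [set p | k0 p.1 /\ p.2 = sk p.1].
Definition aut_G : set (vG M * vG M) := [set p | G0 p.1 /\ p.2 = sG p.1].

Lemma aut_fsys : fsys A aut_field aut_group.
Proof.
split.
- by move=> a Aa; split; [exact: AK0|rewrite /= fixA].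
- by move=> p q [p1 ->] [q1 ->]; split; [exact: (AB K0sub)|rewrite /= aut_B].
- by move=> p q [p1 ->] [q1 ->]; split; [exact: (AM K0sub)|rewrite /= aut_M].
- by move=> p [p1 ->]; split; [exact: (AV K0sub)|rewrite /= aut_V].
- move=> [x y] [/= p1 ->] x0; exists (x, sK x); first by split=> //; exact: K0H.
  by split; apply: near_refl; rewrite ?aut_eq0.
- by move=> p [p1 ->] ->; rewrite aut_0.
Qed.

Lemma aut_gsys : gsys A aut_group aut_k aut_G.
Proof.
have pw n x : is_power n x -> is_power n (sK x) by move=> [y ->]; exists (sK y); rewrite aut_X.
apply: near_rel_gsys.
- by move=> a Aa a0; split; [exact/K0H/a0/AK0|rewrite /= fixA].
- by move=> p q [p1 ->] [q1 ->]; split; [exact: H_M|rewrite /= aut_M].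
- by move=> p [p1 ->]; split; [exact: H_V|rewrite /= aut_V].
- move=> p n [p1 ->] n0; split; first exact: pw.
  move=> [y e]; have [/(_ SK)[g gK1 gK2] _ _] := autM.
  exists (g y); apply: (@aut_inj SK); change (sK p.1 = sK (g y ^+ n)).
  by rewrite e aut_X; congr (_ ^+ n); exact/esym/gK2.
- by move=> p [p1 ->]; split; [exact: H_val|rewrite /= aut_v //; exact: H_nz].
- move=> p [p1 ->] u; split; first exact: aut_unit.
  by split; [exact: H_res|case: (aut_res (unit_integral u))].
Qed.

End Automorphism.

End Relations.


(** * Nonforking in ordered abelian groups *)

Section OrderedGroup.
Variable M : valuedField.
Notation Gm := (vG M).
Notation GG := (ogroup_struct (vG M)).
Implicit Types g h x y : Gm.

Definition gabs g : Gm := if 0 <= g then g else - g.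

Lemma gle_addr g h k : (g + k <= h + k) = (g <= h).
Proof. by rewrite !(addrC _ k) gle_add2l. Qed.

Lemma gle_add g h g' h' : g <= h -> g' <= h' -> g + g' <= h + h'.
Proof. by move=> a b; apply: (le_trans (y := h + g')); rewrite ?gle_addr ?gle_add2l. Qed.

Lemma gle_opp g h : (- g <= - h) = (h <= g).
Proof. by rewrite (gle_sub (- g)) opprK addrC -gle_sub. Qed.

Lemma gle_sub0 g h : (0 <= h - g) = (g <= h).
Proof. by rewrite -(gle_addr 0 (h - g) g) add0r subrK. Qed.

Lemma gle_muln g h n : g <= h -> g *+ n <= h *+ n.
Proof. by move=> gh; elim: n => [|n IH]; rewrite ?mulr0n // !mulrS; exact: gle_add. Qed.

Lemma gle_total g h : g <= h \/ h <= g.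
Proof. by have /orP[] := vG_total g h; [left|right]. Qed.

Lemma gabs_cases g : (0 <= g /\ gabs g = g) \/ (g <= 0 /\ gabs g = - g).
Proof.
rewrite /gabs; case: ifP => h; [by left|right; split=> //].
by have [e|//] := gle_total 0 g; rewrite e in h.
Qed.

Lemma gabs_ge0 g : 0 <= gabs g.
Proof. by have [[h ->]|[h ->]] := gabs_cases g; rewrite // -oppr0 gle_opp. Qed.

Lemma gabs_le g h : gabs g <= h <-> g <= h /\ - g <= h.
Proof.
have n (x : Gm) : 0 <= x -> - x <= x.
  by move=> x0; apply: (le_trans (y := 0)) => //; rewrite -oppr0 gle_opp.
have [[g0 ->]|[g0 ->]] := gabs_cases g; split=> [gh|[]//]; split=> //.
  exact: le_trans (n _ g0) gh.
by apply: le_trans gh; rewrite -{1}(opprK g); apply: n; rewrite -oppr0 gle_opp.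
Qed.

Lemma gabsN g : gabs (- g) = gabs g.
Proof.
apply/eqP; rewrite eq_le; apply/andP; split; apply/gabs_le.
  by rewrite opprK; have [h1 h2] := (gabs_le g (gabs g)).1 (lexx _).
by have [h1 h2] := (gabs_le (- g) (gabs (- g))).1 (lexx _); rewrite opprK in h2.
Qed.

Lemma gabsD g h : gabs (g + h) <= gabs g + gabs h.
Proof.
have [h1 h2] := (gabs_le g _).1 (lexx _); have [h3 h4] := (gabs_le h _).1 (lexx _).
by apply/gabs_le; rewrite opprD; split; exact: gle_add.
Qed.

Lemma gabsMn g n : gabs (g *+ n) = gabs g *+ n.
Proof.
have pos (x : Gm) : 0 <= x -> gabs (x *+ n) = x *+ n.
  by move=> x0; rewrite /gabs ifT //; have := gle_muln n x0; rewrite mul0rn.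
have [[g0 e]|[g0 e]] := gabs_cases g; rewrite e; first exact: pos.
rewrite -(pos (- g)); last by rewrite -oppr0 gle_opp.
by rewrite mulNrn gabsN.
Qed.

Lemma gabsMz g (i : int) : gabs (g *~ i) = gabs g *+ `|i|%N.
Proof.
case: i => n; first by rewrite -pmulrn gabsMn.
by rewrite NegzE mulrNz gabsN -pmulrn gabsMn abszN.
Qed.

Lemma gabs_eq0 g : gabs g <= 0 -> g = 0.
Proof.
move=> /gabs_le[h1 h2]; apply/eqP; rewrite eq_le h1.
by rewrite -gle_opp oppr0.
Qed.

(* Comparison of the quotients [a i / n i] without division. *)
Lemma min_quotient I (l : seq I) (a : I -> Gm) (n : I -> nat) i0 :
  (forall i, List.In i l -> (0 < n i)%N) -> List.In i0 l ->
  exists i, List.In i l /\ forall j, List.In j l -> a i *+ n j <= a j *+ n i.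
Proof.
have main (k : seq I) i1 : (0 < n i1)%N -> (forall i, List.In i k -> (0 < n i)%N) ->
    exists i, [/\ i = i1 \/ List.In i k, (0 < n i)%N, a i *+ n i1 <= a i1 *+ n i &
      forall j, List.In j k -> a i *+ n j <= a j *+ n i].
  elim: k i1 => [|j k IH] i1 n1 npos; first by exists i1; split=> //; left.
  have nj := npos j (or_introl erefl).
  have nk i : List.In i k -> (0 < n i)%N by move=> h; apply: npos; right.
  have tr (x y z : I) : (0 < n y)%N -> a x *+ n y <= a y *+ n x -> a y *+ n z <= a z *+ n y ->
      a x *+ n z <= a z *+ n x.
    move=> ny h1 h2; apply: (torsion_free_le ny).
    rewrite mulrnAC; apply: (le_trans (gle_muln (n z) h1)).
    by rewrite mulrnAC [X in _ <= X]mulrnAC; exact: gle_muln.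
  have [h|h] := gle_total (a j *+ n i1) (a i1 *+ n j).
    have [i [h1 h2 h3 h4]] := IH j nj nk; exists i; split=> //.
    - by right; case: h1 => [->|]; [left|right].
    - exact: tr nj h3 h.
    - by move=> m /= [<-|/h4].
  have [i [h1 h2 h3 h4]] := IH i1 n1 nk; exists i; split=> //.
  - by case: h1 => [->|h1]; [left|right; right].
  - by move=> m /= [<-|/h4//]; exact: tr n1 h3 h.
move=> npos hi; have [i [h1 _ _ h4]] := main l i0 (npos _ hi) npos.
by exists i; split=> //; case: h1 => [->|].
Qed.

Definition gterm (V : ctx unit) (t : asg GG V -> Gm) :=
  exists u : @term ogroup_sig V tt, forall e, eval e u = t e.

Lemma gterm_var (V : ctx unit) (y : V) : gterm (fun e : asg GG V => e y).
Proof.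
exists (@tcast ogroup_sig V (csort y) tt (unit_sort (csort y) tt) (@TVar ogroup_sig V y)) => e.
exact: (@eval_tcast ogroup_sig (vG M) (@zmod_interp (vG M))
    (fun _ (a : 'I_2 -> vG M) => a ord0 <= a ord_max)).
Qed.

Lemma gterm0 (V : ctx unit) : gterm (fun _ : asg GG V => 0).
Proof. by exists (ogroup_cst V tt). Qed.

Lemma gtermD (V : ctx unit) (t u : asg GG V -> Gm) : gterm t -> gterm u -> gterm (fun e => t e + u e).
Proof.
move=> [t' ht] [u' hu].
exists (@TApp ogroup_sig V GMul (fun i : 'I_2 => if nat_of_ord i is 0%N then t' else u')) => e.
by rewrite -ht -hu.
Qed.

Lemma gtermMn (V : ctx unit) (t : asg GG V -> Gm) n : gterm t -> gterm (fun e => t e *+ n).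
Proof.
move=> ht; elim: n => [|n [u hu]].
  by have [u hu] := gterm0 V; exists u => e; rewrite mulr0n.
have [w hw] := gtermD ht (ex_intro _ u hu).
by exists w => e; rewrite hw mulrS.
Qed.

Lemma gtermMz (V : ctx unit) (t : asg GG V -> Gm) (i : int) : gterm t -> gterm (fun e => t e *~ i).
Proof.
case: i => n ht; first exact: gtermMn.
have [u hu] := gtermMn n.+1 ht.
exists (@TApp ogroup_sig V GInv (fun=> u)) => e.
by rewrite NegzE mulrNz -pmulrn -hu.
Qed.

Variables (U : Type) (D : set U).
Hypothesis Dinf : injects [set: nat] D.
Hypothesis Msat : saturated (vf_struct M) D.

Notation gdefinable := (@definable_by ogroup_sig GG tt).

Lemma gdefinable_le (p : Gm) (k : int) : gdefinable (fun f => 0 <= p + f *~ k).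
Proof.
pose V := cadd (cone tt) (cone tt) : ctx unit.
have [t ht] := gtermD (gterm_var (inr tt : V)) (gtermMz k (gterm_var (inl tt : V))).
have [z hz] := gterm0 V.
exists (cone tt), (fun _ => p),
  (@FRel ogroup_sig V tt (fun i : 'I_2 => if nat_of_ord i is 0%N then z else t)); split.
  by exists (fun=> 0%N); split=> // -[] [].
move=> f; set e := asg_add _ _.
by rewrite -[sat _ _]/(is_true ((eval e z : Gm) <= (eval e t : Gm))) hz ht.
Qed.

Lemma gdefinable_dvd n : gdefinable (fun f => exists z, f = z *+ n).
Proof.
pose W : ctx unit := Ctx (fun _ : void => tt).
pose V := cadd (cone tt) W : ctx unit.
have [t ht] := gterm_var (Some (inl tt) : cext V tt).
have [u hu] := gtermMn n (gterm_var (None : cext V tt)).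
exists W, (fun v : void => match v return Gm with end), (FEx (FEq t u)); split.
  by exists (fun=> 0%N); split=> // -[].
move=> f; rewrite sat_ex; apply: ex_iff => z.
set e := asg_ext _ _.
by rewrite -[sat _ _]/(eval e t = eval e u) ht hu.
Qed.

Lemma gdefinable_neq0 (b : bool) : gdefinable (fun f => b -> f <> 0).
Proof.
pose W : ctx unit := Ctx (fun _ : void => tt).
pose V := cadd (cone tt) W : ctx unit.
have [t ht] := gterm_var (inl tt : V); have [z hz] := gterm0 V.
exists W, (fun v : void => match v return Gm with end), (if b then FNot (FEq t z) else FEq z z); split.
  by exists (fun=> 0%N); split=> // -[].
move=> f; set e := asg_add _ _; case: b; last by split.
rewrite sat_not -[sat _ _]/(eval e t = eval e z) ht hz.
by split=> [h _|]; [exact: h|exact].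
Qed.

Lemma group_saturated (P : set (Gm * int)) (b : bool) : injects P D ->
  (forall l N, (0 < N)%N -> (forall q, List.In q l -> P q) -> exists f, [/\ exists z, f = z *+ N,
     b -> f <> 0 & forall q, List.In q l -> 0 <= q.1 + f *~ q.2]) ->
  exists f, [/\ forall N, (0 < N)%N -> exists z, f = z *+ N, b -> f <> 0 & forall q, P q -> 0 <= q.1 + f *~ q.2].
Proof.
move=> Psm fin.
pose I := ({q | P q} + option nat)%type.
pose C (i : I) (f : Gm) : Prop := match i with
  | inl q => 0 <= (sval q).1 + f *~ (sval q).2
  | inr (Some n) => exists z, f = z *+ n.+1
  | inr None => b -> f <> 0 end.
have [|||f hf] := @saturated_definable_by _ GG tt U D I C Dinf (saturated_G Msat).
- apply: small_sum => //; first exact: small_sig.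
  by apply: (@small_nat _ _ Dinf _ (fun o : option nat => if o is Some n then n.+1 else 0%N)) => -[m|] [n|] _ _ //= -[->].
- move=> [q|[n|]] /=; [exact: gdefinable_le|exact: gdefinable_dvd|exact: gdefinable_neq0].
- move=> l.
  have [qs [N [N0 qP hq hN]]] : exists (qs : seq (Gm * int)) (N : nat), [/\ (0 < N)%N,
      forall q, List.In q qs -> P q,
      forall q, List.In (inl q) l -> List.In (sval q) qs &
      forall n, List.In (inr (Some n)) l -> (n.+1 %| N)%N].
    elim: l => [|i l [qs [N [N0 h1 h2 h3]]]]; first by exists [::], 1%N.
    case: i => [q|[n|]].
    + exists (sval q :: qs), N; split=> //.
      * by move=> q' /= [<-|/h1]; first exact: svalP.
      * by move=> q' /= [[->]|/h2]; [left|right].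
      * by move=> n /= [|/h3].
    + exists qs, (n.+1 * N)%N; split; rewrite ?muln_gt0 //.
      * by move=> q' /= [|/h2].
      * by move=> m /= [[->]|/h3 h]; [exact: dvdn_mulr|exact: dvdn_mull].
    + by exists qs, N; split=> // [q' /= [|/h2]|n /= [|/h3]].
  have [f [[z ez] hb hf]] := fin qs N N0 qP.
  exists f => -[q|[n|]] il //=; first exact/hf/hq.
  have /dvdnP[m mN] := hN n il; exists (z *+ m).
  by rewrite ez mN mulrnA.
exists f; split.
- by move=> [//|n] _; exact: (hf (inr (Some n))).
- exact: (hf (inr None)).
- by move=> q Pq; exact: (hf (inl (exist _ q Pq))).
Qed.

(** Small perturbations: y - x is divisible by every integer and negligible with respect to x. They
    are elementary in every saturated ordered abelian group, so no elimination of quantifiers is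
    called for. *)
Record close_rel (E : set (Gm * Gm)) : Prop := CloseRel {
  cr_group : group_rel E;
  cr_dvd : forall p N, E p -> (0 < N)%N -> exists z, p.2 - p.1 = z *+ N;
  cr_le : forall p m, E p -> gabs (p.2 - p.1) *+ m <= gabs p.1 }.

Lemma close_swap E : close_rel E -> close_rel (swap E).
Proof.
move=> [h1 h2 h3]; split.
- by split; [exact: h1.1|move=> [x y] [x' y']; exact: h1.2].
- move=> [x y] N Exy N0; have [z hz] := h2 _ N Exy N0; exists (- z).
  by rewrite mulNrn -hz /= opprB.
- move=> [x y] m Exy /=; have := h3 _ m.+1 Exy; rewrite /= mulrS -(gabsN (x - y)) opprB => h.
  rewrite -(gle_add2l _ _ (gabs (y - x))); apply: (le_trans h).
  by have := gabsD (y - x) x; rewrite subrK.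
Qed.

Lemma subrACA (a b c d : Gm) : (a - b) - (c - d) = (a - c) - (b - d).
Proof. by rewrite !opprD !opprK addrACA. Qed.

Lemma gabs_sign (w g : Gm) m (s : bool) : gabs w *+ m <= g -> 0 <= g + w *~ (if s then m%:Z else - m%:Z).
Proof.
rewrite -gabsMn => /gabs_le[h1 h2].
rewrite -(gle_add2l _ _ (- g)) addr0 addKr.
by case: s; [rewrite -gle_opp opprK|rewrite mulrNz gle_opp].
Qed.

Lemma sign_gabs (w g : Gm) m : (forall s : bool, 0 <= g + w *~ (if s then m%:Z else - m%:Z)) -> gabs w *+ m <= g.
Proof.
move=> h; rewrite -gabsMn; apply/gabs_le.
have := h true; have := h false; rewrite mulrNz -pmulrn => h1 h2; split.
  by rewrite -(gle_addr _ _ (- (w *+ m))) subrr.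
by rewrite -(gle_addr _ _ (w *+ m)) addNr.
Qed.

(** One looks for y' = y + f with f divisible and p.2 - p.1 + j f negligible with respect to p.1 + j
    y for all p in [E] and all j. Among finitely many constraints choose the one with least |p.1 + j
    y| / |j| and let f cancel its perturbation exactly. The other constraints follow from the
    hypothesis on a combination eliminating y. Saturation gives all constraints at once. *)
Lemma close_extend E y : close_rel E -> injects E D ->
  exists E' y', [/\ E `<=` E', close_rel E', injects E' D & E' (y, y')].
Proof.
move=> hE Esm; have hg := cr_group hE.
have divf p (j : int) N : E p -> j != 0 -> (0 < N)%N ->
    exists f, f *~ j = - (p.2 - p.1) /\ exists z, f = z *+ N.
  move=> Ep j0 N0; have n0 : (0 < `|j|)%N by rewrite absz_gt0.
  have Nj : (0 < N * `|j|)%N by rewrite muln_gt0 N0.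
  have [z hz] := cr_dvd hE Ep Nj; rewrite hz mulrnA.
  case: j {j0 n0 Nj hz} => n.
    exists (- (z *+ N)); split; first by rewrite -pmulrn mulNrn.
    by exists (- z); rewrite mulNrn.
  by exists (z *+ N); split; [rewrite NegzE mulrNz -pmulrn abszN|exists z].
have fin (l : seq (Gm * Gm * int)) N : (0 < N)%N -> (forall q, List.In q l -> E q.1) ->
    exists f, (exists z, f = z *+ N) /\ forall q m, List.In q l ->
      gabs (q.1.2 - q.1.1 + f *~ q.2) *+ m <= gabs (q.1.1 + y *~ q.2).
  move=> N0 lE; have [nz|[q0 q0l q00]] : (forall q, List.In q l -> q.2 = 0) \/ exists2 q, List.In q l & q.2 != 0.
    have [[q ql q0]|n] := pselect (exists2 q, List.In q l & q.2 != 0); first by right; exists q.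
    by left=> q ql; apply: contrapT => /eqP h; apply: n; exists q.
    exists 0; split=> [|q m ql]; first by exists 0; rewrite mul0rn.
    by rewrite (nz q ql) !mulr0z !addr0; exact: (cr_le hE m (lE q ql)).
  have [||[p0 j0] [inz pmin]] := @min_quotient _ (seq.filter (fun q : Gm * Gm * int => q.2 != 0) l)
      (fun q => gabs (q.1.1 + y *~ q.2)) (fun q => `|q.2|%N) q0.
  - by move=> q /In_filter[_]; rewrite absz_gt0.
  - by rewrite In_filter.
  have {inz} [p0l j00] := (In_filter _ _ _).1 inz; rewrite /= in j00.
  have [f [fj fN]] := divf p0 j0 N (lE _ p0l) j00 N0.
  exists f; split=> // -[p j] m ql /=; have Ep := lE _ ql; have Ep0 := lE _ p0l; rewrite /= in Ep Ep0.
  have J0 : (0 < `|j0| * 2)%N by rewrite muln_gt0 absz_gt0 j00.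
  (* This combination eliminates [y] between the constraint at hand and the minimal one. *)
  have Ew : E (p.1 *~ j0 - p0.1 *~ j, p.2 *~ j0 - p0.2 *~ j).
    exact: (hg.2 _ _ (gr_MnZ j0 hg Ep) (gr_MnZ j hg Ep0)).
  have e2 : p.2 *~ j0 - p0.2 *~ j - (p.1 *~ j0 - p0.1 *~ j) = (p.2 - p.1 + f *~ j) *~ j0.
    rewrite subrACA -!mulrzBl [RHS]mulrzDl; congr (_ + _).
    by rewrite mulrzAC fj mulNrz.
  have e1 : p.1 *~ j0 - p0.1 *~ j = (p.1 + y *~ j) *~ j0 - (p0.1 + y *~ j0) *~ j.
    by rewrite !mulrzDl opprD addrACA [y *~ j *~ j0]mulrzAC subrr addr0.
  (* The factor 2 pays for the two terms of the triangle inequality, the second being bounded by the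
     first through the minimality of [(p0, j0)]. *)
  apply: (torsion_free_le J0); have := cr_le hE (2 * m)%N Ew; rewrite /= e2 e1 gabsMz => h.
  have -> : gabs (p.2 - p.1 + f *~ j) *+ m *+ (`|j0| * 2) = gabs (p.2 - p.1 + f *~ j) *+ `|j0| *+ (2 * m).
    by rewrite -!mulrnA; congr (_ *+ _); rewrite mulnC mulnA.
  apply: (le_trans h); apply: (le_trans (gabsD _ _)); rewrite gabsN !gabsMz.
  rewrite mulrnA mulr2n gle_add2l.
  have [->|jn] := eqVneq j 0.
    by rewrite mulr0n; have := gle_muln `|j0| (gabs_ge0 (p.1 + y *~ 0)); rewrite mul0rn.
  by have := pmin (p, j); apply; rewrite In_filter.
pose sg (m : nat) (s : bool) : int := if s then m%:Z else - m%:Z.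
(* A bound on an absolute value is a pair of linear inequalities in f, indexed by the boolean
   sign. *)
pose cond (t : Gm * Gm * (int * nat * bool)) : Gm * int :=
  (gabs (t.1.1 + y *~ t.2.1.1) + (t.1.2 - t.1.1) *~ sg t.2.1.2 t.2.2, t.2.1.1 * sg t.2.1.2 t.2.2).
have condE t f : (cond t).1 + f *~ (cond t).2 =
    gabs (t.1.1 + y *~ t.2.1.1) + (t.1.2 - t.1.1 + f *~ t.2.1.1) *~ sg t.2.1.2 t.2.2.
  by rewrite /= -addrA mulrzA -mulrzDl.
have [||f [fN _ fP]] := @group_saturated (cond @` (E `*` [set: int * nat * bool])) false.
- apply: small_image => //; apply: small_prod => //.
  by apply: (@small_nat _ _ Dinf _ (@pickle _)) => a b _ _; exact: (pcan_inj (@pickleK _)).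
- move=> l N N0 lP.
  have [|m [m1 m2]] := @list_choice _ _ (fun q t => E t.1 /\ cond t = q) l.
    by move=> q /lP[t [Et _] e]; exists t.
  have [|f [fz hf]] := fin [seq (t.1, t.2.1.1) | t <- m] N N0.
    by move=> q /In_map[t /m1[q' _ [Et _]] <-].
  exists f; split=> // q /m2[t tm [Et <-]]; rewrite condE; apply: gabs_sign.
  have tin : List.In (t.1, t.2.1.1) [seq (t.1, t.2.1.1) | t <- m] by rewrite In_map; exists t.
  exact: (hf _ t.2.1.2 tin).
have fE p j m : E p -> gabs (p.2 - p.1 + f *~ j) *+ m <= gabs (p.1 + y *~ j).
  move=> Ep; apply: sign_gabs => s.
  by have := fP _ (ex_intro2 _ _ (p, (j, m, s)) (conj Ep I) erefl); rewrite condE.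
pose E' : set (Gm * Gm) := [set (t.1.1 + y *~ t.2, t.1.2 + (y + f) *~ t.2) | t in E `*` [set: int]].
have ed (p : Gm * Gm) j : p.2 + (y + f) *~ j - (p.1 + y *~ j) = p.2 - p.1 + f *~ j.
  by rewrite mulrzDl opprD addrACA (addrC (y *~ j)) addrK.
exists E', (y + f); split.
- by move=> [x x'] Ep; exists ((x, x'), 0); rewrite //= !mulr0z !addr0.
- split; first split.
  + by exists ((0, 0), 0); [split=> //; exact: hg.1|rewrite /= !mulr0z !addr0].
  + move=> _ _ [[p j] [/= Ep _] <-] [[q k] [/= Eq _] <-].
    exists ((p.1 - q.1, p.2 - q.2), j - k); first by split=> //; exact: hg.2.
    by rewrite /= !mulrzBr; congr pair; rewrite opprD addrACA.
  + move=> _ N [[p j] [/= Ep _] <-] N0; rewrite /= ed.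
    have [z hz] := cr_dvd hE Ep N0; have [z' hz'] := fN N N0.
    exists (z + z' *~ j); rewrite hz hz' mulrnDl; congr (_ + _).
    by rewrite !pmulrn mulrzAC.
  + by move=> _ m [[p j] [/= Ep _] <-] /=; rewrite ed; exact: fE.
- apply: small_image => //; apply: small_prod => //.
  by apply: (@small_nat _ _ Dinf _ (@pickle _)) => a b _ _; exact: (pcan_inj (@pickleK _)).
- by exists ((0, 0), 1); [split=> //; exact: hg.1|rewrite /= !mulr1z !add0r].
Qed.

(** Back-and-forth by [close_extend] and [close_swap]; negligibility with m = 1 already gives
    preservation of equality and order. *)
Lemma close_elementary E : close_rel E -> injects E D -> elem_G E.
Proof.
have fn E0 x y y' : close_rel E0 -> E0 (x, y) -> E0 (x, y') -> y = y'.
  move=> h h1 h2; have := cr_le h 1%N ((cr_group h).2 _ _ h1 h2).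
  rewrite /= subrr subr0 mulr1n [gabs 0]ifT ?lexx // => h0.
  by apply/eqP; rewrite -subr_eq0; apply/eqP; exact: gabs_eq0 h0.
have le0 E0 x y : close_rel E0 -> E0 (x, y) -> 0 <= x -> 0 <= y.
  move=> h h1 x0; have := cr_le h 1%N h1; rewrite /= mulr1n.
  have [[_ ->]|[xn ->]] := gabs_cases x.
    move=> /gabs_le[_]; rewrite opprB => h2.
    by rewrite -[X in _ <= X](addr0 x) gle_add2l -oppr0 gle_opp in h2.
  move=> h2; have e : x = 0 by apply/eqP; rewrite eq_le xn.
  rewrite e oppr0 in h2; have := gabs_eq0 h2; rewrite addr0 => ->; exact: lexx.
move=> hE Esm V e e' ee p.
elim: p E hE Esm e e' ee => [{}V s t u|{}V r a|{}V|{}V p hp q hq|{}V s p hp] E hE Esm e e' ee; try by [].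
- have ev s0 (w : @term ogroup_sig V s0) E0 (d d' : asg GG V) : close_rel E0 -> (forall z, E0 (d z, d' z)) ->
      E0 (eval d w, eval d' w).
    move=> h dd; have hg := cr_group h; elim: w => [x|[] a IH] /=; [exact: dd|exact: hg.1| | ].
      exact: (gr_N hg (IH ord0)).
    exact: (gr_D hg (IH ord0) (IH ord_max)).
  split=> /= E1.
    by apply: (fn _ _ _ _ hE (ev _ t _ _ _ hE ee)); rewrite E1; exact: ev.
  have hs := close_swap hE.
  by apply: (fn _ _ _ _ hs (ev _ t _ e' e hs ee)); rewrite E1; exact: (ev _ u _ e' e hs).
- have ev s0 (w : @term ogroup_sig V s0) E0 (d d' : asg GG V) : close_rel E0 -> (forall z, E0 (d z, d' z)) ->
      E0 (eval d w, eval d' w).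
    move=> h dd; have hg := cr_group h; elim: w => [x|[] b IH] /=; [exact: dd|exact: hg.1| | ].
      exact: (gr_N hg (IH ord0)).
    exact: (gr_D hg (IH ord0) (IH ord_max)).
  have main E0 (d d' : asg GG V) : close_rel E0 -> (forall z, E0 (d z, d' z)) ->
      sat (FRel a) d -> sat (FRel a) d'.
    move=> h dd /= h1; have := (cr_group h).2 _ _ (ev _ (a ord_max) _ _ _ h dd) (ev _ (a ord0) _ _ _ h dd).
    by move=> /(le0 _ _ _ h) /=; rewrite !gle_sub0; apply.
  by split; [exact: main hE ee|exact: main (close_swap hE) _].
- by have h1 := hp E hE Esm e e' ee; have h2 := hq E hE Esm e e' ee; split=> /= h /h1/h/h2.
- have main E0 (d d' : asg GG V) : close_rel E0 -> injects E0 D -> (forall z, E0 (d z, d' z)) ->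
      sat (FAll p) d -> sat (FAll p) d'.
    move=> h0 E0sm dd /= h b.
    have ssm : injects (swap E0) D.
      apply: small_sub (small_image Dinf (fun p => (p.2, p.1)) E0sm).
      by move=> [x y] Exy; exists (y, x).
    have [E1 [a [s1 h1 sm1 Eba]]] := close_extend b (close_swap h0) ssm.
    apply/(hp E1 h1 sm1 (asg_ext d' b) (asg_ext d a)); last exact: h.
    by move=> [z|] //=; apply: s1; exact: dd.
  split; first exact: main hE Esm ee.
  apply: main (close_swap hE) _ _ => //.
  apply: small_sub (small_image Dinf (fun p => (p.2, p.1)) Esm).
  by move=> [x y] Exy; exists (y, x).
Qed.

Definition min_positive (w : Gm) := [/\ 0 <= w, w <> 0 & forall h, 0 <= h -> h <> 0 -> w <= h].

(** If there is a least positive w, an element below n w lies between two consecutive multiples of w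
    and is then a multiple itself, which is excluded. If there is none, halve repeatedly. *)
Lemma positive_fraction (mu : Gm) n : 0 <= mu -> mu <> 0 ->
  (forall w q, min_positive w -> mu <> w *+ q) -> exists eta, [/\ 0 <= eta, eta <> 0 & eta *+ n <= mu].
Proof.
move=> mu0 mun hq; have [[w wmin]|nw] := pselect (exists w, min_positive w).
  have [w0 wn wle] := wmin.
  have [h|h] := pselect (w *+ n <= mu); first by exists w.
  have ex : exists m, `[< ~ w *+ m <= mu >] by exists n; apply/asboolP.
  case: (ex_minnP ex) => -[|m] /asboolP hm mmin; first by exfalso; apply: hm; rewrite mulr0n.
  have wm : w *+ m <= mu.
    by apply: contrapT => h'; have := mmin m (asboolT h'); rewrite ltnn.
  exfalso; apply: hm; rewrite mulrS -(subrK (w *+ m) mu) gle_addr; apply: wle; rewrite ?gle_sub0 //.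
  by move=> /eqP; rewrite subr_eq0 => /eqP; exact: hq.
have half (x : Gm) : 0 <= x -> x <> 0 -> exists z, [/\ 0 <= z, z <> 0 & z *+ 2 <= x].
  move=> x0 xn; have [h [h0 hn hx]] : exists h, [/\ 0 <= h, h <> 0 & ~ x <= h].
    apply: contrapT => nh; apply: nw; exists x; split=> // h h0 hn.
    by apply: contrapT => hx; apply: nh; exists h.
  have hx' : h <= x by have [//|/hx] := gle_total h x.
  have [l|l] := gle_total h (x - h).
    by exists h; split=> //; rewrite mulr2n -[X in _ <= X](subrK h) gle_addr.
  exists (x - h); split; first by rewrite gle_sub0.
    by move=> /eqP; rewrite subr_eq0 => /eqP e; apply: hx; rewrite e.
  by rewrite mulr2n -[X in _ <= X](subrK h) gle_add2l.
elim: n => [|n [z [z0 zn zle]]]; first by exists mu; rewrite mulr0n.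
have [->|n0] := posnP n; first by exists mu.
have [y [y0 yn yle]] := half z z0 zn; exists y; split=> //.
apply: le_trans zle; apply: (le_trans _ (gle_muln n yle)).
rewrite -mulrnA; have -> : (2 * n = n.+1 + n.-1)%N by lia.
by rewrite mulrnDr -[X in X <= _]addr0 gle_add2l; have := gle_muln n.-1 y0; rewrite mul0rn.
Qed.

(** Saturation provides a positive divisible e, negligible with respect to every a + k g with a in
    [A'] and k nonzero. Such elements are nonzero since no multiple of g is in [A'], and they are
    not multiples of a least positive element, which lies in [A']. Moving g by multiples of e is
    then a perturbation in the sense of [close_rel]. *)
Lemma many_conjugates (A' : set Gm) (g : Gm) : injects A' D -> A' 0 -> (forall x y, A' x -> A' y -> A' (x - y)) ->
  (forall w, min_positive w -> A' w) -> (forall n, (0 < n)%N -> ~ A' (g *+ n)) ->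
  exists2 e : Gm, e <> 0 & forall l, elem_G ([set p | A' p.1 /\ p.2 = p.1] `|` [set (g, g + e *+ l)]).
Proof.
move=> Asm A0' AB' Amin gn.
have AN' x : A' x -> A' (- x) by move=> h; rewrite -sub0r; exact: AB'.
have AD' x y : A' x -> A' y -> A' (x + y) by move=> hx hy; rewrite -(opprK y); apply: AB' => //; exact: AN'.
have AMn x n : A' x -> A' (x *+ n) by move=> hx; elim: n => [|n IH]; rewrite ?mulr0n // mulrS; exact: AD'.
have gz a (k : int) : A' a -> k != 0 -> ~ A' (a + g *~ k).
  move=> Aa k0 h; have : A' (g *~ k) by rewrite -(addKr a (g *~ k)); apply: AD' => //; exact: AN'.
  case: k k0 {h} => n n0 h; first by apply: (gn n); [rewrite lt0n|].
  by apply: (gn n.+1) => //; rewrite -(opprK (g *+ n.+1)); apply: AN'.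
have pos a (k : int) n : A' a -> k != 0 -> exists eta, [/\ 0 <= eta, eta <> 0 & eta *+ n <= gabs (a + g *~ k)].
  move=> Aa k0; apply: positive_fraction; first exact: gabs_ge0.
    move=> e0; apply: (gz a k Aa k0); rewrite (_ : a + g *~ k = 0) //.
    by apply: gabs_eq0; rewrite e0 lexx.
  move=> w q wm e; apply: (gz a k Aa k0).
  have wq : A' (w *+ q) by apply/AMn/Amin.
  have [[_ e']|[_ e']] := gabs_cases (a + g *~ k); first by rewrite -e' e.
  by rewrite -(opprK (a + _)) -e' e; exact: AN'.
pose P : set (Gm * int) := [set (gabs (t.1 + g *~ t.2.1), - t.2.2%:Z) | t in
  [set t : Gm * (int * nat) | A' t.1 /\ t.2.1 != 0]] `|` [set (0, 1)].
have [||e [edvd e0 eP]] := @group_saturated P true.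
- apply: small_union => //; last exact: small_set1.
  apply: small_image => //; apply: (@small_sub _ _ _ _ (A' `*` [set: int * nat])).
    by move=> t [].
  apply: small_prod => //.
  by apply: (@small_nat _ _ Dinf _ (@pickle _)) => a b _ _; exact: (pcan_inj (@pickleK _)).
- move=> l N N0 lP.
  have [eta [h0 hn hl]] : exists eta, [/\ 0 <= eta, eta <> 0 &
      forall q z, List.In q l -> 0 <= z -> z <= eta -> 0 <= q.1 + (z *+ N) *~ q.2].
    elim: l lP => [|q l IH] lP.
      by have [eta [h1 h2 _]] := pos 0 1 0%N A0' isT; exists eta.
    have [|eta [h0 hn hl]] := IH; first by move=> q' h; apply: lP; right.
    have [[t [At t0] e]|->] := lP q (or_introl erefl); last first.
      exists eta; split=> // q' z /= [<-|/hl h]; last exact: h.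
      by move=> z0 _; rewrite add0r mulr1z; have := gle_muln N z0; rewrite mul0rn.
    have [eta' [h0' hn' hl']] := pos t.1 t.2.1 (N * t.2.2)%N At t0.
    have cond z : z <= eta' -> 0 <= q.1 + (z *+ N) *~ q.2.
      move=> zle; rewrite -e /= mulrNz -pmulrn gle_sub0 -mulrnA.
      by apply: le_trans hl'; exact: gle_muln.
    have [le|le] := gle_total eta eta'.
      exists eta; split=> // q' z /= [<-|h] z0 zle; last exact: hl.
      by apply: cond; exact: le_trans zle le.
    exists eta'; split=> // q' z /= [<-|h] z0 zle; first exact: cond.
    by apply: hl => //; exact: le_trans zle le.
  exists (eta *+ N); split; first by exists eta.
    by move=> _ z0; apply: hn; apply: (torsion_free N0); rewrite z0 mul0rn.
  by move=> q ql; exact: hl ql h0 (lexx _).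
have e_le a (k : int) m : A' a -> k != 0 -> e *+ m <= gabs (a + g *~ k).
  move=> Aa k0; have := eP (gabs (a + g *~ k), - m%:Z) (or_introl (ex_intro2 _ _ (a, (k, m)) (conj Aa k0) erefl)).
  by rewrite /= mulrNz -pmulrn gle_sub0.
have ge0 : 0 <= e by have := eP (0, 1) (or_intror erefl); rewrite /= add0r mulr1z.
exists e; first exact: e0.
move=> l; pose E := [set (t.1 + g *~ t.2, t.1 + (g + e *+ l) *~ t.2) | t in A' `*` [set: int]].
have dE (t : Gm) (k : int) : t + (g + e *+ l) *~ k - (t + g *~ k) = e *+ l *~ k.
  by rewrite mulrzDl addrA (addrC _ (e *+ l *~ k)) addrK.
apply: (@elementary_sub ogroup_sig (vG M) (@zmod_interp (vG M))
    (fun _ (a : 'I_2 -> vG M) => a ord0 <= a ord_max) _ E); last first.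
  apply: close_elementary; last first.
    apply: small_image => //; apply: small_prod => //.
    by apply: (@small_nat _ _ Dinf _ (@pickle _)) => a b _ _; exact: (pcan_inj (@pickleK _)).
  split; first split.
  - by exists (0, 0) => //; rewrite /= !mulr0z !addr0.
  - move=> _ _ [[a k] [/= Aa _] <-] [[b j] [/= Ab _] <-].
    exists (a - b, k - j); first by split=> //; exact: AB'.
    by rewrite /= !mulrzBr; congr pair; rewrite opprD addrACA.
  - move=> _ N [[a k] [/= Aa _] <-] N0; rewrite /= dE.
    have [z hz] := edvd N N0; exists (z *+ l *~ k).
    by rewrite hz mulrnAC !pmulrn; exact: mulrzAC.
  - move=> _ m [[a k] [/= Aa _] <-] /=; rewrite dE.
    have [->|k0] := eqVneq k 0.
      by rewrite mulr0z [gabs 0]ifT ?lexx // mul0rn; exact: gabs_ge0.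
    by rewrite gabsMz gabsMn [gabs e]ifT // -!mulrnA; exact: e_le.
move=> [x y] [[/= Ax ->]|[-> ->]].
  by exists (x, 0) => //; rewrite /= !mulr0z !addr0.
by exists (0, 1); [split|rewrite /= !mulr1z !add0r].
Qed.

(** A value outside [A'] has no multiple in [A'] by purity, hence infinitely many conjugates, and
    the formula equating a variable with it divides. *)
Lemma nonforking_value (A' S : set Gm) (X : ctx unit) (c : asg GG X) (x : X) :
  injects A' D -> A' 0 -> (forall x y, A' x -> A' y -> A' (x - y)) ->
  (forall w, min_positive w -> A' w) -> (forall n, (0 < n)%N -> A' ((c x : Gm) *+ n) -> A' (c x)) ->
  nonforking_over (at_sort GG tt A') (at_sort GG tt S) c -> S (c x) -> A' (c x).
Proof.
move=> Asm A0' AB' Amin pure nf Sx; apply: contrapT => nA.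
have [|e e0 he] := many_conjugates Asm A0' AB' Amin (g := c x).
  by move=> n n0 h; apply: nA; exact: pure n0 h.
pose Y : ctx unit := Ctx (fun _ : 'I_1 => tt).
pose a (l : nat) : asg GG Y := fun _ => (c x : Gm) + e *+ l.
have atp m : tp (a m) (at_sort GG tt A') = tp ((fun _ => c x) : asg GG Y) (at_sort GG tt A').
  have ee := he m _ (asg_add ((fun _ => c x) : asg GG Y) (incl (at_sort GG tt A')))
    (asg_add (a m) (incl (at_sort GG tt A'))).
  have {}ee : equivalent (asg_add ((fun _ => c x) : asg GG Y) (incl (at_sort GG tt A')))
    (asg_add (a m) (incl (at_sort GG tt A'))).
    apply: ee => -[i|[p hp]] /=; [by right|left].
    by case: hp => z Az e'; case: _ / e'.
  by apply/seteqP; split=> p; apply: (ee p).1 || apply: (ee p).2.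
have [|||b [b0 btp bind bne]] := @indiscernible_from _ _ ogroup_sig GG Y (at_sort GG tt A')
    (fun _ => c x) a ord0 Dinf (saturated_G Msat) ogroup_cst _ _ atp _.
- exact: small_fin.
- exact: small_image.
- move=> m m' /addrI h; wlog mm : m m' h / (m <= m')%N.
    by move=> w; case: (leqP m m') => [|/ltnW] hm; [exact: w|apply/esym; exact: w].
  have : e *+ (m' - m) = 0 by rewrite mulrnBr // h subrr.
  move=> h'; have [d0|d0] := posnP (m' - m)%N; first by lia.
  by exfalso; apply: e0; apply: (torsion_free d0); rewrite h' mul0rn.
have [t ht] := gterm_var (inl x : cadd X Y : ctx unit); have [u hu] := gterm_var (inr ord0 : cadd X Y : ctx unit).
apply: (nf 1%N (fun=> tt) (FEq t u) (fun=> c x)).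
- by move=> i; exists (c x).
- by rewrite /= ht hu.
apply: divides_forks; exists b; split=> //.
exists 2%N => -[d hd]; apply: bne.
have := hd 0%N isT; have := hd 1%N isT; rewrite /= !ht !hu /=.
by move=> -> ->.
Qed.

End OrderedGroup.


(** * Pairs from indiscernible sequences, and sequences moving a nonalgebraic element *)

Section IndiscerniblePairs.
Variables (L : signature) (M : structure L) (P : set (points M)).

Lemma indiscernible_reindex (Y W : ctx (sorts L)) (f : W -> Y) (b : nat -> asg M Y)
    (Wf := Ctx (fun w => csort (f w))) :
  indiscernible P b -> indiscernible P ((fun l w => b l (f w)) : nat -> asg M Wf).
Proof.
move=> ib n i j hi hj p.
pose g (z : cadd (cpow n Wf) (cpts P)) : term (cadd (cpow n Y) (cpts P)) (csort z) :=
  match z return term (cadd (cpow n Y) (cpts P)) (csort (c := cadd (cpow n Wf) (cpts P)) z) with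
  | inl y => @TVar L (cadd (cpow n Y) (cpts P)) (inl (y.1, f y.2))
  | inr y => @TVar L (cadd (cpow n Y) (cpts P)) (inr y) end.
have E k : sat (fsub p g) (asg_add ((fun x => b (k x.1) x.2) : asg M (cpow n Y)) (incl P)) =
    sat p (asg_add ((fun x => b (k x.1) (f x.2)) : asg M (cpow n Wf)) (incl P)).
  by rewrite sat_fsub; apply: sat_ext => -[z|z].
by rewrite -!E; exact: ib.
Qed.

Lemma indiscernible_pairs (Y : ctx (sorts L)) (b : nat -> asg M Y) :
  indiscernible P b -> indiscernible P (fun l => asg_add (b l.*2) (b l.*2.+1)).
Proof.
move=> ib n i j hi hj p.
pose W := cpow (n + n) Y.
have r0 (r : 'I_n) : (r.*2 < n + n)%N by rewrite addnn ltn_double.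
have r1 (r : 'I_n) : (r.*2.+1 < n + n)%N by rewrite addnn -doubleS leq_double.
pose g (z : cadd (cpow n (cadd Y Y)) (cpts P)) : term (cadd W (cpts P)) (csort z) :=
  match z return term (cadd W (cpts P)) (csort (c := cadd (cpow n (cadd Y Y)) (cpts P)) z) with
  | inl (r, inl y) => @TVar L (cadd W (cpts P)) (inl (Ordinal (r0 r), y))
  | inl (r, inr y) => @TVar L (cadd W (cpts P)) (inl (Ordinal (r1 r), y))
  | inr y => @TVar L (cadd W (cpts P)) (inr y) end.
have half (r : 'I_(n + n)) : (r./2 < n)%N by rewrite ltn_half_double -addnn.
pose d (k : 'I_n -> nat) (r : 'I_(n + n)) : nat := ((k (Ordinal (half r))).*2 + odd r)%N.
have dE (k : 'I_n -> nat) : {homo k : x y / (x < y)%N} -> {homo d k : x y / (x < y)%N}.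
  move=> hk x y xy; rewrite /d.
  have [e|ne] := eqVneq x./2 y./2.
    have -> : Ordinal (half x) = Ordinal (half y) by apply: val_inj.
    rewrite ltn_add2l; move: xy (odd_double_half x) (odd_double_half y); rewrite e.
    by case: (odd x); case: (odd y) => /=; lia.
  have h : (x./2 < y./2)%N by rewrite ltn_neqAle ne; exact: half_leq (ltnW xy).
  have := hk (Ordinal (half x)) (Ordinal (half y)) h.
  set u := k _; set w := k _; rewrite -ltn_Sdouble => uw.
  apply: (leq_trans _ (leq_trans uw _)); last by exact: leq_addr.
  by rewrite ltnS; case: (odd x); rewrite ?addn1 ?addn0 // ltnW.
have E k : sat (fsub p g) (asg_add ((fun x => b (d k x.1) x.2) : asg M W) (incl P)) =
    sat p (asg_add ((fun x => asg_add (b (k x.1).*2) (b (k x.1).*2.+1) x.2) : asg M (cpow n (cadd Y Y))) (incl P)).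
  have k0 r : d k (Ordinal (r0 r)) = (k r).*2.
    rewrite /d /= odd_double addn0; congr (k _).*2; apply: val_inj; exact: doubleK.
  have k1 r : d k (Ordinal (r1 r)) = (k r).*2.+1.
    rewrite /d /= odd_double addn1; congr (k _).*2.+1; apply: val_inj; exact: uphalf_double.
  by rewrite sat_fsub; apply: sat_ext => -[[r [y|y]]|z] //=; rewrite ?k0 ?k1.
by rewrite -!E; apply: ib; exact: dE.
Qed.

Variables (U : Type) (D : set U).
Hypothesis Dinf : injects [set: nat] D.
Hypothesis Msat : saturated M D.
Variable cst : forall (V : ctx (sorts L)) s, term V s.

(** Each formula in the type of a nonalgebraic element has infinitely many solutions, so by
    saturation the type has infinitely many realizations. They extend to conjugates of the whole
    tuple, and [indiscernible_from] applies. *)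
Lemma nonalgebraic_conjugates (Y : ctx (sorts L)) (e : asg M Y) (y0 : Y) :
  injects [set: Y] D -> injects P D -> ~ acl P (csort y0) (e y0) ->
  exists b : nat -> asg M Y, [/\ b 0%N = e, forall n, tp (b n) P = tp e P,
    indiscernible P b & b 0%N y0 <> b 1%N y0].
Proof.
move=> Ysm Psm nacl; set s := csort y0 in nacl.
pose T1 := [set y : M s | tp ((fun _ => y) : asg M (cone s)) P = tp ((fun _ => e y0) : asg M (cone s)) P].
have inf : ~ finite_set T1.
  move=> /finite_set_list[ys ysP].
  pose W := cadd (cpts P) (Ctx (fun _ : 'I_(size ys) => s)).
  pose V := cadd (cone s) W.
  pose w : asg M W := asg_add (incl P) ((fun i => nth (e y0) ys i) : asg M (Ctx (fun _ : 'I_(size ys) => s))).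
  pose f (z : cadd (cone s) (cpts P)) : term V (csort z) :=
    match z return term V (csort (c := cadd (cone s) (cpts P)) z) with
    | inl x => @TVar L V (inl x) | inr y => @TVar L V (inr (inl y)) end.
  pose df : form V := FAnds [seq FNot (@FEq L V s (@TVar L V (inl tt)) (@TVar L V (inr (inr i)))) | i <- enum 'I_(size ys)].
  have fE p (x : M s) : sat (fsub p f) (asg_add ((fun _ => x) : asg M (cone s)) w) =
      sat p (asg_add ((fun _ => x) : asg M (cone s)) (incl P)).
    by rewrite sat_fsub; apply: sat_ext => -[z|z].
  have dE (x : M s) : sat df (asg_add ((fun _ => x) : asg M (cone s)) w) <-> ~ List.In x ys.
    rewrite sat_ands; split=> [h xy|h q].
      have [i [il xi]] : exists i, (i < size ys)%N /\ nth (e y0) ys i = x.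
        elim: (ys) xy => //= y l IH [->|/IH[i [h1 h2]]]; first by exists 0%N.
        by exists i.+1.
      have := h (FNot (@FEq L V s (@TVar L V (inl tt)) (@TVar L V (inr (inr (Ordinal il)))))).
      rewrite In_map sat_not => h'; apply: h'; last by rewrite /= xi.
      by exists (Ordinal il) => //; rewrite In_mem mem_enum.
    rewrite In_map => -[i _ <-]; rewrite sat_not => e1; apply: h.
    rewrite -[x]/(eval (asg_add ((fun _ => x) : asg M (cone s)) w) (@TVar L V (inl tt))) e1 /=.
    case: i {e1} => i il /=; elim: (ys) i il => //= y l IH [|i] il /=; [by left|by right; exact: IH].
  have Wsm : injects [set: W] D by apply: small_sum => //; [exact: small_sig|exact: small_fin].
  have [|x hx] := Msat Wsm (w := w) (s := s) (T := [set FAnd (fsub p f) df | p in tp ((fun _ => e y0) : asg M (cone s)) P]).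
  - move=> l lT.
    have [|m [m1 m2]] := @list_choice _ _ (fun r p => tp ((fun _ => e y0) : asg M (cone s)) P p /\ FAnd (fsub p f) df = r) l.
      by move=> r /lT[p hp e1]; exists p.
    have q0 : sat (FAnds m) (asg_add ((fun _ => e y0) : asg M (cone s)) (incl P)).
      by rewrite sat_ands => p /m1[r _ []].
    have [x [hx nx]] : exists x, defset (FAnds m) x /\ ~ List.In x ys.
      apply: contrapT => nx; apply: nacl; exists (FAnds m); split=> //.
      apply: (@sub_finite_set _ _ [set x | List.In x ys]); last exact: list_finite_set.
      by move=> x hx; apply: contrapT => h; apply: nx; exists x.
    exists x => r /m2[p pm [hp <-]]; rewrite sat_and fE; split; last exact/dE.
    by move: hx; rewrite /defset /= sat_ands; apply.
  have xe : equivalent (asg_add ((fun _ => e y0) : asg M (cone s)) (incl P)) (asg_add ((fun _ => x) : asg M (cone s)) (incl P)).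
    apply: equiv_le => p hp; have := hx (FAnd (fsub p f) df).
    by rewrite sat_and fE => h; apply: (h _).1; exists p.
  have := hx (FAnd (fsub (FNot (@FBot L _)) f) df); rewrite sat_and dE => h.
  apply: (h _).2; first by exists (FNot (@FBot L _)) => //; exact.
  by apply/ysP/seteqP; split=> p; apply: (xe p).1 || apply: (xe p).2.
have [f [fT fi]] := infinite_injects inf.
have tr m : exists c : asg M Y, tp c P = tp e P /\ c y0 = f m.
  have ee : equivalent (asg_add ((fun _ => e y0) : asg M (cone s)) (incl P)) (asg_add ((fun _ => f m) : asg M (cone s)) (incl P)).
    have h : tp ((fun _ => f m) : asg M (cone s)) P = _ := fT m I.
    by move=> p; have /seteqP[h1 h2] := h; split; [exact: h2|exact: h1].
  have [||c cc] := transfer Dinf Msat cst e _ _ ee => //.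
    apply: small_sum => //; last exact: small_sig.
    by apply: (@small_nat _ _ Dinf _ (fun=> 0%N)) => -[] [].
  exists c; split.
    have := equiv_sub (fun z : cadd Y (cpts P) => match z return term (cadd Y (cadd (cone s) (cpts P))) (csort (c := cadd Y (cpts P)) z) with
      | inl y => @TVar L (cadd Y (cadd (cone s) (cpts P))) (inl y)
      | inr y => @TVar L (cadd Y (cadd (cone s) (cpts P))) (inr (inr y)) end) cc.
    move=> h; apply/seteqP; split=> p; rewrite /tp /=; have := h p.
      rewrite (sat_ext (e' := asg_add e (incl P))); last by case.
      by rewrite (sat_ext (e := fun x => eval (asg_add c _) _) (e' := asg_add c (incl P))); [move=> []|case].
    rewrite (sat_ext (e' := asg_add e (incl P))); last by case.
    by rewrite (sat_ext (e := fun x => eval (asg_add c _) _) (e' := asg_add c (incl P))); [move=> []|case].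
  have := cc (@FEq L (cadd Y (cadd (cone s) (cpts P))) s (@TVar L (cadd Y (cadd (cone s) (cpts P))) (inl y0)) (@TVar L (cadd Y (cadd (cone s) (cpts P))) (inr (inl tt)))).
  by move=> [h _]; exact: h.
have [a aP] := choice tr.
apply: (indiscernible_from (a := a) Dinf Msat cst Ysm Psm).
- by move=> m; case: (aP m).
- by move=> m m'; rewrite (aP m).2 (aP m').2; exact: fi.
Qed.

End IndiscerniblePairs.


(** * Nonforking and linear disjointness in algebraically bounded fields *)

(** A nontrivial relation among n + 1 vectors of length n is solved for its last term. *)
Lemma vectors_dependent (F : fieldType) n (r : nat -> 'I_n -> F) :
  exists m (s : 'I_m -> F), forall i, r m i = \sum_l s l * r l i.
Proof.
pose A : 'M[F]_(n.+1, n) := \matrix_(l, i) r l i.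
have : kermx A != 0.
  rewrite -mxrank_eq0 mxrank_ker subn_eq0 -ltnNge ltnS.
  exact: rank_leq_col.
move=> /rowV0Pn[u /sub_kermxP uA u0].
have ex : exists m, (m < n.+1)%N && (u 0 (inord m) != 0).
  have /rowV0Pn := u0; have [i ui] : exists i, u 0 i != 0.
    by apply/existsP; apply: contraNT u0; rewrite negb_exists => /forallP h; apply/eqP/rowP => i; rewrite mxE; have := h i; rewrite negbK => /eqP.
  by move=> _; exists i; rewrite inord_val ui ltn_ord.
have bd m : (m < n.+1)%N && (u 0 (inord m) != 0) -> (m <= n)%N by move=> /andP[].
case: (ex_maxnP ex bd) => m /andP[mn um] mmax.
exists m, (fun l => - u 0 (inord l) / u 0 (inord m)) => i.
have := congr1 (fun B : 'rV_n => B 0 i) uA; rewrite !mxE => s0.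
have E : \sum_(j < n.+1) u 0 j * A j i = u 0 (inord m) * r m i + \sum_(l < m) u 0 (inord l) * r l i.
  transitivity (\sum_(0 <= l < n.+1) u 0 (inord l) * r l i).
    by rewrite big_mkord; apply: eq_bigr => j _; rewrite inord_val mxE.
  have z : \sum_(m.+1 <= l < n.+1) u 0 (inord l) * r l i = 0.
    rewrite big_nat big1 // => l /andP[ml ln]; apply/eqP; rewrite mulf_eq0; apply/orP; left.
    by apply: contraT => h; have := mmax l; rewrite ln h => /(_ isT); rewrite leqNgt ml.
  rewrite (big_cat_nat (leq0n m.+1) mn) /= z addr0.
  by rewrite big_nat_recr //= big_mkord addrC.
rewrite E in s0; under eq_bigr => l _ do rewrite mulrAC mulNr.
rewrite -mulr_suml sumrN; apply: (mulfI um).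
by rewrite mulrCA mulfV // mulr1; apply/eqP; rewrite -addr_eq0; apply/eqP.
Qed.

Section LinearDisjointness.
Variables (F : fieldType) (U : Type) (D : set U).
Notation N := (field_struct F).
Hypothesis Dinf : injects [set: nat] D.
Hypothesis Nsat : saturated N D.

Definition rterm (V : ctx unit) (t : asg N V -> F) :=
  exists u : @term ring_sig V tt, forall e, eval e u = t e.

Lemma rterm_var (V : ctx unit) (y : V) : rterm (fun e : asg N V => e y).
Proof.
exists (@tcast ring_sig V (csort y) tt (unit_sort (csort y) tt) (@TVar ring_sig V y)) => e.
exact: (@eval_tcast ring_sig F (@ring_interp F) (fun r : void => match r with end)).
Qed.

Lemma rterm0 (V : ctx unit) : rterm (fun _ : asg N V => 0).
Proof. by exists (ring_cst V tt). Qed.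

Lemma rterm1 (V : ctx unit) : rterm (fun _ : asg N V => 1).
Proof. by exists (@TApp ring_sig V ROne (fun i : 'I_0 => False_rect _ (notF (valP i)))). Qed.

Lemma rtermD (V : ctx unit) (t u : asg N V -> F) : rterm t -> rterm u -> rterm (fun e => t e + u e).
Proof.
move=> [t' ht] [u' hu].
exists (@TApp ring_sig V RAdd (fun i : 'I_2 => if nat_of_ord i is 0%N then t' else u')) => e.
by rewrite -ht -hu.
Qed.

Lemma rtermM (V : ctx unit) (t u : asg N V -> F) : rterm t -> rterm u -> rterm (fun e => t e * u e).
Proof.
move=> [t' ht] [u' hu].
exists (@TApp ring_sig V RMul (fun i : 'I_2 => if nat_of_ord i is 0%N then t' else u')) => e.
by rewrite -ht -hu.
Qed.

Lemma rtermN (V : ctx unit) (t : asg N V -> F) : rterm t -> rterm (fun e => - t e).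
Proof. by move=> [t' ht]; exists (@TApp ring_sig V ROpp (fun=> t')) => e; rewrite -ht. Qed.

Lemma rtermX (V : ctx unit) (t : asg N V -> F) n : rterm t -> rterm (fun e => t e ^+ n).
Proof.
move=> ht; elim: n => [|n IH]; first exact: rterm1.
by have [u hu] := rtermM ht IH; exists u => e; rewrite hu exprS.
Qed.

Lemma rterm_sum (V : ctx unit) n (t : 'I_n -> asg N V -> F) :
  (forall i, rterm (t i)) -> rterm (fun e => \sum_i t i e).
Proof.
move=> ht; have h (r : seq 'I_n) : rterm (fun e => \sum_(i <- r) t i e).
  elim: r => [|i r IH].
    by have [u hu] := rterm0 V; exists u => e; rewrite big_nil.
  by have [u hu] := rtermD (ht i) IH; exists u => e; rewrite big_cons.
by have [u hu] := h (index_enum _); exists u.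
Qed.

Lemma rterm_eq0 (V : ctx unit) (t : asg N V -> F) : rterm t ->
  exists p : @Defs.form ring_sig V, forall e : asg N V, sat p e <-> t e = 0.
Proof.
move=> [u hu]; exists (FEq u (ring_cst V tt)) => e.
by rewrite -[sat _ _]/(eval e u = (0 : F)) hu.
Qed.

Lemma rterm_equiv (V : ctx unit) (t : asg N V -> F) (e e' : asg N V) : rterm t -> equivalent e e' ->
  t e = 0 <-> t e' = 0.
Proof. by move=> /rterm_eq0[p hp] ee; rewrite -!hp; exact: ee. Qed.

Variable A : set F.
Notation PA := (at_sort N tt A).

Definition param a (Aa : A a) : cpts PA := exist _ (existT N tt a) (ex_intro2 _ _ a Aa erefl).

Hypothesis Asub : subfield A.
Hypothesis Asm : injects A D.
Hypothesis bounded : algebraically_bounded F.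

(** Move the relation from [c] to its conjugate [x] by [transfer]. The new coefficients are roots of
    the same polynomials, hence algebraic over [A], and the linear disjointness of E from the
    algebraic elements forbids the relation. *)
Lemma algebraic_relation n (X : ctx unit) (c x : asg N X) (y : 'I_n -> X) (t : 'I_n -> F) (j : 'I_n) (E : set F) :
  injects [set: X] D ->
  equivalent (asg_add c (incl PA)) (asg_add x (incl PA)) ->
  (forall z, E (x z)) -> lin_disjoint E (alg_over A) A ->
  (forall i, alg_over A (t i)) -> t j = 1 -> \sum_i t i * c (y i) = 0 ->
  ~ lin_indep A (fun i => c (y i)).
Proof.
move=> Xsm cx Ex ld talg tj st ind.
pose W := cadd X (cpts PA); pose T : ctx unit := Ctx (fun _ : 'I_n => tt); pose V := cadd T W.
have PAsm : injects PA D by exact: small_image.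
have [||t' tt'] := transfer Dinf Nsat ring_cst (t : asg N T) _ _ cx.
- exact: small_fin.
- by apply: small_sum => //; exact: small_sig.
have t'alg i : alg_over A (t' i).
  have [p [p0 pA rp]] := talg i; exists p; split=> //; apply/rootP.
  have rt : rterm (fun e : asg N V => \sum_(l < size p) e (inr (inr (param (pA l)))) * e (inl i) ^+ l).
    by apply: rterm_sum => l; apply: rtermM; [exact: rterm_var|apply: rtermX; exact: rterm_var].
  have := rterm_equiv rt tt'; rewrite /= -!horner_coef => h; apply: h.1.
  exact/rootP.
have t'j : t' j = 1.
  have rt : rterm (fun e : asg N V => e (inl j) - 1).
    by apply: rtermD; [exact: rterm_var|apply: rtermN; exact: rterm1].
  have := rterm_equiv rt tt'; rewrite /= tj subrr => h.
  by apply/eqP; rewrite -subr_eq0; apply/eqP/h.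
have st' : \sum_i t' i * x (y i) = 0.
  have rt : rterm (fun e : asg N V => \sum_i e (inl i) * e (inr (inl (y i)))).
    by apply: rterm_sum => l; apply: rtermM; exact: rterm_var.
  by have := rterm_equiv rt tt'; rewrite /= => h; apply/h.
have indx : lin_indep A (fun i => x (y i)).
  move=> a Aa sa; apply: ind => //.
  have rt : rterm (fun e : asg N W => \sum_i e (inr (param (Aa i))) * e (inl (y i))).
    by apply: rterm_sum => l; apply: rtermM; exact: rterm_var.
  by have := rterm_equiv rt cx; rewrite /= => h; apply/h.
have := ld n (fun i => x (y i)) (fun i => Ex _) indx t' t'alg st' j.
by rewrite t'j => /eqP; rewrite oner_eq0.
Qed.

Notation Y := (Ctx (fun _ : nat => tt) : ctx unit).

(** Otherwise [c] satisfies the formula saying that it is orthogonal to b_0 but not to b_1, and this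
    formula divides along the pairs (b_(2l), b_(2l+1)). Indeed some b_d is a combination of b_0,
    ..., b_(d-1); by indiscernibility b_(2d+1) is one of b_0, b_2, ..., b_(2d-2), so the first d + 1
    instances are inconsistent. *)
Lemma dividing_relation n (X : ctx unit) (y : 'I_n -> X) (b : nat -> nat -> F) (S : set F) (c : asg N X) :
  (forall l, tp (b l : asg N Y) PA = tp (b 0%N : asg N Y) PA) -> indiscernible PA (b : nat -> asg N Y) ->
  nonforking_over PA (at_sort N tt S) c -> (forall i, S (b 0%N i)) -> (forall i, S (b 1%N i)) ->
  \sum_(i < n) b 0%N i * c (y i) = 0 -> \sum_(i < n) b 1%N i * c (y i) = 0.
Proof.
move=> btp bind nf Sb0 Sb1 s0; apply: contrapT => s1.
pose W := cadd Y Y; pose V := cadd X W.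
have rt0 : rterm (fun e : asg N V => \sum_(i < n) e (inr (inl (nat_of_ord i))) * e (inl (y i))).
  by apply: rterm_sum => l; apply: rtermM; exact: rterm_var.
have rt1 : rterm (fun e : asg N V => \sum_(i < n) e (inr (inr (nat_of_ord i))) * e (inl (y i))).
  by apply: rterm_sum => l; apply: rtermM; exact: rterm_var.
have [p0 hp0] := rterm_eq0 rt0; have [p1 hp1] := rterm_eq0 rt1.
have [m [f [q hq]]] := form_params (FAnd p0 (FNot p1)).
pose w l : asg N W := asg_add (b l.*2 : asg N Y) (b l.*2.+1 : asg N Y).
pose Wf := @Ctx (sorts ring_sig) 'I_m (fun k => csort (f k)).
pose wf l : asg N Wf := fun k => w l (f k).
have qE l (e : asg N X) : sat q (asg_add e (wf l)) <->
    \sum_(i < n) b l.*2 i * e (y i) = 0 /\ \sum_(i < n) b l.*2.+1 i * e (y i) <> 0.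
  by rewrite (hq N e (w l)) sat_and sat_not hp0 hp1.
apply: (nf m _ q (wf 0%N)).
- move=> k; have wS (z : W) : at_sort N tt S (existT N (csort z) (w 0%N z)).
    by case: z => i; [exists (b 0%N i)|exists (b 1%N i)].
  exact: (wS (f k)).
- by apply/qE.
have [d [s hs]] := @vectors_dependent F n (fun l i => b l i).
have span l : b l.*2.+1 = b l.*2.+1 -> (d <= l)%N -> exists s' : 'I_d -> F, forall i : 'I_n,
    b l.*2.+1 i = \sum_k s' k * b k.*2 i.
  move=> _ dl; pose T : ctx unit := Ctx (fun _ : 'I_d => tt).
  pose Z := cadd (cpow d.+1 Y) (cpts PA); pose Q := cadd T Z.
  have rt i : rterm (fun e : asg N Q => e (inr (inl (ord_max : 'I_d.+1, i))) -
      \sum_k e (inl k) * e (inr (inl (widen_ord (leqnSn d) k, i)))).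
    apply: rtermD; first exact: rterm_var.
    by apply: rtermN; apply: rterm_sum => k; apply: rtermM; exact: rterm_var.
  have /choice[pr hpr] : forall i : nat, exists p : @Defs.form ring_sig Q, forall e : asg N Q, sat p e <->
      e (inr (inl (ord_max : 'I_d.+1, i))) - \sum_k (e (inl k) : F) * e (inr (inl (widen_ord (leqnSn d) k, i))) = 0.
    by move=> i; exact: rterm_eq0 (rt i).
  have [r hr] := exists_form (L := ring_sig) ring_cst (FAnds [seq pr (nat_of_ord i) | i <- enum 'I_n]).
  (* Indiscernibility is applied to the increasing indices 0, ..., d and 0, 2, ..., 2d - 2, 2l +
     1. *)
  pose jj (k : 'I_d.+1) : nat := if (k < d)%N then k.*2 else l.*2.+1.
  have hj : {homo jj : x y / (x < y)%N}.
    move=> x z xz; rewrite /jj; have := ltn_ord z; have := ltn_ord x.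
    by case: ifP => h1; case: ifP => h2; lia.
  have hi : {homo (fun k : 'I_d.+1 => k : nat) : x y / (x < y)%N} by [].
  have rE (h : 'I_d.+1 -> nat) : sat r (asg_add ((fun z => b (h z.1) z.2) : asg N (cpow d.+1 Y)) (incl PA)) <->
      exists s' : 'I_d -> F, forall i : 'I_n, b (h ord_max) i = \sum_k s' k * b (h (widen_ord (leqnSn d) k)) i.
    rewrite hr; apply: ex_iff => s'; rewrite sat_ands; split=> [H i|H p'].
      have /hpr /= : sat (pr i) (asg_add s' (asg_add ((fun z => b (h z.1) z.2) : asg N (cpow d.+1 Y)) (incl PA))).
        by apply: H; rewrite In_map; exists i => //; rewrite In_mem mem_enum.
      by move/eqP; rewrite subr_eq0 => /eqP.
    rewrite In_map => -[i _ <-]; apply/hpr => /=.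
    by rewrite H subrr.
  have /rE[s' hs'] : sat r (asg_add ((fun z => b (jj z.1) z.2) : asg N (cpow d.+1 Y)) (incl PA)).
    by apply/(bind _ _ _ hi hj)/rE; exists s.
  exists s' => i; have := hs' i; rewrite /jj ltnn => ->.
  by apply: eq_bigr => k _; rewrite /= ltn_ord.
apply: divides_forks; exists wf; split=> //.
- move=> l; have e : equivalent (asg_add (w l) (incl PA)) (asg_add (w 0%N) (incl PA)).
    pose h2 (k : nat) (i : 'I_2) : nat := if nat_of_ord i is 0%N then k.*2 else k.*2.+1.
    have hh k : {homo h2 k : x y / (x < y)%N}.
      by move=> [[|[|x]] hx] [[|[|z]] hz] //= _; rewrite /h2 /=.
    pose g (z : cadd W (cpts PA)) : @term ring_sig (cadd (cpow 2 Y) (cpts PA)) (csort z) :=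
      match z return @term ring_sig (cadd (cpow 2 Y) (cpts PA)) (csort (c := cadd W (cpts PA)) z) with
      | inl (inl i) => @TVar ring_sig (cadd (cpow 2 Y) (cpts PA)) (inl (ord0, i))
      | inl (inr i) => @TVar ring_sig (cadd (cpow 2 Y) (cpts PA)) (inl (ord_max, i))
      | inr z => @TVar ring_sig (cadd (cpow 2 Y) (cpts PA)) (inr z) end.
    have gE k (p : @Defs.form ring_sig (cadd W (cpts PA))) : sat (fsub p g) (asg_add ((fun x => b (h2 k x.1) x.2) : asg N (cpow 2 Y)) (incl PA)) =
        sat p (asg_add (w k) (incl PA)).
      by rewrite sat_fsub; apply: sat_ext => -[[i|i]|z].
    by move=> p; rewrite -!gE; exact: bind.
  have := equiv_sub (fun z : cadd Wf (cpts PA) =>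
    match z return @term ring_sig (cadd W (cpts PA)) (csort (c := cadd Wf (cpts PA)) z) with
    | inl k => @TVar ring_sig (cadd W (cpts PA)) (inl (f k))
    | inr z => @TVar ring_sig (cadd W (cpts PA)) (inr z) end) e => h.
  have X1 l' p : sat p (fun z => eval (asg_add (w l') (incl PA)) (match z return @term ring_sig (cadd W (cpts PA)) (csort (c := cadd Wf (cpts PA)) z) with
    | inl k => @TVar ring_sig (cadd W (cpts PA)) (inl (f k))
    | inr z => @TVar ring_sig (cadd W (cpts PA)) (inr z) end)) =
      sat p (asg_add (wf l') (incl PA)).
    by apply: sat_ext => -[z|z].
  by apply/seteqP; split=> p; rewrite /tp /= -!X1; apply: (h p).1 || apply: (h p).2.
- exact: (@indiscernible_reindex ring_sig N PA W Wf f w (indiscernible_pairs bind)).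
- exists d.+1 => -[e he].
  have [s' hs'] := span d erefl (leqnn d).
  have /qE[_] := he d (ltnSn d); apply.
  under eq_bigr => i _ do rewrite hs' mulr_suml.
  rewrite exchange_big big1 // => k _.
  have /qE[h _] := he k (ltnW (ltn_ord k)).
  by under eq_bigr => i _ do rewrite -mulrA; rewrite -mulr_sumr h mulr0.
Qed.

(** A finite tuple of [S] with a nonalgebraic entry starts an indiscernible sequence moving that
    entry, whose second term is still in [S]; nonforking over [S] then sees both terms. *)
Definition splitting (S : set F) := forall (s : seq F) i, (forall z, List.In z s -> S z) ->
  ~ alg_over A (nth 0 s i) -> exists b : nat -> nat -> F, [/\ forall m, b 0%N m = nth 0 s m, b 0%N i <> b 1%N i,
    forall l, tp (b l : asg N Y) PA = tp (b 0%N : asg N Y) PA, indiscernible PA (b : nat -> asg N Y) &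
    forall m, S (b 1%N m)].

Lemma splitting_hull (S0 : set F) : injects S0 D ->
  exists S, [/\ S0 `<=` S, injects S D, subfield S & splitting S].
Proof.
move=> S0sm.
have [nx nxP] : exists nx : seq F * nat -> nat -> nat -> F, forall s i, ~ alg_over A (nth 0 s i) ->
    [/\ forall m, nx (s, i) 0%N m = nth 0 s m, nx (s, i) 0%N i <> nx (s, i) 1%N i,
      forall l, tp (nx (s, i) l : asg N Y) PA = tp (nx (s, i) 0%N : asg N Y) PA &
      indiscernible PA (nx (s, i) : nat -> asg N Y)].
  have h (p : seq F * nat) : exists b : nat -> nat -> F, ~ alg_over A (nth 0 p.1 p.2) ->
     [/\ forall m, b 0%N m = nth 0 p.1 m, b 0%N p.2 <> b 1%N p.2,
      forall l, tp (b l : asg N Y) PA = tp (b 0%N : asg N Y) PA &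
      indiscernible PA (b : nat -> asg N Y)].
    have [al|nal] := pselect (alg_over A (nth 0 p.1 p.2)); first by exists (fun _ _ => 0).
    have [|||b [b0 btp bind bne]] := @nonalgebraic_conjugates ring_sig N PA U D Dinf Nsat ring_cst Y (nth 0 p.1) p.2.
    - by apply: (injects_sub _ Dinf).
    - exact: small_image.
    (* Algebraic boundedness: an element outside the field-theoretic algebraic closure is not
       model-theoretically algebraic. *)
    - by rewrite bounded.
    exists b => _; split=> //; first by move=> m; rewrite b0.
    by move=> l; rewrite btp b0.
  by have [f hf] := choice h; exists f => s i; exact: (hf (s, i)).
pose op (n : nat) (s : seq F) : F := match n with
  | 0%N => 1 | 1%N => nth 0 s 0 - nth 0 s 1 | 2%N => nth 0 s 0 / nth 0 s 1
  | k.+3 => if unpickle k is Some p then nx (s, p.1) 1%N p.2 else 0 end.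
pose S := [set x | hull_mem op S0 x].
have S2 n x y : S x -> S y -> S (op n [:: x; y]).
  by move=> hx hy; apply: HullOp => z /= [<-|[<-|]].
exists S; split.
- by move=> x; exact: HullBase.
- exact: small_hull.
- split; rewrite ?inE.
  + by apply: (@HullOp _ op S0 0%N [::]).
  + by move=> x y; rewrite !inE => hx hy; exact: (S2 1%N).
  + by move=> x y; rewrite !inE => hx hy; exact: (S2 2%N).
- move=> s i Ss nal; have [h1 h2 h3 h4] := nxP s i nal.
  exists (nx (s, i)); split=> // m.
  have := @HullOp _ op S0 (pickle (i, m)).+3 s Ss.
  by rewrite /op pickleK.
Qed.

(** Induction on the length of a relation, normalized to have coefficient 1 at j. If all
    coefficients are algebraic, [algebraic_relation] applies. If one is not, move the coefficients
    along an indiscernible sequence: the moved relation still holds by [dividing_relation], and the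
    difference of the two relations loses its coefficient at j, so it is trivial by induction
    although the chosen coefficient was moved. *)
Lemma nonforking_lin_disjoint (X : ctx unit) (c x : asg N X) (E S : set F) :
  injects [set: X] D -> subfield S -> splitting S ->
  equivalent (asg_add c (incl PA)) (asg_add x (incl PA)) ->
  (forall z, E (x z)) -> lin_disjoint E (alg_over A) A ->
  nonforking_over PA (at_sort N tt S) c ->
  lin_disjoint [set u | exists z, u = c z] S A.
Proof.
move=> Xsm Ssub Ssp cx Ex ld nf n; elim: n => [|n IH] u uE ind t St st; first by case.
have [//|nt] := pselect (forall i, t i = 0); exfalso.
have [j tj] : exists j, t j != 0.
  by apply: contrapT => h; apply: nt => i; apply: contrapT => /eqP h'; apply: h; exists i.
have /choice[y yP] := uE.
pose t' i := t i / t j; have t'j : t' j = 1 by rewrite /t' divff.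
have St' i : S (t' i) by exact: (Adiv Ssub).
have st' : \sum_i t' i * c (y i) = 0.
  transitivity ((\sum_i t i * u i) / t j); last by rewrite st mul0r.
  by rewrite mulr_suml; apply: eq_bigr => i _; rewrite yP mulrAC.
have indc : lin_indep A (fun i => c (y i)).
  by move=> a Aa sa; apply: ind => //; rewrite -[RHS]sa; apply: eq_bigr => i _; rewrite yP.
have [al|[i0 ni0]] : (forall i, alg_over A (t' i)) \/ exists i, ~ alg_over A (t' i).
  have [|h] := pselect (forall i, alg_over A (t' i)); [by left|right].
  by apply: contrapT => h'; apply: h => i; apply: contrapT => h''; apply: h'; exists i.
  exact: (algebraic_relation Xsm cx Ex ld al t'j st').
pose s := [seq t' i | i <- enum 'I_n.+1].
have sE (i : 'I_n.+1) : nth 0 s i = t' i.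
  by rewrite /s (nth_map i) ?size_enum_ord // nth_ord_enum.
have [||b [b0 bne btp bind Sb1]] := Ssp s i0.
- by move=> z /In_map[i _ <-].
- by rewrite sE.
have Sb0 (i : nat) : S (b 0%N i).
  rewrite b0; have [lt|ge] := ltnP i (size s); last by rewrite nth_default //; exact: (A0 Ssub).
  by rewrite size_map size_enum_ord in lt; rewrite (sE (Ordinal lt)).
have r0 : \sum_(i < n.+1) b 0%N i * c (y i) = 0.
  by rewrite -[RHS]st'; apply: eq_bigr => i _; rewrite b0 sE.
have r1 := dividing_relation btp bind nf Sb0 Sb1 r0.
have b1j : b 1%N j = 1.
  have rt : rterm (fun e : asg N Y => e (nat_of_ord j) - 1).
    by apply: rtermD; [exact: rterm_var|apply: rtermN; exact: rterm1].
  have [p hp] := rterm_eq0 rt.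
  pose q := fsub p (fun i : Y => @TVar ring_sig (cadd Y (cpts PA)) (inl i)).
  have qE l : sat q (asg_add (b l : asg N Y) (incl PA)) <-> b l j = 1.
    rewrite sat_fsub (sat_ext (e' := (b l : asg N Y))) // hp.
    by split=> [/eqP|->]; rewrite ?subrr // subr_eq0 => /eqP.
  have /seteqP[_ h] := btp 1%N; apply/qE; apply: h; apply/qE.
  by rewrite b0 sE.
have b0j : b 0%N j = 1 by rewrite b0 sE.
have [k i0k|i0j] := unliftP j i0; last by apply: bne; rewrite i0j b0j b1j.
have indl : lin_indep A (fun i => u (lift j i)).
  move=> a Aa sa i; pose a' z := if unlift j z is Some k then a k else 0.
  have -> : a i = a' (lift j i) by rewrite /a' liftK.
  apply: ind; first by move=> z; rewrite /a'; case: unlift => [k'|]; [exact: Aa|exact: (A0 Asub)].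
  rewrite (bigD1_ord j) //= {1}/a' unlift_none mul0r add0r -[RHS]sa.
  by apply: eq_bigr => z _; rewrite /a' liftK.
have := IH (fun i => u (lift j i)) (fun i => uE _) indl (fun i => b 1%N (lift j i) - b 0%N (lift j i)) _ _ k.
rewrite -i0k => h; apply: bne; apply/esym/eqP; rewrite -subr_eq0; apply/eqP; apply: h.
  by move=> i; exact: (AB Ssub).
have : \sum_(i < n.+1) (b 1%N i - b 0%N i) * u i = 0.
  transitivity (\sum_(i < n.+1) b 1%N i * c (y i) - \sum_(i < n.+1) b 0%N i * c (y i)).
    by rewrite -sumrB; apply: eq_bigr => i _; rewrite yP mulrBl.
  by rewrite r1 r0 subrr.
by rewrite (bigD1_ord j) //= b1j b0j subrr mul0r add0r.
Qed.

End LinearDisjointness.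


(** * Automorphisms and homogeneity *)

Section Automorphisms.
Variables (L : signature) (M : structure L).

Lemma sat_aut (g : forall s, M s -> M s) V (p : form V) (e : asg M V) : automorphism g ->
  sat p e <-> sat p (fun x => g _ (e x)).
Proof.
move=> [gb gf gr]; have ev W s (t : term W s) (d : asg M W) : eval (fun x => g _ (d x)) t = g _ (eval d t).
  elim: t => //= f a IH; rewrite gf; congr finterp.
  by apply: functional_extensionality_dep => i; exact: IH.
elim: p e => [{}V s t u|{}V r a|{}V|{}V p hp q hq|{}V s p hp] e /=.
- rewrite !ev; split=> [->//|]; exact: bij_inj (gb s) _ _.
- rewrite gr (_ : (fun i => g _ (eval e (a i))) = fun i => eval (fun x => g _ (e x)) (a i)) //.
  by apply: functional_extensionality_dep => i; rewrite ev.
- by [].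
- by have h1 := hp e; have h2 := hq e; split=> h /h1/h/h2.
- have E a : sat p (asg_ext e a) <-> sat p (asg_ext (fun x => g _ (e x)) (g s a)).
    rewrite hp (sat_ext (e' := asg_ext (fun x => g _ (e x)) (g s a))) // => -[x|] //.
  split=> h a; last exact/E/h.
  by have [g' _ gK] := gb s; rewrite -(gK a); apply/E/h.
Qed.

Lemma aut_id : automorphism (fun s (x : M s) => x).
Proof. by split=> // s; exists id. Qed.

Lemma aut_comp (g h : forall s, M s -> M s) : automorphism g -> automorphism h ->
  automorphism (fun s x => g s (h s x)).
Proof.
move=> [g1 g2 g3] [h1 h2 h3]; split=> [s|f a|r a]; first exact: bij_comp.
  by rewrite h2 g2.
by rewrite h3 g3.
Qed.

(** Homogeneity is about sets of points, whereas a tuple may repeat a point. Each point is named by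
    one of its variables, and equality formulas take care of the others. *)
Lemma homogeneous_extend U (D : set U) V (e e' : asg M V) : injects [set: nat] D ->
  succ_strongly_homogeneous M D -> injects [set: V] D -> equivalent e e' ->
  exists g : forall s, M s -> M s, automorphism g /\ forall x, g _ (e x) = e' x.
Proof.
move=> Dinf hom Vsm ee.
pose P : set (points M) := [set existT M (csort y) (e y) | y in [set: V]].
have PD : (P #<= D)%card by apply: card_le_injects; apply: small_image.
have ex0 (q : points M) : P q -> exists t : term V (projT1 q), eval e t = projT2 q.
  by move=> [y _ <-]; exists (TVar y).
have ex (x : cpts P) : exists t : term V (csort x), eval e t = incl P x := ex0 _ (svalP x).
have [t tP] := dependent_choice ex.
have [p|g [ga gP]] := hom P PD (fun x => eval e' (t x)).
  have E1 : sat (fsub p t) e = sat p (incl P) by rewrite sat_fsub; exact: sat_ext.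
  by have := ee (fsub p t); rewrite E1 sat_fsub.
exists g; split=> // x.
pose x' : cpts P := exist _ _ (ex_intro2 _ _ x I erefl).
rewrite (gP x' : g _ (e x) = _).
exact: ((ee (@FEq L V (csort x') (t x') (TVar x))).1 (tP x')).
Qed.

End Automorphisms.

Lemma small_list T U (D : set U) (l : seq T) : injects [set: nat] D -> injects [set x | List.In x l] D.
Proof.
move=> Dinf; elim: l => [|x l IH].
  by case: Dinf => f _; exists (fun=> f 0%N); split.
by apply: small_sub (small_union Dinf (small_set1 Dinf x) IH) => y [->|]; [left|right].
Qed.

(** * Power cosets and normed families from the hypotheses on A and C *)

Section Reductions.
Variable M : valuedField.
Notation MM := (vf_struct M).
Notation K := (vK M).
Notation kk := (field_struct (vk M)).
Notation GG := (ogroup_struct (vG M)).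
Implicit Types A B C : set K.

Lemma res_of_subfield A : subfield A -> subfield (res_of A).
Proof.
move=> As; split; rewrite ?inE.
- by exists 1; [split; [exact: A1|exact: integral1]|exact: res1].
- move=> x y; rewrite !inE => -[a [Aa ia] <-] [b [Ab ib] <-].
  by exists (a - b); [split; [exact: AB|exact: integralB]|exact: resB].
- move=> x y; rewrite !inE => -[a [Aa ia] <-] [b [Ab ib] <-].
  have [ub|sb] := integral_cases ib; last first.
    exists (a / b); first by split; [exact: Adiv|apply: integralM => //; exact/unit_integral/unitV].
    by rewrite resM ?resV //; exact/unit_integral/unitV.
  exists 0; first by split; [exact: A0|exact: integral0].
  by rewrite res0 ((res_eq0 ib).2 ub) invr0 mulr0.
Qed.

Lemma val_of0 A : subfield A -> val_of A 0.
Proof. by move=> As; exists 1; [exact: A1|rewrite (val_v (oner_neq0 _)) v1]. Qed.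

Lemma val_ofB A g h : subfield A -> val_of A g -> val_of A h -> val_of A (g - h).
Proof.
move=> As [a Aa va] [b Ab vb]; have a0 := val_neq0 va; have b0 := val_neq0 vb.
exists (a / b); first exact: Adiv.
rewrite val_v ?mulf_neq0 ?invr_neq0 // vM ?invr_neq0 // vV //.
by rewrite /v va vb.
Qed.

Lemma val_ofP A g : val_of A g -> exists a, [/\ A a, a != 0 & v a = g].
Proof. by move=> [a Aa va]; exists a; split; rewrite ?(val_neq0 va) // /v va. Qed.

(** Lifting a coset equation from RV to K costs a factor in 1 + M, which is an n-th power by
    Hensel's lemma. *)
Lemma cosets_of_RV A : henselian M -> [pchar (vk M)] =i pred0 ->
  (forall N : nat, (0 < N)%N -> forall r : vRV M,
     exists (a : K) (s : vRV M), [/\ A a, a != 0 & vrv a = (r * s ^+ N)%g]) ->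
  forall n (x : K), (0 < n)%N -> x != 0 -> exists a y, [/\ A a, a != 0 & x = a * y ^+ n].
Proof.
move=> Mhens Mchar hRV n x n0 x0; have [a [s [Aa a0 e]]] := hRV n n0 (vrv x).
have [y y0 ys] := rv_surj s.
have rvX m : vrv (y ^+ m) = (vrv y ^+ m)%g.
  elim: m => [|m IH]; last by rewrite exprS expgS rvM ?expf_neq0 // IH.
  by rewrite expr0 expg0; apply/(rv_eq1 (oner_neq0 _)); rewrite subrr; exact: small0.
have n1 : near a (x * y ^+ n).
  apply/rv_near => //; first by rewrite mulf_neq0 ?expf_neq0.
  by rewrite rvM ?expf_neq0 // rvX ys.
have pw : is_power n (x / a).
  have yn0 : y ^+ n != 0 by rewrite expf_neq0.
  apply/(is_power_mul2 _ yn0); first by exists y.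
  apply/(near_power Mhens Mchar n0 (y := 1)); last by exists 1; rewrite expr1n.
  rewrite mulrAC; apply: near_trans (nearM (near_sym n1) (near_refl (invr_neq0 a0))) _.
  by rewrite divff //; apply: near_refl; exact: oner_neq0.
have [z hz] := pw; exists a, z; split=> //.
by rewrite -hz mulrC divfK.
Qed.

Lemma cosets_of_residue A : 
  (forall N : nat, (0 < N)%N -> forall c : vk M, c != 0 ->
     exists (a : vK M) (d : vk M), [/\ A a, vval a = Some 0, d != 0 & vres a = c * d ^+ N]) ->
  forall n (x : K), (0 < n)%N -> unit_el x ->
    exists a y, [/\ A a, unit_el a, unit_el y & vres a = vres x * vres y ^+ n].
Proof.
move=> hk n x n0 ux; have [a [d [Aa va d0 e]]] := hk n n0 _ ((res_unit (unit_integral ux)).1 ux).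
have [y iy yd] := res_surj d; exists a, y; split=> //; last by rewrite yd.
by apply/(res_unit iy); rewrite yd.
Qed.

Lemma vmax_big_le I (r : seq I) (f : I -> option (vG M)) b :
  (forall i, List.In i r -> vle (f i) b) -> vle (\big[@vmax (vG M) / None]_(i <- r) f i) b.
Proof.
elim: r => [|i r IH] h; first by rewrite big_nil.
rewrite big_cons; apply: vmax_le; first by apply: h; left.
by apply: IH => j hj; apply: h; right.
Qed.

Lemma vmax_big_ge I (r : seq I) (f : I -> option (vG M)) i :
  List.In i r -> vle (f i) (\big[@vmax (vG M) / None]_(i <- r) f i).
Proof.
elim: r => //= j r IH h; rewrite big_cons /vmax.
set m := \big[_/_]_(_ <- r) _ in IH *.
case: h => [->|/IH h].
  case: ifP => // _; by have /orP[] := vle_total (f i) (f i).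
case: ifP => // h'; have /orP[e|e] := vle_total (f j) m; first by rewrite e in h'.
exact: vle_trans h e.
Qed.

(** In a separating basis of the span of the family, a combination has the value of its dominant
    term, so its quotient by that term is a unit. *)
Lemma separated_normed A C : subfield A -> subfield C -> A `<=` C -> separated_ext A C -> normed_set A C.
Proof.
move=> As Cs AC sep n c Cc.
have Csum m (t u : 'I_m -> K) : (forall i, A (t i)) -> (forall i, C (u i)) -> C (\sum_i t i * u i).
  move=> At Cu; elim/big_ind: _ => [|x y|i _]; [exact: A0|exact: AD|].
  by apply: AM => //; exact: AC.
have [||m [w [Vw indw normw]]] := sep (lspan A c).
- by move=> x [t At ->]; exact: Csum.
- by exists n, c.
have A00 := A0 As; have A11 := A1 As.
have delta k (j : 'I_k) : forall i, A ((i == j)%:R).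
  by move=> i; case: (i == j).
have deltas k (j : 'I_k) (u : 'I_k -> K) : \sum_i (i == j)%:R * u i = u j.
  rewrite (bigD1 j) //= eqxx mul1r big1 ?addr0 // => i /negPf ->.
  by rewrite mul0r.
have /choice[a aP] : forall i, exists t : 'I_m -> K, (forall j, A (t j)) /\ c i = \sum_j t j * w j.
  move=> i; have : lspan A w (c i).
    by rewrite -Vw; exists (fun j => (j == i)%:R); [exact: delta|rewrite deltas].
  by move=> [t At e]; exists t.
have w0 j : w j != 0.
  apply/eqP => wj; have := indw (fun i => (i == j)%:R) (delta _ j).
  by rewrite deltas => /(_ wj j)/eqP; rewrite eqxx oner_eq0.
exists m, w, a; split=> //.
- move=> j; have : lspan A c (w j).
    by rewrite Vw; exists (fun i => (i == j)%:R); [exact: delta|rewrite deltas].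
  by move=> [t At ->]; exact: Csum.
- by move=> i j; case: (aP i).
- by move=> i; case: (aP i).
move=> b j Ab bj bi.
have bw0 : b j * w j != 0 by rewrite mulf_neq0.
rewrite -mulr_suml; set s := \sum_i _.
have vs : vval s = Some (v (b j * w j)).
  rewrite /s normw // -(val_v bw0).
  have le1 : vle (\big[@vmax (vG M) / None]_i vval (b i * w i)) (vval (b j * w j)).
    apply: vmax_big_le => i _; have [e|e] := eqVneq (b i * w i) 0; first by rewrite e val0.
    by rewrite !val_v //=; exact/(integral_div e bw0).
  have := @vmax_big_ge _ (index_enum 'I_m) (fun i => vval (b i * w i)) j.
  rewrite In_mem mem_index_enum => /(_ isT) le2.
  case: (\big[_/_]_i _) le1 le2 => [h|] /=; rewrite (val_v bw0) //= => h1 h2.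
  by congr Some; apply/eqP; rewrite eq_le h1.
have s0 := val_neq0 vs; apply/unit_div => //.
by rewrite {1}/v vs.
Qed.

End Reductions.

(** * Forking in the residue field or value group implies forking in M *)

(** Eliminates once and for all the dependent pairs hidden in [at_sort]. *)
Lemma at_sort_ind (L : signature) (M : structure L) (s : sorts L) (D : set (M s))
    (Q : forall s, M s -> Prop) :
  (forall a, D a -> Q s a) -> forall x : cpts (at_sort M s D), Q (csort x) (incl (at_sort M s D) x).
Proof.
move=> h; have h1 (q : points M) : at_sort M s D q -> Q (projT1 q) (projT2 q).
  by move=> [a Da <-]; exact: h.
by move=> x; exact: h1 (svalP x).
Qed.

Lemma elementary_diag (L : signature) (K : Type) (fi : forall f : Defs.fsym L, ('I_(farity f) -> K) -> K)
    (ri : forall r : rsym L, ('I_(rarity r) -> K) -> Prop) :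
  elementary fi ri [set p | p.1 = p.2].
Proof.
move=> V e e' ee p; rewrite (sat_ext (e' := e')) //.
Qed.

Lemma elem_k_sub (M : valuedField) (E E' : set (vk M * vk M)) : E `<=` E' -> elem_k E' -> elem_k E.
Proof. exact: (@elementary_sub ring_sig). Qed.

Lemma elem_G_sub (M : valuedField) (E E' : set (vG M * vG M)) : E `<=` E' -> elem_G E' -> elem_G E.
Proof. exact: (@elementary_sub ogroup_sig). Qed.

Lemma elem_k_diag (M : valuedField) : elem_k [set p : vk M * vk M | p.1 = p.2].
Proof. exact: (@elementary_diag ring_sig). Qed.

Lemma elem_G_diag (M : valuedField) : elem_G [set p : vG M * vG M | p.1 = p.2].
Proof. exact: (@elementary_diag ogroup_sig). Qed.

Section Forward.
Variable M : valuedField.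
Notation MM := (vf_struct M).
Notation K := (vK M).
Notation kk := (field_struct (vk M)).
Notation GG := (ogroup_struct (vG M)).
Variables (A : set K) (U : Type) (D : set U).
Hypothesis Dinf : injects [set: nat] D.
Hypothesis Msat : saturated MM D.
Hypothesis Asub : subfield A.
Hypothesis Asm : injects A D.
Hypothesis Mhens : henselian M.
Hypothesis Mchar : [pchar (vk M)] =i pred0.
Hypothesis Acosets : forall n (x : K), (0 < n)%N -> x != 0 ->
  exists a y, [/\ A a, a != 0 & x = a * y ^+ n].
Hypothesis Aunits : forall n (x : K), (0 < n)%N -> unit_el x ->
  exists a y, [/\ A a, unit_el a, unit_el y & vres a = vres x * vres y ^+ n].

Lemma small_res_of (C : set K) : injects C D -> injects (res_of C) D.
Proof. by move=> Csm; apply: small_image => //; apply: small_sub Csm => x []. Qed.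

Lemma small_val_of (C : set K) : injects C D -> injects (val_of C) D.
Proof.
move=> Csm; apply: (small_sub _ (small_image Dinf (@v M) Csm)) => g [c Cc vc].
by exists c => //; rewrite /v vc.
Qed.

Lemma small_diag T (C : set T) : injects C D -> injects [set p | C p.1 /\ p.1 = p.2] D.
Proof.
move=> Csm; apply: (small_sub _ (small_image Dinf (fun c => (c, c)) Csm)) => -[x y] [/= Cx <-].
by exists x.
Qed.

Lemma relative_equiv (s : vf_sort) (Y0 : Type) (d d' : Y0 -> MM s) (p : @Defs.form vf_sig
     (cadd (Ctx (fun _ : Y0 => s)) (cpts (at_sort MM SK A)))) :
  (forall l : seq Y0, exists F G Ek EG, system A D F G Ek EG /\ forall y, List.In y l -> related F G Ek EG (d y) (d' y)) ->
  (sat p (asg_add (d : asg MM (Ctx (fun _ : Y0 => s))) (incl (at_sort MM SK A))) <->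
   sat p (asg_add (d' : asg MM (Ctx (fun _ : Y0 => s))) (incl (at_sort MM SK A)))).
Proof.
move=> h; have [l hl] := form_support p.
pose isl (W0 : Type) (z : (Y0 + W0)%type) := if z is inl x then Some x else None.
have [F [G [Ek [EG [hs hd]]]]] := h (pmap (@isl _) l).
have inl_in y : List.In (inl y) l -> List.In y (pmap (@isl _) l).
  by elim: (l) => //= -[z|z] m IH [e|/IH h1] //=; [left; case: e|right].
have [y0|] := pselect (exists y, List.In y (pmap (@isl _) l)); last first.
  move=> ny; rewrite (hl MM _ (asg_add (d' : asg MM (Ctx (fun _ : Y0 => s))) (incl (at_sort MM SK A)))) //.
  by move=> [y|y] //= /inl_in yl; case: ny; exists y.
have [z0 z0l] := y0.
(* Coordinates outside the support of [p] are irrelevant; replacing them by the one at [z0] makes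
   the whole tuple related. *)
pose e (f : Y0 -> MM s) : asg MM (Ctx (fun _ : Y0 => s)) :=
  fun y => if `[< List.In y (pmap (@isl _) l) >] then f y else f z0.
have E f : sat p (asg_add (f : asg MM (Ctx (fun _ : Y0 => s))) (incl (at_sort MM SK A))) =
    sat p (asg_add (e f) (incl (at_sort MM SK A))).
  by apply: hl => -[y|y] //= /inl_in yl; rewrite /e asboolT.
rewrite (E d) (E d'); apply: (system_equiv Dinf Msat Asub Asm Mhens Mchar Acosets Aunits hs).
move=> [y|x] /=.
  by rewrite /e; case: asboolP => [/hd//|_]; exact: hd.
apply: (at_sort_ind (Q := fun s0 a => related F G Ek EG a a)) => a Aa /=.
exact: (fs_A (sy_F hs)).
Qed.

Lemma small_list_image T V (f : T -> V) (l : seq T) : injects (f @` [set y | List.In y l]) D.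
Proof. by apply: small_image => //; exact: small_list. Qed.

(** An elementary map of the residue field over res(A), paired with the identity of val(A), starts a
    system. *)
Lemma equiv_k (Y0 : ctx unit) (d d' : asg kk Y0) :
  equivalent (asg_add d (incl (at_sort kk tt (res_of A)))) (asg_add d' (incl (at_sort kk tt (res_of A)))) ->
  equivalent (asg_add (d : asg MM (Ctx (fun _ : Y0 => Sk))) (incl (at_sort MM SK A)))
    (asg_add (d' : asg MM (Ctx (fun _ : Y0 => Sk))) (incl (at_sort MM SK A))).
Proof.
move=> dd p; apply: relative_equiv => // l.
have := elementary_range (L := ring_sig) unit_sort dd; set R := [set _ | _ in _] => hR.
pose E := [set (d y : vk M, d' y : vk M) | y in [set y | List.In y l]] `|` [set p | res_of A p.1 /\ p.1 = p.2].
have hE : elem_k E.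
  apply: (elem_k_sub _ hR) => -[x y] [[z _ [<- <-]]|[/= [a Aa <-] <-]]; first by exists (inl z).
  by exists (inr (param (ex_intro2 _ _ a Aa erefl : res_of A (vres a)))).
have hG : elem_G [set p | val_of A p.1 /\ p.1 = p.2].
  by apply: (elem_G_sub _ (@elem_G_diag M)) => q [].
have [||||F [G [Ek [EG [hs s1 s2]]]]] := initial_system Dinf Msat Asub Asm Mhens Mchar hE hG.
- apply: small_union => //; first exact: small_list_image.
  exact/small_diag/small_res_of.
- exact/small_diag/small_val_of.
- by move=> u Au; right.
- by [].
exists F, G, Ek, EG; split=> // y yl; apply: s1; left; by exists y.
Qed.

Lemma equiv_G (Y0 : ctx unit) (d d' : asg GG Y0) :
  equivalent (asg_add d (incl (at_sort GG tt (val_of A)))) (asg_add d' (incl (at_sort GG tt (val_of A)))) ->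
  equivalent (asg_add (d : asg MM (Ctx (fun _ : Y0 => SG))) (incl (at_sort MM SK A)))
    (asg_add (d' : asg MM (Ctx (fun _ : Y0 => SG))) (incl (at_sort MM SK A))).
Proof.
move=> dd p; apply: relative_equiv => // l.
have := elementary_range (L := ogroup_sig) unit_sort dd; set R := [set _ | _ in _] => hR.
pose E := [set (d y : vG M, d' y : vG M) | y in [set y | List.In y l]] `|` [set p | val_of A p.1 /\ p.1 = p.2].
have hE : elem_G E.
  apply: (elem_G_sub _ hR) => -[x y] [[z _ [<- <-]]|[/= Ax <-]]; first by exists (inl z).
  by exists (inr (exist _ (existT GG tt x) (ex_intro2 _ _ x Ax erefl))).
have hk : elem_k [set p | res_of A p.1 /\ p.1 = p.2].
  by apply: (elem_k_sub _ (@elem_k_diag M)) => q [].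
have [||||F [G [Ek [EG [hs s1 s2]]]]] := initial_system Dinf Msat Asub Asm Mhens Mchar hk hE.
- exact/small_diag/small_res_of.
- apply: small_union => //; first exact: small_list_image.
  exact/small_diag/small_val_of.
- by [].
- by move=> g Ag; right.
exists F, G, Ek, EG; split=> // y yl; apply: s2; left; by exists y.
Qed.

Lemma forks_k (B C : set K) :
  tp_forks (at_sort kk tt (res_of C)) (at_sort kk tt (res_of B)) (at_sort kk tt (res_of A)) ->
  tp_forks (at_sort MM SK C) (at_sort MM SK B) (at_sort MM SK A).
Proof.
pose V := cadd (cone (SK : sorts vf_sig)) (cone (Sk : sorts vf_sig)).
have lift (E : set K) (x : cpts (at_sort kk tt (res_of E))) :
    exists t : @term vf_sig (cpts (at_sort MM SK E)) SK,
      integral (eval (incl (at_sort MM SK E)) t : K) /\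
      vres (eval (incl (at_sort MM SK E)) t : K) = incl (at_sort kk tt (res_of E)) x.
  have := at_sort_ind (Q := fun s0 (u : kk s0) => exists t : @term vf_sig (cpts (at_sort MM SK E)) SK,
      integral (eval (incl (at_sort MM SK E)) t : K) /\
      vres (eval (incl (at_sort MM SK E)) t : K) = u) _ x; apply=> u [a [Ea ia] au].
  by exists (@TVar vf_sig (cpts (at_sort MM SK E)) (exist _ (existT MM SK a) (ex_intro2 _ _ a Ea erefl))).
have /choice[gX hX] := lift C; have /choice[gB hB] := lift B.
pose R (x : K) (u : vk M) := integral x /\ vres x = u.
have rhoP (x : MM SK) (u : MM Sk) : sat (@fres V (@TVar vf_sig V (inl tt)) (@TVar vf_sig V (inr tt)))
    (asg_add ((fun _ => x) : asg MM (cone (SK : sorts vf_sig))) ((fun _ => u) : asg MM (cone (Sk : sorts vf_sig)))) <-> R x u by [].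
have Rfun x u u' : R x u -> R x u' -> u = u' by move=> [_ <-] [_ <-].
exact: (@type_forks_interp vf_sig MM Sk SK ring_sig (@ring_interp (vk M)) (fun r : void => match r with end)
   (@interp_k M) vf_cst R _ rhoP Rfun _ _ _ _ equiv_k _ _ _ _ _ _ hX hB).
Qed.

Lemma forks_G (B C : set K) :
  tp_forks (at_sort GG tt (val_of C)) (at_sort GG tt (val_of B)) (at_sort GG tt (val_of A)) ->
  tp_forks (at_sort MM SK C) (at_sort MM SK B) (at_sort MM SK A).
Proof.
pose V := cadd (cone (SK : sorts vf_sig)) (cone (SG : sorts vf_sig)).
have lift (E : set K) (x : cpts (at_sort GG tt (val_of E))) :
    exists t : @term vf_sig (cpts (at_sort MM SK E)) SK,
      vval (eval (incl (at_sort MM SK E)) t : K) = Some (incl (at_sort GG tt (val_of E)) x : vG M).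
  have := at_sort_ind (Q := fun s0 (u : GG s0) => exists t : @term vf_sig (cpts (at_sort MM SK E)) SK,
      vval (eval (incl (at_sort MM SK E)) t : K) = Some (u : vG M)) _ x; apply=> u [a Ea au].
  by exists (@TVar vf_sig (cpts (at_sort MM SK E)) (exist _ (existT MM SK a) (ex_intro2 _ _ a Ea erefl))).
have /choice[gX hX] := lift C; have /choice[gB hB] := lift B.
pose R (x : K) (g : vG M) := vval x = Some g.
have rhoP (x : MM SK) (u : MM SG) : sat (@fval V (@TVar vf_sig V (inl tt)) (@TVar vf_sig V (inr tt)))
    (asg_add ((fun _ => x) : asg MM (cone (SK : sorts vf_sig))) ((fun _ => u) : asg MM (cone (SG : sorts vf_sig)))) <-> R x u by [].
have Rfun x u u' : R x u -> R x u' -> u = u' by rewrite /R => -> [].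
exact: (@type_forks_interp vf_sig MM SG SK ogroup_sig (@zmod_interp (vG M)) (fun _ (a : 'I_2 -> vG M) => a ord0 <= a ord_max)
   (@interp_G M) vf_cst R _ rhoP Rfun _ _ _ _ equiv_G _ _ _ _ _ _ hX hB).
Qed.

End Forward.

(** * Elements determined by a tuple, and their conjugates *)

Section Determined.
Variables (L : signature) (M : structure L) (s : sorts L) (L0 : signature).
Variables (fi : forall f : Defs.fsym L0, ('I_(farity f) -> M s) -> M s)
  (ri : forall r : rsym L0, ('I_(rarity r) -> M s) -> Prop).
Let N := @Structure L0 (fun _ => M s) fi ri.
Hypothesis interp : forall (V0 : ctx (sorts L0)) (p : form V0),
  exists q : form (Ctx (fun _ : V0 => s)), forall e : asg N V0,
    sat q (e : asg M (Ctx (fun _ : V0 => s))) <-> sat p e.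
Variables (A : set (points M)) (A0 : set (points N)).

Definition fixing (g : forall s, M s -> M s) := automorphism g /\ forall x : cpts A, g _ (incl A x) = incl A x.

(** A semantic form of definability of u over A and d. *)
Definition determined V (d : asg M V) s0 (u : M s0) := forall g h, fixing g -> fixing h ->
  (forall i, g _ (d i) = h _ (d i)) -> g _ u = h _ u.

Lemma fixing_id : fixing (fun s (x : M s) => x).
Proof. by split; first exact: aut_id. Qed.

Lemma fixing_comp g h : fixing g -> fixing h -> fixing (fun s x => g s (h s x)).
Proof. by move=> [g1 g2] [h1 h2]; split=> [|x]; [exact: aut_comp|rewrite h2 g2]. Qed.

Hypothesis fixA0 : forall g, fixing g -> forall x : cpts A0, g s (incl A0 x) = incl A0 x.

Lemma sat_fixing (V0 : ctx (sorts L0)) (p : form V0) (e : asg N V0) g : fixing g ->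
  sat p e <-> sat p ((fun x => g s (e x)) : asg N V0).
Proof.
move=> [ga _]; have [q hq] := interp p; rewrite -!hq.
exact: (@sat_aut L M g _ q (e : asg M (Ctx (fun _ : V0 => s))) ga).
Qed.

Variables (U : Type) (D : set U).
Hypothesis Dinf : injects [set: nat] D.
Hypothesis hom : succ_strongly_homogeneous M D.
Hypothesis Asm : injects A D.

(** The automorphisms [g m] are arbitrary, but on determined elements their effect depends only on
    [b m]. An automorphism carrying one increasing tuple of terms of b to another therefore carries
    the corresponding images along. *)
Lemma conjugates_indiscernible (V : ctx (sorts L)) (b : nat -> asg M V) (g : nat -> forall s, M s -> M s)
    (Y : ctx (sorts L0)) (e : Y -> M s) (df := (fun m y => g m s (e y)) : nat -> asg N Y) :
  injects [set: V] D -> indiscernible A b -> (forall m, fixing (g m)) ->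
  (forall m i, g m _ (b 0%N i) = b m i) -> (forall y, determined (b 0%N) (e y)) ->
  (forall m, tp (df m) A0 = tp (df 0%N) A0) /\ indiscernible A0 df.
Proof.
move=> Vsm bind gfix gb edet; split.
  have h m : tp (df m) A0 = tp (e : asg N Y) A0.
    have E p : sat p (asg_add (df m) (incl A0)) <-> sat p (asg_add (e : asg N Y) (incl A0)).
      have -> : sat p (asg_add (df m) (incl A0)) =
          sat p ((fun x => g m s (asg_add (e : asg N Y) (incl A0) x)) : asg N (cadd Y (cpts A0))).
        by apply: sat_ext => -[y|y] //=; apply/esym; exact: fixA0.
      by apply: iff_sym; exact: sat_fixing.
    by apply/seteqP; split=> p; rewrite /tp /= E.
  by move=> m; rewrite h h.
move=> n i j hi hj p.
pose W := cadd (cpow n V) (cpts A).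
have [||t [ta tP]] := @homogeneous_extend L M U D W
    (asg_add ((fun x => b (i x.1) x.2) : asg M (cpow n V)) (incl A))
    (asg_add ((fun x => b (j x.1) x.2) : asg M (cpow n V)) (incl A)) Dinf hom.
- apply: small_sum => //; last exact: small_sig.
  by apply: injects_sub (small_prod Dinf (small_fin Dinf 'I_n) Vsm) => z _; split.
- by move=> q; have h := bind n i j hi hj q; split; apply h.
have tfix : fixing t by split=> // x; exact: (tP (inr x)).
rewrite (sat_fixing p (asg_add ((fun x => df (i x.1) x.2) : asg N (cpow n Y)) (incl A0)) tfix).
have -> : sat p (asg_add ((fun x => df (j x.1) x.2) : asg N (cpow n Y)) (incl A0)) =
    sat p ((fun x => t s (asg_add ((fun x => df (i x.1) x.2) : asg N (cpow n Y)) (incl A0) x)) :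
      asg N (cadd (cpow n Y) (cpts A0))); last by [].
apply: sat_ext => -[[r y]|y] /=; last by apply/esym; exact: fixA0.
apply/esym; apply: (edet y _ _ (fixing_comp tfix (gfix (i r))) (gfix (j r))) => k.
by rewrite !gb; exact: (tP (inl (r, k))).
Qed.

Hypothesis Nsat : saturated N D.

(** [nonforking_conjugates] for the whole family of determined elements at once: one tuple [c2]
    serves all the conjugates of index below n. *)
Lemma determined_conjugates (V : ctx (sorts L)) (b : nat -> asg M V) (g : nat -> forall s, M s -> M s)
    (X : ctx (sorts L0)) (c : asg N X) (s1 : sorts L0) (T S : set (M s)) (Y := Ctx (fun _ : {u | T u} => s1)) :
  injects [set: V] D -> indiscernible A b -> (forall m, fixing (g m)) ->
  (forall m i, g m _ (b 0%N i) = b m i) ->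
  injects [set: X] D -> injects T D -> T `<=` S -> (forall u, T u -> determined (b 0%N) u) ->
  nonforking_over A0 (at_sort N s1 S) c ->
  forall n, exists c2 : asg N X, forall m, (m < n)%N ->
    equivalent (asg_add c ((fun z => sval z) : asg N Y)) (asg_add c2 ((fun z => g m s (sval z)) : asg N Y)).
Proof.
move=> Vsm bind gfix gb Xsm Tsm TS Tdet nf n.
have g0 u : T u -> g 0%N s u = u.
  by move=> Tu; apply: (Tdet u Tu _ _ (gfix 0%N) fixing_id) => i; rewrite gb.
have [|||c2 hc2] := nonforking_conjugates Dinf Nsat (d := (fun m z => g m s (sval z)) : nat -> asg N Y) Xsm _ nf _ _ n.
- exact: small_sig.
- move=> z; exists (sval z); first exact/TS/svalP.
  by rewrite g0 //; exact: svalP.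
- move=> r f Z df; have fdet i : determined (b 0%N) (sval (f i)) by exact/Tdet/svalP.
  exact: (@conjugates_indiscernible V b g (Ctx (fun _ : 'I_r => s1)) (fun i => sval (f i)) Vsm bind gfix gb fdet).
exists c2 => m mn; apply: equiv_le => p hp; apply: hc2 => //.
rewrite (sat_ext (e' := asg_add c ((fun z => sval z) : asg N Y))) // => -[x|z] //=.
exact/g0/svalP.
Qed.

End Determined.

(** * Copies of C and their amalgamation with other fields *)

Section Backward.
Variable M : valuedField.
Notation MM := (vf_struct M).
Notation K := (vK M).
Notation kk := (field_struct (vk M)).
Notation GG := (ogroup_struct (vG M)).
Variables (A : set K) (U : Type) (D : set U).
Hypothesis Dinf : injects [set: nat] D.
Hypothesis Msat : saturated MM D.
Hypothesis Asub : subfield A.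
Hypothesis Asm : injects A D.
Hypothesis Mhens : henselian M.
Hypothesis Mchar : [pchar (vk M)] =i pred0.
Hypothesis Acosets : forall n (x : K), (0 < n)%N -> x != 0 ->
  exists a y, [/\ A a, a != 0 & x = a * y ^+ n].
Hypothesis Aunits : forall n (x : K), (0 < n)%N -> unit_el x ->
  exists a y, [/\ A a, unit_el a, unit_el y & vres a = vres x * vres y ^+ n].

Notation PK := (at_sort MM SK).
Notation Pk E := (at_sort kk tt (res_of E)).
Notation PG E := (at_sort GG tt (val_of E)).

Variable C : set K.
Hypothesis Csm : injects C D.
Hypothesis Csub : subfield C.
Hypothesis AC : A `<=` C.

(** Prescribed images of res(C) and val(C) start a system over the identity of [A], and the field
    map is then extended to all of C. *)
Lemma embedding (B : set K) (ck : asg kk (cpts (Pk C))) (cg : asg GG (cpts (PG C))) :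
  A `<=` B -> injects B D ->
  equivalent (asg_add (incl (Pk C)) (incl (Pk B))) (asg_add ck (incl (Pk B))) ->
  equivalent (asg_add (incl (PG C)) (incl (PG B))) (asg_add cg (incl (PG B))) ->
  exists F G Ek EG, [/\ system A D F G Ek EG, forall c, C c -> exists x, F (c, x),
    (forall x, Ek (incl (Pk C) x : vk M, ck x : vk M)) /\ (forall u, res_of B u -> Ek (u, u)) &
    (forall x, EG (incl (PG C) x : vG M, cg x : vG M)) /\ (forall u, val_of B u -> EG (u, u))].
Proof.
move=> AB Bsm ek eg.
have hk := elementary_range (L := ring_sig) unit_sort ek.
have hg := elementary_range (L := ogroup_sig) unit_sort eg.
set Rk := [set _ | _ in _] in hk; set RG := [set _ | _ in _] in hg.
have RkB u : res_of B u -> Rk (u, u).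
  by move=> Bu; exists (inr (exist _ (existT kk tt u) (ex_intro2 _ _ u Bu erefl))).
have RGB u : val_of B u -> RG (u, u).
  by move=> Bu; exists (inr (exist _ (existT GG tt u) (ex_intro2 _ _ u Bu erefl))).
have [||||F0 [G0 [Ek0 [EG0 [hs s1 s2]]]]] := initial_system Dinf Msat Asub Asm Mhens Mchar (Ek := Rk) (EG := RG) hk hg.
- apply: small_image => //; apply: small_sum => //; apply: small_sig; apply: small_image => //; exact: small_res_of.
- apply: small_image => //; apply: small_sum => //; apply: small_sig; apply: small_image => //; exact: small_val_of.
- by move=> u [a [Aa ia] <-]; apply: RkB; exists a => //; split=> //; exact: AB.
- by move=> g [a Aa va]; apply: RGB; exists a => //; exact: AB.
have [F [G [Ek [EG [_ _ sk sg [hs1 dom]]]]]] := system_extend Dinf Msat Asub Asm Mhens Mchar Acosets Aunits hs Csm.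
exists F, G, Ek, EG; split=> //; split.
- by move=> x; apply/sk/s1; exists (inl x).
- by move=> u Bu; exact/sk/s1/RkB.
- by move=> x; apply/sg/s2; exists (inl x).
- by move=> u Bu; exact/sg/s2/RGB.
Qed.

Hypothesis Cnormed : normed_set A C.

(** [amalgam_exists] with the map between two copies of C on one side and the restriction of an
    automorphism on the other. *)
Lemma amalgam_span (F1 G1 F2 G2 : set (K * K)) (E1 E2 Rk : set (vk M * vk M)) (H1 H2 RG : set (vG M * vG M))
    (sigma : forall s, MM s -> MM s) (K0 H : set K) (k0 : set (vk M)) (G0 : set (vG M)) (T : set K) :
  fsys A F1 G1 -> gsys A G1 E1 H1 -> fsys A F2 G2 -> gsys A G2 E2 H2 ->
  elem_G H1 -> group_rel H1 -> ring_rel E1 -> elem_k E1 ->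
  (forall c, C c -> exists x, F1 (c, x)) -> (forall c, C c -> exists x, F2 (c, x)) ->
  automorphism sigma -> (forall a, A a -> sigma SK a = a) ->
  subfield K0 -> A `<=` K0 -> (forall x, K0 x -> x != 0 -> H x) ->
  (forall x y, H x -> H y -> H (x * y)) -> (forall x, H x -> H x^-1) -> (forall x, H x -> x != 0) ->
  (forall x, H x -> unit_el x -> k0 (vres x)) -> (forall x, H x -> G0 (v x)) ->
  K0 `<=` T -> H `<=` T -> injects T D ->
  elem_k Rk -> injects Rk D -> span_k C E1 E2 `<=` Rk -> (forall u, k0 u -> Rk (u, sigma Sk u)) ->
  elem_G RG -> injects RG D -> span_G C H1 H2 `<=` RG -> (forall u, G0 u -> RG (u, sigma SG u)) ->
  (forall c x h, C c -> G1 (c, x) -> H h -> v x + v h = 0 -> exists a, [/\ A a, a != 0 & v a = v x]) ->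
  lin_disjoint [set u | exists u', span_k C E1 E2 (u, u')] k0 (res_of A) ->
  exists F G Ek EG, [/\ system A D F G Ek EG, span_field C F1 F2 `<=` F,
    (forall x, K0 x -> F (x, sigma SK x)) &
    [/\ forall h, H h -> G (h, sigma SK h), forall u, k0 u -> Ek (u, sigma Sk u) &
        forall u, G0 u -> EG (u, sigma SG u)]].
Proof.
move=> hF1 hG1 hF2 hG2 elH1 hH1 hE1 elE1 dom1 dom2 autS fixS K0sub AK0 K0H HM HV Hnz Hres Hval K0T HT Tsm
  elRk smRk sRk kRk elRG smRG sRG gRG iG ik.
have [|||||||||||F [G [Ek [EG [hs s1 s2 [s3 s4 s5]]]]]] := amalgam_exists Dinf Msat Asub Mhens Mchar Acosets Aunits
  (span_fsys Csub AC hF1 hG1 hF2) (span_gsys Asub Csub AC hG1 hG2 elH1 hH1)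
  (aut_fsys autS fixS K0sub AK0 K0H)
  (aut_gsys Asub Mhens Mchar autS fixS AK0 K0H HM HV Hnz Hres Hval).
- by apply: (elem_k_sub _ elRk) => -[x y] [/sRk//|[/= k0x ->]]; exact: kRk.
- by apply: (elem_G_sub _ elRG) => -[x y] [/sRG//|[/= k0x ->]]; exact: gRG.
- by apply: (small_sub _ smRk) => -[x y] [/sRk//|[/= k0x ->]]; exact: kRk.
- by apply: (small_sub _ smRG) => -[x y] [/sRG//|[/= k0x ->]]; exact: gRG.
- exact: (span_normed Asub hF1 hG1 elH1 hH1 dom1 dom2 Cnormed).
- move=> p q [c [Cc c1 _]] [h [Hh _] [n _]] e.
  by apply: (iG c p.1 h.1 Cc c1 Hh); rewrite -e; congr (_ + _); exact: near_v.
- by move=> n w wC ind c cK; apply: ik => // i; have [u' []] := cK i.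
- exact: (span_small Dinf hF1 hF2 Csm).
- apply: (small_sub _ (small_image Dinf (fun x => (x, sigma SK x)) Tsm)) => -[x y] [/= k0x ->].
  by exists x => //; exact: K0T.
- exact: (span_near Dinf G2 hG1 elH1 hH1 hE1 elE1 Csm).
- exists T => // p [h [Hh _] [n _]]; exists h.1; [exact: HT|exact: near_sym].
exists F, G, Ek, EG; split=> //.
- by move=> x K0x; apply: s2; split.
- split.
  + move=> h Hh; apply: s3; exists (h, sigma SK h); first by split.
    by split; apply: near_refl; rewrite ?(aut_eq0 autS); exact: Hnz.
  + by move=> u k0u; apply: s4; split.
  + by move=> u k0u; apply: s5; split.
Qed.

End Backward.

Section Delta.
Variable M : valuedField.
Notation MM := (vf_struct M).
Notation K := (vK M).
Variables (A L : set K).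
Hypothesis Asub : subfield A.
Hypothesis hL : closed_field A L.
Notation PA := (at_sort MM SK A).
Variables (V : ctx (sorts vf_sig)) (d : asg MM V).

Definition lifts (s : vf_sort) : MM s -> K -> Prop :=
  match s return MM s -> K -> Prop with
  | SK => fun x y => y = x
  | Sk => fun x y => integral y /\ vres y = x
  | SG => fun x y => vval y = Some x
  | SRV => fun x y => y != 0 /\ vrv y = x
  end.

Lemma lifts_total (q : points MM) : exists y, lifts (projT2 q) y.
Proof.
case: q => -[] /= x; first by exists x.
- by have [y iy ey] := res_surj x; exists y.
- exact: val_surj.
- by have [y y0 ey] := rv_surj x; exists y.
Qed.

(** The part of [L] on which a conjugating automorphism is governed by the conjugate of [d], for
    field elements and then for leading terms, residues and values. The last three are not derived
    from [delta_K]: a determined residue, say, may have no determined lift. *)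
Definition delta_K : set K := [set x | L x /\ determined PA d (x : MM SK)].
Definition delta_H : set K := [set h | [/\ L h, h != 0 & forall f g, fixing PA f -> fixing PA g ->
  (forall i, f _ (d i) = g _ (d i)) -> near (f SK h) (g SK h)]].
Definition delta_k : set (vk M) := [set u | res_of L u /\ determined PA d (u : MM Sk)].
Definition delta_G : set (vG M) := [set g | val_of L g /\ determined PA d (g : MM SG)].

Lemma fixing_A f a : fixing PA f -> A a -> f SK a = a.
Proof. by move=> [_ h] Aa; exact: (h (exist _ (existT MM SK a) (ex_intro2 _ _ a Aa erefl))). Qed.

Lemma fixing_res f u : fixing PA f -> res_of A u -> f Sk u = u.
Proof.
move=> ff [a [Aa ia] <-]; have [_ <-] := aut_res ff.1 ia.
by rewrite (fixing_A ff).
Qed.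

Lemma fixing_val f g : fixing PA f -> val_of A g -> f SG g = g.
Proof.
move=> ff [a Aa va]; have := aut_val ff.1 va.
by rewrite (fixing_A ff) // va => -[].
Qed.

Lemma delta_K_subfield : subfield delta_K.
Proof.
split; rewrite ?inE.
- by split; [exact: (cf_1 hL)|move=> f g ff fg _; rewrite (aut_1 ff.1) (aut_1 fg.1)].
- move=> x y; rewrite !inE => -[Lx dx] [Ly dy]; split; first exact: (cf_B hL).
  by move=> f g ff fg fd; rewrite (aut_B ff.1) (aut_B fg.1) (dx f g) // (dy f g).
- move=> x y; rewrite !inE => -[Lx dx] [Ly dy]; split; first exact/(cf_M hL)/(cf_V hL).
  by move=> f g ff fg fd; rewrite !(aut_M ff.1) !(aut_M fg.1) !(aut_V ff.1) !(aut_V fg.1) (dx f g) // (dy f g).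
Qed.

Lemma A_delta_K : A `<=` delta_K.
Proof.
move=> a Aa; split; first exact: (cf_A hL).
by move=> f g ff fg _; rewrite !fixing_A.
Qed.

Lemma delta_KH x : delta_K x -> x != 0 -> delta_H x.
Proof.
move=> [Lx dx] x0; split=> // f g ff fg fd.
by rewrite (dx f g) //; apply: near_refl; rewrite (aut_eq0 fg.1).
Qed.

Lemma delta_HM x y : delta_H x -> delta_H y -> delta_H (x * y).
Proof.
move=> [Lx x0 dx] [Ly y0 dy]; split; [exact: (cf_M hL)|exact: mulf_neq0|].
by move=> f g ff fg fd; rewrite (aut_M ff.1) (aut_M fg.1); apply: nearM; [exact: dx|exact: dy].
Qed.

Lemma delta_HV x : delta_H x -> delta_H x^-1.
Proof.
move=> [Lx x0 dx]; split; [exact: (cf_V hL)|by rewrite invr_neq0|].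
by move=> f g ff fg fd; rewrite (aut_V ff.1) (aut_V fg.1); apply: nearV; exact: dx.
Qed.

Lemma delta_Hres x : delta_H x -> unit_el x -> delta_k (vres x).
Proof.
move=> [Lx x0 dx] ux; have ix := unit_integral ux; split; first by exists x.
move=> f g ff fg fd; have [_ <-] := aut_res ff.1 ix; have [_ <-] := aut_res fg.1 ix.
by apply: near_vres; [exact: dx|exact: (aut_unit ff.1)].
Qed.

Lemma delta_Hval x : delta_H x -> delta_G (v x).
Proof.
move=> [Lx x0 dx]; split; first by exists x => //; exact: val_v.
move=> f g ff fg fd; rewrite -(aut_v ff.1) // -(aut_v fg.1) //.
by apply: near_v; exact: dx.
Qed.

Lemma A_delta_k u : res_of A u -> delta_k u.
Proof.
move=> Au; split; last by move=> f g ff fg _; rewrite !fixing_res.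
by case: Au => a [Aa ia] <-; exists a => //; split=> //; exact: (cf_A hL).
Qed.

Lemma A_delta_G g : val_of A g -> delta_G g.
Proof.
move=> Ag; split; last by move=> f h ff fh _; rewrite !fixing_val.
by case: Ag => a Aa va; exists a => //; exact: (cf_A hL).
Qed.

Lemma delta_related F G Ek EG (sigma : forall s, MM s -> MM s) i y :
  automorphism sigma -> lifts (d i) y -> L y ->
  (forall x, delta_K x -> F (x, sigma SK x)) -> (forall h, delta_H h -> G (h, sigma SK h)) ->
  (forall u, delta_k u -> Ek (u, sigma Sk u)) -> (forall u, delta_G u -> EG (u, sigma SG u)) ->
  related F G Ek EG (d i) (sigma _ (d i)).
Proof.
move=> autS; have : determined PA d (d i) by move=> f g _ _; exact.
move: (d i); set s := csort i; case: s => x dx; rewrite /lifts.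
- by move=> -> Lx hK _ _ _; apply: hK.
- by move=> [iy ex] Ly _ _ hk _; rewrite -ex in dx *; apply: hk; split; [exists y|exact: dx].
- by move=> vy Ly _ _ _ hG; apply: hG; split; [by exists y|exact: dx].
- move=> [y0 ey] Ly _ hH _ _; exists (y, sigma SK y); split=> //; last by rewrite (aut_rv autS) // ey.
  apply: hH; split=> // f g ff fg fd.
  by apply/rv_near; rewrite ?(aut_eq0 ff.1) ?(aut_eq0 fg.1) // (aut_rv ff.1) // (aut_rv fg.1) // ey; exact: dx.
Qed.

End Delta.

Section Descent.
Variable M : valuedField.
Notation MM := (vf_struct M).
Notation K := (vK M).
Notation kk := (field_struct (vk M)).
Notation GG := (ogroup_struct (vG M)).
Variables (A : set K) (U : Type) (D : set U).
Hypothesis Dinf : injects [set: nat] D.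
Hypothesis Msat : saturated MM D.
Hypothesis Asub : subfield A.
Hypothesis Asm : injects A D.
Hypothesis Mhens : henselian M.
Hypothesis Mchar : [pchar (vk M)] =i pred0.
Hypothesis Acosets : forall n (x : K), (0 < n)%N -> x != 0 ->
  exists a y, [/\ A a, a != 0 & x = a * y ^+ n].
Hypothesis Aunits : forall n (x : K), (0 < n)%N -> unit_el x ->
  exists a y, [/\ A a, unit_el a, unit_el y & vres a = vres x * vres y ^+ n].

Notation PK := (at_sort MM SK).
Notation Pk E := (at_sort kk tt (res_of E)).
Notation PG E := (at_sort GG tt (val_of E)).

Variable C : set K.
Hypothesis Csm : injects C D.
Hypothesis Csub : subfield C.
Hypothesis AC : A `<=` C.
Hypothesis Cnormed : normed_set A C.

Lemma related_choice F G Ek EG : (forall c, C c -> exists x, F (c, x)) ->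
  exists g : asg MM (cpts (PK C)), forall x, related F G Ek EG (incl (PK C) x) (g x).
Proof.
move=> dom; have h := @at_sort_ind vf_sig MM SK C (fun s (a : MM s) => exists y, related F G Ek EG a y) dom.
exact: (dependent_choice h).
Qed.

(** The identity on all leading terms; with [id_fsys] it lets C itself play the part of the first
    copy. *)
Definition id_group : set (K * K) := near_rel [set p : K * K | p.1 != 0 /\ p.2 = p.1].

Lemma id_fsys : fsys A [set p | p.1 = p.2] id_group.
Proof.
split=> //=.
- by move=> [x x'] [y y'] /= -> ->.
- by move=> [x x'] [y y'] /= -> ->.
- by move=> [x x'] /= ->.
- by move=> [x x'] /= <- x0; exists (x, x) => //; split; exact: near_refl.
- by move=> [x x'] /= -> ->.
Qed.

Lemma id_gsys : gsys A id_group [set p : vk M * vk M | p.1 = p.2] [set p : vG M * vG M | p.1 = p.2].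
Proof.
apply: (near_rel_gsys Asub Mhens Mchar) => //=.
- by move=> [x x'] [y y'] /= [x0 ->] [y0 ->]; rewrite mulf_neq0.
- by move=> [x x'] /= [x0 ->]; rewrite invr_neq0.
- by move=> [x x'] n /= [x0 ->].
- by move=> [x x'] /= [x0 ->].
- by move=> [x x'] /= [x0 ->].
Qed.

(** The map from C to its copy is amalgamated with the identity of [B]; separatedness and the
    independence of residues and values over A are what the amalgam requires. *)
Lemma base_equiv (B : set K) F1 G1 E1 H1 (g : asg MM (cpts (PK C))) :
  subfield B -> A `<=` B -> injects B D ->
  lin_disjoint (res_of C) (res_of B) (res_of A) -> val_of C `&` val_of B = val_of A ->
  system A D F1 G1 E1 H1 -> (forall c, C c -> exists x, F1 (c, x)) ->
  (forall u, res_of B u -> E1 (u, u)) -> (forall u, val_of B u -> H1 (u, u)) ->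
  (forall x, related F1 G1 E1 H1 (incl (PK C) x) (g x)) ->
  equivalent (asg_add (incl (PK C)) (incl (PK B))) (asg_add g (incl (PK B))).
Proof.
move=> Bsub AB Bsm rd vd hs dom BE BH gr.
have hkd : ring_rel [set p : vk M * vk M | p.1 = p.2].
  by split=> //= [[x x'] [y y']|[x x'] [y y']] /= -> ->.
have hgd : group_rel [set p : vG M * vG M | p.1 = p.2].
  by split=> //= [[x x'] [y y']] /= -> ->.
pose H := [set x | B x /\ x != 0].
have domd c : C c -> exists x, [set p : K * K | p.1 = p.2] (c, x) by exists c.
have HM x y : H x -> H y -> H (x * y).
  by move=> [Bx x0] [By y0]; split; [exact: AM|exact: mulf_neq0].
have HV x : H x -> H x^-1 by move=> [Bx x0]; split; [exact: AV|rewrite invr_neq0].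
have Hnz x : H x -> x != 0 by case.
have Hres x : H x -> unit_el x -> res_of B (vres x).
  by move=> [Bx x0] ux; exists x => //; split=> //; exact: unit_integral.
have Hval x : H x -> val_of B (v x) by move=> [Bx x0]; exists x => //; exact: val_v.
have HB : H `<=` B by move=> x [].
have KH x : B x -> x != 0 -> H x by [].
have sk : span_k C [set p : vk M * vk M | p.1 = p.2] E1 `<=` E1 by move=> [x y] [u [_ /= -> h]].
have sg : span_G C [set p : vG M * vG M | p.1 = p.2] H1 `<=` H1 by move=> [x y] [u [_ /= -> h]].
have iG c x h : C c -> id_group (c, x) -> H h -> v x + v h = 0 -> exists a, [/\ A a, a != 0 & v a = v x].
  move=> Cc [q [q0 qq] [n1 n2]] [Bh h0] e; apply: val_ofP; rewrite -vd.
  have [_ c0 _] := n1; rewrite /= in n1 n2 c0.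
  have vx : v x = v c by rewrite -(near_v n1) -(near_v n2) qq.
  split; first by rewrite vx; exists c => //; exact: val_v.
  exists h^-1; first exact: AV.
  rewrite val_v ?invr_neq0 // vV //; congr Some.
  by apply/eqP; rewrite eq_sym -addr_eq0 e.
have ik : lin_disjoint [set u | exists u', span_k C [set p : vk M * vk M | p.1 = p.2] E1 (u, u')] (res_of B) (res_of A).
  by move=> n w wC; apply: rd => i; have [u' [z [/= Cz <- _]]] := wC i.
have [F [G [Ek [EG [hs' s1 s2 _]]]]] := @amalgam_span M A U D Dinf Msat Asub Mhens Mchar Acosets Aunits C Csm Csub AC Cnormed
  _ _ _ _ _ _ _ _ _ _ (fun s x => x) B H (res_of B) (val_of B) B
  id_fsys id_gsys (sy_F hs) (sy_G hs) (@elem_G_diag M) hgd hkd (@elem_k_diag M) domd dom (aut_id MM) (fun a Aa => erefl)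
  Bsub AB KH HM HV Hnz Hres Hval (fun x h => h) HB Bsm
  (sy_ek hs) (sy_smk hs) sk BE (sy_eg hs) (sy_smg hs) sg BH iG ik.
apply: (system_equiv Dinf Msat Asub Asm Mhens Mchar Acosets Aunits hs').
move=> [x|x] /=; last by apply: (at_sort_ind (Q := fun s a => related F G Ek EG a a)) => a Ba; exact: s2.
have := gr x; move: (g x); apply: (at_sort_ind (Q := fun s (a : MM s) => forall y, related F1 G1 E1 H1 a y -> related F G Ek EG a y)).
by move=> a Ca y /= Fay; apply: s1; exists a.
Qed.

(** The map between the two copies of C is amalgamated with [sigma] on the determined elements. The
    last hypotheses, on values and residues, make the first copy independent from [L] over A. *)
Lemma conjugate_equiv F1 G1 E1 H1 F2 G2 E2 H2 (ck ck2 : asg kk (cpts (Pk C))) (cg cg2 : asg GG (cpts (PG C)))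
    (g g2 : asg MM (cpts (PK C))) (L : set K) (V : ctx (sorts vf_sig)) (d : asg MM V)
    (sigma : forall s, MM s -> MM s) (S : set (vk M)) :
  system A D F1 G1 E1 H1 -> system A D F2 G2 E2 H2 ->
  (forall c, C c -> exists x, F1 (c, x)) -> (forall c, C c -> exists x, F2 (c, x)) ->
  (forall x, E1 (incl (Pk C) x : vk M, ck x : vk M)) -> (forall x, E2 (incl (Pk C) x : vk M, ck2 x : vk M)) ->
  (forall x, H1 (incl (PG C) x : vG M, cg x : vG M)) -> (forall x, H2 (incl (PG C) x : vG M, cg2 x : vG M)) ->
  (forall x, related F1 G1 E1 H1 (incl (PK C) x) (g x)) -> (forall x, related F2 G2 E2 H2 (incl (PK C) x) (g2 x)) ->
  closed_field A L -> injects L D -> fixing (PK A) sigma -> (forall i, exists2 y, lifts (d i) y & L y) ->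
  equivalent (asg_add ck ((fun z => sval z) : asg kk (Ctx (fun _ : {u | delta_k A L d u} => tt))))
    (asg_add ck2 ((fun z => sigma Sk (sval z)) : asg kk (Ctx (fun _ : {u | delta_k A L d u} => tt)))) ->
  equivalent (asg_add cg ((fun z => sval z) : asg GG (Ctx (fun _ : {u | delta_G A L d u} => tt))))
    (asg_add cg2 ((fun z => sigma SG (sval z)) : asg GG (Ctx (fun _ : {u | delta_G A L d u} => tt)))) ->
  (forall x, val_of L (cg x) -> val_of A (cg x)) ->
  res_of L `<=` S -> lin_disjoint [set u : vk M | exists x, u = ck x] S (res_of A) ->
  equivalent (asg_add g d) (asg_add g2 (fun i => sigma _ (d i))).
Proof.
move=> hs1 hs2 dom1 dom2 ek1 ek2 eg1 eg2 gr1 gr2 hL Lsm fs dL kk2 gg2 og LS ok.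
have hk := elementary_range (L := ring_sig) unit_sort kk2.
have hg := elementary_range (L := ogroup_sig) unit_sort gg2.
set Rk := [set _ | _ in _] in hk; set RG := [set _ | _ in _] in hg.
have resC u : res_of C u -> exists x, incl (Pk C) x = u.
  by move=> Cu; exists (exist _ (existT kk tt u) (ex_intro2 _ _ u Cu erefl)).
have valC u : val_of C u -> exists x, incl (PG C) x = u.
  by move=> Cu; exists (exist _ (existT GG tt u) (ex_intro2 _ _ u Cu erefl)).
have e1k u w : res_of C u -> E1 (u, w) -> exists x, u = incl (Pk C) x /\ w = ck x.
  by move=> /resC[x <-] h; exists x; split=> //; exact: (elem_k_eq (sy_ek hs1) h (ek1 x)).1.
have sk : span_k C E1 E2 `<=` Rk.
  move=> [w w'] [u [Cu /= h1 h2]]; have [x [ux ->]] := e1k _ _ Cu h1.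
  exists (inl x) => //; congr pair; rewrite ux in h2.
  by apply/esym; apply: (elem_k_eq (sy_ek hs2) h2 (ek2 x)).1.
have e1g u w : val_of C u -> H1 (u, w) -> exists x, u = incl (PG C) x /\ w = cg x.
  by move=> /valC[x <-] h; exists x; split=> //; exact: (elem_G_eq (sy_eg hs1) h (eg1 x)).1.
have sg : span_G C H1 H2 `<=` RG.
  move=> [w w'] [u [Cu /= h1 h2]]; have [x [ux ->]] := e1g _ _ Cu h1.
  exists (inl x) => //; congr pair; rewrite ux in h2.
  by apply/esym; apply: (elem_G_eq (sy_eg hs2) h2 (eg2 x)).1.
have kR u : delta_k A L d u -> Rk (u, sigma Sk u) by move=> du; exists (inr (exist _ u du)).
have gR u : delta_G A L d u -> RG (u, sigma SG u) by move=> du; exists (inr (exist _ u du)).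
have smk : injects Rk D.
  apply: small_image => //; apply: small_sum => //; apply: small_sig.
    by apply: small_image => //; exact: small_res_of.
  by apply: small_sub (small_res_of Dinf Lsm) => u [].
have smg : injects RG D.
  apply: small_image => //; apply: small_sum => //; apply: small_sig.
    by apply: small_image => //; exact: small_val_of.
  by apply: small_sub (small_val_of Dinf Lsm) => u [].
have iG c x h : C c -> G1 (c, x) -> delta_H A L d h -> v x + v h = 0 -> exists a, [/\ A a, a != 0 & v a = v x].
  move=> Cc G1c [Lh h0 _] e; apply: val_ofP.
  have [c0 x0] := gs_nz (sy_G hs1) G1c; have h1 := gs_v (sy_G hs1) G1c; rewrite /= in c0 x0 h1.
  have [z [_ vz]] := e1g (v c) (v x) (ex_intro2 _ _ c Cc (val_v c0)) h1.
  rewrite vz; apply: og; rewrite -vz; exists h^-1; first exact: (cf_V hL).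
  rewrite val_v ?invr_neq0 // vV //; congr Some.
  by apply/eqP; rewrite eq_sym -addr_eq0 e.
have ik : lin_disjoint [set u | exists u', span_k C E1 E2 (u, u')] (delta_k A L d) (res_of A).
  move=> n w wC ind c cd; apply: ok => // i.
    by have [u' [u [Cu /= h1 _]]] := wC i; have [x [_ ->]] := e1k _ _ Cu h1; exists x.
  by have [Lc _] := cd i; exact: LS.
have LK : delta_K A L d `<=` L by move=> x [].
have LH : delta_H A L d `<=` L by move=> x [].
have [F [G [Ek [EG [hs' s1 s2 [s3 s4 s5]]]]]] := @amalgam_span M A U D Dinf Msat Asub Mhens Mchar Acosets Aunits C Csm Csub AC Cnormed
  _ _ _ _ _ _ _ _ _ _ sigma (delta_K A L d) (delta_H A L d) (delta_k A L d) (delta_G A L d) L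
  (sy_F hs1) (sy_G hs1) (sy_F hs2) (sy_G hs2) (sy_eg hs1) (sy_g hs1) (sy_k hs1) (sy_ek hs1) dom1 dom2 fs.1 (fun a => @fixing_A M A sigma a fs)
  (delta_K_subfield hL d) (A_delta_K hL d) (@delta_KH M A L V d) (@delta_HM M A L hL V d) (@delta_HV M A L hL V d) (fun x h => let: And3 _ x0 _ := h in x0)
  (@delta_Hres M A L V d) (@delta_Hval M A L V d) LK LH Lsm
  hk smk sk kR hg smg sg gR iG ik.
apply: (system_equiv Dinf Msat Asub Asm Mhens Mchar Acosets Aunits hs').
move=> [x|i] /=; last by have [y yl Ly] := dL i; exact: (delta_related fs.1 yl Ly s2 s3 s4 s5).
have h1 := gr1 x; have h2 := gr2 x; move: (g x) (g2 x) h1 h2.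
apply: (at_sort_ind (Q := fun s (a : MM s) => forall y z, related F1 G1 E1 H1 a y -> related F2 G2 E2 H2 a z -> related F G Ek EG y z)).
by move=> a Ca y z /= F1a F2a; apply: s1; exists a.
Qed.

End Descent.

(** * Nonforking in the residue field and value group implies nonforking in M *)

Lemma In_flatten T (ss : seq (seq T)) s x : List.In s ss -> List.In x s -> List.In x (flatten ss).
Proof.
elim: ss => //= s' ss IH [->|/IH h] hx; rewrite In_cat; [by left|by right; exact: h].
Qed.

(** A least positive element is unique and has a definition without parameters, which brings it into
    val(A). *)
Lemma min_positive_dcl (M : valuedField) (w : vG M) : min_positive w -> dcl (M := vf_struct M) set0 SG w.
Proof.
pose MM := vf_struct M.
pose fle V (t u : @term vf_sig V SG) : @Defs.form vf_sig V :=
  @FRel vf_sig V Rle (fun i : 'I_2 => if nat_of_ord i is 0%N then t else u).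
have fleE V t u (e : asg MM V) : sat (fle V t u) e <-> (eval e t : vG M) <= (eval e u : vG M) by [].
pose V := cadd (cone (SG : sorts vf_sig)) (cpts (set0 : set (points MM))).
pose W := cext V (SG : sorts vf_sig).
pose p := FAnd (FNot (fle V (@TVar vf_sig V (inl tt)) (vf_cst V SG)))
  (@FAll vf_sig V SG (FImp (FNot (fle W (@TVar vf_sig W None) (vf_cst W SG)))
     (fle W (@TVar vf_sig W (Some (inl tt))) (@TVar vf_sig W None)))).
have pos (x : vG M) : ~ (x <= 0) <-> 0 <= x /\ x <> 0.
  split=> [n|[x0 xn] h].
    by have [//|h] := gle_total x 0; split=> // e; apply: n; rewrite e.
  by apply: xn; apply/eqP; rewrite eq_le h.
have pE x : defset p x <-> min_positive x.
  pose e : asg MM V := asg_add ((fun _ => x) : asg MM (cone (SG : sorts vf_sig))) (incl set0).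
  rewrite -[defset p x]/(sat p e) sat_and sat_not.
  have h0 : sat (fle V (@TVar vf_sig V (inl tt)) (vf_cst V SG)) e <-> (x : vG M) <= 0 by [].
  split=> [[h1 h2]|[h1 h2 h3]].
    have /pos[x0 xn] : ~ ((x : vG M) <= 0) by move=> h; apply: h1; exact/h0.
    split=> // h hh hn; have := h2 h; rewrite /= -/(FNot _) => h3.
    by apply: h3 => h4; exact: (pos h).2 (conj hh hn) h4.
  split; first by move=> /h0; apply: (pos x).2.
  by move=> h /= hn; apply: h3; have [] := (pos h).1 hn.
move=> wm; exists p; apply/seteqP; split=> x.
  move=> /pE[x0 xn xm]; have [w0 wn wle] := wm.
  by apply/eqP; rewrite eq_le (xm w w0 wn) (wle x x0 xn).
by move=> ->; apply/pE.
Qed.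

Section Nonforking.
Variable M : valuedField.
Notation MM := (vf_struct M).
Notation K := (vK M).
Notation kk := (field_struct (vk M)).
Notation GG := (ogroup_struct (vG M)).
Variables (A : set K) (U : Type) (D : set U).
Hypothesis Dinf : injects [set: nat] D.
Hypothesis Msat : saturated MM D.
Hypothesis Asub : subfield A.
Hypothesis Asm : injects A D.
Hypothesis Mhens : henselian M.
Hypothesis Mchar : [pchar (vk M)] =i pred0.
Hypothesis Acosets : forall n (x : K), (0 < n)%N -> x != 0 ->
  exists a y, [/\ A a, a != 0 & x = a * y ^+ n].
Hypothesis Aunits : forall n (x : K), (0 < n)%N -> unit_el x ->
  exists a y, [/\ A a, unit_el a, unit_el y & vres a = vres x * vres y ^+ n].

Notation PK := (at_sort MM SK).
Notation Pk E := (at_sort kk tt (res_of E)).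
Notation PG E := (at_sort GG tt (val_of E)).

Variables B C : set K.
Hypothesis Csm : injects C D.
Hypothesis Csub : subfield C.
Hypothesis AC : A `<=` C.
Hypothesis Cnormed : normed_set A C.
Hypothesis Bsm : injects B D.
Hypothesis Bsub : subfield B.
Hypothesis AB : A `<=` B.

(** Purity of val(C) passes to its conjugate [cg] by equivalence over val(A). *)
Lemma realization_value (cg : asg GG (cpts (PG C))) : pure_ext (val_of A) (val_of C) ->
  equivalent (asg_add (incl (PG C)) (incl (PG A))) (asg_add cg (incl (PG A))) ->
  forall x n, (0 < n)%N -> val_of A ((cg x : vG M) *+ n) -> val_of A (cg x).
Proof.
move=> [_ pure] eg x n n0 h.
pose W := cadd (cpts (PG C)) (cpts (PG A)).
have eqn (m : nat) (a : vG M) (Aa : val_of A a) : (cg x : vG M) *+ m = a <-> (incl (PG C) x : vG M) *+ m = a.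
  pose pa : cpts (PG A) := exist _ (existT GG tt a) (ex_intro2 _ _ a Aa erefl).
  have [t ht] := gtermMn m (@gterm_var M W (inl x)); have [u hu] := @gterm_var M W (inr pa).
  have [h1 h2] := eg (@FEq ogroup_sig W tt t u).
  rewrite /= !ht !hu /= in h1 h2.
  by split.
have Cx : val_of C (incl (PG C) x).
  exact: (@at_sort_ind ogroup_sig GG tt (val_of C) (fun s (a : GG s) => val_of C a) (fun a Ca => Ca) x).
have e := (eqn n _ h).1 erefl.
have [|d Ad dn] := pure n (incl (PG C) x) n0 Cx; first by rewrite e.
have dx := torsion_free n0 dn.
suff -> : cg x = d by [].
by have := (eqn 1%N d Ad).2; rewrite mulr1n; apply; rewrite dx.
Qed.

Lemma nonforking_descent : succ_strongly_homogeneous MM D -> algebraically_bounded (vk M) ->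
  lin_disjoint (res_of C) (alg_over (res_of A)) (res_of A) -> pure_ext (val_of A) (val_of C) ->
  lin_disjoint (res_of C) (res_of B) (res_of A) -> val_of C `&` val_of B = val_of A ->
  (forall w : vG M, min_positive w -> val_of A w) ->
  ~ tp_forks (Pk C) (Pk B) (Pk A) -> ~ tp_forks (PG C) (PG B) (PG A) ->
  ~ tp_forks (PK C) (PK B) (PK A).
Proof.
move=> hom bounded reg pure rd vd wA nk nG [f [[q [qtp qfin qf]] [fs [fsfin fsdiv ffs]]]].
have [ls lsP] := finite_set_list fsfin.
(* All parameters of the dividing formulas; [L] is fixed before the nonforking realizations, which
   are taken with respect to it. *)
pose ps : seq (points MM) := flatten [seq [seq existT MM (psort g i) (pparam g i) | i <- enum 'I_(parity g)] | g <- ls].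
have [lf lfP] := choice (@lifts_total M).
have [L [psL Lsm hL]] := closed_hull Dinf Asm Acosets Aunits (small_image Dinf lf (small_list ps Dinf)).
have dL g : fs g -> forall i, exists2 y, lifts (pparam g i) y & L y.
  move=> fg i; exists (lf (existT MM (psort g i) (pparam g i))); first exact: (lfP (existT MM _ _)).
  apply: psL; eexists; last reflexivity.
  apply: (@In_flatten _ _ [seq existT MM (psort g i) (pparam g i) | i <- enum 'I_(parity g)]).
    by rewrite In_map; exists g => //; apply/lsP.
  by rewrite In_map; exists i => //; rewrite In_mem mem_enum.
have ksat := saturated_k Msat; have gsat := saturated_G Msat.
have Aksub := res_of_subfield Asub; have Aksm := small_res_of Dinf Asm.
have smP (N : signature) (X : structure N) s (T : set (X s)) : injects T D -> injects (at_sort X s T) D.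
  by move=> h; exact: small_image.
have [Sk0 [LS Sksm Sksub Sksp]] := splitting_hull Dinf ksat Aksub Aksm bounded (small_res_of Dinf Lsm).
have Xk : injects [set: cpts (Pk C)] D by exact: small_sig (smP _ kk tt _ (small_res_of Dinf Csm)).
have Xg : injects [set: cpts (PG C)] D by exact: small_sig (smP _ GG tt _ (small_val_of Dinf Csm)).
(* In k nonforking is asked over the larger splitting field [Sk0], as linear disjointness needs; in
   the value group val(L) is enough. *)
have [ck [hck nfk]] := nonforking_realization Dinf ksat Xk (smP _ kk tt _ (small_res_of Dinf Bsm)) (smP _ kk tt _ Sksm) nk.
have [cg [hcg nfg]] := nonforking_realization Dinf gsat Xg (smP _ GG tt _ (small_val_of Dinf Bsm))
  (smP _ GG tt _ (small_val_of Dinf Lsm)) nG.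
have ek := equiv_le hck; have eg := equiv_le hcg.
have [F1 [G1 [E1 [H1 [hs1 dom1 [ek1 ekB] [eg1 egB]]]]]] :=
  embedding Dinf Msat Asub Asm Mhens Mchar Acosets Aunits Csm AB Bsm ek eg.
have [g gr] := related_choice G1 E1 H1 dom1.
have eqB := base_equiv Dinf Msat Asub Asm Mhens Mchar Acosets Aunits Csm Csub AC Cnormed Bsub AB Bsm rd vd hs1 dom1 ekB egB gr.
(* The copy [g] realizes tp(C/B), so it satisfies the implied formula and hence one of the dividing
   formulas. *)
have fg : psat f g by apply: qf => h qh; exact: (eqB h).1 (qtp h qh).
have [gf fgf hgf] := ffs g fg; have [b [b0 btp bind [n nb]]] := fsdiv gf fgf.
apply: nb; case: n => [|n]; first by exists g.
have ekA : equivalent (asg_add (incl (Pk C)) (incl (Pk A))) (asg_add ck (incl (Pk A))).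
  apply: (equiv_reindex (L := ring_sig) unit_sort ek) => -[x|y]; first by exists (inl x).
  have [z zy] := @at_sort_ind ring_sig kk tt (res_of A) (fun s (u : kk s) => exists z : cpts (Pk B), u = (incl (Pk B) z : vk M))
    (fun u Au => let: ex_intro2 a (conj Aa ia) e := Au in
       ex_intro _ (exist _ (existT kk tt u) (ex_intro2 _ _ u (ex_intro2 _ _ a (conj (AB Aa) ia) e) erefl)) erefl) y.
  by exists (inr z).
have egA : equivalent (asg_add (incl (PG C)) (incl (PG A))) (asg_add cg (incl (PG A))).
  apply: (equiv_reindex (L := ogroup_sig) unit_sort eg) => -[x|y]; first by exists (inl x).
  have [z zy] := @at_sort_ind ogroup_sig GG tt (val_of A) (fun s (u : GG s) => exists z : cpts (PG B), u = (incl (PG B) z : vG M))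
    (fun u Au => let: ex_intro2 a Aa e := Au in
       ex_intro _ (exist _ (existT GG tt u) (ex_intro2 _ _ u (ex_intro2 _ _ a (AB Aa) e) erefl)) erefl) y.
  by exists (inr z).
pose V := @Ctx (sorts vf_sig) 'I_(parity gf) (psort gf).
pose d : asg MM V := pparam gf.
have Vsm : injects [set: V] D by exact: small_fin.
(* Automorphisms over A conjugating the parameters. They are not canonical, which is why only
   determined elements are followed. *)
have /choice[sg sgP] : forall m, exists s : forall s, MM s -> MM s, fixing (PK A) s /\ forall i, s _ (b 0%N i) = b m i.
  move=> m; have [||t [ta tP]] := @homogeneous_extend vf_sig MM U D (cadd V (cpts (PK A)))
      (asg_add (b 0%N) (incl (PK A))) (asg_add (b m) (incl (PK A))) Dinf hom.
  - by apply: small_sum => //; apply/small_sig/smP.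
  - have /seteqP[h1 h2] : tp (b 0%N) (PK A) = tp (b m) (PK A) by rewrite !btp.
    by move=> p; split; [exact: h1|exact: h2].
  exists t; split; last by move=> i; exact: (tP (inl i)).
  by split=> // x; exact: (tP (inr x)).
have fixs m := (sgP m).1; have sgb m := (sgP m).2.
have det0 s (u : MM s) : determined (PK A) d u -> determined (PK A) (b 0%N) u by rewrite b0.
have PAsm : injects (PK A) D by exact: smP.
(* Nonforking gives one residue tuple in the position of [ck] with respect to all n + 1 conjugates
   of the determined residues; the values are treated in the same way below. *)
have [||||ck2 hck2] := @determined_conjugates vf_sig MM Sk ring_sig (@ring_interp (vk M))
  (fun r : void => match r with end) (@interp_k M) (PK A) (Pk A) _ U D Dinf hom PAsm ksat V b sg (cpts (Pk C)) ck tt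
  (delta_k A L d) Sk0 Vsm bind fixs sgb Xk _ _ _ nfk n.+1.
- move=> t ft; exact: (@at_sort_ind ring_sig kk tt (res_of A) (fun s (u : kk s) => t Sk u = u) (fun u => fixing_res ft)).
- by apply: small_sub (small_res_of Dinf Lsm) => u [].
- by move=> u [Lu _]; exact: LS.
- by move=> u [_]; exact: det0.
have [||||cg2 hcg2] := @determined_conjugates vf_sig MM SG ogroup_sig (@zmod_interp (vG M))
  (fun _ (a : 'I_2 -> vG M) => a ord0 <= a ord_max) (@interp_G M) (PK A) (PG A) _ U D Dinf hom PAsm gsat V b sg
  (cpts (PG C)) cg tt (delta_G A L d) (val_of L) Vsm bind fixs sgb Xg _ _ _ nfg n.+1.
- move=> t ft; exact: (@at_sort_ind ogroup_sig GG tt (val_of A) (fun s (u : GG s) => t SG u = u) (fun u => fixing_val ft)).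
- by apply: small_sub (small_val_of Dinf Lsm) => u [].
- by move=> u [].
- by move=> u [_]; exact: det0.
have ek2A : equivalent (asg_add (incl (Pk C)) (incl (Pk A))) (asg_add ck2 (incl (Pk A))).
  apply: equiv_trans ekA _.
  apply: (equiv_reindex (L := ring_sig) unit_sort (hck2 0%N isT)) => -[x|y]; first by exists (inl x).
  have [z [zy zs]] := @at_sort_ind ring_sig kk tt (res_of A) (fun s (u : kk s) => exists z : {u | delta_k A L d u},
     u = (sval z : vk M) /\ u = sg 0%N Sk (sval z))
    (fun u Au => ex_intro _ (exist _ u (A_delta_k hL d Au)) (conj erefl (esym (fixing_res (fixs 0%N) Au)))) y.
  by exists (inr z).
have eg2A : equivalent (asg_add (incl (PG C)) (incl (PG A))) (asg_add cg2 (incl (PG A))).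
  apply: equiv_trans egA _.
  apply: (equiv_reindex (L := ogroup_sig) unit_sort (hcg2 0%N isT)) => -[x|y]; first by exists (inl x).
  have [z [zy zs]] := @at_sort_ind ogroup_sig GG tt (val_of A) (fun s (u : GG s) => exists z : {u | delta_G A L d u},
     u = (sval z : vG M) /\ u = sg 0%N SG (sval z))
    (fun u Au => ex_intro _ (exist _ u (A_delta_G hL d Au)) (conj erefl (esym (fixing_val (fixs 0%N) Au)))) y.
  by exists (inr z).
have [F2 [G2 [E2 [H2 [hs2 dom2 [ek2 _] [eg2 _]]]]]] :=
  embedding Dinf Msat Asub Asm Mhens Mchar Acosets Aunits Csm (fun a Aa => Aa) Asm ek2A eg2A.
have [g2 gr2] := related_choice G2 E2 H2 dom2.
have ok : lin_disjoint [set u : vk M | exists x, u = ck x] Sk0 (res_of A).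
  apply: (nonforking_lin_disjoint Dinf ksat Aksub Aksm Xk Sksub Sksp (equiv_sym ekA) _ reg nfk).
  exact: (@at_sort_ind ring_sig kk tt (res_of C) (fun s (a : kk s) => res_of C a) (fun a Ca => Ca)).
have og x : val_of L (cg x) -> val_of A (cg x).
  move=> Lx; apply: (nonforking_value Dinf Msat (small_val_of Dinf Asm) (val_of0 Asub) _ wA _ nfg Lx).
    by move=> u w; exact: val_ofB.
  exact: realization_value.
(* The second copy of C satisfies all the conjugate formulas simultaneously. *)
exists g2 => m mn.
have h := conjugate_equiv Dinf Msat Asub Asm Mhens Mchar Acosets Aunits Csm Csub AC Cnormed hs1 hs2 dom1 dom2
  ek1 ek2 eg1 eg2 gr gr2 hL Lsm (fixs m) (dL gf fgf) (hck2 m mn) (hcg2 m mn) og LS ok.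
have := (h (pbody gf)).1 hgf.
rewrite (sat_ext (e' := asg_add g2 (b m))) // => -[x|i] //=.
by rewrite -(sgb m) b0.
Qed.

End Nonforking.

(** * The equivalence *)

Lemma nat_injects (M : valuedField) (A D : set (vK M)) : [pchar (vk M)] =i pred0 -> subfield A ->
  A `<=` D -> injects [set: nat] D.
Proof.
move=> char0 Asub AD; exists (fun n => n%:R); split=> [n _|m n _ _ e].
  by apply: AD; elim: n => [|n IH]; [exact: A0|rewrite -addn1 natrD; apply: AD => //; exact: A1].
suff h i j : (i%:R : vK M) = j%:R -> (j <= i)%N.
  by apply/eqP; rewrite eqn_leq (h n m) // (h m n).
move=> eij; rewrite leqNgt; apply/negP => ij.
have := unit_nat char0 (n := (j - i)%N); rewrite subn_gt0 ij => /(_ isT).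
by rewrite /unit_el natrB ?(ltnW ij) // eij subrr (val_eq_None _).2.
Qed.

Theorem proposition7p2p3 (M : valuedField) (A B C : set (vK M))
  (hhens : henselian M)
  (hnontriv : nontrivially_valued M)
  (hchar : [pchar (vk M)] =i pred0)
  (hA : subfield A) (hB : subfield B) (hC : subfield C)
  (hAB : A `<=` B) (hAC : A `<=` C)
  (hsat : succ_saturated (vf_struct M) (B `|` C))
  (hhom : succ_strongly_homogeneous (vf_struct M) (B `|` C))
  (hindex : forall N : nat, (0 < N)%N ->
     finite_set [set [set x * y ^+ N | y in [set y : vK M | y != 0]]
                | x in [set x : vK M | x != 0]])
  (hRV : forall N : nat, (0 < N)%N -> forall r : vRV M,
     exists (a : vK M) (s : vRV M), [/\ A a, a != 0 & vrv a = (r * s ^+ N)%g])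
  (hk : forall N : nat, (0 < N)%N -> forall c : vk M, c != 0 ->
     exists (a : vK M) (d : vk M), [/\ A a, vval a = Some 0, d != 0 & vres a = c * d ^+ N])
  (hdcl : forall g : vG M, dcl (M := vf_struct M) set0 SG g ->
     exists2 a, A a & vval a = Some g)
  (hbdd : algebraically_bounded (vk M))
  (hreg : regular_ext (res_of A) (res_of C))
  (hpure : pure_ext (val_of A) (val_of C))
  (hresdisj : lin_disjoint (res_of C) (res_of B) (res_of A))
  (hvaldisj : val_of C `&` val_of B = val_of A)
  (hsep : separated_ext A C) :
  ~ tp_forks
      (at_sort (vf_struct M) SK C) (at_sort (vf_struct M) SK B) (at_sort (vf_struct M) SK A) <->
  ~ tp_forks
      (at_sort (field_struct (vk M)) tt (res_of C)) (at_sort (field_struct (vk M)) tt (res_of B))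
      (at_sort (field_struct (vk M)) tt (res_of A)) /\
  ~ tp_forks
      (at_sort (ogroup_struct (vG M)) tt (val_of C)) (at_sort (ogroup_struct (vG M)) tt (val_of B))
      (at_sort (ogroup_struct (vG M)) tt (val_of A)).

Proof.
pose D := B `|` C.
have AD : A `<=` D by move=> a Aa; left; exact: hAB.
have Dinf : injects [set: nat] D := nat_injects hchar hA AD.
have Msat : saturated (vf_struct M) D := succ_saturated_saturated 1 Dinf hsat.
have sub (E : set (vK M)) : E `<=` D -> injects E D by move=> ED; exists id.
have Asm := sub A AD.
have Bsm : injects B D by apply: sub => x Bx; left.
have Csm : injects C D by apply: sub => x Cx; right.
have cosets := cosets_of_RV hhens hchar hRV; have units := cosets_of_residue hk.
split=> [nf|[nk nG]].
  split=> h; apply: nf.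
    exact: (forks_k Dinf Msat hA Asm hhens hchar (@cosets) (@units) h).
  exact: (forks_G Dinf Msat hA Asm hhens hchar (@cosets) (@units) h).
apply: (nonforking_descent Dinf Msat hA Asm hhens hchar (@cosets) (@units) Csm hC hAC
  (separated_normed hA hC hAC hsep) Bsm hB hAB hhom hbdd _ hpure hresdisj hvaldisj _ nk nG).
  (* Regularity, tested in k itself through the identity embedding. *)
  by have := hreg.2 (vk M) idfun; rewrite !image_id.
by move=> w /min_positive_dcl /hdcl.
Qed.
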